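(* The set $\mathfrak{ruled}_{3,3}$ is an irreducible component of $\mathrm{Bir}_{3,3}(\mathbb{P}^3_\mathbb{C})$, and $\mathrm{Bir}_{3,3}(\mathbb{P}^3_\mathbb{C})$ has exactly one other irreducible component. More precisely, the closure of the set of de Jonquières $(3,3)$ maps is contained in the closure of the set of determinantal $(3,3)$ maps, whereas $\mathfrak{ruled}_{3,3}$ is not contained in the closure of the set of determinantal $(3,3)$ maps.
   Context: $\mathrm{Bir}_{3,3}(\mathbb{P}^3_\mathbb{C})$ is the set of birational maps $\psi=(\psi_0:\dots:\psi_3)$ of $\mathbb{P}^3_\mathbb{C}$ with $\deg\psi=\deg\psi^{-1}=3$, viewed in the projective space of quadruples of cubic forms with Zariski topology. $\psi$ is ruled if the strict transform of a generic plane under $\psi^{-1}$ is a ruled cubic surface; $\mathfrak{ruled}_{3,3}$ is the set of ruled $(3,3)$ maps. A $(3,3)$ birational map is determinantal if there is a $4\times 3$ matrix with linear entries whose four $3\times3$ minors are the components of $\psi$. A $(3,3)$ birational map is de Jonquières if the strict transform under $\psi^{-1}$ of a general line is a singular plane rational cubic curve whose singular point is fixed (independent of the line). *)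

(* Defs.v *)
From mathcomp Require Import all_boot all_algebra.
From mathcomp Require Import Rstruct complex.
From mathcomp Require Export mpoly.

Set Implicit Arguments.
Unset Strict Implicit.
Unset Printing Implicit Defensive.

Import GRing.Theory.
Local Open Scope ring_scope.

Definition CC : closedFieldType := (Rdefinitions.R)[i].

Notation poly4 := {mpoly CC[4]}.
(** Points of C^4 (affine cone over P^3). *)
Notation pt4 := ('I_4 -> CC).

(** A quadruple of polynomials (candidate map psi = (psi_0 : ... : psi_3)). *)
Definition quad := 'I_4 -> poly4.

Definition nonzero_pt (p : pt4) : Prop := exists i, p i != 0.

Definition mdivides (n : nat) (g f : {mpoly CC[n]}) : Prop := exists q, f = g * q.
Definition mconstant (n : nat) (g : {mpoly CC[n]}) : Prop := exists c : CC, g = c%:MP.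

Definition no_common_factor (n : nat) (f : 'I_4 -> {mpoly CC[n]}) : Prop :=
  forall g : {mpoly CC[n]}, (forall i, mdivides g (f i)) -> mconstant g.

Definition degree3 (psi : quad) : Prop :=
  (forall i, psi i \is 3.-homog) /\ (exists i, psi i != 0) /\ no_common_factor psi.

Definition qcomp (phi psi : quad) : quad :=
  fun i => phi i \mPo [tuple psi j | j < 4].

Definition comp_is_id (phi psi : quad) : Prop :=
  exists h : poly4, h != 0 /\ forall i, qcomp phi psi i = h * 'X_i.

Definition inverse33 (psi phi : quad) : Prop :=
  degree3 phi /\ comp_is_id phi psi /\ comp_is_id psi phi.

(** Bir_{3,3}(P^3_C): birational maps with deg psi = deg psi^{-1} = 3
    (as representatives in the affine cone over the projective space of
     quadruples of cubic forms). *)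
Definition Bir33 : quad -> Prop :=
  fun psi => degree3 psi /\ exists phi, inverse33 psi phi.

(** Coordinates: the coefficients of the quadruple, indexed by k < 256 encoding
    (i, a, b, c) with k = 64 i + 16 a + 4 b + c, the coordinate being the
    coefficient of x_a x_b x_c in psi_i (redundant but linear coordinates). *)
Definition qcoords (psi : quad) : 'I_256 -> CC :=
  fun k => (psi (inord (k %/ 64))) @_
             (U_(inord (k %/ 16 %% 4)) + U_(inord (k %/ 4 %% 4)) + U_(inord (k %% 4)))%MM.

Definition zclosed (Z : quad -> Prop) : Prop :=
  exists F : {mpoly CC[256]} -> Prop,
    (forall P, F P -> exists d, P \is d.-homog) /\
    forall psi, Z psi <-> (forall P, F P -> P.@[qcoords psi] = 0).

Definition qsubset (A B : quad -> Prop) : Prop := forall x, A x -> B x.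

Definition zclosure (S : quad -> Prop) : quad -> Prop :=
  fun psi => forall Z, zclosed Z -> qsubset S Z -> Z psi.

Definition zirreducible (S : quad -> Prop) : Prop :=
  (exists x, S x) /\
  forall Z1 Z2, zclosed Z1 -> zclosed Z2 ->
    qsubset S (fun x => Z1 x \/ Z2 x) -> qsubset S Z1 \/ qsubset S Z2.

Definition irr_component (X C : quad -> Prop) : Prop :=
  qsubset C X /\ zirreducible C /\
  forall D, qsubset D X -> zirreducible D -> qsubset C D -> D = C.

Definition lin_indep2 (p q : pt4) : Prop :=
  forall s t : CC, (forall i, s * p i + t * q i = 0) -> s = 0 /\ t = 0.

Definition ruled_surface (F : poly4) : Prop :=
  forall p : pt4, nonzero_pt p -> F.@[p] = 0 ->
    exists q : pt4, lin_indep2 p q /\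
      forall s t : CC, F.@[fun i => s * p i + t * q i] = 0.

Definition ruled_cubic_surface (F : poly4) : Prop :=
  F \is 3.-homog /\ F != 0 /\ ruled_surface F.

Definition generic4 (P : pt4 -> Prop) : Prop :=
  exists G : poly4, G != 0 /\ forall a : pt4, G.@[a] != 0 -> P a.

(** Strict transform under psi^{-1} of the plane {sum_i a_i y_i = 0}:
    the surface {sum_i a_i psi_i = 0}. *)
Definition plane_pullback (psi : quad) (a : pt4) : poly4 :=
  \sum_(i < 4) a i *: psi i.

Definition ruled33 : quad -> Prop :=
  fun psi => Bir33 psi /\ generic4 (fun a => ruled_cubic_surface (plane_pullback psi a)).

Definition determinantal (psi : quad) : Prop :=
  exists (M : 'M[poly4]_(4, 3)) (c : CC),
    (forall i j, M i j \is 1.-homog) /\ c != 0 /\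
    forall i : 'I_4, psi i = c *: \det (row' i M).

Definition det33 : quad -> Prop := fun psi => Bir33 psi /\ determinantal psi.

(** General line: spanned by two points u, v of C^4; genericity is taken on
    the pair (u, v) in C^8. *)
Definition join8 (u v : pt4) : 'I_8 -> CC :=
  fun k => if (k < 4)%N then u (inord k) else v (inord (k - 4)).

Definition generic_line (P : pt4 -> pt4 -> Prop) : Prop :=
  exists G : {mpoly CC[8]}, G != 0 /\
    forall u v : pt4, G.@[join8 u v] != 0 -> P u v.

(** Parametrization (s:t) |-> phi(s u + t v) of the image of the line <u,v>
    under phi = psi^{-1}: binary forms in 2 variables. *)
Definition restr_line (phi : quad) (u v : pt4) : 'I_4 -> {mpoly CC[2]} :=
  fun i => phi i \mPo [tuple (u j)%:MP * 'X_(@ord0 1) + (v j)%:MP * 'X_(@ord_max 1) | j < 4].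

Definition eval_curve (g : 'I_4 -> {mpoly CC[2]}) (st : 'I_2 -> CC) : pt4 :=
  fun i => (g i).@[st].

Definition curve_pt (g : 'I_4 -> {mpoly CC[2]}) (x : pt4) : Prop :=
  exists st, nonzero_pt (eval_curve g st) /\ x = eval_curve g st.

Definition proportional (x y : pt4) : Prop := exists c : CC, c != 0 /\ y = fun i => c * x i.

Definition on_plane (b x : pt4) : Prop := \sum_(i < 4) b i * x i = 0.

Definition plane_curve (g : 'I_4 -> {mpoly CC[2]}) : Prop :=
  exists l : pt4, nonzero_pt l /\ \sum_(i < 4) l i *: g i = 0.

(** The image curve is a (rational) cubic: the parametrization is given by
    binary cubic forms without common factor, and a general plane meets the
    curve in exactly 3 distinct points (degree 3). *)
Definition rational_cubic_curve (g : 'I_4 -> {mpoly CC[2]}) : Prop :=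
  (forall i, g i \is 3.-homog) /\ (exists i, g i != 0) /\ no_common_factor g /\
  generic4 (fun b =>
    exists x1 x2 x3 : pt4,
      curve_pt g x1 /\ curve_pt g x2 /\ curve_pt g x3 /\
      on_plane b x1 /\ on_plane b x2 /\ on_plane b x3 /\
      ~ proportional x1 x2 /\ ~ proportional x1 x3 /\ ~ proportional x2 x3 /\
      forall x, curve_pt g x -> on_plane b x ->
        proportional x1 x \/ proportional x2 x \/ proportional x3 x).

(** p is a singular point of the parametrized curve: p has multiplicity >= 2
    on the curve, i.e. every plane through p cuts the curve with
    multiplicity >= 2 at (the preimages of) p: all the binary forms
    l(g) with l(p) = 0 are divisible by a common binary quadratic form. *)
Definition singular_point (g : 'I_4 -> {mpoly CC[2]}) (p : pt4) : Prop :=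
  exists h : {mpoly CC[2]}, h \is 2.-homog /\ h != 0 /\
    forall l : pt4, on_plane l p -> mdivides h (\sum_(i < 4) l i *: g i).

Definition deJonquieres33 : quad -> Prop :=
  fun psi => Bir33 psi /\ exists phi, inverse33 psi phi /\
    exists p : pt4, nonzero_pt p /\
      generic_line (fun u v =>
        let g := restr_line phi u v in
        plane_curve g /\ rational_cubic_curve g /\ singular_point g p).

(* Main.v *)
(** Let phi be the inverse of psi. For a point o and a plane <o,v1,v2>, let a be the plane spanned by psi(o) and the derivatives of psi at o along v1 and v2.
  The cubic a.psi then has a node at o in the plane, and rho(o,v1,v2) is the resultant of its quadratic and cubic parts.
  If rho vanishes identically, a generic plane contains a line mapped to a line; these lines force a double line of base
  points. Then every a.psi is ruled, and psi is a limit of an explicit irreducible family [sfam] of ruled maps.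
  Conversely a ruling of a.psi through o gives rho = 0, so ruled maps are cut out by rho = 0.
  If rho is not identically zero, the nodal cubic a.psi = 0 of the plane is rational, and it yields three linear syzygies of psi
  unless the images under phi of all lines are planar; in the first case psi is determinantal.
  In the second case phi is of de Jonquieres form: three independent linear combinations of its components share a quadratic
  factor. The inverse of such a map is a limit of minors of a pencil of matrices.
  Finally the matrix of the products x_i psi_j has a nonzero minor of order 14 at a ruled map, while three independent linear
  syzygies kill it; and rho is nonzero at the standard Cremona map, which is determinantal. *)

From HB Require Import structures.
From mathcomp Require Import all_boot all_algebra ssrnum.
From mathcomp Require Import perm ring zify.
From mathcomp Require Import Rstruct complex.
From mathcomp Require Import mpoly.
From Stdlib Require Import Classical FunctionalExtensionality PropExtensionality.
Require Import Defs.

Set Implicit Arguments.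
Unset Strict Implicit.
Unset Printing Implicit Defensive.

Import GRing.Theory Num.Theory.
Local Open Scope ring_scope.

(** Let phi be the inverse of psi. A plane n = <o, v1, v2> and the plane a that it determines play
    symmetric roles: a.psi cuts n in a cubic with node o, n.phi cuts a in a cubic with node psi(o),
    and psi maps one curve to the other. Both are parametrized by the slope at the node, so
    injectivity makes psi a Moebius transformation between the slopes. A linear syzygy over the
    plane a then has 8 unknowns subject to the 5 coefficients of a polynomial of degree 4, whence
    three syzygies. They are glued along a line whose image under phi is a twisted cubic, because a
    linear form vanishing on such a curve is zero. Generic position is expressed by functions
    polynomial along lines: two of them that are not identically zero are nonzero at a common point.
    The size of the base locus is controlled by elimination in a factorial ring: a family without
    common factor has a nonzero eliminant. The order 14 is 16 - 2: the chosen ruled map satisfies x1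
    psi0 = x0 psi1 and x3 psi2 = x2 psi3, and three independent syzygies have a nonzero combination
    that avoids one product of each relation. *)

(** * Prime elements and unique factorization in an integral domain *)

Section Factoriality.
Variable R : idomainType.
Implicit Types a b c p : R.

Definition rdvd a b : Prop := exists c, b = a * c.

Definition rprime p : Prop :=
 [/\ p != 0, p \isn't a GRing.unit & forall a b, rdvd p (a * b) -> rdvd p a \/ rdvd p b].

Definition factorial_ring : Prop :=
 forall a, a != 0 -> exists s : seq R,
  (forall p, p \in s -> rprime p) /\ exists2 u, u \is a GRing.unit & a = u * \prod_(p <- s) p.

Lemma rdvd0 a : rdvd a 0.
Proof. by exists 0; rewrite mulr0. Qed.

Lemma rdvd_refl a : rdvd a a.
Proof. by exists 1; rewrite mulr1. Qed.

Lemma rdvd_trans b a c : rdvd a b -> rdvd b c -> rdvd a c.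
Proof. by move=> [x ->] [y ->]; exists (x * y); rewrite mulrA. Qed.

Lemma rdvd_mull a b c : rdvd a c -> rdvd a (b * c).
Proof. by move=> [x ->]; exists (b * x); rewrite mulrCA. Qed.

Lemma rdvd_mulr a b c : rdvd a b -> rdvd a (b * c).
Proof. by rewrite mulrC; apply: rdvd_mull. Qed.

Lemma rdvd_add a b c : rdvd a b -> rdvd a c -> rdvd a (b + c).
Proof. by move=> [x ->] [y ->]; exists (x + y); rewrite mulrDr. Qed.

Lemma rdvd_opp a b : rdvd a b -> rdvd a (- b).
Proof. by move=> [x ->]; exists (- x); rewrite mulrN. Qed.

Lemma rdvd_sub a b c : rdvd a b -> rdvd a c -> rdvd a (b - c).
Proof. by move=> ? ?; apply: rdvd_add => //; apply: rdvd_opp. Qed.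

Lemma rdvd_unit a u : u \is a GRing.unit -> rdvd a u -> a \is a GRing.unit.
Proof. by move=> uu [x e]; move: uu; rewrite e unitrM => /andP[]. Qed.

Lemma rdvd_cancel c a b : c != 0 -> rdvd (c * a) (c * b) -> rdvd a b.
Proof. by move=> c0 [x]; rewrite -mulrA => /(mulfI c0) ->; exists x. Qed.

Lemma prime_rdvd_assoc p q : rprime p -> rprime q -> rdvd p q -> rdvd q p.
Proof.
move=> [p0 pu _] [q0 qu qp] [x e].
have /qp[//|[y e2]] : rdvd q (p * x) by rewrite -e; apply: rdvd_refl.
move: e; rewrite e2 mulrCA -{1}[q]mulr1 => /(mulfI q0) e.
by case/negP: pu; apply/unitrPr; exists y.
Qed.

Hypothesis Rfact : factorial_ring.

Lemma factorial_ind (P : R -> Prop) :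
 (forall u, u \is a GRing.unit -> P u) ->
 (forall p a, rprime p -> a != 0 -> P a -> P (p * a)) ->
 forall a, a != 0 -> P a.
Proof.
move=> Pu Pp a /Rfact[s [sp [u uu ->]]]; elim: s sp => [|p s IH] sp.
 by rewrite big_nil mulr1; apply: Pu.
have sp' q : q \in s -> rprime q by move=> qs; apply: sp; rewrite inE qs orbT.
rewrite big_cons mulrCA; apply: Pp (IH sp') => //; first by apply: sp; rewrite inE eqxx.
rewrite mulf_neq0 //; first by apply: contraTneq uu => ->; rewrite unitr0.
rewrite prodf_seq_neq0; apply/allP => q /sp' [q0 _ _]; exact/implyP.
Qed.

Lemma exists_prime_divisor a :
 a != 0 -> a \isn't a GRing.unit -> exists2 p, rprime p & rdvd p a.
Proof.
move=> a0; elim/factorial_ind: a / a0 => [u -> //|p a pp a0 _ _].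
by exists p => //; exists a.
Qed.

Lemma no_prime_divisor_unit a :
 a != 0 -> (forall p, rprime p -> ~ rdvd p a) -> a \is a GRing.unit.
Proof.
move=> a0 h; apply: NNPP => /negP nu.
by have [p pp pa] := exists_prime_divisor a0 nu; apply: h pa.
Qed.

(** Strip the primes of [c] one at a time: such a prime divides every [g * f i] but misses some
    [f i], hence divides [g] and cancels on both sides. *)
Lemma coprime_family_rdvd (I : Type) (f : I -> R) c g :
 c != 0 -> (forall p, rprime p -> ~ (forall i, rdvd p (f i))) ->
 (forall i, rdvd c (g * f i)) -> rdvd c g.
Proof.
move=> c0 hf; elim/factorial_ind: c / c0 g => [u uu g _|p a pp a0 IH g hg].
 by exists (u^-1 * g); rewrite mulVKr.
have [i ni] : exists i, ~ rdvd p (f i).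
 by apply: not_all_ex_not; apply: hf.
have [p0 _ hp] := pp.
have /hp[[g' eg]|//] : rdvd p (g * f i) by apply: rdvd_trans (hg i); exists a.
rewrite eg; have [x ->] : rdvd a g'; last by exists x; rewrite mulrA.
by apply: IH => j; apply: (rdvd_cancel p0); have := hg j; rewrite eg mulrA.
Qed.

(** Removing one prime shortens the factorization by exactly one; this length is the measure that
    makes the extraction of a primitive part terminate. *)
Lemma prime_divisor_split p (s : seq R) u :
 rprime p -> (forall q, q \in s -> rprime q) -> u \is a GRing.unit ->
 rdvd p (u * \prod_(q <- s) q) ->
 exists s' u', [/\ (forall q, q \in s' -> rprime q), u' \is a GRing.unit,
   size s = (size s').+1 & u * \prod_(q <- s) q = p * (u' * \prod_(q <- s') q)].
Proof.
move=> pp; have [p0 pu hp] := pp.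
elim: s u => [|q s IH] u sp uu; rewrite ?big_nil ?mulr1 => pd.
 by case/negP: pu; apply: rdvd_unit pd.
have sp' r : r \in s -> rprime r by move=> qs; apply: sp; rewrite inE qs orbT.
have qp : rprime q by apply: sp; rewrite inE eqxx.
move: pd; rewrite big_cons mulrCA => /hp[pq|pd].
 have [y ey] := prime_rdvd_assoc pp qp pq; have [x ex] := pq.
 have yx1 : y * x = 1.
  by apply: (mulfI p0); rewrite mulr1 [y * x]mulrC mulrA -ex.
 exists s, (u * x); split=> //.
  by rewrite unitrM uu; apply/unitrPr; exists y; rewrite mulrC.
 by rewrite ex; ring.
have [s' [u' [h1 h2 h3 h4]]] := IH u sp' uu pd.
exists (q :: s'), u'; split=> //=; last by rewrite big_cons h4; ring.
- by move=> r; rewrite inE => /orP[/eqP->|/h1].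
- by rewrite h3.
Qed.

End Factoriality.

(** * Gauss's theorem for polynomials over a factorial ring *)

Section PolyFactorial.
Variable R : idomainType.
Hypothesis Rfact : factorial_ring R.
Implicit Types (p q f g r d : {poly R}) (c : R).

Lemma rdvd_polyCP c q : rdvd c%:P q <-> forall i, rdvd c q`_i.
Proof.
split=> [[k ->] i|]; first by rewrite coefCM; exists k`_i.
elim/poly_ind: q => [|q b IH] h; first exact: rdvd0.
have [k ek] : rdvd c%:P q.
 by apply: IH => i; have := h i.+1; rewrite coefD coefMX coefC /= addr0.
have [x ex] : rdvd c b by have := h 0%N; rewrite coefD coefMX coefC /= add0r.
by exists (k * 'X + x%:P); rewrite ek ex mulrDr mulrA polyCM.
Qed.

(** Induction on the total size: [c] divides the product of the constant terms, hence one of them;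
    removing that term and dividing by ['X] leaves a smaller product. *)
Lemma polyC_rprime c : rprime c -> rprime c%:P.
Proof.
move=> [c0 cu hc]; split; first by rewrite polyC_eq0.
 by rewrite poly_unitE coefC eqxx negb_and cu orbT.
move=> a b; have [n] := ubnP (size a + size b)%N; elim: n a b => // n IH a b.
rewrite ltnS => sn dab.
have [->|a0] := eqVneq a 0; first by left; apply: rdvd0.
have [->|b0] := eqVneq b 0; first by right; apply: rdvd0.
have ea := poly_take_drop 1 a; have eb := poly_take_drop 1 b.
have h1 (p : {poly R}) : take_poly 1 p = (p`_0)%:P.
 by apply/polyP => i; rewrite coef_take_poly coefC; case: i.
rewrite !h1 expr1 in ea eb.
have sz (p : {poly R}) : p != 0 -> (size (drop_poly 1 p) < size p)%N.
 by move=> p0; rewrite size_drop_poly subn1 prednK // size_poly_gt0.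
have red (p : {poly R}) : rdvd c p`_0 -> rdvd c%:P (drop_poly 1 p) -> rdvd c%:P p.
 move=> [x ex] hd; rewrite -[p](poly_take_drop 1) h1 expr1; apply: rdvd_add.
  by exists x%:P; rewrite ex polyCM.
 exact: rdvd_mulr.
have dX (p : {poly R}) : rdvd c%:P (p * 'X) -> rdvd c%:P p.
 by move/rdvd_polyCP => h; apply/rdvd_polyCP => i; have := h i.+1; rewrite coefMX.
have /hc[ha|hb] : rdvd c (a`_0 * b`_0).
 by move/rdvd_polyCP: (dab) => /(_ 0%N); rewrite coefM big_ord_recl big_ord0 addr0 subn0.
- have d1 : rdvd c%:P (drop_poly 1 a * b).
  apply: dX; have -> : drop_poly 1 a * b * 'X = a * b - (a`_0)%:P * b.
   by rewrite -{2}ea mulrDl addrC addKr mulrAC.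
  apply: rdvd_sub => //; apply: rdvd_mulr; case: ha => x ->.
  by exists x%:P; rewrite polyCM.
 have [|h|h] := IH _ _ _ d1; last by right.
  by apply: leq_trans sn; rewrite ltn_add2r sz.
 by left; apply: red.
- have d1 : rdvd c%:P (a * drop_poly 1 b).
  apply: dX; have -> : a * drop_poly 1 b * 'X = a * b - a * (b`_0)%:P.
   by rewrite -{2}eb mulrDr addrC addKr mulrA.
  apply: rdvd_sub => //; apply: rdvd_mull; case: hb => x ->.
  by exists x%:P; rewrite polyCM.
 have [|h|h] := IH _ _ _ d1; first by apply: leq_trans sn; rewrite ltn_add2l sz.
  by left.
 by right; apply: red.
Qed.

Definition primitive_poly r := forall c, rprime c -> ~ rdvd c%:P r.

(** A prime factor of [c] divides [r * k] and cannot divide the primitive [r], so it divides the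
    cofactor [k] and cancels. *)
Lemma gauss_cancel c r f :
 c != 0 -> primitive_poly r -> rdvd r (c%:P * f) -> rdvd r f.
Proof.
move=> c0 pr; elim/(factorial_ind Rfact): c / c0 f => [u uu f [k ek]|c a pc a0 IH f [k ek]].
 exists (u^-1%:P * k); rewrite mulrCA -ek mulrA -polyCM mulVr //.
 by rewrite mul1r.
have [_ _ hc] := polyC_rprime pc.
have /hc[/pr//|[k' ek']] : rdvd c%:P (r * k).
 by rewrite -ek polyCM -mulrA; exists (a%:P * f).
apply: IH; exists k'; have c0 : c%:P != 0 by have [? _ _] := polyC_rprime pc.
by apply: (mulfI c0); rewrite [LHS]mulrA -polyCM ek ek' mulrCA.
Qed.

Lemma primitive_part f : f != 0 ->
 exists c r, [/\ c != 0, primitive_poly r & f = c%:P * r].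
Proof.
move=> f0; have l0 : lead_coef f != 0 by rewrite lead_coef_eq0.
have [s [sp [u uu eu]]] := Rfact l0.
(* Every prime extracted from [f] also divides the leading coefficient, so the number of prime
   factors of the latter decreases. *)
have [n] := ubnP (size s); elim: n s u f f0 l0 sp uu eu => // n IH s u f f0 l0 sp uu eu.
rewrite ltnS => sn; have [pf|] := classic (primitive_poly f).
 by exists 1, f; rewrite oner_neq0 mul1r.
move=> /not_all_ex_not[c h]; have [pc /NNPP[k ek]] := imply_to_and _ _ h; clear h.
have [c0 _ _] := pc.
have el : lead_coef f = c * lead_coef k by rewrite ek lead_coefM lead_coefC.
have [|s' [u' [sp' uu' ss es]]] := prime_divisor_split pc sp uu.
 by rewrite -eu el; exists (lead_coef k).
have k0 : k != 0 by apply: contraNneq f0 => k0; rewrite ek k0 mulr0.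
have ek2 : lead_coef k = u' * \prod_(q <- s') q.
 by apply: (mulfI c0); rewrite -el eu es.
have [||a [r [a0 pr er]]] := IH s' u' k k0 _ sp' uu' ek2.
- by rewrite lead_coef_eq0.
- by rewrite ss in sn.
by exists (c * a), r; rewrite mulf_neq0 // ek er polyCM mulrA.
Qed.

(** A substitute for principal ideals over the fraction field. Pseudo-division by an element of
    least size leaves no remainder, so after [gauss_cancel] its primitive part [r] divides the whole
    ideal; [c] is its content. *)
Lemma ideal_divisor (I : {poly R} -> Prop) :
 (forall f g, I f -> I g -> I (f + g)) -> (forall f g, I g -> I (f * g)) ->
 (exists2 f, I f & f != 0) ->
 exists c r, [/\ c != 0, primitive_poly r, r != 0, I (c%:P * r) & forall g, I g -> rdvd r g].
Proof.
move=> Iadd Imul [f If f0].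
have [r [Ir r0 rmin]] : exists r, [/\ I r, r != 0 & forall g, I g -> g != 0 -> (size r <= size g)%N].
 have [n] := ubnP (size f); elim: n f If f0 => // n IH f If f0; rewrite ltnS => sn.
 have [h|] := classic (forall g, I g -> g != 0 -> (size f <= size g)%N); first by exists f.
 move=> /not_all_ex_not[g h]; have [Ig h'] := imply_to_and _ _ h.
 have [g0 /negP] := imply_to_and _ _ h'; rewrite -ltnNge => lt.
 by apply: (IH g) => //; apply: leq_trans sn.
have [c [q [c0 pq er]]] := primitive_part r0.
have q0 : q != 0 by apply: contraNneq r0 => q0; rewrite er q0 mulr0.
exists c, q; split=> //; first by rewrite -er.
move=> g Ig; have eg := Pdiv.Idomain.divp_eq g r.
have lr : lead_coef r ^+ scalp g r != 0 by rewrite expf_neq0 // lead_coef_eq0.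
apply: (gauss_cancel lr pq); rewrite mul_polyC eg.
have -> : g %% r = 0; last by rewrite addr0 {2}er; apply: rdvd_mull; exists c%:P; rewrite mulrC.
apply/eqP; apply: contraT => m0.
have Im : I (g %% r).
 have -> : g %% r = (lead_coef r ^+ scalp g r)%:P * g + (- (g %/ r)) * r.
  by rewrite mul_polyC eg mulNr addrC addKr.
 by apply: Iadd; apply: Imul.
by have := rmin _ Im m0; rewrite leqNgt ltn_modp r0.
Qed.

Lemma primitive_const c : c != 0 -> primitive_poly c%:P -> c \is a GRing.unit.
Proof.
move=> c0 pc; apply: (no_prime_divisor_unit Rfact c0) => p pp [x e].
by apply: (pc p pp); exists x%:P; rewrite e polyCM.
Qed.

Lemma polyC_unit c : c \is a GRing.unit -> c%:P \is a @GRing.unit {poly R}.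
Proof. by move=> h; rewrite poly_unitE coefC size_polyC eqxx h; case: (c =P 0) h => [->|]; rewrite ?unitr0. Qed.

Lemma primitive_dvd d f : primitive_poly f -> rdvd d f -> primitive_poly d.
Proof. by move=> pf df c pc cd; apply: (pf c pc); apply: rdvd_trans df. Qed.

(** A Bezout argument: the common divisor [r] of the ideal (d, f) is either of positive degree,
    hence associated to [d], or constant, and then [d] divides a constant times [g], which Gauss's
    lemma cancels. *)
Lemma minimal_divisor_prime d : (1 < size d)%N -> primitive_poly d ->
 (forall e, rdvd e d -> (1 < size e)%N -> (size d <= size e)%N) -> rprime d.
Proof.
move=> sd pd dmin; have d0 : d != 0 by rewrite -size_poly_gt0; apply: leq_trans sd.
split=> //; first by rewrite poly_unitE gtn_eqF.
move=> f g dfg.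
have [||| c [r [c0 pr r0 [u [v euv]] hr]]] := @ideal_divisor (fun h => exists u v, h = u * d + v * f).
- by move=> _ _ [u1 [v1 ->]] [u2 [v2 ->]]; exists (u1 + u2), (v1 + v2); ring.
- by move=> h _ [u1 [v1 ->]]; exists (h * u1), (h * v1); ring.
- by exists d => //; exists 1, 0; rewrite mul1r mul0r addr0.
have rd : rdvd r d by apply: hr; exists 1, 0; rewrite mul1r mul0r addr0.
have rf : rdvd r f by apply: hr; exists 0, 1; rewrite mul1r mul0r add0r.
have [s1|s1] := ltnP 1 (size r).
 left; have [k ek] := rd.
 have k0 : k != 0 by apply: contraNneq d0 => k0; rewrite ek k0 mulr0.
 have sk : size k = 1%N.
  have := dmin r rd s1; rewrite ek size_mul // -(prednK (ltnW s1)) addSn /= => le.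
  have : (0 < size k)%N by rewrite size_poly_gt0.
  by move=> sk0; apply/eqP; rewrite eqn_leq sk0 andbT -(leq_add2l (size r).-1) addn1.
 move: k0 ek; rewrite (size1_polyC (eq_leq sk)) polyC_eq0 => k0 ek.
 have uk : k`_0 \is a GRing.unit.
  apply: primitive_const => //; apply: (primitive_dvd pd).
  by exists r; rewrite ek mulrC.
 case: rf => x ->; exists ((k`_0)^-1%:P * x).
 by rewrite ek -!mulrA [_ * (_ * x)]mulrA -polyCM divrr // mul1r.
right; have er := size1_polyC s1; move: r0 euv; rewrite er polyC_eq0 => r0 euv.
apply: (@gauss_cancel (c * r`_0)) => //; first by rewrite mulf_neq0.
rewrite polyCM euv mulrDl; apply: rdvd_add; first by exists (u * g); ring.
by rewrite -mulrA; apply: rdvd_mull.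
Qed.

Lemma primitive_factorization f : f != 0 -> primitive_poly f -> exists s : seq {poly R},
  (forall p, p \in s -> rprime p) /\
  exists2 u, u \is a @GRing.unit {poly R} & f = u * \prod_(p <- s) p.
Proof.
have [n] := ubnP (size f); elim: n f => // n IH f; rewrite ltnS => sn f0 pf.
have [s1|s1] := leqP (size f) 1.
 exists [::]; split=> //; exists f; last by rewrite big_nil mulr1.
 rewrite (size1_polyC s1) polyC_unit // primitive_const -?(size1_polyC s1) //.
 by rewrite -polyC_eq0 -(size1_polyC s1).
have [d [df d1 dmin]] : exists d, [/\ rdvd d f, (1 < size d)%N &
  forall e, rdvd e d -> (1 < size e)%N -> (size d <= size e)%N].
 suff main m d : (size d < m)%N -> rdvd d f -> (1 < size d)%N -> exists d, [/\ rdvd d f, (1 < size d)%N &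
   forall e, rdvd e d -> (1 < size e)%N -> (size d <= size e)%N].
  exact: (main (size f).+1 f (ltnSn _) (rdvd_refl f) s1).
 elim: m d => // m IHm d; rewrite ltnS => sm df d1.
 have [h|] := classic (forall e, rdvd e d -> (1 < size e)%N -> (size d <= size e)%N); first by exists d.
 move=> /not_all_ex_not[g h]; have [Ig h'] := imply_to_and _ _ h.
 have [g0 /negP] := imply_to_and _ _ h'; rewrite -ltnNge => lt.
 by apply: (IHm g) => //; [apply: leq_trans sm | apply: rdvd_trans df].
have pd := minimal_divisor_prime d1 (primitive_dvd pf df) dmin.
have [k ek] := df.
have k0 : k != 0 by apply: contraNneq f0 => k0; rewrite ek k0 mulr0.
have d0 : d != 0 by rewrite -size_poly_gt0; apply: leq_trans d1.
have [|||s [sp [u uu eu]]] := IH k.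
- apply: leq_trans sn; rewrite ek size_mul //.
 by case: (size d) d1 => [//|[//|m]] _; rewrite addSn /= ltnS leq_addl.
- by [].
- by apply: (primitive_dvd pf); exists d; rewrite ek mulrC.
exists (d :: s); split; first by move=> p; rewrite inE => /orP[/eqP->|/sp].
by exists u => //; rewrite big_cons ek eu mulrCA.
Qed.

Lemma factorial_poly : factorial_ring {poly R}.
Proof.
move=> f f0; have [c [r [c0 pr er]]] := primitive_part f0.
have r0 : r != 0 by apply: contraNneq f0 => q0; rewrite er q0 mulr0.
have [s [sp [u uu eu]]] := primitive_factorization r0 pr.
have [t [tp [v vv ev]]] := Rfact c0.
exists (map (@polyC R) t ++ s); split.
 by move=> p; rewrite mem_cat => /orP[/mapP[q /tp qt ->]|/sp//]; apply: polyC_rprime.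
exists (v%:P * u); first by rewrite unitrM polyC_unit.
rewrite er eu ev big_cat big_map /= polyCM rmorph_prod /=; ring.
Qed.

(** Elimination of ['X]: the primitive divisor of the ideal generated by the family has no prime
    factor, hence is a unit, and what remains is a nonzero constant in the ideal. *)
Lemma ideal_constant k (f : 'I_k -> {poly R}) :
 (exists i, f i != 0) -> (forall p, rprime p -> ~ (forall i, rdvd p (f i))) ->
 exists2 c : R, c != 0 & exists u : 'I_k -> {poly R}, c%:P = \sum_i u i * f i.
Proof.
move=> [i0 fi0] hf.
have [||| c [r [c0 pr r0 [u eu] hr]]] := @ideal_divisor (fun h => exists u : 'I_k -> {poly R}, h = \sum_i u i * f i).
- move=> _ _ [u ->] [v ->]; exists (fun i => u i + v i).
 by rewrite -big_split; apply: eq_bigr => i _; rewrite mulrDl.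
- by move=> g _ [u ->]; exists (fun i => g * u i); rewrite mulr_sumr; apply: eq_bigr => i _; rewrite mulrA.
- exists (f i0) => //; exists (fun i => (i == i0)%:R); rewrite (bigD1 i0) //= eqxx mul1r big1 ?addr0 //.
 by move=> i /negPf->; rewrite mul0r.
have ru : r \is a GRing.unit.
 apply: (no_prime_divisor_unit factorial_poly r0) => p pp pr'; apply: (hf p pp) => i.
 apply: rdvd_trans pr' _; apply: hr; exists (fun j => (j == i)%:R).
 by rewrite (bigD1 i) //= eqxx mul1r big1 ?addr0 // => j /negPf->; rewrite mul0r.
move: ru eu r0; rewrite poly_unitE => /andP[/eqP s1 _]; rewrite (size1_polyC (eq_leq s1)) polyC_eq0 => eu r0.
by exists (c * r`_0); [rewrite mulf_neq0 | exists u; rewrite polyCM].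
Qed.

End PolyFactorial.

(** * Several variables: factoriality, elimination, hypersurfaces *)

Section MpolyFactorial.
Variable K : numClosedFieldType.

Local Notation widen := (widen_ord (leqnSn _)).

Lemma mpoly_rmorph_eq n (S : comNzRingType) (f g : {rmorphism {mpoly K[n]} -> S}) :
 (forall c, f c%:MP = g c%:MP) -> (forall i, f 'X_i = g 'X_i) -> f =1 g.
Proof.
move=> hC hX p; rewrite [p]mpolyE !rmorph_sum; apply: eq_bigr => m _ /=.
rewrite -mul_mpolyC !rmorphM /= hC; congr (_ * _).
rewrite mpolyXE_id !rmorph_prod; apply: eq_bigr => i _ /=.
by rewrite !rmorphXn /= hX.
Qed.

Lemma muni_Xmax n : muni ('X_ord_max : {mpoly K[n.+1]}) = 'X.
Proof.
rewrite /muni mmapX mmap1U; case: splitP => //; case=> j lt_jn /eqP /=.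
by have := lt_jn; rewrite ltn_neqAle eq_sym=> /andP[/negbTE->].
Qed.

Lemma muni_Xwiden n (i : 'I_n) : muni ('X_(widen i) : {mpoly K[n.+1]}) = ('X_i)%:P.
Proof.
rewrite /muni mmapX mmap1U; case: splitP => [j eq|j].
 by congr ('X__)%:P; apply/val_inj=> /=; rewrite -eq.
by rewrite ord1 /= addn0 => /eqP /=; rewrite ltn_eqF.
Qed.

Lemma ord_widenP n (i : 'I_n.+1) : i = ord_max \/ exists j : 'I_n, i = widen j.
Proof.
have := ltn_ord i; rewrite ltnS leq_eqVlt => /orP[/eqP e|lt].
 by left; apply: val_inj.
by right; exists (Ordinal lt); apply: val_inj.
Qed.

Lemma muni_mwiden n (c : {mpoly K[n]}) : muni (mwiden c) = c%:P.
Proof.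
have := @mpoly_rmorph_eq n {poly {mpoly K[n]}} (@muni n K \o @mwiden n K) (@polyC _).
apply=> [b|i] /=; first by rewrite mwidenC muniC.
by rewrite mwidenX mnmwiden1 muni_Xwiden.
Qed.

Definition of_muni n (q : {poly {mpoly K[n]}}) : {mpoly K[n.+1]} :=
 (map_poly (@mwiden n K) q).['X_ord_max].

Lemma of_muniE n : @of_muni n =1 (horner_eval ('X_ord_max) \o map_poly (@mwiden n K)).
Proof. by move=> q; rewrite /= /horner_eval. Qed.

Lemma muniK n : cancel (@muni n K) (@of_muni n).
Proof.
move=> p; rewrite of_muniE.
have := @mpoly_rmorph_eq n.+1 {mpoly K[n.+1]}
 ((horner_eval ('X_ord_max) \o map_poly (@mwiden n K)) \o @muni n K) idfun.
apply=> [b|i] /=; first by rewrite muniC map_polyC /= /horner_eval hornerC mwidenC.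
case: (ord_widenP i) => [->|[j ->]].
 by rewrite muni_Xmax map_polyX /horner_eval hornerX.
by rewrite muni_Xwiden map_polyC /= /horner_eval hornerC mwidenX mnmwiden1.
Qed.

Lemma of_muniK n : cancel (@of_muni n) (@muni n K).
Proof.
elim/poly_ind => [|q c IH]; rewrite /of_muni.
 by rewrite rmorph0 horner0 muni0.
rewrite rmorphD rmorphM /= map_polyX map_polyC /= hornerD hornerM hornerX hornerC.
by rewrite muniD muniM muni_Xmax muni_mwiden IH.
Qed.

Lemma iso_dvd (R S : idomainType) (f : {rmorphism R -> S}) (g : S -> R) :
 cancel f g -> cancel g f -> forall a b, rdvd a b <-> rdvd (f a) (f b).
Proof.
move=> fK gK a b; split=> [[c ->]|[c ec]]; first by exists (f c); rewrite rmorphM.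
by exists (g c); apply: (can_inj fK); rewrite rmorphM gK.
Qed.

Lemma iso_unit (R S : idomainType) (f : {rmorphism R -> S}) (g : S -> R) :
 cancel f g -> cancel g f -> forall a, (f a \is a GRing.unit) = (a \is a GRing.unit).
Proof.
move=> fK gK a; apply/idP/idP => [/unitrP[x [xa ax]]|]; last exact: rmorph_unit.
by apply/unitrP; exists (g x); split; apply: (can_inj fK); rewrite rmorphM gK rmorph1.
Qed.

Lemma iso_rprime (R S : idomainType) (f : {rmorphism R -> S}) (g : S -> R) :
 cancel f g -> cancel g f -> forall a, rprime a <-> rprime (f a).
Proof.
move=> fK gK a; have dv := iso_dvd fK gK; split=> -[h0 hu hp]; split.
- by apply: contra_neq h0 => h; apply: (can_inj fK); rewrite h rmorph0.
- by rewrite (iso_unit fK gK).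
- move=> x y; rewrite -[x]gK -[y]gK -rmorphM => /dv /hp.
 by case=> h; [left|right]; apply/dv.
- by apply: contra_neq h0 => ->; rewrite rmorph0.
- by rewrite -(iso_unit fK gK).
- move=> x y /dv; rewrite rmorphM => /hp.
 by case=> h; [left|right]; apply/dv.
Qed.

Lemma iso_factorial (R S : idomainType) (f : {rmorphism R -> S}) (g : S -> R) :
 cancel f g -> cancel g f -> factorial_ring S -> factorial_ring R.
Proof.
move=> fK gK fact a a0.
have fa0 : f a != 0 by apply: contra_neq a0 => h; apply: (can_inj fK); rewrite h rmorph0.
have [s [sp [u uu eu]]] := fact _ fa0.
exists (map g s); split.
 by move=> p /mapP[q /sp qp ->]; apply/(iso_rprime fK gK); rewrite gK.
exists (g u); first by rewrite -(iso_unit fK gK) gK.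
apply: (can_inj fK); rewrite eu rmorphM gK rmorph_prod big_map; congr (_ * _).
by apply: eq_bigr => q _; rewrite gK.
Qed.

Lemma mpoly_unitE n (p : {mpoly K[n]}) :
 p \is a GRing.unit -> exists2 c, c != 0 & p = c%:MP.
Proof. by move=> /andP[/eqP e u]; exists p@_0 => //; rewrite -unitfE. Qed.

Lemma mpolyC_unit n (c : K) : c != 0 -> c%:MP_[n] \is a GRing.unit.
Proof. by move=> c0; apply: rmorph_unit; rewrite unitfE. Qed.

Lemma mpoly0_unit (p : {mpoly K[0]}) : p != 0 -> p \is a GRing.unit.
Proof.
move=> p0; have e : p = (p@_0)%:MP.
 by apply/mpolyP => m; rewrite mcoeffC (_ : m = 0%MM) ?eqxx ?mulr1 //; apply/mnmP; case.
by rewrite e mpolyC_unit //; apply: contra_neq p0 => h; rewrite e h mpolyC0.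
Qed.

Lemma factorial_mpoly n : factorial_ring {mpoly K[n]}.
Proof.
elim: n => [|n IH].
 move=> p p0; exists [::]; split=> //; exists p; last by rewrite big_nil mulr1.
 exact: mpoly0_unit.
exact: iso_factorial (@muniK n) (@of_muniK n) (factorial_poly IH).
Qed.

Lemma meval_muni n (p : {mpoly K[n.+1]}) (x : 'I_n.+1 -> K) :
 p.@[x] = (map_poly (meval (fun i => x (widen i))) (muni p)).[x ord_max].
Proof.
have := @mpoly_rmorph_eq n.+1 K (meval x)
 ((horner_eval (x ord_max) \o map_poly (meval (fun i : 'I_n => x (widen i)))) \o @muni n K).
apply=> [b|i] /=; first by rewrite muniC map_polyC /= /horner_eval hornerC !mevalC.
case: (ord_widenP i) => [->|[j ->]].
 by rewrite muni_Xmax map_polyX /horner_eval hornerX mevalXU.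
by rewrite muni_Xwiden map_polyC /= /horner_eval hornerC !mevalXU.
Qed.

Lemma poly_nonroot (p : {poly K}) : p != 0 -> exists t, p.[t] != 0.
Proof.
move=> p0; apply: NNPP => h.
have hr t : root p t by apply/negPn/negP => /negP nt; apply: h; exists t; apply/negP.
have ra : all (root p) [seq i%:R | i <- iota 0 (size p)] by apply/allP.
have ru : uniq [seq (i%:R : K) | i <- iota 0 (size p)].
 by rewrite map_inj_uniq ?iota_uniq //; move=> i j /eqP; rewrite eqr_nat => /eqP.
by have := max_poly_roots p0 ra ru; rewrite size_map size_iota ltnn.
Qed.

Definition extend_pt n (x : 'I_n -> K) (t : K) : 'I_n.+1 -> K :=
 fun i => if insub (val i) is Some j then x j else t.

Lemma extend_pt_max n (x : 'I_n -> K) t : extend_pt x t ord_max = t.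
Proof. by rewrite /extend_pt insubF //= ltnn. Qed.

Lemma extend_pt_widen n (x : 'I_n -> K) t i : extend_pt x t (widen i) = x i.
Proof.
rewrite /extend_pt; case: insubP => [j _ e|]; last by rewrite /= ltn_ord.
by congr x; apply: val_inj; rewrite e.
Qed.

Lemma meval_extend n (p : {mpoly K[n.+1]}) x t :
 p.@[extend_pt x t] = (map_poly (meval x) (muni p)).[t].
Proof.
rewrite meval_muni extend_pt_max; congr (_.[_]); apply: eq_map_poly => q.
by apply: meval_eq => i; rewrite extend_pt_widen.
Qed.

Lemma meval_neq0 n (p : {mpoly K[n]}) : p != 0 -> exists x, p.@[x] != 0.
Proof.
elim: n p => [|n IH] p p0.
 have [c c0 ->] := mpoly_unitE (mpoly0_unit p0).
 by exists (fun=> 0); rewrite mevalC.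
have q0 : muni p != 0 by rewrite -(can_eq (@of_muniK n)) muniK /of_muni rmorph0 horner0.
have [x hx] : exists x, (lead_coef (muni p)).@[x] != 0 by apply: IH; rewrite lead_coef_eq0.
have [|t ht] := @poly_nonroot (map_poly (meval x) (muni p)).
 by apply: contra_neq hx => h; rewrite lead_coefE -coef_map /= h coef0.
by exists (extend_pt x t); rewrite meval_extend.
Qed.

Lemma meval_inj n (p q : {mpoly K[n]}) : (forall x, p.@[x] = q.@[x]) -> p = q.
Proof.
move=> h; apply/eqP; rewrite -subr_eq0; apply/negPn/negP => /meval_neq0[x].
by rewrite mevalB h subrr eqxx.
Qed.

Definition coprime_family k n (f : 'I_k -> {mpoly K[n]}) : Prop :=
 forall p, rprime p -> ~ forall i, rdvd p (f i).

(** [f i0] divides every [f j * g i0] and the [f j] have no common prime, so it divides [g i0]; the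
    quotient serves all indices. Proportional maps are compared in this way throughout. *)
Lemma mpoly_cross_ratio k n (f g : 'I_k -> {mpoly K[n]}) :
 coprime_family f -> (exists i, f i != 0) -> (forall i j, f i * g j = f j * g i) ->
 exists r, forall i, g i = f i * r.
Proof.
move=> cf [i0 fi0] h.
have [r er] : rdvd (f i0) (g i0).
 apply: (coprime_family_rdvd (@factorial_mpoly n) fi0 cf) => j.
 by exists (g j); rewrite h mulrC.
exists r => j; apply: (mulfI fi0); rewrite h er; ring.
Qed.

(** [D] is a combination of the family that is free of the last variable, so it sees a common zero
    only through its projection. *)
Lemma base_elimination k n (f : 'I_k -> {mpoly K[n.+1]}) :
 coprime_family f -> (exists i, f i != 0) ->
 exists2 D : {mpoly K[n]}, D != 0 &
  forall x, (forall i, (f i).@[x] = 0) -> D.@[fun i => x (widen i)] = 0.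
Proof.
move=> cf [i0 fi0].
have [|p pp hp|D D0 [u eu]] := @ideal_constant _ (@factorial_mpoly n) k (fun i => muni (f i)).
- by exists i0; rewrite -(can_eq (@of_muniK n)) muniK /of_muni rmorph0 horner0.
- apply: (cf (of_muni p)).
  by apply/(iso_rprime (@muniK n) (@of_muniK n)); rewrite /= of_muniK.
 by move=> i; apply/(iso_dvd (@muniK n) (@of_muniK n)); rewrite /= of_muniK.
exists D => // x hx.
have -> : D.@[fun i => x (widen i)] = (map_poly (meval (fun i => x (widen i))) D%:P).[x ord_max].
 by rewrite map_polyC /= hornerC.
rewrite eu rmorph_sum /= horner_sum big1 // => i _.
by rewrite rmorphM /= hornerM -meval_muni hx mulr0.
Qed.

(** A Nullstellensatz for prime hypersurfaces, by induction on the variables. If [p] is free of the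
    last variable, the coefficients of [f] are treated one by one. Otherwise [p] and [f] without
    common factor have an eliminant [D], and a point where neither [D] nor the leading coefficient
    of [p] vanishes lifts to a zero of [p], a contradiction. *)
Lemma zero_set_divisor n (p f : {mpoly K[n]}) :
 rprime p -> (forall x, p.@[x] = 0 -> f.@[x] = 0) -> rdvd p f.
Proof.
elim: n p f => [|n IH] p f pp h.
 by case: (pp) => p0; rewrite mpoly0_unit.
have [p0 pu _] := pp.
have q0 : muni p != 0 by rewrite -(can_eq (@of_muniK n)) muniK /of_muni rmorph0 horner0.
have [s1|s1] := leqP (size (muni p)) 1.
 have ep := size1_polyC s1; set c := (muni p)`_0 in ep.
 have cp : rprime c.
  move/(iso_rprime (@muniK n) (@of_muniK n)): (pp); rewrite /= ep => -[h0 hu hp].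
  split; first by move: h0; rewrite polyC_eq0.
   by apply: contra hu; apply: polyC_unit.
  have e a b : rdvd a b <-> rdvd a%:P b%:P :> Prop.
   split; first by case=> x ->; exists x%:P; rewrite polyCM.
   by move/rdvd_polyCP => /(_ 0%N); rewrite coefC.
  move=> a b hab; have /hp[h'|h'] : rdvd c%:P (a%:P * b%:P) by have := proj1 (e _ _ _) hab; rewrite polyCM.
   by left; apply: (proj2 (e _ _ _) h').
  by right; apply: (proj2 (e _ _ _) h').
 apply/(iso_dvd (@muniK n) (@of_muniK n)); rewrite /= ep; apply/rdvd_polyCP => i.
 apply: IH => // x hx.
 have f0 : map_poly (meval x) (muni f) = 0.
  apply/eqP/negPn/negP => /poly_nonroot[t]; rewrite -meval_extend h ?eqxx //.
  by rewrite meval_extend ep map_polyC /= hornerC hx.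
 by have := congr1 (fun q : {poly K} => q`_i) f0; rewrite coef_map coef0.
apply: NNPP => nd.
have [||D D0 hD] := @base_elimination 2 n (fun i => if i == ord0 then p else f).
- move=> q qp hq; apply: nd; apply: rdvd_trans (hq ord_max).
 by apply: prime_rdvd_assoc => //; apply: (hq ord0).
- by exists ord0.
have l0 : lead_coef (muni p) != 0 by rewrite lead_coef_eq0.
have [x] := meval_neq0 (mulf_neq0 D0 l0); rewrite mevalM mulf_eq0 negb_or => /andP[hx1 hx2].
have [t ht] : exists t, root (map_poly (meval x) (muni p)) t.
 apply/closed_rootP; rewrite size_poly_eq1; apply: contraTN isT => /=; move=> h1.
 by move: s1; rewrite -(size_map_poly_id0 (f := meval x) hx2) => s1; have := eqp_size h1; rewrite size_poly1 => e; rewrite e in s1.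
have pt : p.@[extend_pt x t] = 0 by rewrite meval_extend; apply/eqP.
case/eqP: hx1; rewrite -(hD (extend_pt x t)).
 by apply: meval_eq => i; rewrite extend_pt_widen.
by move=> i; case: ifP => // _; apply: h.
Qed.

End MpolyFactorial.

(** * Generic choices for functions polynomial along lines *)

Section PolynomialFunctions.
Variable K : numClosedFieldType.

(* Functions that are polynomial along every line: the Zariski-dense-open arguments only use restriction to lines. *)
Definition pfun (W : lmodType K) (f : W -> K) : Prop :=
 forall u v, exists p : {poly K}, forall t, f (u + t *: v) = p.[t].

Definition pvec (W : lmodType K) n (f : W -> 'rV[K]_n) : Prop := forall i, pfun (fun w => f w 0 i).

Lemma pfunE (W : lmodType K) (f g : W -> K) : f =1 g -> pfun f -> pfun g.
Proof. by move=> e pf u v; have [p hp] := pf u v; exists p => t; rewrite -e. Qed.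

Lemma pfun_const (W : lmodType K) (c : K) : pfun (fun _ : W => c).
Proof. by move=> u v; exists c%:P => t; rewrite hornerC. Qed.

Lemma pfunD (W : lmodType K) (f g : W -> K) : pfun f -> pfun g -> pfun (fun w => f w + g w).
Proof.
by move=> pf pg u v; have [p hp] := pf u v; have [q hq] := pg u v; exists (p + q) => t; rewrite hp hq hornerD.
Qed.

Lemma pfunM (W : lmodType K) (f g : W -> K) : pfun f -> pfun g -> pfun (fun w => f w * g w).
Proof.
by move=> pf pg u v; have [p hp] := pf u v; have [q hq] := pg u v; exists (p * q) => t; rewrite hp hq hornerM.
Qed.

Lemma pfunN (W : lmodType K) (f : W -> K) : pfun f -> pfun (fun w => - f w).
Proof. by move=> pf u v; have [p hp] := pf u v; exists (- p) => t; rewrite hp hornerN. Qed.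

Lemma pfunB (W : lmodType K) (f g : W -> K) : pfun f -> pfun g -> pfun (fun w => f w - g w).
Proof. by move=> pf pg; apply: pfunD => //; apply: pfunN. Qed.

Lemma pfunX (W : lmodType K) (f : W -> K) n : pfun f -> pfun (fun w => f w ^+ n).
Proof. by move=> pf u v; have [p hp] := pf u v; exists (p ^+ n) => t; rewrite hp horner_exp. Qed.

Lemma pfun_sum (W : lmodType K) (I : Type) (r : seq I) (P : pred I) (F : I -> W -> K) :
 (forall i, pfun (F i)) -> pfun (fun w => \sum_(i <- r | P i) F i w).
Proof.
move=> pF; elim: r => [|i r IH]; first by apply: (pfunE _ (@pfun_const W 0)) => w; rewrite big_nil.
case e : (P i).
 by apply: (pfunE _ (pfunD (pF i) IH)) => w; rewrite big_cons e.
by apply: (pfunE _ IH) => w; rewrite big_cons e.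
Qed.

Lemma pfun_prod (W : lmodType K) (I : Type) (r : seq I) (P : pred I) (F : I -> W -> K) :
 (forall i, pfun (F i)) -> pfun (fun w => \prod_(i <- r | P i) F i w).
Proof.
move=> pF; elim: r => [|i r IH]; first by apply: (pfunE _ (@pfun_const W 1)) => w; rewrite big_nil.
case e : (P i).
 by apply: (pfunE _ (pfunM (pF i) IH)) => w; rewrite big_cons e.
by apply: (pfunE _ IH) => w; rewrite big_cons e.
Qed.

Lemma pfun_meval (W : lmodType K) n (p : {mpoly K[n]}) (f : 'I_n -> W -> K) :
 (forall i, pfun (f i)) -> pfun (fun w => p.@[fun i => f i w]).
Proof.
move=> pf; apply: (pfunE (f := fun w => \sum_(m <- msupp p) p@_m * \prod_(i < n) f i w ^+ m i)).
 by move=> w; rewrite mevalE.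
apply: pfun_sum => m; apply: pfunM; first exact: pfun_const.
by apply: pfun_prod => i; apply: pfunX.
Qed.

Lemma pfun_line (W : lmodType K) (f : W -> K) u v : pfun f -> pfun (fun t : K^o => f (u + t *: v)).
Proof.
move=> pf a b; have [p hp] := pf (u + a *: v) (b *: v).
by exists p => t; rewrite -hp scalerDl addrA !scalerA.
Qed.

(** On the line through [u] and [v] both functions are nonzero polynomials in one variable, so their
    product has a nonroot. All genericity arguments reduce to this. *)
Lemma pfun_nonzero2 (W : lmodType K) (f g : W -> K) u v :
 pfun f -> pfun g -> f u != 0 -> g v != 0 -> exists w, f w != 0 /\ g w != 0.
Proof.
move=> pf pg fu gv; have [p hp] := pf u (v - u); have [q hq] := pg u (v - u).
have p0 : p != 0.
 by apply: contraNneq fu => p0; have := hp 0; rewrite scale0r addr0 p0 horner0 => ->.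
have q0 : q != 0.
 by apply: contraNneq gv => q0; have := hq 1; rewrite scale1r addrC subrK q0 horner0 => ->.
have [t] := poly_nonroot (mulf_neq0 p0 q0).
by rewrite hornerM mulf_eq0 negb_or => /andP[h1 h2]; exists (u + t *: (v - u)); rewrite hp hq.
Qed.

Lemma pfun_dense (W : lmodType K) (f g : W -> K) :
 pfun f -> pfun g -> (exists w, g w != 0) -> (forall w, g w != 0 -> f w = 0) -> forall w, f w = 0.
Proof.
move=> pf pg [w0 gw0] h w; apply/eqP/negPn/negP => fw.
by have [x [fx gx]] := pfun_nonzero2 pf pg fw gw0; rewrite h ?eqxx in fx.
Qed.

Lemma pfun_prod_seq (W : lmodType K) (I : eqType) (r : seq I) (F : I -> W -> K) :
 (forall i, pfun (F i)) -> (forall i, i \in r -> exists w, F i w != 0) ->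
 exists w, forall i, i \in r -> F i w != 0.
Proof.
move=> pF; elim: r => [|i r IH] h; first by exists 0.
have [w hw] : exists w, forall j, j \in r -> F j w != 0.
 by apply: IH => j jr; apply: h; rewrite inE jr orbT.
have [v hv] : exists v, F i v != 0 by apply: h; rewrite inE eqxx.
have pr0 : \prod_(j <- r) F j w != 0.
 by rewrite prodf_seq_neq0; apply/allP => j /hw ->.
have [x [h1]] := pfun_nonzero2 (pF i) (pfun_prod r xpredT pF) hv pr0.
rewrite prodf_seq_neq0 => /allP h2; exists x => j; rewrite inE => /orP[/eqP->//|jr].
exact: h2.
Qed.

Lemma pfun_scalar (W : lmodType K) (f : {scalar W}) : pfun f.
Proof.
move=> u v; exists ((f u)%:P + (f v) *: 'X) => t.
by rewrite linearD linearZ /= hornerD hornerC hornerZ hornerX mulrC.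
Qed.

Lemma pvec_lin (W : lmodType K) n (f : {linear W -> 'rV[K]_n}) : pvec f.
Proof.
move=> i u v; exists ((f u 0 i)%:P + (f v 0 i) *: 'X) => t.
by rewrite linearD linearZ /= !mxE hornerD hornerC hornerZ hornerX mulrC.
Qed.

Lemma pvec_id n : pvec (fun w : 'rV[K]_n => w).
Proof. exact: (@pvec_lin _ _ idfun). Qed.

Lemma pvec_const (W : lmodType K) n (a : 'rV[K]_n) : pvec (fun _ : W => a).
Proof. by move=> i; apply: pfun_const. Qed.

Lemma pvecD (W : lmodType K) n (f g : W -> 'rV[K]_n) : pvec f -> pvec g -> pvec (fun w => f w + g w).
Proof. by move=> pf pg i; apply: pfunE (pfunD (pf i) (pg i)) => w; rewrite mxE. Qed.

Lemma pvecN (W : lmodType K) n (f : W -> 'rV[K]_n) : pvec f -> pvec (fun w => - f w).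
Proof. by move=> pf i; apply: pfunE (pfunN (pf i)) => w; rewrite mxE. Qed.

Lemma pvecZ (W : lmodType K) n (c : W -> K) (f : W -> 'rV[K]_n) :
 pfun c -> pvec f -> pvec (fun w => c w *: f w).
Proof. by move=> pc pf i; apply: pfunE (pfunM pc (pf i)) => w; rewrite mxE. Qed.

End PolynomialFunctions.

(** * Determinants, cross products and Cramer's rule in dimension 4 *)

Section Space4.
Variable K : numClosedFieldType.
Notation V := ('rV[K]_4).
Implicit Types a b c d x y z : V.

Definition q0 : 'I_4 := @Ordinal 4 0 isT.
Definition q1 : 'I_4 := @Ordinal 4 1 isT.
Definition q2 : 'I_4 := @Ordinal 4 2 isT.
Definition q3 : 'I_4 := @Ordinal 4 3 isT.

Lemma sum4 (S : nmodType) (F : 'I_4 -> S) : \sum_i F i = F q0 + F q1 + F q2 + F q3.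
Proof.
rewrite !big_ord_recl big_ord0 addr0 !addrA.
by congr (_ + _ + _ + _); congr F; apply: val_inj.
Qed.

Lemma ord4P (P : 'I_4 -> Prop) : P q0 -> P q1 -> P q2 -> P q3 -> forall i, P i.
Proof.
move=> h0 h1 h2 h3 [[|[|[|[|//]]]] lt].
- by rewrite (_ : Ordinal _ = q0) //; apply: val_inj.
- by rewrite (_ : Ordinal _ = q1) //; apply: val_inj.
- by rewrite (_ : Ordinal _ = q2) //; apply: val_inj.
- by rewrite (_ : Ordinal _ = q3) //; apply: val_inj.
Qed.

Lemma row4P x y : x 0 q0 = y 0 q0 -> x 0 q1 = y 0 q1 -> x 0 q2 = y 0 q2 -> x 0 q3 = y 0 q3 -> x = y.
Proof. by move=> h0 h1 h2 h3; apply/rowP; apply: ord4P. Qed.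

(** The lock keeps [dot], [det4] and [cross] folded under simplification and unification; only their
    unfolding equations open them. *)
Fact geo_key : unit. Proof. by []. Qed.

Definition dot : V -> V -> K := locked_with geo_key
 (fun a x => a 0 q0 * x 0 q0 + a 0 q1 * x 0 q1 + a 0 q2 * x 0 q2 + a 0 q3 * x 0 q3).

Lemma dotE a x : dot a x = a 0 q0 * x 0 q0 + a 0 q1 * x 0 q1 + a 0 q2 * x 0 q2 + a 0 q3 * x 0 q3.
Proof. by rewrite /dot unlock. Qed.

Definition minor2 : V -> V -> 'I_4 -> 'I_4 -> K := fun a b i j => a 0 i * b 0 j - a 0 j * b 0 i.

(** Laplace expansion along the first two vectors. *)
Definition det4 : V -> V -> V -> V -> K := locked_with geo_key (fun a b c d =>
 minor2 a b q0 q1 * minor2 c d q2 q3 - minor2 a b q0 q2 * minor2 c d q1 q3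
 + minor2 a b q0 q3 * minor2 c d q1 q2 + minor2 a b q1 q2 * minor2 c d q0 q3
 - minor2 a b q1 q3 * minor2 c d q0 q2 + minor2 a b q2 q3 * minor2 c d q0 q1).

Lemma det4E a b c d : det4 a b c d =
 minor2 a b q0 q1 * minor2 c d q2 q3 - minor2 a b q0 q2 * minor2 c d q1 q3
 + minor2 a b q0 q3 * minor2 c d q1 q2 + minor2 a b q1 q2 * minor2 c d q0 q3
 - minor2 a b q1 q3 * minor2 c d q0 q2 + minor2 a b q2 q3 * minor2 c d q0 q1.
Proof. by rewrite /det4 unlock. Qed.

Definition evec (i : 'I_4) : V := delta_mx 0 i.

(** The covector of the plane through [a], [b], [c]. Points and planes share the type [V], with
    incidence given by [dot]. *)
Definition cross : V -> V -> V -> V := locked_with geo_key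
 (fun a b c => \row_j det4 a b c (evec j)).

Lemma evecE i j : evec i 0 j = (j == i)%:R.
Proof. by rewrite mxE eqxx. Qed.

Lemma crossE a b c j : cross a b c 0 j = det4 a b c (evec j).
Proof. by rewrite /cross unlock mxE. Qed.

Ltac geo := rewrite ?dotE ?crossE ?det4E /minor2 ?evecE ?mxE /=; ring.

Lemma dotC a x : dot a x = dot x a. Proof. geo. Qed.
Lemma dotDr a x y : dot a (x + y) = dot a x + dot a y. Proof. geo. Qed.
Lemma dotDl a b x : dot (a + b) x = dot a x + dot b x. Proof. geo. Qed.
Lemma dotZr k a x : dot a (k *: x) = k * dot a x. Proof. geo. Qed.
Lemma dotZl k a x : dot (k *: a) x = k * dot a x. Proof. geo. Qed.
Lemma dotNr a x : dot a (- x) = - dot a x. Proof. geo. Qed.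
Lemma dotNl a x : dot (- a) x = - dot a x. Proof. geo. Qed.
Lemma dot0r a : dot a 0 = 0. Proof. geo. Qed.
Lemma dot0l a : dot 0 a = 0. Proof. geo. Qed.
Lemma dot_evec a i : dot a (evec i) = a 0 i.
Proof. by move: i; apply: ord4P; geo. Qed.

Lemma dot_cross a b c x : dot (cross a b c) x = det4 a b c x.
Proof. geo. Qed.

Lemma dot_ext a b : (forall x, dot a x = dot b x) -> a = b.
Proof. by move=> h; apply/rowP => i; rewrite -!dot_evec h. Qed.

Lemma dot_neq0 a : a != 0 -> exists x, dot a x != 0.
Proof.
move=> a0; apply: NNPP => h; case/eqP: a0; apply: dot_ext => x; rewrite dot0l.
by apply/eqP/negPn/negP => hx; apply: h; exists x.
Qed.

Lemma det4D1 a a' b c d : det4 (a + a') b c d = det4 a b c d + det4 a' b c d. Proof. geo. Qed.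
Lemma det4D2 a b b' c d : det4 a (b + b') c d = det4 a b c d + det4 a b' c d. Proof. geo. Qed.
Lemma det4D3 a b c c' d : det4 a b (c + c') d = det4 a b c d + det4 a b c' d. Proof. geo. Qed.
Lemma det4D4 a b c d d' : det4 a b c (d + d') = det4 a b c d + det4 a b c d'. Proof. geo. Qed.
Lemma det4Z1 k a b c d : det4 (k *: a) b c d = k * det4 a b c d. Proof. geo. Qed.
Lemma det4Z2 k a b c d : det4 a (k *: b) c d = k * det4 a b c d. Proof. geo. Qed.
Lemma det4Z3 k a b c d : det4 a b (k *: c) d = k * det4 a b c d. Proof. geo. Qed.
Lemma det4Z4 k a b c d : det4 a b c (k *: d) = k * det4 a b c d. Proof. geo. Qed.
Lemma det4_12 a c d : det4 a a c d = 0. Proof. geo. Qed.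
Lemma det4_13 a b d : det4 a b a d = 0. Proof. geo. Qed.
Lemma det4_14 a b c : det4 a b c a = 0. Proof. geo. Qed.
Lemma det4_23 a b d : det4 a b b d = 0. Proof. geo. Qed.
Lemma det4_24 a b c : det4 a b c b = 0. Proof. geo. Qed.
Lemma det4_34 a b c : det4 a b c c = 0. Proof. geo. Qed.
Lemma det4_swap12 a b c d : det4 b a c d = - det4 a b c d. Proof. geo. Qed.
Lemma det4_swap23 a b c d : det4 a c b d = - det4 a b c d. Proof. geo. Qed.
Lemma det4_swap34 a b c d : det4 a b d c = - det4 a b c d. Proof. geo. Qed.
Lemma det4_01 b c d : det4 0 b c d = 0. Proof. geo. Qed.
Lemma det4_02 a c d : det4 a 0 c d = 0. Proof. geo. Qed.
Lemma det4_03 a b d : det4 a b 0 d = 0. Proof. geo. Qed.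
Lemma det4_04 a b c : det4 a b c 0 = 0. Proof. geo. Qed.

Lemma cramer4 a b c d x : det4 a b c d *: x =
 det4 x b c d *: a + det4 a x c d *: b + det4 a b x d *: c + det4 a b c x *: d.
Proof. by apply: row4P; geo. Qed.

Definition indep2 a b := forall s t : K, s *: a + t *: b = 0 -> s = 0 /\ t = 0.

Lemma minor2_dep a b i : (forall i j, minor2 a b i j = 0) -> a 0 i *: b - b 0 i *: a = 0.
Proof. by move=> h; apply/rowP => k; rewrite !mxE -(h i k) /minor2; ring. Qed.

Lemma indep2_minor a b : indep2 a b -> exists i j, minor2 a b i j != 0.
Proof.
move=> ind; apply: NNPP => h.
have h0 i j : minor2 a b i j = 0.
 by apply/eqP/negPn/negP => hm; apply: h; exists i, j.
have a0 : a = 0.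
 apply/rowP => i; rewrite !mxE; have e := minor2_dep i h0.
 by have [_ ->] : - b 0 i = 0 /\ a 0 i = 0 by apply: ind; rewrite scaleNr addrC.
have [/eqP] : 1 = 0 :> K /\ 0 = 0 :> K by apply: ind; rewrite a0 scaler0 scale0r addr0.
by rewrite oner_eq0.
Qed.

(** The two coordinate vectors complementary to a nonzero minor complete the basis; the twelve cases
    differ by order and sign. *)
Lemma indep2_basis a b : indep2 a b -> exists c d, det4 a b c d != 0.
Proof.
move=> /indep2_minor[i [j h]]; apply: NNPP => nh.
have h0 c d : det4 a b c d = 0 by apply/eqP/negPn/negP => hm; apply: nh; exists c, d.
case/eqP: h; move: i j; do 2!apply: ord4P; rewrite /minor2; try ring.
- by rewrite -(h0 (evec q2) (evec q3)); geo.
- by rewrite -[RHS]oppr0 -(h0 (evec q1) (evec q3)); geo.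
- by rewrite -(h0 (evec q1) (evec q2)); geo.
- by rewrite -[RHS]oppr0 -(h0 (evec q2) (evec q3)); geo.
- by rewrite -(h0 (evec q0) (evec q3)); geo.
- by rewrite -[RHS]oppr0 -(h0 (evec q0) (evec q2)); geo.
- by rewrite -(h0 (evec q1) (evec q3)); geo.
- by rewrite -[RHS]oppr0 -(h0 (evec q0) (evec q3)); geo.
- by rewrite -(h0 (evec q0) (evec q1)); geo.
- by rewrite -[RHS]oppr0 -(h0 (evec q1) (evec q2)); geo.
- by rewrite -(h0 (evec q0) (evec q2)); geo.
- by rewrite -[RHS]oppr0 -(h0 (evec q0) (evec q1)); geo.
Qed.

Lemma cross_basis a b c : cross a b c != 0 -> exists d, det4 a b c d != 0.
Proof. by move=> /dot_neq0[d]; rewrite dot_cross => h; exists d. Qed.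

Lemma det4_cross a b c d : det4 a b c d != 0 -> cross a b c != 0.
Proof. by apply: contraNneq => h; rewrite -dot_cross h dot0l. Qed.

Lemma plane_span a b c x : cross a b c != 0 -> dot (cross a b c) x = 0 ->
 exists r s t, x = r *: a + s *: b + t *: c.
Proof.
move=> /cross_basis[d hd]; rewrite dot_cross => hx.
have := cramer4 a b c d x; rewrite hx scale0r addr0 => e.
exists (det4 x b c d / det4 a b c d), (det4 a x c d / det4 a b c d), (det4 a b x d / det4 a b c d).
by rewrite -[x in LHS](scalerK hd) e !scalerDr !scalerA ![_^-1 * _]mulrC.
Qed.

Lemma cross_unique a b c n : cross a b c != 0 ->
 dot n a = 0 -> dot n b = 0 -> dot n c = 0 -> exists k, n = k *: cross a b c.
Proof.
move=> /cross_basis[d hd] ha hb hc; exists (dot n d / det4 a b c d); apply: dot_ext => x.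
rewrite dotZl dot_cross; apply: (mulfI hd).
rewrite -dotZr (cramer4 a b c d x) !dotDr !dotZr ha hb hc; field.
exact: hd.
Qed.

Lemma indep2_cross a b c : indep2 a b -> cross a b c = 0 -> exists s t, c = s *: a + t *: b.
Proof.
move=> ind h; have [e [d hd]] := indep2_basis ind.
have h0 x : det4 a b c x = 0 by rewrite -dot_cross h dot0l.
have := cramer4 a b e d c; rewrite h0 scale0r addr0.
rewrite (_ : det4 a b e c = 0) ?scale0r ?addr0 => [e1|]; last by rewrite -[LHS]opprK -det4_swap34 h0 oppr0.
exists (det4 c b e d / det4 a b e d), (det4 a c e d / det4 a b e d).
by rewrite -[c in LHS](scalerK hd) e1 !scalerDr !scalerA ![_^-1 * _]mulrC.
Qed.

Lemma det4_indep2 a b c d : det4 a b c d != 0 -> indep2 a b.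
Proof.
move=> hd s t e; split; apply/eqP.
 by rewrite -(mulIr_eq0 _ (mulIf hd)) -det4Z1 (_ : s *: a = - t *: b) ?det4Z1 ?det4_12 ?mulr0 // scaleNr; apply/eqP; rewrite -addr_eq0 e.
by rewrite -(mulIr_eq0 _ (mulIf hd)) -det4Z2 (_ : t *: b = - s *: a) ?det4Z2 ?det4_12 ?mulr0 // scaleNr; apply/eqP; rewrite -addr_eq0 addrC e.
Qed.

Lemma pfun_dot (W : lmodType K) (f g : W -> V) : pvec f -> pvec g -> pfun (fun w => dot (f w) (g w)).
Proof.
move=> pf pg; apply: (pfunE (fun w => esym (dotE _ _))).
by repeat first [apply: pfunD | apply: pfunM | apply: pf | apply: pg].
Qed.

Lemma pfun_det4 (W : lmodType K) (f1 f2 f3 f4 : W -> V) : pvec f1 -> pvec f2 -> pvec f3 -> pvec f4 ->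
 pfun (fun w => det4 (f1 w) (f2 w) (f3 w) (f4 w)).
Proof.
move=> h1 h2 h3 h4; apply: (pfunE (fun w => esym (det4E _ _ _ _))); rewrite /minor2.
by repeat first [apply: pfunB | apply: pfunD | apply: pfunM | apply: h1 | apply: h2 | apply: h3 | apply: h4].
Qed.

Lemma pvec_cross (W : lmodType K) (f1 f2 f3 : W -> V) : pvec f1 -> pvec f2 -> pvec f3 ->
 pvec (fun w => cross (f1 w) (f2 w) (f3 w)).
Proof.
move=> h1 h2 h3 i; apply: (pfunE (fun w => esym (crossE _ _ _ _))).
by apply: pfun_det4 => //; apply: pvec_const.
Qed.

End Space4.

(* Unlike [set], this leaves a variable without body, which [ring], [field] and rewriting treat as
   an atom. *)
Tactic Notation "name" ident(x) ident(e) ":=" constr(t) :=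
 let z := fresh in assert (z : exists y, y = t) by (eexists; reflexivity); destruct z as [x e].

Ltac vring := let i := fresh "i" in apply/rowP => i; rewrite !mxE; ring.

(** * Polarized cubic maps and birational pairs *)

Section CubicMaps.
Variable K : numClosedFieldType.
Notation V := ('rV[K]_4).

Lemma mderiv_homog n (p : {mpoly K[n]}) d i : p \is d.+1.-homog -> p^`M(i) \is d.-homog.
Proof.
move=> /dhomogP hp; apply/dhomogP => m; rewrite mcoeff_msupp mcoeff_deriv => hm.
have : (m + U_(i))%MM \in msupp p by rewrite mcoeff_msupp; apply: contraNneq hm => ->; rewrite mul0rn.
by move=> /hp /=; rewrite mdegD mdeg1 addn1 => -[].
Qed.

Lemma homog0_meval n (p : {mpoly K[n]}) x : p \is 0.-homog -> p.@[x] = p@_0.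
Proof.
move=> /dhomogP hp; suff {1}-> : p = (p@_0)%:MP by rewrite mevalC.
apply/mpolyP => m; rewrite mcoeffC; have [->|m0] := eqVneq m 0%MM; first by rewrite mulr1.
rewrite mulr0; apply/eqP; rewrite mcoeff_eq0; apply/negP => /hp /= /eqP.
by rewrite mdeg_eq0 (negPf m0).
Qed.

Lemma euler_homog n (p : {mpoly K[n]}) d (x : 'I_n -> K) : p \is d.-homog ->
 \sum_i x i * (p^`M(i)).@[x] = d%:R * p.@[x].
Proof.
move=> /dhomogP hp; rewrite [p]mpolyE.
have -> : \sum_i x i * ((\sum_(m <- msupp p) p@_m *: 'X_[m])^`M(i)).@[x]
  = \sum_(m <- msupp p) p@_m * \sum_i x i * ('X_[m]^`M(i)).@[x].
 have e i : x i * ((\sum_(m <- msupp p) p@_m *: 'X_[m])^`M(i)).@[x]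
   = \sum_(m <- msupp p) x i * (p@_m *: 'X_[m]^`M(i)).@[x].
  rewrite -mulr_sumr; congr (_ * _).
  rewrite (big_morph _ (mderivD i) (mderiv0 _ i)) (big_morph _ (mevalD x) (meval0 x)).
  by apply: eq_bigr => m _; rewrite mderivZ.
 rewrite (eq_bigr _ (fun i _ => e i)) exchange_big /=; apply: eq_bigr => m _; rewrite mulr_sumr; apply: eq_bigr => i _.
 by rewrite mevalZ mulrCA.
rewrite [in RHS]raddf_sum /= mulr_sumr !big_seq; apply: eq_bigr => m /hp /= md.
rewrite mevalZ mulrCA; congr (_ * _); rewrite -md mdegE natr_sum mulr_suml; apply: eq_bigr => i _.
rewrite mderivX mevalZ mulrCA; have [->|mi0] := eqVneq (m i) 0%N; first by rewrite !mul0r.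
congr (_ * _); rewrite -[in RHS](@submK _ U_(i) m) ?mpolyXD ?mevalM ?mevalXU 1?mulrC //.
by rewrite lep1mP.
Qed.

(* symmetric trilinear maps V^3 -> V, that is, polarized cubic maps *)
Record symtri := Symtri {
 st :> V -> V -> V -> V;
 stD1 : forall x x' y z, st (x + x') y z = st x y z + st x' y z;
 stZ1 : forall c x y z, st (c *: x) y z = c *: st x y z;
 st12 : forall x y z, st y x z = st x y z;
 st23 : forall x y z, st x z y = st x y z }.

Section SymtriTheory.
Variable T : symtri.
Implicit Types x y z a b c : V.

Lemma st13 x y z : T z y x = T x y z.
Proof. by rewrite st12 st23 st12. Qed.
Lemma stD2 x y y' z : T x (y + y') z = T x y z + T x y' z.
Proof. by rewrite st12 stD1 !(st12 T _ x). Qed.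
Lemma stD3 x y z z' : T x y (z + z') = T x y z + T x y z'.
Proof. by rewrite st23 stD2 !(st23 T _ y). Qed.
Lemma stZ2 r x y z : T x (r *: y) z = r *: T x y z.
Proof. by rewrite st12 stZ1 !(st12 T _ x). Qed.
Lemma stZ3 r x y z : T x y (r *: z) = r *: T x y z.
Proof. by rewrite st23 stZ2 !(st23 T _ y). Qed.
Lemma st01 y z : T 0 y z = 0. Proof. by rewrite -{1}(scale0r (0 : V)) stZ1 scale0r. Qed.
Lemma st02 x z : T x 0 z = 0. Proof. by rewrite -{1}(scale0r (0 : V)) stZ2 scale0r. Qed.
Lemma st03 x y : T x y 0 = 0. Proof. by rewrite -{1}(scale0r (0 : V)) stZ3 scale0r. Qed.

Definition cub x := T x x x.

Lemma cubZ r x : cub (r *: x) = r ^+ 3 *: cub x.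
Proof. by rewrite /cub stZ1 stZ2 stZ3 !scalerA; congr (_ *: _); ring. Qed.

Lemma cubD x y : cub (x + y) = cub x + 3 *: T x x y + 3 *: T x y y + cub y.
Proof.
rewrite /cub !stD1 !stD2 !stD3 (st12 T x y x) (st23 T x x y) (st12 T x y y) (st13 x y y).
by vring.
Qed.

Lemma pvec_st (W : lmodType K) (f1 f2 f3 : W -> V) :
 pvec f1 -> pvec f2 -> pvec f3 -> pvec (fun w => T (f1 w) (f2 w) (f3 w)).
Proof.
move=> h1 h2 h3 i.
have e1 x y z : T x y z = \sum_j x 0 j *: T (evec K j) y z.
 rewrite {1}[x]row_sum_delta; elim/big_rec2: _ => [|j u v _ <-]; first by rewrite st01.
 by rewrite stD1 stZ1.
have e2 x y z : T x y z = \sum_j y 0 j *: T x (evec K j) z.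
 by rewrite st12 e1; apply: eq_bigr => j _; rewrite st12.
have e3 x y z : T x y z = \sum_j z 0 j *: T x y (evec K j).
 by rewrite st23 e2; apply: eq_bigr => j _; rewrite st23.
apply: (pfunE (f := fun w => \sum_j f1 w 0 j * \sum_k f2 w 0 k * \sum_l f3 w 0 l * T (evec K j) (evec K k) (evec K l) 0 i)).
 move=> w; rewrite e1 summxE; apply: eq_bigr => j _; rewrite mxE; congr (_ * _).
 rewrite e2 summxE; apply: eq_bigr => k _; rewrite mxE; congr (_ * _).
 by rewrite e3 summxE; apply: eq_bigr => l _; rewrite mxE.
apply: pfun_sum => j; apply: pfunM; first exact: h1.
apply: pfun_sum => k; apply: pfunM; first exact: h2.
apply: pfun_sum => l; apply: pfunM; first exact: h3.
exact: pfun_const.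
Qed.

Lemma pvec_cub (W : lmodType K) (f : W -> V) : pvec f -> pvec (fun w => cub (f w)).
Proof. by move=> h; apply: pvec_st. Qed.

End SymtriTheory.

Definition tens (f : 'I_4 -> {mpoly K[4]}) i a b c : K := ((f i)^`M(a)^`M(b)^`M(c))@_0 / 6.

Definition pol_fun : ('I_4 -> {mpoly K[4]}) -> V -> V -> V -> V := locked_with geo_key
 (fun f x y z => \row_i \sum_a x 0 a * \sum_b y 0 b * \sum_c z 0 c * tens f i a b c).

Lemma pol_funE f x y z i :
 pol_fun f x y z 0 i = \sum_a x 0 a * \sum_b y 0 b * \sum_c z 0 c * tens f i a b c.
Proof. by rewrite /pol_fun unlock mxE. Qed.

Lemma pol_D1 f x x' y z : pol_fun f (x + x') y z = pol_fun f x y z + pol_fun f x' y z.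
Proof.
by apply/rowP => i; rewrite !(pol_funE, mxE) -big_split; apply: eq_bigr => a _; rewrite mxE mulrDl.
Qed.

Lemma pol_Z1 f r x y z : pol_fun f (r *: x) y z = r *: pol_fun f x y z.
Proof.
by apply/rowP => i; rewrite !(pol_funE, mxE) mulr_sumr; apply: eq_bigr => a _; rewrite mxE mulrA.
Qed.

Lemma pol_12 f x y z : pol_fun f y x z = pol_fun f x y z.
Proof.
apply/rowP => i; rewrite !(pol_funE, mxE).
under eq_bigr do rewrite mulr_sumr; rewrite exchange_big; apply: eq_bigr => b _ /=.
rewrite mulr_sumr; apply: eq_bigr => a _; rewrite mulrCA; congr (_ * (_ * _)).
by apply: eq_bigr => c _; rewrite /tens (mderiv_comm a b).
Qed.

Lemma pol_23 f x y z : pol_fun f x z y = pol_fun f x y z.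
Proof.
apply/rowP => i; rewrite !(pol_funE, mxE); apply: eq_bigr => a _; congr (_ * _).
under eq_bigr do rewrite mulr_sumr; rewrite exchange_big; apply: eq_bigr => b _ /=.
rewrite mulr_sumr; apply: eq_bigr => c _; rewrite mulrCA; congr (_ * (_ * _)).
by rewrite /tens (mderiv_comm b c).
Qed.

Definition pol f := Symtri (pol_D1 f) (pol_Z1 f) (pol_12 f) (pol_23 f).

Definition pev (p : {mpoly K[4]}) (x : V) : K := p.@[fun j => x 0 j].
Definition ev (f : 'I_4 -> {mpoly K[4]}) (x : V) : V := \row_i pev (f i) x.

Lemma ev_pol f x : (forall i, f i \is 3.-homog) -> ev f x = cub (pol f) x.
Proof.
move=> hf; apply/rowP => i; rewrite /cub /= pol_funE mxE /pev; set X := fun j => x 0 j.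
have e3 := euler_homog X (hf i).
have e2 a := euler_homog X (mderiv_homog a (hf i)).
have e1 a b := euler_homog X (mderiv_homog b (mderiv_homog a (hf i))).
have n0 k : k.+1%:R != 0 :> K by rewrite pnatr_eq0.
(* [n0 5] says that 6 is nonzero: the three applications of Euler's relation contribute the factors
   3, 2 and 1. *)
apply: (mulfI (n0 5)); rewrite [RHS]mulr_sumr.
transitivity (2 * (3 * (f i).@[X])); first by rewrite mulrA -natrM.
rewrite -e3 mulr_sumr; apply: eq_bigr => a _; rewrite [LHS]mulrCA [RHS]mulrCA; congr (_ * _).
rewrite -e2 mulr_sumr; apply: eq_bigr => b _; rewrite [RHS]mulrCA; congr (_ * _).
rewrite -[LHS]mul1r -e1 mulr_sumr; apply: eq_bigr => c _.
rewrite [RHS]mulrCA; congr (_ * _); rewrite homog0_meval; last by do 3!apply: mderiv_homog.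
by rewrite /tens [RHS]mulrC divfK.
Qed.

Lemma pfun_pev (W : lmodType K) p (f : W -> V) : pvec f -> pfun (fun w => pev p (f w)).
Proof. by move=> pf; apply: (@pfun_meval _ _ 4 p (fun j w => f w 0 j)). Qed.

Lemma pev_neq0 p : p != 0 -> exists x, pev p x != 0.
Proof.
move=> /meval_neq0[x hx]; exists (\row_j x j); rewrite /pev.
by rewrite (_ : _.@[_] = p.@[x]) //; apply: meval_eq => j; rewrite mxE.
Qed.

Lemma pev_inj p q : (forall x, pev p x = pev q x) -> p = q.
Proof.
move=> h; apply: meval_inj => x; have := h (\row_j x j); rewrite /pev.
by rewrite !(@meval_eq _ _ _ x) // => j; rewrite mxE.
Qed.

(** The composites are multiples of the identity. A point is treated as general when its multiplier
    [h] or [k] does not vanish: there the map is injective with invertible differential. *)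
Record bir (f g : 'I_4 -> {mpoly K[4]}) (h k : {mpoly K[4]}) : Prop := Bir {
 bir_fh : forall i, f i \is 3.-homog;
 bir_gh : forall i, g i \is 3.-homog;
 bir_fc : coprime_family f;
 bir_gc : coprime_family g;
 bir_f0 : exists i, f i != 0;
 bir_g0 : exists i, g i != 0;
 bir_h0 : h != 0;
 bir_k0 : k != 0;
 bir_gf : forall x, ev g (ev f x) = pev h x *: x;
 bir_fg : forall x, ev f (ev g x) = pev k x *: x }.

Lemma bir_sym f g h k : bir f g h k -> bir g f k h.
Proof. by case=> *; split. Qed.

Section BirTheory.
Variables (f g : 'I_4 -> {mpoly K[4]}) (h k : {mpoly K[4]}).
Hypothesis B : bir f g h k.
Let T := pol f.
Let S := pol g.
Let H := pev h.

Lemma bir_cub x : cub S (cub T x) = H x *: x.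
Proof. by rewrite -!ev_pol ?(bir_gf B) //; [apply: bir_fh B | apply: bir_gh B]. Qed.

(** The composite has degree 9, and one degree belongs to the factor [x]. The comparison needs
    nonzero vectors, so the value at 0 is obtained by density on a line. *)
Lemma bir_hZ c x : H (c *: x) = c ^+ 8 * H x.
Proof.
have e d y : y != 0 -> d != 0 -> H (d *: y) = d ^+ 8 * H y.
 move=> y0 d0; have := bir_cub (d *: y); rewrite !cubZ bir_cub !scalerA -exprM => /eqP.
 rewrite -subr_eq0 -scalerBl scaler_eq0 (negPf y0) orbF subr_eq0 => /eqP e.
 by apply: (mulIf d0); rewrite -e; ring.
have h0 : H 0 = 0.
 have [y y0] : exists y : V, y != 0.
  by exists (evec K q0); apply/eqP => /rowP/(_ q0)/eqP; rewrite evecE mxE eqxx oner_eq0.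
 have pf : pfun (fun t : K^o => H (0 + t *: y) - t ^+ 8 * H y).
  apply: pfunB; first by apply: (@pfun_line _ _ H); apply: pfun_pev; apply: pvec_id.
  apply: pfunM; last exact: pfun_const.
  by apply: pfunX; apply: (pfun_scalar (idfun : {scalar K^o})).
 have := @pfun_dense _ _ _ (fun t : K^o => t) pf (pfun_scalar (idfun : {scalar K^o})) _ _ 0.
 rewrite scale0r addr0 expr0n mul0r subr0; apply; first by exists (1 : K); rewrite oner_eq0.
 by move=> t t0; rewrite add0r e // subrr.
have [->|c0] := eqVneq c 0; first by rewrite scale0r h0 expr0n mul0r.
have [->|x0] := eqVneq x 0; first by rewrite scaler0 h0 mulr0.
exact: e.
Qed.

Lemma bir_h_neq0 x : H x != 0 -> x != 0.
Proof. by apply: contraNneq => ->; rewrite -(scale0r 0) bir_hZ expr0n mul0r. Qed.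

Lemma bir_cub_neq0 x : H x != 0 -> cub T x != 0.
Proof.
move=> hx; apply: contraNneq (bir_h_neq0 hx) => c0.
have := bir_cub x; rewrite c0 /cub st01 => /esym/eqP.
by rewrite scaler_eq0 (negPf hx).
Qed.

Lemma bir_inj x y c : H x != 0 -> cub T x = c *: cub T y -> exists r, x = r *: y.
Proof.
move=> hx e; have := bir_cub x; rewrite e cubZ bir_cub scalerA => e2.
by exists ((H x)^-1 * (c ^+ 3 * H y)); rewrite -scalerA e2 scalerK.
Qed.

Lemma bir_h_ex : exists x, H x != 0.
Proof. exact: pev_neq0 (bir_h0 B). Qed.

(* first and second derivatives of g o f = h * id along the line x + t v *)
Lemma bir_chain x v : exists a b,
 9 *: S (cub T x) (cub T x) (T x x v) = H x *: v + a *: x /\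
 9 *: S (cub T x) (cub T x) (T x v v) + 27 *: S (cub T x) (T x x v) (T x x v)
  = a *: v + b *: x.
Proof.
have [q hq] : exists q : {poly K}, forall t, H (x + t *: v) = q.[t].
 by apply: (pfun_pev h (@pvec_id _ 4)).
name c0 E0 := (cub T x).
name c1 E1 := (3 *: T x x v).
name c2 E2 := (3 *: T x v v).
name c3 E3 := (cub T v).
have ec (t : K) : cub T (x + t *: v) = c0 + t *: c1 + t ^+ 2 *: (c2 + t *: c3).
 by rewrite cubD cubZ !stZ2 !stZ3 E0 E1 E2 E3; vring.
(* Higher-order terms are lumped in [r], with weight [t ^+ 3]; only the coefficients of [t] and
   [t ^+ 2] are compared with the expansion [q] of the multiplier. *)
pose r (t : K^o) := 6 *: S c0 c1 (c2 + t *: c3) + (3 * t) *: S c0 (c2 + t *: c3) (c2 + t *: c3)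
 + cub S (c1 + t *: (c2 + t *: c3)).
have es (t : K) : H (x + t *: v) *: (x + t *: v) = cub S c0 + t *: (3 *: S c0 c0 c1)
  + t ^+ 2 *: (3 *: S c0 c0 (c2 + t *: c3) + 3 *: S c0 c1 c1) + t ^+ 3 *: r t.
 rewrite -bir_cub ec -addrA.
 have -> : t *: c1 + t ^+ 2 *: (c2 + t *: c3) = t *: (c1 + t *: (c2 + t *: c3)).
  by vring.
 rewrite cubD cubZ !stZ2 !stZ3 /r.
 have -> : S c0 (c1 + t *: (c2 + t *: c3)) (c1 + t *: (c2 + t *: c3)) =
  S c0 c1 c1 + (2 * t) *: S c0 c1 (c2 + t *: c3) + t ^+ 2 *: S c0 (c2 + t *: c3) (c2 + t *: c3).
  move: (c2 + t *: c3) => y; rewrite !stD2 !stD3 !stZ2 !stZ3 (st23 S c0 c1).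
  by vring.
 by rewrite (stD3 S c0 c0) stZ3; vring.
have pt : pvec (fun t : K^o => c2 + t *: c3).
 apply: pvecD; [exact: pvec_const|apply: pvecZ; last exact: pvec_const].
 exact: (pfun_scalar (idfun : {scalar K^o})).
have pid : pfun (fun t : K^o => t) by exact: (pfun_scalar (idfun : {scalar K^o})).
have pr : pvec r.
 rewrite /r; apply: pvecD; first apply: pvecD.
 - by apply: pvecZ; [apply: pfun_const|apply: pvec_st => //; apply: pvec_const].
 - apply: pvecZ; first by apply: pfunM => //; apply: pfun_const.
  by apply: pvec_st => //; apply: pvec_const.
 - by apply: pvec_cub; apply: pvecD; [apply: pvec_const|apply: pvecZ].
clearbody r.
have key i : 3 * S c0 c0 c1 0 i = q`_0 * v 0 i + q`_1 * x 0 i /\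
  3 * S c0 c0 c2 0 i + 3 * S c0 c1 c1 0 i = q`_1 * v 0 i + q`_2 * x 0 i.
 have [p hp] := pr i 0 1.
 have hp' t : r t 0 i = p.[t] by rewrite -hp add0r /GRing.scale /= mulr1.
 pose s : {poly K} := (cub S c0 0 i)%:P + (3 * S c0 c0 c1 0 i) *: 'X
   + (3 * S c0 c0 c2 0 i + 3 * S c0 c1 c1 0 i) *: 'X^2 + (3 *  S c0 c0 c3 0 i) *: 'X^3 + 'X^3 * p.
 have eq : q * ((x 0 i)%:P + v 0 i *: 'X) = s.
  apply/eqP; rewrite -subr_eq0; apply/negPn/negP => /poly_nonroot[t].
  rewrite hornerD hornerN /s !(hornerXn, hornerE) -hq -hp'.
  have := congr1 (fun u : V => u 0 i) (es t); rewrite !stD3 !stZ3 !mxE => ee.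
  apply/negP; rewrite negbK subr_eq0; apply/eqP.
  transitivity (H (x + t *: v) * (x 0 i + t * v 0 i)); first by ring.
  by rewrite ee /=; ring.
 have cX (c : K) m n : (c *: 'X^m : {poly K})`_n = c * (n == m)%:R by rewrite coefZ coefXn.
 have := congr1 (fun u : {poly K} => u`_1) eq; have := congr1 (fun u : {poly K} => u`_2) eq.
 have cc (z : K) n : (z *: 'X : {poly K})`_n = z * (n == 1)%:R by rewrite coefZ coefX.
 rewrite /s !coefD !cX !cc !coefC !coefXnM !coefM !big_ord_recl !big_ord0 /= !coefD !cc !coefC /=.
 move=> e2 e1; split; [move: e1 | move: e2]; rewrite /= !(mulr0, mulr1, addr0, add0r) => <-.
  by rewrite addrC; congr (_ * _ + _); rewrite mulrC.
 by rewrite addrC.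
exists q`_1, q`_2.
have q00 : q`_0 = H x by rewrite -horner_coef0 -hq scale0r addr0.
split; apply/rowP => i; have [k1 k2] := key i; rewrite !mxE.
 by rewrite -q00 -k1 -E0 E1 stZ3 mxE; ring.
by rewrite -k2 -E0 E1 E2 !stZ2 !stZ3 !mxE; ring.
Qed.

(** The chain rule makes [v] a multiple of [x], and on multiples of [x] the differential gives
    multiples of [cub T x], which is nonzero. *)
Lemma bir_dinj x v : H x != 0 -> T x x v = 0 -> v = 0.
Proof.
move=> hx e; have [a [_ [+ _]]] := bir_chain x v; rewrite e st03 scaler0 => /esym/eqP.
rewrite addr_eq0 -scaleNr => /eqP ev.
have {}ev : v = (- a / H x) *: x by rewrite mulrC -scalerA -ev scalerK.
move: e; rewrite ev stZ3 => /eqP; rewrite scaler_eq0 (negPf (bir_cub_neq0 hx)) orbF => /eqP->.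
by rewrite scale0r.
Qed.

End BirTheory.
End CubicMaps.

#[global] Arguments pol : simpl never.
#[global] Arguments st : simpl never.

Lemma pvec_affine (K : numClosedFieldType) (W : lmodType K) n (f : W -> 'rV[K]_n) :
 (forall u v t, f (u + t *: v) = f u + t *: f v) -> pvec f.
Proof. by move=> h i u v; exists ((f u 0 i)%:P + (f v 0 i) *: 'X) => t; rewrite h !mxE !hornerE mulrC. Qed.

Lemma pfun_affine (K : numClosedFieldType) (W : lmodType K) (f : W -> K) :
 (forall u v t, f (u + t *: v) = f u + t * f v) -> pfun f.
Proof. by move=> h u v; exists ((f u)%:P + (f v) *: 'X) => t; rewrite h !hornerE mulrC. Qed.

(** Directed by the shape of the function; the last two alternatives catch projections and other
    functions that are affine by computation. *)
Ltac polynomial_step := first [solve [trivial] | exact: pfun_const | exact: pvec_const | apply: pfun_dot | apply: pfun_det4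
 | apply: pvec_cross | apply: pvec_st | apply: pvec_cub | apply: pfun_pev | apply: pfunD | apply: pfunN | apply: pfunM
 | apply: pfunX | apply: pvecD | apply: pvecN | apply: pvecZ | solve [apply: pvec_affine => *; reflexivity]
 | solve [apply: pfun_affine => *; reflexivity]].

Ltac polynomial := solve [repeat polynomial_step].

(** * Homogeneous polynomials and their factors *)

Section Forms.
Variable K : numClosedFieldType.
Notation V := ('rV[K]_4).
Notation P4 := ({mpoly K[4]}).
Implicit Types (p q r : P4) (a b x y : V).

Lemma pevD p q x : pev (p + q) x = pev p x + pev q x. Proof. exact: mevalD. Qed.
Lemma pevN p x : pev (- p) x = - pev p x. Proof. exact: mevalN. Qed.
Lemma pevM p q x : pev (p * q) x = pev p x * pev q x. Proof. exact: mevalM. Qed.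
Lemma pevZ c p x : pev (c *: p) x = c * pev p x. Proof. exact: mevalZ. Qed.
Lemma pevC c x : pev c%:MP x = c. Proof. exact: mevalC. Qed.
Lemma pevXU i x : pev 'X_i x = x 0 i. Proof. exact: mevalXU. Qed.
Lemma pev_sum (I : Type) (s : seq I) (P : pred I) (F : I -> P4) x :
 pev (\sum_(i <- s | P i) F i) x = \sum_(i <- s | P i) pev (F i) x.
Proof. exact: (big_morph _ (mevalD (fun j => x 0 j)) (meval0 (fun j => x 0 j))). Qed.

Lemma pev_homogZ p d c x : p \is d.-homog -> pev p (c *: x) = c ^+ d * pev p x.
Proof.
move=> /dhomogP hp; rewrite /pev !mevalE mulr_sumr !big_seq; apply: eq_bigr => m /hp /= md.
rewrite mulrCA; congr (_ * _).
under eq_bigr do rewrite mxE exprMn.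
by rewrite big_split /=; congr (_ * _); rewrite prodrXr -md mdegE.
Qed.

Definition lin a : P4 := \sum_i a 0 i *: 'X_i.

Lemma pev_lin a x : pev (lin a) x = dot a x.
Proof. by rewrite pev_sum sum4 dotE !pevZ !pevXU. Qed.

Lemma lin_homog a : lin a \is 1.-homog.
Proof. by apply: rpred_sum => i _; apply: rpredZ; rewrite dhomogX /= mdeg1. Qed.

Lemma lin_inj : injective lin.
Proof. by move=> a b e; apply: dot_ext => x; rewrite -!pev_lin e. Qed.

Lemma lin_eq0 a : (lin a == 0) = (a == 0).
Proof.
rewrite -(inj_eq lin_inj); congr (_ == _); apply: pev_inj => x.
by rewrite pev_lin dot0l /pev meval0.
Qed.

Lemma homog1_lin p : p \is 1.-homog -> exists a, p = lin a.
Proof.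
move=> hp; exists (\row_i (p^`M(i))@_0); apply: pev_inj => x; rewrite pev_lin.
rewrite -[pev p x]mul1r -(euler_homog (fun j => x 0 j) hp) sum4 dotE !mxE.
by rewrite !homog0_meval ?mderiv_homog // ![x 0 _ * _]mulrC.
Qed.

Lemma homog0_const n (p : {mpoly K[n]}) : p \is 0.-homog -> p = (p@_0)%:MP.
Proof. by move=> hp; apply: meval_inj => x; rewrite homog0_meval // mevalC. Qed.

Lemma msize_lin a : a != 0 -> msize (lin a) = 2%N.
Proof.
rewrite -lin_eq0 => a0; have := dhomog_msize (lin_homog a) => h.
have := dhomog_uniq a0 (lin_homog a) h => /= e; rewrite (mpolySpred _ a0); congr (_.+1).
by rewrite -e.
Qed.

Lemma msize_homog n (p : {mpoly K[n]}) d : p \is d.-homog -> p != 0 -> msize p = d.+1.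
Proof.
by move=> hp p0; rewrite (mpolySpred _ p0) -(dhomog_uniq p0 hp (dhomog_msize hp)).
Qed.

Lemma msize1_unit n (p : {mpoly K[n]}) : p != 0 -> (msize p <= 1)%N -> p \is a GRing.unit.
Proof.
by move=> p0 s1; rewrite (msize1_polyC s1) mpolyC_unit //; apply: contraNneq p0 => e; rewrite (msize1_polyC s1) e mpolyC0.
Qed.

Lemma nonunit_msize n (p : {mpoly K[n]}) : p \isn't a GRing.unit -> p != 0 -> (1 < msize p)%N.
Proof. by move=> pu p0; rewrite ltnNge; apply: contra pu; apply: msize1_unit. Qed.

Lemma rdvd_lin p a : a != 0 -> p \isn't a GRing.unit -> rdvd p (lin a) ->
 exists2 c, c != 0 & p = c *: lin a.
Proof.
move=> a0 pu [q e]; have l0 : lin a != 0 by rewrite lin_eq0.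
have p0 : p != 0 by apply: contraNneq l0 => p0; rewrite e p0 mul0r.
have q0 : q != 0 by apply: contraNneq l0 => q0; rewrite e q0 mulr0.
have := msizeM p0 q0; rewrite -e msize_lin // => s.
have s1 := nonunit_msize pu p0.
have /mpoly_unitE[c c0 ec] : q \is a GRing.unit.
 apply: msize1_unit => //; rewrite leqNgt; apply/negP => s2.
 by case: (msize p + msize q)%N s (leq_add s1 s2) => [|[|[|[|m]]]].
exists c^-1; first by rewrite invr_eq0.
by rewrite e ec mulrC mul_mpolyC scalerA mulVf // scale1r.
Qed.

Lemma coprime_lin k (A : 'I_k -> V) i j : indep2 (A i) (A j) -> coprime_family (fun i => lin (A i)).
Proof.
move=> ind p [p0 pu _] hp.
have nz : A i != 0 /\ A j != 0.
 split; apply/eqP => z.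
  by have [|/eqP] := ind 1 0; rewrite ?z ?scaler0 ?scale0r ?addr0 // oner_eq0.
 by have [|_ /eqP] := ind 0 1; rewrite ?z ?scaler0 ?scale0r ?addr0 // oner_eq0.
have [c c0 ec] := rdvd_lin nz.1 pu (hp i); have [d d0 ed] := rdvd_lin nz.2 pu (hp j).
have [|/eqP] := ind c (- d); last by rewrite (negPf c0).
apply: lin_inj; apply: pev_inj => x; rewrite !pev_lin dotDl !dotZl dot0l mulNr -!pev_lin -!pevZ.
by rewrite -ec -ed subrr.
Qed.

Definition comb (f : 'I_4 -> P4) a : P4 := \sum_i a 0 i *: f i.

Lemma pev_comb f a x : pev (comb f a) x = dot a (ev f x).
Proof. by rewrite pev_sum sum4 dotE !pevZ !mxE. Qed.

Lemma comb_homog f a d : (forall i, f i \is d.-homog) -> comb f a \is d.-homog.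
Proof. by move=> h; apply: rpred_sum => i _; apply: rpredZ. Qed.

Lemma mpoly_pihomog n (p : {mpoly K[n]}) : p = \sum_(d < msize p) pihomog mdeg d p.
Proof. exact: pihomog_partitionE. Qed.

Lemma pihomog_out n (p : {mpoly K[n]}) d : (msize p <= d)%N -> pihomog mdeg d p = 0.
Proof.
move=> le; rewrite pihomogE big_seq_cond big1 // => m /andP[/msize_mdeg_lt lt /eqP e].
by move: lt; rewrite e ltnNge le.
Qed.

Lemma pihomogM n (p q : {mpoly K[n]}) e d : p \is e.-homog ->
 pihomog mdeg (e + d) (p * q) = p * pihomog mdeg d q.
Proof.
move=> hp; rewrite {1}[q](pihomog_partitionE (mf := mdeg) (k := maxn (msize q) d.+1)) ?leq_maxl //.
rewrite mulr_sumr raddf_sum /= (bigD1 (Ordinal (leq_maxr (msize q) d.+1))) //= big1 ?addr0.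
 by rewrite pihomog_dE // dhomogM // pihomogP.
move=> i ne; apply: pihomog_ne0 (dhomogM hp (pihomogP _ _ _)).
by rewrite eqn_add2l; apply: contra ne => /eqP e1; apply/eqP/val_inj; first [exact: e1 | exact: esym e1].
Qed.

Lemma homog_quot n (p q : {mpoly K[n]}) e d :
 p \is e.-homog -> p != 0 -> p * q \is (e + d).-homog -> q \is d.-homog.
Proof.
move=> hp p0 hpq; rewrite homog_piE; apply/eqP; apply: (mulfI p0).
by rewrite -(pihomogM q d hp) pihomog_dE.
Qed.

(** The lowest components of [p] and [q] multiply to a nonzero component of the product, and so do
    the highest. Both sit in degree [d], so the lowest and highest degrees of [p] agree. *)
Lemma homog_factor n (p q : {mpoly K[n]}) d : p * q != 0 -> p * q \is d.-homog ->
 exists e, p \is e.-homog.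
Proof.
move=> pq0 hpq; move: (pq0); rewrite mulf_eq0 negb_or => /andP[p0 q0].
pose lo (r : {mpoly K[n]}) := exists m, [/\ pihomog mdeg m r != 0 & forall j, (j < m)%N -> pihomog mdeg j r = 0].
have low (r : {mpoly K[n]}) : r != 0 -> lo r.
 move=> r0; have : exists m, pihomog mdeg m r != 0.
  apply: NNPP => h; case/eqP: r0; rewrite [r]mpoly_pihomog big1 // => i _.
  by apply/eqP/negPn/negP => hi; apply: h; exists i.
 move=> /ex_minnP[m hm mmin]; exists m; split=> // j jm; apply/eqP/negPn/negP => /mmin.
 by rewrite leqNgt jm.
pose hi (r : {mpoly K[n]}) := exists m, [/\ pihomog mdeg m r != 0 & forall j, (m < j)%N -> pihomog mdeg j r = 0].
have high (r : {mpoly K[n]}) : r != 0 -> hi r.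
 move=> r0; have [m [hm _]] := low r r0.
 have ub j : pihomog mdeg j r != 0 -> (j <= msize r)%N.
  by move=> hj; rewrite leqNgt; apply: contra hj => lt; rewrite pihomog_out // ltnW.
 case: (ex_maxnP (ex_intro _ m hm) ub) => k hk kmax; exists k; split=> // j kj; apply/eqP/negPn/negP => /kmax.
 by rewrite leqNgt kj.
have prod_pi i j (N := maxn (msize p) i.+1) : pihomog mdeg (i + j) (p * q) =
  \sum_(l < N) (if (l <= i + j)%N then pihomog mdeg l p * pihomog mdeg (i + j - l) q else 0).
 rewrite {1}[p](pihomog_partitionE (mf := mdeg) (k := N)) ?leq_maxl // mulr_suml raddf_sum /=.
 apply: eq_bigr => l _; case: ifP => le; first by rewrite -{1}(subnKC le) pihomogM // pihomogP.
 rewrite {1}[q]mpoly_pihomog mulr_sumr raddf_sum big1 // => t _ /=.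
 apply: pihomog_ne0 (dhomogM (pihomogP _ _ _) (pihomogP _ _ _)).
 by apply: contraFN le => /eqP <-; rewrite leq_addr.
have extremal i j : pihomog mdeg i p != 0 -> pihomog mdeg j q != 0 ->
  (forall l, (l < i)%N -> pihomog mdeg l p = 0 \/ pihomog mdeg (i + j - l) q = 0) ->
  (forall l, (i < l)%N -> (l <= i + j)%N -> pihomog mdeg l p = 0 \/ pihomog mdeg (i + j - l) q = 0) ->
  d = (i + j)%N.
 move=> hi1 hj1 h1 h2; apply/eqP; apply: contraT => ne.
 have := pihomog_ne0 ne hpq; rewrite prod_pi.
 rewrite (bigD1 (Ordinal (leq_maxr (msize p) i.+1))) //= leq_addr addKn big1 ?addr0.
  by move=> /eqP; rewrite mulf_eq0 (negPf hi1) (negPf hj1).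
 move=> l ne2; case: ifP => // le.
 have : (l < i)%N || (i < l)%N by rewrite -neq_ltn; apply: contra ne2 => /eqP e; apply/eqP/val_inj.
 by case/orP => lt; [case: (h1 _ lt) | case: (h2 _ lt le)] => ->; rewrite ?mul0r ?mulr0.
have [i1 [a1 b1]] := low p p0; have [j1 [c1 d1]] := low q q0.
have [i2 [a2 b2]] := high p p0; have [j2 [c2 d2]] := high q q0.
have e1 : d = (i1 + j1)%N.
 apply: extremal => // l lt; first by left; apply: b1.
 move=> le; right; apply: d1; rewrite -(ltn_add2r l) subnK // addnC ltn_add2l //.
have e2 : d = (i2 + j2)%N.
 apply: extremal => // l lt; last by move=> _; left; apply: b2.
 right; apply: d2; rewrite -(ltn_add2r l) subnK; first by rewrite addnC ltn_add2r.
 by apply: leq_trans (leq_addr _ _); apply: ltnW.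
have le1 : (i1 <= i2)%N by rewrite leqNgt; apply: contra a2 => /b1->.
have le2 : (j1 <= j2)%N by rewrite leqNgt; apply: contra c2 => /d1->.
have ei : i1 = i2.
 by apply/eqP; rewrite eqn_leq le1 /= -(leq_add2r j2) -e2 e1 leq_add2l.
exists i1; rewrite [p]mpoly_pihomog; apply: rpred_sum => i _.
have [e|ne] := eqVneq (i : nat) i1; first by rewrite -e pihomogP.
have : (i < i1)%N || (i1 < i)%N by rewrite -neq_ltn.
by case/orP => lt; [rewrite b1|rewrite b2 -?ei] => //; apply: rpred0.
Qed.

End Forms.

(** * General lines and planes versus the base locus *)

Section Elimination.
Variable K : numClosedFieldType.
Notation V := ('rV[K]_4).
Notation P4 := ({mpoly K[4]}).

Definition msubst (A : 'M[K]_4) (p : P4) : P4 := p \mPo [tuple \sum_j A j i *: 'X_j | i < 4].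

Lemma pev_msubst A p x : pev (msubst A p) x = pev p (x *m A).
Proof.
rewrite /pev comp_mpoly_meval; apply: meval_eq => i.
rewrite tnth_mktuple -[LHS]/(pev _ x) pev_sum mxE; apply: eq_bigr => j _.
by rewrite pevZ pevXU mulrC.
Qed.

Lemma msubstK A : A \in unitmx -> cancel (msubst A) (msubst (invmx A)).
Proof. by move=> uA p; apply: pev_inj => x; rewrite !pev_msubst mulmxKV. Qed.

Lemma msubstKV A : A \in unitmx -> cancel (msubst (invmx A)) (msubst A).
Proof. by move=> uA p; apply: pev_inj => x; rewrite !pev_msubst mulmxK. Qed.

Lemma exists_last_row (e : V) : e != 0 -> exists2 A, A \in unitmx & exists2 c, c != 0 & e = c *: row q3 A.
Proof.
move=> e0; have uE := row_ebase_unit e; have := mulmx_ebase e; rewrite rank_rV e0 => ee.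
exists (xrow q0 q3 (row_ebase e)).
 by rewrite xrowE unitmx_mul uE unitmx_perm.
exists (col_ebase e 0 0).
 apply: contraNneq e0 => c0; rewrite -ee (_ : col_ebase e = 0) ?mul0mx //.
 by apply/matrixP => i j; rewrite !ord1 c0 mxE.
apply/rowP => j; rewrite -{1}ee !mxE /= tpermR.
rewrite (bigD1 q0) //= big1 ?addr0.
 by rewrite !mxE (bigD1 ord0) //= big1 ?addr0 ?mxE ?mulr1 // => i; rewrite ord1.
move=> i ne; rewrite !mxE (bigD1 ord0) //= big1 ?addr0; last by move=> i'; rewrite ord1.
rewrite mxE /= (_ : (0 == i)%N = false) ?mulr0 ?mul0r //.
by apply/negbTE; apply: contra ne => /eqP e1; apply/eqP/val_inj.
Qed.

(** After a change of coordinates that makes [e] the last coordinate vector, the eliminant is the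
    equation [D] of a cone with vertex [e] through the common zeros. *)
Lemma elim_center k (f : 'I_k -> P4) (e : V) :
 coprime_family f -> (exists i, f i != 0) -> e != 0 ->
 exists D : V -> K, [/\ pfun D, exists x, D x != 0, forall x t, D (x + t *: e) = D x &
  forall x, (forall i, pev (f i) x = 0) -> D x = 0].
Proof.
move=> cf [i0 fi0] /exists_last_row[A uA [c c0 ee]].
have iso1 := msubstK uA; have iso2 := msubstKV uA.
pose F := @comp_mpoly 4 K 4 [tuple \sum_j A j i *: 'X_j | i < 4].
have [p pp hp||D D0 hD] := @base_elimination K k 3 (fun i => msubst A (f i)).
- apply: (cf (msubst (invmx A) p)).
  by apply/(@iso_rprime _ _ F _ iso1 iso2); rewrite /= -/(msubst A _) iso2.
 by move=> i; apply/(@iso_dvd _ _ F _ iso1 iso2); rewrite /= -!/(msubst A _) iso2.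
- by exists i0; apply: contra_neq fi0 => e0; rewrite -(iso1 (f i0)) e0; apply: (rmorph0 (@comp_mpoly 4 K 4 _)).
pose w (y : V) := fun i : 'I_3 => (y *m invmx A) 0 (widen_ord (leqnSn 3) i).
exists (fun x => D.@[w x]); split.
- apply: (@pfun_meval _ _ 3 D (fun i y => w y i)) => i; rewrite /w.
 exact: (@pvec_lin _ _ 4 (mulmxr (invmx A)) (widen_ord (leqnSn 3) i)).
- have [x hx] := meval_neq0 D0; exists ((\row_j extend_pt x 0 j) *m A).
 rewrite (_ : _.@[_] = D.@[x]) //; apply: meval_eq => i.
 by rewrite /w mulmxK // mxE extend_pt_widen.
- move=> x t; apply: meval_eq => i; rewrite /w mulmxDl mxE ee -!scalemxAl -row_mul mulmxV // !mxE.
 by rewrite (_ : (q3 == _) = false) ?mulr0 ?addr0 //; apply/eqP => /(congr1 val) /= e1; have := ltn_ord i; rewrite -e1.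
move=> x hx; rewrite -(hD (fun j => (x *m invmx A) 0 j)) // => i.
by rewrite -[LHS]/(pev _ (x *m invmx A)) pev_msubst mulmxKV.
Qed.

(** The base locus lies on the cone [D] with vertex [e]; a line through [e] off this cone can meet
    it only in [e], which is no base point. *)
Lemma base_free_line (f : 'I_4 -> P4) d (e : V) : (forall i, f i \is d.-homog) ->
 coprime_family f -> (exists i, f i != 0) -> e != 0 -> ev f e != 0 ->
 exists D : V -> K, [/\ pfun D, exists x, D x != 0, forall x, ev f x = 0 -> D x = 0 &
  forall w, D w != 0 -> forall s t, (s != 0) || (t != 0) -> ev f (s *: e + t *: w) != 0].
Proof.
move=> hf cf f0 e0 fe.
have evZ c x : ev f (c *: x) = c ^+ d *: ev f x.
 by apply/rowP => i; rewrite !mxE (pev_homogZ _ _ (hf i)).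
have evP x : ev f x = 0 -> forall i, pev (f i) x = 0.
 by move=> /rowP h i; have := h i; rewrite !mxE.
have [D [pD D0 De Df]] := elim_center cf f0 e0; exists D; split=> // [x /evP/Df //|].
move=> w Dw s t st; have [t0|t0] := eqVneq t 0.
 move: st; rewrite t0 eqxx orbF scale0r addr0 evZ scaler_eq0 negb_or fe andbT => s0.
 exact: expf_neq0.
have -> : s *: e + t *: w = t *: (w + (s / t) *: e).
 by rewrite scalerDr scalerA mulrCA mulfV // mulr1 addrC.
rewrite evZ scaler_eq0 negb_or expf_neq0 //=; apply: contraNneq Dw => /evP/Df.
by rewrite De => ->.
Qed.

Lemma poly_roots (p : {poly K}) : p != 0 -> exists s : seq K, forall t, p.[t] = 0 -> t \in s.
Proof.
move=> p0; have [s es] := closed_field_poly_normal p; exists s => t.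
rewrite es hornerZ => /eqP; rewrite mulf_eq0 lead_coef_eq0 (negPf p0) /= => h.
by rewrite -root_prod_XsubC.
Qed.

(** The cone with vertex [u] leaves finitely many values for the coordinate along [v], and
    conversely, so the base points in the plane lie on a finite grid. Since <u, v> has no base
    point, [t] is nonzero. *)
Lemma plane_finite_base (f : 'I_4 -> P4) d (u v : V) : (forall i, f i \is d.-homog) ->
 coprime_family f -> (exists i, f i != 0) -> u != 0 -> v != 0 ->
 (forall s t, (s != 0) || (t != 0) -> ev f (s *: u + t *: v) != 0) ->
 exists D : V -> K, [/\ pfun D, exists x, D x != 0 &
  forall w, D w != 0 -> exists L : seq V, forall r s t, ev f (r *: u + s *: v + t *: w) = 0 ->
   [|| r != 0, s != 0 | t != 0] -> t != 0 /\ exists2 x, x \in L & r *: u + s *: v + t *: w = t *: x].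
Proof.
move=> hf cf f0 u0 v0 bf.
have evZ c x : ev f (c *: x) = c ^+ d *: ev f x.
 by apply/rowP => i; rewrite !mxE (pev_homogZ _ _ (hf i)).
have evP x : ev f x = 0 -> forall i, pev (f i) x = 0.
 by move=> /rowP h i; have := h i; rewrite !mxE.
have [D1 [pD1 [x1 D10] De1 Df1]] := elim_center cf f0 u0.
have [D2 [pD2 [x2 D20] De2 Df2]] := elim_center cf f0 v0.
exists (fun x => D1 x * D2 x); split; first exact: pfunM.
 have [w [h1 h2]] := pfun_nonzero2 pD1 pD2 D10 D20; exists w; exact: mulf_neq0.
move=> w; rewrite mulf_eq0 negb_or => /andP[h1 h2].
have [p1 hp1] := pD1 w v; have [p2 hp2] := pD2 w u.
have p10 : p1 != 0 by apply: contraNneq h1 => z; rewrite -[w]addr0 -(scale0r v) hp1 z horner0.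
have p20 : p2 != 0 by apply: contraNneq h2 => z; rewrite -[w]addr0 -(scale0r u) hp2 z horner0.
have [s1 hs1] := poly_roots p10; have [s2 hs2] := poly_roots p20.
exists [seq a *: u + b *: v + w | a <- s2, b <- s1] => r s t fz nz.
have t0 : t != 0.
 apply: contraTneq nz => t0; rewrite t0 eqxx orbF; apply/negP => /bf/eqP; apply.
 by rewrite -fz t0 scale0r addr0.
split=> //; exists ((r / t) *: u + (s / t) *: v + w); last first.
 by rewrite !scalerDr !scalerA ![t * _]mulrC !divfK.
have fw : ev f ((r / t) *: u + (s / t) *: v + w) = 0.
 have := fz; have -> : r *: u + s *: v + t *: w = t *: ((r / t) *: u + (s / t) *: v + w).
  by rewrite !scalerDr !scalerA ![t * _]mulrC !divfK.
 by rewrite evZ => /eqP; rewrite scaler_eq0 (negPf (expf_neq0 _ t0)) => /eqP.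
apply: allpairs_f.
 apply: hs2; rewrite -hp2 -(De2 _ (s / t)); apply: Df2; apply: evP.
 by rewrite -fw; congr ev; rewrite addrAC addrC addrA addrAC.
apply: hs1; rewrite -hp1 -(De1 _ (r / t)); apply: Df1; apply: evP.
by rewrite -fw; congr ev; rewrite addrC addrCA addrC addrAC.
Qed.

(** A common prime factor is a form of positive degree, which vanishes somewhere on every line; if
    its restriction to [u + t *: v] is a constant, the zero is [v]. *)
Lemma line_coprime (f : 'I_4 -> P4) d (u v : V) : (forall i, f i \is d.-homog) ->
 (forall s t, (s != 0) || (t != 0) -> ev f (s *: u + t *: v) != 0) -> coprime_family f.
Proof.
move=> hf bf p pp hp; have [p0 pu _] := pp.
have [i fi0] : exists i, f i != 0.
 apply: NNPP => h; have := bf 1 0; rewrite oner_eq0 /= => /(_ isT)/eqP; apply; apply/rowP => i.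
 rewrite !mxE; have -> : f i = 0 by apply/eqP/negPn/negP => fi; apply: h; exists i.
 by rewrite /pev meval0.
have [e he] : exists e, p \is e.-homog.
 by have [q eq] := hp i; apply: (@homog_factor _ _ p q d); rewrite -eq.
have e0 : (0 < e)%N.
 have := nonunit_msize pu p0; rewrite (msize_homog he p0); by case: (e).
suff [s [t [st z]]] : exists s t, ((s != 0) || (t != 0)) /\ pev p (s *: u + t *: v) = 0.
 have /eqP := bf s t st; apply; apply/rowP => j; rewrite !mxE.
 by have [q ->] := hp j; rewrite pevM z mul0r.
have [q hq] : exists q : {poly K}, forall t, pev p (u + t *: v) = q.[t].
 by apply: (pfun_pev p (@pvec_id _ 4)).
have [/closed_rootP[t rt]|s1] := boolP (size q != 1%N).
 by exists 1, t; rewrite oner_eq0 scale1r hq; split=> //; apply/eqP.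
exists 0, 1; rewrite oner_eq0 orbT scale0r add0r scale1r; split=> //.
have q1 := size1_polyC (eq_leq (eqP (negPn s1))); set c := q`_0 in q1.
have pf : pfun (fun t : K^o => pev p (v + t *: u) - t ^+ e * c).
 apply: pfunB; first by apply: (@pfun_line _ _ (pev p)); apply: pfun_pev; apply: pvec_id.
 by apply: pfunM; [apply: pfunX; apply: (pfun_scalar (idfun : {scalar K^o}))|apply: pfun_const].
have := @pfun_dense _ _ _ (fun t : K^o => t) pf (pfun_scalar (idfun : {scalar K^o})) _ _ 0.
rewrite scale0r addr0 expr0n (gtn_eqF e0) mul0r subr0; apply; first by exists (1 : K); rewrite oner_eq0.
move=> t t0; have -> : v + t *: u = t *: (u + t^-1 *: v) by rewrite scalerDr scalerA mulfV // scale1r addrC.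
by rewrite (pev_homogZ _ _ he) hq q1 hornerC subrr.
Qed.

(** By coprimality P divides its derivative, which has smaller degree and so is zero; in
    characteristic zero P is constant. *)
Lemma coprime_no_wronskian (P Q : {poly K}) : coprimep P Q -> P^`() * Q = Q^`() * P ->
 (size P <= 1)%N /\ (size Q <= 1)%N.
Proof.
have deriv_dvd (R : {poly K}) : R %| R^`() -> (size R <= 1)%N.
 move=> dv; have [R0|R0] := eqVneq R 0; first by rewrite R0 size_poly0.
 have [d0|d0] := eqVneq R^`() 0.
  apply/leq_sizeP => -[//|j] _; have := congr1 (fun q : {poly K} => q`_j) d0.
  by rewrite coef_deriv coef0 => /eqP; rewrite mulrn_eq0 => /eqP.
 by have := dvdp_leq d0 dv; rewrite leqNgt lt_size_deriv.
move=> co e; split; apply: deriv_dvd.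
 rewrite -(Gauss_dvdpl _ co) e; exact: dvdp_mull.
rewrite coprimep_sym in co; rewrite -(Gauss_dvdpl _ co) -e; exact: dvdp_mull.
Qed.

(* A rational function of degree at least 2 takes a general value twice. *)
Lemma rational_injective (P Q N : {poly K}) : coprimep P Q -> N != 0 ->
 (forall s t, N.[s] != 0 -> N.[t] != 0 -> P.[s] * Q.[t] = P.[t] * Q.[s] -> s = t) ->
 (size P <= 2)%N /\ (size Q <= 2)%N.
Proof.
wlog sPQ : P Q / (size Q <= size P)%N.
 move=> wl co N0 inj; have [le|lt] := leqP (size Q) (size P); first exact: wl.
 have [] := wl Q P (ltnW lt) _ N0; rewrite 1?coprimep_sym // => s t h1 h2 e.
 by apply: inj => //; rewrite mulrC -e mulrC.
move=> co N0 inj; suff s2 : (size P <= 2)%N by split=> //; apply: leq_trans s2.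
rewrite leqNgt; apply/negP => sP.
have P0 : P != 0 by rewrite -size_poly_gt0; apply: leq_trans sP.
pose F t := Q.[t] *: P - P.[t] *: Q.
have indep a b : a *: P + b *: Q = 0 -> a = 0 /\ b = 0.
 move=> e; have [b0|b0] := eqVneq b 0.
  by move: e; rewrite b0 scale0r addr0 => /eqP; rewrite scaler_eq0 (negPf P0) orbF => /eqP.
 have eQ : Q = (- a / b) *: P.
  apply: (scalerI b0); rewrite scalerA mulrC divfK // scaleNr; apply/eqP.
  by rewrite -addr_eq0 addrC e.
 move: co; rewrite eQ => co; have : P %| 1.
  have [c0|c0] := eqVneq (- a / b) 0.
   by move: co; rewrite c0 scale0r coprimep0 => /eqp_dvdl ->.
  by move: co; rewrite coprimepZr // coprimepp => /eqP h; move: sP; rewrite h.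
 by move=> d1; have := dvdp_leq (oner_neq0 _) d1; rewrite size_poly1 leqNgt (ltn_trans _ sP).
have W0 : P^`() * Q - Q^`() * P != 0.
 rewrite subr_eq0; apply/eqP => /(coprime_no_wronskian co)[+ _].
 by rewrite leqNgt (ltn_trans _ sP).
have L0 : P`_(size P).-1 *: Q - Q`_(size P).-1 *: P != 0.
 apply/eqP => e; have [|/eqP + _] := indep (- Q`_(size P).-1) (P`_(size P).-1).
  by rewrite scaleNr addrC.
 rewrite oppr_eq0 => /eqP q; have := e; rewrite q scale0r subr0 => /eqP.
 rewrite scaler_eq0 -lead_coefE lead_coef_eq0 (negPf P0) /= => /eqP Q0.
 by move: co; rewrite Q0 coprimep0 -size_poly_eq1 => h; move: sP; rewrite (eqP h).
have [bad hbad] := poly_roots N0.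
pose G := \prod_(b <- bad) (P.[b] *: Q - Q.[b] *: P).
have G0 : G != 0.
 rewrite prodf_seq_neq0; apply/allP => b _; apply/implyP => _; apply/eqP => e.
 have [|/eqP + Pb] := indep (- Q.[b]) (P.[b]); first by rewrite scaleNr addrC.
 rewrite oppr_eq0 => /eqP Qb.
 have := co; rewrite coprimep_def => /eqP sg.
 have : ('X - b%:P) %| gcdp P Q by rewrite dvdp_gcd !dvdp_XsubCl /root Pb Qb eqxx.
 move/dvdp_leq; rewrite sg size_XsubC => /(_ _)/negP; apply => //.
 by rewrite -size_poly_gt0 sg.
(* The Wronskian makes [t0] a simple root of [F t0], [L0] keeps the degree of [F t0] maximal, hence
   at least 2, and [G] keeps the zeros of [N] out of the fibre of [t0]. *)
have [t0] := poly_nonroot (mulf_neq0 (mulf_neq0 W0 L0) (mulf_neq0 G0 N0)).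
rewrite !hornerM !mulf_eq0 !negb_or => /andP[/andP[w0 l0] /andP[g0 n0]].
have rF : root (F t0) t0 by rewrite /root /F !hornerE mulrC subrr.
have [F1 eF] := factor_theorem _ _ rF.
have sF : size (F t0) = size P.
 apply/eqP; rewrite eqn_leq; apply/andP; split.
  rewrite (leq_trans (size_polyD _ _)) // geq_max size_polyN.
  by rewrite (leq_trans (size_scale_leq _ _)) // (leq_trans (size_scale_leq _ _)).
 rewrite -(prednK (leq_trans _ sP)) // ltnNge; apply: contra l0 => /leq_sizeP/(_ _ (leqnn _)).
 rewrite /F coefB !coefZ !hornerE => e; rewrite mulrC [X in _ - X]mulrC e; exact: eqxx.
have F10 : F1 != 0.
 by apply: contraTneq sP => z; rewrite -sF eF z mul0r size_poly0.
have sF1 : size F1 != 1%N.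
 move: sF; rewrite eF size_mul ?polyXsubC_eq0 // size_XsubC addn2 /= => e.
 by apply: contraTneq sP => z; rewrite -e z.
have [t1 rt1] := closed_rootP _ sF1.
have Ft1 : (F t0).[t1] = 0 by rewrite eF hornerM (eqP rt1) mul0r.
have ne : t1 != t0.
 apply: contraNneq w0 => e; have : (F t0)^`().[t0] = 0.
  by rewrite eF derivM hornerD !hornerM derivXsubC !hornerE -e (eqP rt1) subrr mulr0 addr0.
 rewrite /F derivB !derivZ !hornerE => e2; rewrite mulrC [X in _ - X]mulrC e2; exact: eqxx.
case/eqP: ne; apply: inj => //; last first.
 by move: Ft1; rewrite /F !hornerE => /eqP; rewrite subr_eq0 mulrC => /eqP->; rewrite mulrC.
apply/negP => /eqP/hbad b1; move: g0; rewrite /G horner_prod prodf_seq_neq0 => /allP/(_ _ b1)/=.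
move=> /eqP; apply; move/eqP: Ft1; rewrite /F !hornerE subr_eq0 => /eqP e.
by rewrite mulrC e mulrC subrr.
Qed.

End Elimination.

(** * Lines mapped to lines, and osculating planes *)

Section Lines.
Variable K : numClosedFieldType.
Notation V := ('rV[K]_4).

Lemma basis1 (e : V) : e != 0 -> exists b c d, det4 e b c d != 0.
Proof.
move=> e0; have [i ei0] : exists i, e 0 i != 0.
 by apply: NNPP => h; case/eqP: e0; apply/rowP => i; rewrite mxE; apply/eqP/negPn/negP => hi; apply: h; exists i.
have E n m : evec K n 0 m = (m == n)%:R := evecE K n m.
move: i ei0; apply: ord4P => ei.
- exists (evec K q1), (evec K q2), (evec K q3); apply: contra_neq ei => <-; rewrite det4E /minor2 !E /=; ring.
- exists (evec K q2), (evec K q0), (evec K q3); apply: contra_neq ei => <-; rewrite det4E /minor2 !E /=; ring.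
- exists (evec K q0), (evec K q1), (evec K q3); apply: contra_neq ei => <-; rewrite det4E /minor2 !E /=; ring.
- exists (evec K q1), (evec K q0), (evec K q2); apply: contra_neq ei => <-; rewrite det4E /minor2 !E /=; ring.
Qed.

Lemma det4_lin3 (a b c y : V) (x0 x1 x2 z0 z1 z2 w0 w1 w2 : K) :
 det4 (x0 *: a + x1 *: b + x2 *: c) (z0 *: a + z1 *: b + z2 *: c) (w0 *: a + w1 *: b + w2 *: c) y
 = (x0 * (z1 * w2 - z2 * w1) - x1 * (z0 * w2 - z2 * w0) + x2 * (z0 * w1 - z1 * w0)) * det4 a b c y.
Proof. by rewrite !det4E /minor2 !mxE; ring. Qed.

Lemma st_sq (T : symtri K) (a b c : V) : T (a + b) (a + b) c = T a a c + 2 *: T a b c + T b b c.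
Proof. by rewrite !stD1 !stD2 (st12 T a b); vring. Qed.

Section LinesBir.
Variables (f g : 'I_4 -> {mpoly K[4]}) (h k : {mpoly K[4]}).
Hypothesis B : bir f g h k.
Notation T := (pol f).

Lemma bir_indep_tangent o w : pev h o != 0 -> indep2 o w -> indep2 (T o o o) (T o o w).
Proof.
move=> ho ind s t e; apply: ind; apply: (bir_dinj B ho).
by rewrite stD3 !stZ3.
Qed.

Lemma bir_line_pfun o w : pfun (fun t : K^o => pev h (o + t *: w)).
Proof. by polynomial. Qed.

Lemma pfun_K : pfun (fun t : K^o => t).
Proof. exact: (pfun_scalar (idfun : {scalar K^o})). Qed.

Lemma bir_h_line o w : pev h o != 0 -> exists2 q : {poly K}, q != 0 & forall t, pev h (t *: o + w) = q.[t].
Proof.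
move=> ho; have [q hq] : exists q : {poly K}, forall t, pev h (w + t *: o) = q.[t].
 by apply: (pfun_pev h (@pvec_id _ 4)).
exists q; last by move=> t; rewrite addrC hq.
apply: contraNneq ho => q0.
have := @pfun_dense _ _ _ _ (bir_line_pfun o w) pfun_K _ _ 0.
rewrite scale0r addr0 => ->//; first by exists (1 : K); rewrite oner_eq0.
move=> t t0; have -> : o + t *: w = t *: (w + t^-1 *: o) by rewrite scalerDr scalerA mulfV // scale1r addrC.
by rewrite (bir_hZ B) hq q0 horner0 mulr0.
Qed.

(** On the line the map is A c0 + C c1 with A of degree 3. The quotient of A by C is injective at
    general points, so after division by G = gcd(A, C) its degree is at most 1. Hence G has degree
    at least 2, and its roots are base points: two distinct ones or a double one. *)
Lemma rank2_line o w : pev h o != 0 -> indep2 o w ->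
 (exists a b, T o w w = a *: T o o o + b *: T o o w) ->
 (exists a b, T w w w = a *: T o o o + b *: T o o w) ->
 (exists r, let p := r *: o + w in cub T p = 0 /\ T p p o = 0 /\ T p p w = 0) \/
 (exists r s, r != s /\ cub T (r *: o + w) = 0 /\ cub T (s *: o + w) = 0).
Proof.
move=> ho ind [a [b e2]] [a' [b' e3]].
have ind' := bir_indep_tangent ho ind.
name c0 E0 := (T o o o).
name c1 E1 := (T o o w).
rewrite -E0 -E1 in e2 e3 ind'.
pose A : {poly K} := 'X^3 + (3 * a) *: 'X + a'%:P.
pose C : {poly K} := 3 *: 'X^2 + (3 * b) *: 'X + b'%:P.
have eA t : A.[t] = t ^+ 3 + 3 * a * t + a' by rewrite /A !(hornerXn, hornerE) /=.
have eC t : C.[t] = 3 * t ^+ 2 + 3 * b * t + b' by rewrite /C !(hornerXn, hornerE) /=.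
have ecub t : cub T (t *: o + w) = A.[t] *: c0 + C.[t] *: c1.
 rewrite cubD cubZ !stZ1 !stZ2 e2 /cub e3 -E0 -E1 eA eC.
 by vring.
have eder t : T (t *: o + w) (t *: o + w) o = (t ^+ 2 + a) *: c0 + (2 * t + b) *: c1.
 rewrite st_sq !stZ1 !stZ2 (st23 T o o w) (st13 T o w w) e2 -E0 -E1.
 by vring.
have [q q0 hq] := bir_h_line w ho.
have sA : size A = 4%N.
 rewrite /A -addrA size_polyDl ?size_polyXn // ltnS (leq_trans (size_polyD _ _)) // geq_max.
 rewrite (leq_trans (size_scale_leq _ _)) ?size_polyX // size_polyC; by case: (_ == _).
have A0 : A != 0 by rewrite -size_poly_gt0 sA.
pose G := gcdp A C.
have G0 : G != 0 by rewrite gcdp_eq0 (negPf A0).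
have dA : A = A %/ G * G by rewrite divpK // dvdp_gcdl.
have dC : C = C %/ G * G by rewrite divpK // dvdp_gcdr.
have co : coprimep (A %/ G) (C %/ G) by apply: coprimep_div_gcd; rewrite A0.
move: dA dC co; set A1 := A %/ G; set C1 := C %/ G => dA dC co.
have [sA1 _] : (size A1 <= 2)%N /\ (size C1 <= 2)%N.
 apply: (rational_injective co (mulf_neq0 q0 G0)) => s t.
 rewrite !hornerM !mulf_eq0 !negb_or -!hq => /andP[hs gs] /andP[ht gt] e.
 have cs : cub T (s *: o + w) = (G.[s] * A1.[s]) *: c0 + (G.[s] * C1.[s]) *: c1.
  by rewrite ecub dA dC !hornerM ![_ * G.[s]]mulrC.
 have ct : cub T (t *: o + w) = (G.[t] * A1.[t]) *: c0 + (G.[t] * C1.[t]) *: c1.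
  by rewrite ecub dA dC !hornerM ![_ * G.[t]]mulrC.
 have [c ec] : exists c, cub T (s *: o + w) = c *: cub T (t *: o + w).
  have [z|nz] := eqVneq A1.[t] 0.
   have C0 : C1.[t] != 0.
    apply: contraNneq (bir_cub_neq0 B ht) => z'.
    by rewrite ct z z' !mulr0 !scale0r addr0.
   have z1 : A1.[s] = 0.
    by move/eqP: e; rewrite z mul0r mulf_eq0 (negPf C0) orbF => /eqP.
   exists (G.[s] * C1.[s] / (G.[t] * C1.[t])); rewrite cs ct z z1 !mulr0 !scale0r !add0r scalerA divfK //.
   by rewrite mulf_neq0.
  exists (G.[s] * A1.[s] / (G.[t] * A1.[t])); rewrite cs ct scalerDr !scalerA divfK ?mulf_neq0 //.
  congr (_ + _ *: _); apply: (mulIf nz).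
  have -> : G.[s] * A1.[s] / (G.[t] * A1.[t]) * (G.[t] * C1.[t]) * A1.[t] = G.[s] * (A1.[s] * C1.[t]).
   by field; rewrite nz gt.
  by rewrite e; ring.
 have [r er] := bir_inj B hs ec.
 have [|h1 h2] := ind (s - r * t) (1 - r).
  by move/eqP: (er); rewrite -subr_eq0 => /eqP er'; rewrite -[RHS]er'; vring.
 have r1 : r = 1 by apply/eqP; rewrite eq_sym -subr_eq0; apply/eqP.
 by apply/eqP; rewrite -subr_eq0; apply/eqP; rewrite -h1 r1 mul1r.
have A10 : A1 != 0 by apply: contraNneq A0 => z; rewrite dA z mul0r.
have sG : (2 < size G)%N.
 move: sA; rewrite dA size_mul // => e; rewrite ltnNge; apply/negP => le.
 by have := leq_add sA1 le; move: e; case: (_ + _)%N => [|[|[|[|[|m]]]]].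
have /closed_rootP[r /factor_theorem[G1 eG]] : size G != 1%N by rewrite gtn_eqF // ltnW.
have G10 : G1 != 0 by apply: contraNneq G0 => z; rewrite eG z mul0r.
have /closed_rootP[s /factor_theorem[G2 eG1]] : size G1 != 1%N.
 move: sG; rewrite eG size_mul ?polyXsubC_eq0 // size_XsubC addn2 /= => lt; by rewrite gtn_eqF.
have base t : G.[t] = 0 -> cub T (t *: o + w) = 0.
 by move=> z; rewrite ecub dA dC !hornerM z !mulr0 !scale0r addr0.
have br : G.[r] = 0 by rewrite eG !hornerE subrr mulr0.
have bs : G.[s] = 0 by rewrite eG eG1 !hornerE subrr mulr0 mul0r.
have [ers|ne] := eqVneq r s; last by right; exists r, s; rewrite !base.
left; exists r => /=; rewrite base //.
have dd (P P1 : {poly K}) : P = P1 * G -> P^`().[r] = 0.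
 move=> ->; rewrite eG eG1 -ers !derivM !derivXsubC !hornerE subrr /=; ring.
have dA0 : r ^+ 2 + a = 0.
 have := dd _ _ dA; rewrite /A !derivE !(hornerXn, hornerE) /= => e.
 have n3 : 3 != 0 :> K by rewrite pnatr_eq0.
 by apply: (mulfI n3); rewrite mulr0 -e; ring.
have dC0 : 2 * r + b = 0.
 have := dd _ _ dC; rewrite /C !derivE !(hornerXn, hornerE) /= => e.
 have n3 : 3 != 0 :> K by rewrite pnatr_eq0.
 by apply: (mulfI n3); rewrite mulr0 -e; ring.
have po : T (r *: o + w) (r *: o + w) o = 0 by rewrite eder dA0 dC0 !scale0r addr0.
split=> //; split=> //; have := base r br; rewrite /cub stD3 stZ3 po scaler0 add0r //.
Qed.

(** Otherwise a general line through a general point is mapped into a line, so by [rank2_line] it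
    contains a base point, contrary to [base_free_line]. *)
Lemma osculating_plane_ex : exists u v, cross (T u u u) (T u u v) (T u v v) != 0.
Proof.
apply: NNPP => nh; have h0 u v : cross (T u u u) (T u u v) (T u v v) = 0.
 by apply/eqP/negPn/negP => hn; apply: nh; exists u, v.
have [e he] := bir_h_ex B; have e0 := bir_h_neq0 B he.
have fe : ev f e != 0 by rewrite ev_pol; [apply: (bir_cub_neq0 B)|apply: bir_fh B].
have [D [pD [w0 Dw0] _ bf]] := base_free_line (bir_fh B) (bir_fc B) (bir_f0 B) e0 fe.
have [b [c [d hd]]] := basis1 e0.
have pm : pfun (fun w => det4 e w c d) by polynomial.
have [w [Dw dw]] := pfun_nonzero2 pD pm Dw0 hd.
have ind := det4_indep2 dw.
have ind' := bir_indep_tangent he ind.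
have [a1 [b1 e2]] := indep2_cross ind' (h0 e w).
(* The dependence at [e + t *: w] and [w], expanded in [T e e e], [T e e w], [T w w w], is a nonzero
   polynomial in [t] times their determinant with [y]. *)
have : exists a b, T w w w = a *: T e e e + b *: T e e w.
 apply: (indep2_cross ind'); apply: dot_ext => y; rewrite dot0l dot_cross.
 have p0 : ('X + b1 *: 'X^2 - a1 *: 'X^3 : {poly K}) != 0.
  apply/eqP => /(congr1 (fun q : {poly K} => q`_1)).
  by rewrite coefB coefD !coefZ !coefXn coefX coef0 /= !mulr0 subr0 addr0 => /eqP; rewrite oner_eq0.
 have [t] := poly_nonroot p0; rewrite !(hornerXn, hornerE) /= => ht.
 have := congr1 (fun v => dot v y) (h0 (e + t *: w) w); rewrite dot0l dot_cross.
 name c0 E0 := (T e e e).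
 name c1 E1 := (T e e w).
 name c3 E3 := (T w w w).
 have -> : T (e + t *: w) (e + t *: w) (e + t *: w) =
  (1 + 3 * a1 * t ^+ 2) *: c0 + (3 * t + 3 * b1 * t ^+ 2) *: c1 + t ^+ 3 *: c3.
  rewrite -/(cub T _) cubD cubZ !stZ2 !stZ3 e2 /cub -E0 -E1 -E3; vring.
 have -> : T (e + t *: w) (e + t *: w) w = (2 * a1 * t) *: c0 + (1 + 2 * b1 * t) *: c1 + t ^+ 2 *: c3.
  rewrite !stD1 !stD2 !stZ1 !stZ2 (st12 T e w w) e2 -E0 -E1 -E3; vring.
 have -> : T (e + t *: w) w w = a1 *: c0 + b1 *: c1 + t *: c3.
  by rewrite stD1 stZ1 e2 -E0 -E1 -E3.
 rewrite det4_lin3 => /eqP; rewrite mulf_eq0 => /orP[/eqP z|/eqP z]; last by rewrite -E0 -E1 -E3.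
 by case/eqP: ht; rewrite -z; ring.
have bfw r : cub T (r *: e + w) != 0.
 have := bf w Dw r 1; rewrite oner_eq0 orbT scale1r ev_pol; last exact: bir_fh B.
 exact.
move=> e3; case: (rank2_line he ind (ex_intro _ a1 (ex_intro _ b1 e2)) e3) => [[r [z _]]|[r [s [_ [z _]]]]];
 by have := bfw r; rewrite z eqxx.
Qed.

End LinesBir.
End Lines.

(** * Families of cubics with a common quadratic factor *)

Section QuadricPencil.
Variable K : numClosedFieldType.
Notation V := ('rV[K]_4).

Lemma pfun_list (W : lmodType K) (I : eqType) (s : seq I) (P : I -> W -> Prop) :
 (forall i, exists t : W -> K, [/\ pfun t, exists w, t w != 0 & forall w, t w != 0 -> P i w]) ->
 exists t : W -> K, [/\ pfun t, exists w, t w != 0 & forall w, t w != 0 -> forall i, i \in s -> P i w].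
Proof.
move=> h; elim: s => [|i s [t [pt [w tw] ht]]].
 by exists (fun _ => 1); split; [apply: pfun_const|exists 0; rewrite oner_neq0|].
have [t' [pt' [w' tw'] ht']] := h i.
exists (fun w => t w * t' w); split; first exact: pfunM.
 by have [x [h1 h2]] := pfun_nonzero2 pt pt' tw tw'; exists x; rewrite mulf_neq0.
move=> x; rewrite mulf_eq0 negb_or => /andP[h1 h2] j; rewrite inE => /orP[/eqP->|]; first exact: ht'.
exact: ht.
Qed.

Lemma horner_rec_eq0 (s : seq K) : (forall t, horner_rec s t = 0) -> forall i, s`_i = 0.
Proof.
move=> hs i; have -> : s`_i = (Poly s)`_i by rewrite coef_Poly.
suff -> : Poly s = 0 by rewrite coef0.
by apply/eqP/negPn/negP => /poly_nonroot[t]; rewrite horner_Poly hs eqxx.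
Qed.

Lemma mpoly_prime_factor n (p q : {mpoly K[n]}) : q != 0 -> rprime p -> rdvd p q ->
 forall s u, u \is a GRing.unit -> q = u * \prod_(r <- s) r -> (forall r, r \in s -> rprime r) ->
 exists2 r, r \in s & rdvd p r.
Proof.
move=> q0 pp pq s u uu; have [p0 pu hp] := pp.
elim: s q q0 pq => [|r s IH] q q0 pq eq sp.
 by case/negP: pu; apply: rdvd_unit pq; rewrite eq big_nil mulr1.
have /hp[h|h] : rdvd p (r * (u * \prod_(r <- s) r)) by move: pq; rewrite eq big_cons mulrCA.
 by exists r; rewrite ?inE ?eqxx.
have [||r' rs pr] := IH _ _ h erefl; last by exists r'; rewrite // inE rs orbT.
 by apply: contraNneq q0 => z; rewrite eq big_cons mulrCA z mulr0.
by move=> r' rs; apply: sp; rewrite inE rs orbT.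
Qed.

Section PencilBir.
Variables (f g : 'I_4 -> {mpoly K[4]}) (h k : {mpoly K[4]}).
Hypothesis B : bir f g h k.
Notation T := (pol f).
Notation S := (pol g).

(** Compute g(f(g(y))) in two ways and cancel the nonzero vector g(y). *)
Lemma bir_h_comp y : cub S y != 0 -> pev h (cub S y) = pev k y ^+ 3.
Proof.
move=> y0; have := bir_cub B (cub S y); rewrite (bir_cub (bir_sym B)) cubZ => /eqP.
by rewrite -subr_eq0 -scalerBl scaler_eq0 (negPf y0) orbF subr_eq0 => /eqP.
Qed.

Lemma bir_h_comp_neq0 y : pev k y != 0 -> pev h (cub S y) != 0.
Proof. by move=> ky; rewrite bir_h_comp ?expf_neq0 ?(bir_cub_neq0 (bir_sym B)). Qed.

Lemma bir_dsurj x y : pev h x != 0 -> exists v, T x x v = y.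
Proof.
move=> hx; pose M : 'M[K]_4 := \matrix_(i, j) T x x (evec K i) 0 j.
have eM v : v *m M = T x x v.
 apply/rowP => j; rewrite mxE {2}[v]row_sum_delta.
 have -> : T x x (\sum_i v 0 i *: delta_mx 0 i) = \sum_i v 0 i *: T x x (evec K i).
  elim/big_rec2: _ => [|i a b _ <-]; first by rewrite st03.
  by rewrite stD3 stZ3.
 by rewrite summxE; apply: eq_bigr => i _; rewrite !mxE.
have uM : M \in unitmx.
 by rewrite -row_free_unit; apply: inj_row_free => v; rewrite eM; apply: (bir_dinj B hx).
by exists (y *m invmx M); rewrite -eM mulmxKV.
Qed.

Lemma pev_comb_cub a x : pev (comb f a) x = dot a (cub T x).
Proof. by rewrite pev_comb ev_pol //; apply: bir_fh B. Qed.

Lemma comb_line a x v : exists r : {poly K}, forall t, pev (comb f a) (x + t *: v) =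
 dot a (cub T x) + t * (3 * dot a (T x x v)) + t ^+ 2 * r.[t].
Proof.
exists ((3 * dot a (T x v v))%:P + dot a (cub T v) *: 'X) => t.
rewrite pev_comb_cub cubD cubZ !stZ2 !stZ3 !dotDr !dotZr !hornerE /=; ring.
Qed.

Lemma pev_line p x v : exists q : {poly K}, forall t, pev p (x + t *: v) = q.[t].
Proof. exact: (pfun_pev p (@pvec_id _ 4)). Qed.

Lemma double_factor_deriv a p r x v : comb f a = p * p * r -> pev p x = 0 -> dot a (T x x v) = 0.
Proof.
move=> e px; have [c hc] := comb_line a x v; have [q hq] := pev_line p x v; have [r' hr] := pev_line r x v.
have q00 : q`_0 = 0 by rewrite -horner_coef0 -hq scale0r addr0.
have [q' eq] : exists q', q = q' * 'X.
 have /factor_theorem[q' eq] : root q 0 by rewrite /root horner_coef0 q00.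
 by exists q'; rewrite eq polyC0 subr0.
have n3 : 3 != 0 :> K by rewrite pnatr_eq0.
apply: (mulfI n3); rewrite mulr0.
have E : q' * q' * r' * 'X^2 = (dot a (cub T x))%:P + (3 * dot a (T x x v)) *: 'X + 'X^2 * c.
 apply/eqP; rewrite -subr_eq0; apply/negPn/negP => /poly_nonroot[t].
 have := hc t; rewrite e !pevM hq hr => hh; have eqt : q.[t] = q'.[t] * t by rewrite eq hornerM hornerX.
 rewrite !(hornerXn, hornerE) /=; apply/negP; rewrite negbK subr_eq0; apply/eqP.
 transitivity (q.[t] * q.[t] * r'.[t]); first by rewrite eqt; ring.
 by rewrite hh; ring.
have := congr1 (fun u : {poly K} => u`_1) E.
by rewrite coefMXn /= !coefD coefC coefZ coefX coefXnM /= mulr1 add0r addr0.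
Qed.

Lemma simple_factor_deriv a b r x v : comb f a = lin b * r -> dot b x = 0 ->
 3 * dot a (T x x v) = dot b v * pev r x.
Proof.
move=> e bx; have [c hc] := comb_line a x v; have [r' hr] := pev_line r x v.
have E : (dot b v *: r') * 'X = (dot a (cub T x))%:P + (3 * dot a (T x x v)) *: 'X + 'X^2 * c.
 apply/eqP; rewrite -subr_eq0; apply/negPn/negP => /poly_nonroot[t].
 have := hc t; rewrite e !pevM hr pev_lin dotDr dotZr bx add0r => hh.
 rewrite !(hornerXn, hornerE) /=; apply/negP; rewrite negbK subr_eq0; apply/eqP.
 transitivity (t * dot b v * r'.[t]); first by ring.
 by rewrite hh; ring.
have := congr1 (fun u : {poly K} => u`_1) E.
rewrite coefMX /= !coefD coefC !coefZ coefX coefXnM /= mulr1 add0r addr0 => <-.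
by congr (_ * _); rewrite -horner_coef0 -hr scale0r addr0.
Qed.

(** Each cubic a(w).f vanishes only where [h] or one linear form [m] does. Its prime factors other
    than [m] divide [h], which has finitely many, so for general [w] they divide the cubics of all
    parameters and make up the fixed quadric [G]. The point x with nonzero derivative ensures that
    [m] occurs, and simply. *)
Lemma quadric_pencil (W : lmodType K) (a : W -> V) (c : W -> K) :
 pvec a -> pfun c -> (exists w, c w != 0) ->
 (forall w, c w != 0 -> exists m : V, [/\ m != 0,
   forall x, dot (a w) (cub T x) = 0 -> pev h x * dot m x = 0 &
   exists x v, [/\ dot (a w) (cub T x) = 0, pev h x != 0 & dot (a w) (T x x v) != 0]]) ->
 exists G, [/\ G \is 2.-homog, G != 0 &
  forall w, exists l, forall x, dot (a w) (cub T x) = pev G x * dot l x].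
Proof.
move=> pa pc [w0 cw0] hyp.
have [s [sp [u uu eh]]] := factorial_mpoly (bir_h0 B).
pose C w := comb f (a w).
have Ch w : C w \is 3.-homog by apply: comb_homog; apply: bir_fh B.
(* The second clause prepares for a repeated prime: if p^2 divides the cubic of a general parameter,
   all the cubics are singular along p = 0. *)
have [t1 [pt1 [x1 tx1] ht1]] : exists t : W -> K, [/\ pfun t, exists w, t w != 0 & forall w, t w != 0 ->
  forall p, p \in s -> (rprime p -> rdvd p (C w) -> forall w', rdvd p (C w')) /\
   ((exists r, C w = p * p * r) -> forall w' x v, pev p x = 0 -> dot (a w') (T x x v) = 0)].
 apply: (@pfun_list W _ s (fun p w => (rprime p -> rdvd p (C w) -> forall w', rdvd p (C w')) /\
   ((exists r, C w = p * p * r) -> forall w' x v, pev p x = 0 -> dot (a w') (T x x v) = 0))) => p.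
 have [t [pt [w tw] ht]] : exists t : W -> K, [/\ pfun t, exists w, t w != 0 & forall w, t w != 0 ->
   rprime p -> rdvd p (C w) -> forall w', rdvd p (C w')].
  have [hall|] := classic (forall w', rdvd p (C w')).
   by exists (fun _ => 1); split; [apply: pfun_const|exists 0; rewrite oner_neq0|].
  move=> /not_all_ex_not[w hw].
  have [pp|npp] := classic (rprime p); last first.
   by exists (fun _ => 1); split; [apply: pfun_const|exists 0; rewrite oner_neq0|].
  have [x [px cx]] : exists x, pev p x = 0 /\ pev (C w) x != 0.
   apply: NNPP => hn; apply: hw; apply: zero_set_divisor => // x px.
   apply/eqP/negPn/negP => cx; apply: hn; exists (\row_j x j).
   by rewrite /pev !(@meval_eq _ _ _ x) // => j; rewrite mxE.
  exists (fun w => dot (a w) (cub T x)); split.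
  - by polynomial.
  - by exists w; rewrite -pev_comb_cub.
  move=> w' cw' _ [r er]; case/eqP: cw'; rewrite -pev_comb_cub -/(C w') er pevM px mul0r //.
 have [t' [pt' [w' tw'] ht']] : exists t : W -> K, [/\ pfun t, exists w, t w != 0 & forall w, t w != 0 ->
   (exists r, C w = p * p * r) -> forall w' x v, pev p x = 0 -> dot (a w') (T x x v) = 0].
  have [hall|] := classic (forall w' x v, pev p x = 0 -> dot (a w') (T x x v) = 0).
   by exists (fun _ => 1); split; [apply: pfun_const|exists 0; rewrite oner_neq0|].
  move=> hn; have [w' [x [v [px dx]]]] : exists w' x v, pev p x = 0 /\ dot (a w') (T x x v) != 0.
   apply: NNPP => hn'; apply: hn => w' x v px; apply/eqP/negPn/negP => dx.
   by apply: hn'; exists w', x, v.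
  exists (fun w => dot (a w) (T x x v)); split.
  - by polynomial.
  - by exists w'.
  by move=> w1 dw [r er]; case/eqP: dw; apply: double_factor_deriv er px.
 exists (fun w => t w * t' w); split; first exact: pfunM.
  by have [x [h1 h2]] := pfun_nonzero2 pt pt' tw tw'; exists x; rewrite mulf_neq0.
 by move=> x; rewrite mulf_eq0 negb_or => /andP[h1 h2]; split; [apply: ht|apply: ht'].
have [w [cw tw]] := pfun_nonzero2 pc pt1 cw0 tx1.
have [m [m0 zm [x0 [v0 [ax0 hx0 dx0]]]]] := hyp w cw.
have {}ht1 := ht1 w tw.
have C0 : C w != 0.
 apply: contraNneq dx0 => z; apply/eqP; apply: (@double_factor_deriv _ 0 0 x0); first by rewrite -/(C w) z mulr0.
 by rewrite /pev meval0.
have dvd_hm p : rprime p -> rdvd p (C w) -> rdvd p h \/ rdvd p (lin m).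
 move=> pp [r er]; have [_ _ hp] := pp; apply: hp; apply: zero_set_divisor => // x px.
 pose y : V := \row_j x j.
 have py q : q.@[x] = pev q y by apply: meval_eq => j; rewrite mxE.
 rewrite py pevM pev_lin; apply: zm; rewrite -pev_comb_cub -/(C w) er pevM -py px mul0r //.
have [b [b0 [Q eQ] bx0]] : exists b, [/\ b != 0, rdvd (lin b) (C w) & dot b x0 = 0].
 have [s' [sp' [u' uu' eC]]] := factorial_mpoly C0.
 have [p ps px] : exists2 p, p \in s' & pev p x0 = 0.
  have : pev (C w) x0 == 0 by rewrite pev_comb_cub ax0.
  have [c1 c10 ec] := mpoly_unitE uu'.
  rewrite eC ec pevM pevC mulf_eq0 (negPf c10) /= /pev rmorph_prod /=.
  rewrite prodf_seq_eq0 => /hasP[p ps /eqP hp]; by exists p.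
 have pp := sp' p ps; have [p0 pu _] := pp.
 have pC : rdvd p (C w).
  by rewrite eC (big_rem p) //=; exists (u' * \prod_(y <- rem p s') y); rewrite mulrCA.
 case: (dvd_hm p pp pC) => [[r er]|pl].
  by case/eqP: hx0; rewrite er pevM px mul0r.
 have [c1 c10 ep] := rdvd_lin m0 pu pl.
 exists m; split=> //; last first.
  by move/eqP: px; rewrite ep pevZ pev_lin mulf_eq0 (negPf c10) => /eqP.
 by apply: rdvd_trans pC; exists c1%:MP; rewrite ep mulrC mul_mpolyC.
have l0 : lin b != 0 by rewrite lin_eq0.
have Q0 : Q != 0 by apply: contraNneq C0 => z; rewrite eQ z mulr0.
have Qh : Q \is 2.-homog.
 by apply: (homog_quot (e := 1) (lin_homog b) l0); rewrite -eQ.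
have Qx0 : pev Q x0 != 0.
 apply: contraNneq dx0 => z; have := simple_factor_deriv v0 eQ bx0.
 rewrite z mulr0 => /eqP; by rewrite mulf_eq0 pnatr_eq0.
have prQ p : rprime p -> rdvd p Q -> exists2 r, r \in s & rdvd p r /\ rdvd r p.
 move=> pp pQ; have pC : rdvd p (C w) by rewrite eQ; apply: rdvd_mull.
 have [p0 pu _] := pp.
 case: (dvd_hm p pp pC) => [ph|pl]; last first.
  have [c1 c10 ep] := rdvd_lin m0 pu pl.
  have mz : dot m x0 = 0.
   by move/eqP: (zm x0 ax0); rewrite mulf_eq0 (negPf hx0) => /eqP.
  by case: pQ Qx0 => r ->; rewrite pevM ep pevZ pev_lin mz mulr0 mul0r eqxx.
 have [r rs pr] := mpoly_prime_factor (bir_h0 B) pp ph uu eh sp.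
 by exists r => //; split=> //; apply: prime_rdvd_assoc => //; apply: sp.
have spread p : rprime p -> rdvd p Q -> forall w', rdvd p (C w').
 move=> pp pQ w'; have [r rs [pr rp]] := prQ p pp pQ.
 apply: rdvd_trans pr _; apply: (proj1 (ht1 r rs) (sp r rs)).
 by apply: rdvd_trans rp _; rewrite eQ; apply: rdvd_mull.
suff QC w' : rdvd Q (C w').
 exists Q; split=> // w'; have [L eL] := QC w'.
 have /homog1_lin[l el] : L \is 1.-homog by apply: (homog_quot (e := 2) Qh Q0); rewrite -eL.
 by exists l => x; rewrite -pev_comb_cub -/(C w') eL pevM el pev_lin.
have Qs := msize_homog Qh Q0.
have Qu : Q \isn't a GRing.unit.
 by apply: contraTN isT => /mpoly_unitE[d d0 ed]; move: Qs; rewrite ed msizeC d0.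
have [q1 q1p [R eR]] := exists_prime_divisor (@factorial_mpoly _ _) Q0 Qu.
have [q10 q1u hq1] := q1p.
have q1Q : rdvd q1 Q by exists R.
have [Ru|Ru] := boolP (R \is a GRing.unit).
 have [E eE] := spread q1 q1p q1Q w'; exists (R^-1 * E).
 by rewrite eE eR -!mulrA [R * _]mulrA mulrV // mul1r.
have R0 : R != 0 by apply: contraNneq Q0 => z; rewrite eR z mulr0.
have [q2 q2p [R2 eR2]] := exists_prime_divisor (@factorial_mpoly _ _) R0 Ru.
have [q20 q2u hq2] := q2p.
have q2Q : rdvd q2 Q by exists (q1 * R2); rewrite eR eR2 mulrCA.
have R20 : R2 != 0 by apply: contraNneq R0 => z; rewrite eR2 z mulr0.
have s1 := nonunit_msize q1u q10; have s2 := nonunit_msize q2u q20.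
have e1 := msizeM q10 R0; have e2 := msizeM q20 R20; rewrite -eR Qs in e1; rewrite -eR2 in e2.
have sR2 : (0 < msize R2)%N by rewrite lt0n msize_poly_eq0.
have [sq1 sR2'] : msize q1 = 2%N /\ msize R2 = 1%N.
 move: e1 e2 s1 s2 sR2; case: (msize q1) => [|[|a1]] //; case: (msize q2) => [|[|b1]] //; case: (msize R2) => [|c2] //.
 move=> e1 e2 _ _ _; rewrite e2 in e1; move: e1; rewrite !addSn !addnS /= => -[e1].
 by move/esym/eqP: e1; rewrite !addn_eq0 => /andP[/eqP-> /andP[_ /eqP->]].
have R2u : R2 \is a GRing.unit by apply: msize1_unit; rewrite ?sR2'.
suff [E eE] : rdvd (q1 * q2) (C w').
 exists (R2^-1 * E); rewrite eE eR eR2 -!mulrA; congr (_ * (_ * _)); by rewrite mulrA mulrV // mul1r.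
have [E eE] := spread q1 q1p q1Q w'.
suff [E' eE'] : rdvd q2 E by exists E'; rewrite eE eE' mulrA.
(* If the two prime factors of [Q] are associated, divisibility by their product comes from the
   derivative clause; otherwise from primality. *)
have [as12|nas] := classic (rdvd q2 q1); last first.
 have /hq2[//|//] : rdvd q2 (q1 * E) by rewrite -eE; apply: spread.
have [r rs [pr rp]] := prQ q1 q1p q1Q.
have q12 : rdvd q1 q2 by apply: prime_rdvd_assoc.
have [e he] : exists e, q1 \is e.-homog.
 by apply: (@homog_factor _ _ q1 R 2); rewrite -eR.
have e1' : e = 1%N by have := msize_homog he q10; rewrite sq1 => -[].
have /homog1_lin[b1 eb1] : q1 \is 1.-homog by rewrite e1' in he.
have b10 : b1 != 0 by rewrite -lin_eq0 -eb1.
have van : forall w' x v, pev r x = 0 -> dot (a w') (T x x v) = 0.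
 apply: (proj2 (ht1 r rs)); have [y1 ey1] := rp; have [y2 ey2] := q12.
 exists (lin b * y1 * y1 * y2 * R2); rewrite eQ eR eR2 ey2 {1 2}ey1; ring.
apply: (rdvd_trans as12); apply: zero_set_divisor => // x qx.
pose y : V := \row_j x j.
have py q : q.@[x] = pev q y by apply: meval_eq => j; rewrite mxE.
have ry : pev r y = 0 by have [z ->] := pr; rewrite pevM -py qx mul0r.
have by0 : dot b1 y = 0 by rewrite -pev_lin -eb1 -py.
have [v bv] := dot_neq0 b10.
have := simple_factor_deriv (a := a w') (r := E) v _ by0; rewrite van // mulr0 -eb1 => /(_ eE)/esym/eqP.
by rewrite py mulf_eq0 (negPf bv) => /eqP.
Qed.

End PencilBir.
End QuadricPencil.

(** * Maps sending every line to a plane curve *)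

Section PlanarLines.
Variable K : numClosedFieldType.
Notation V := ('rV[K]_4).

(* A conic through a base-point-free rational plane cubic vanishes; the cubic is written with an adapted frame at t = 0. *)
Lemma conic_on_cubic (e0 e1 e2 : K) (Q00 Q01 Q02 Q11 Q12 Q22 : K) :
 let a t := 1 + e0 * t ^+ 3 in let b t := 3 * t + e1 * t ^+ 3 in
 let c t := 3 * t ^+ 2 + e2 * t ^+ 3 in
 (forall t, t != 0 -> c t != 0 -> Q00 * a t ^+ 2 + 2 * Q01 * a t * b t + 2 * Q02 * a t * c t
   + Q11 * b t ^+ 2 + 2 * Q12 * b t * c t + Q22 * c t ^+ 2 = 0) ->
 ~ (3 * e1 + e2 ^+ 2 = 0 /\ 27 * e0 = e2 ^+ 3) ->
 [/\ Q00 = 0, Q01 = 0, Q02 = 0, Q11 = 0 & Q12 = 0 /\ Q22 = 0].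
Proof.
move=> a b c hQ ne.
have n2 : 2 != 0 :> K by rewrite pnatr_eq0.
have n3 : 3 != 0 :> K by rewrite pnatr_eq0.
have n9 : 9 != 0 :> K by rewrite pnatr_eq0.
have n27 : 27 != 0 :> K by rewrite pnatr_eq0.
pose s := [:: Q00; 6 * Q01; 6 * Q02 + 9 * Q11;
 2 * e0 * Q00 + 2 * e1 * Q01 + 2 * e2 * Q02 + 18 * Q12;
 6 * e0 * Q01 + 6 * e1 * Q11 + 6 * e2 * Q12 + 9 * Q22;
 6 * e0 * Q02 + 6 * e1 * Q12 + 6 * e2 * Q22;
 e0 ^+ 2 * Q00 + 2 * e0 * e1 * Q01 + 2 * e0 * e2 * Q02 + e1 ^+ 2 * Q11 + 2 * e1 * e2 * Q12 + e2 ^+ 2 * Q22].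
have es t : horner_rec s t = Q00 * a t ^+ 2 + 2 * Q01 * a t * b t + 2 * Q02 * a t * c t
   + Q11 * b t ^+ 2 + 2 * Q12 * b t * c t + Q22 * c t ^+ 2.
 rewrite /s /= /a /b /c; ring.
have z : Poly s = 0.
 apply/eqP/negPn/negP => s0; pose d : {poly K} := 3 *: 'X^2 + e2 *: 'X^3.
 have d0 : d * 'X != 0.
  rewrite mulf_neq0 ?polyX_eq0 //; apply/eqP => /(congr1 (fun q : {poly K} => q`_2))/eqP.
  by rewrite coefD !coefZ !coefXn coef0 /= mulr0 addr0 mulr1 (negPf n3).
 have [t] := poly_nonroot (mulf_neq0 s0 d0); rewrite !hornerM hornerX !mulf_eq0 !negb_or => /andP[h1 /andP[h2 h3]].
 by case/eqP: h1; rewrite horner_Poly es; apply: hQ => //; move: h2; rewrite /d !(hornerXn, hornerE) /= /c; apply: contraNneq => <-; apply/eqP; ring.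
have zi i : s`_i = 0 by have := congr1 (fun q : {poly K} => q`_i) z; rewrite coef_Poly coef0.
have Z0 : Q00 = 0 := zi 0%N.
have Z1 : Q01 = 0 by have /eqP := zi 1%N; rewrite /= mulf_eq0 pnatr_eq0 => /eqP.
have H11 : Q11 = - (2 / 3) * Q02.
 by have := zi 2%N; rewrite /= => e; apply: (mulfI n9); rewrite -[RHS]addr0 -e; field; rewrite ?n3.
have H12 : Q12 = - (e2 / 9) * Q02.
 have n18 : 18 != 0 :> K by rewrite pnatr_eq0.
 by have := zi 3%N; rewrite /= Z0 Z1 => e; apply: (mulfI n18); rewrite -[LHS]subr0 -e; field; rewrite ?n9.
have H22 : Q22 = (4 * e1 / 9 + 2 * e2 ^+ 2 / 27) * Q02.
 have := zi 4%N; rewrite /= Z1 H11 H12 => e; apply: (mulfI n9); rewrite -[LHS]subr0 -e; field.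
 by rewrite ?n3 ?n9 ?n27.
have Z02 : Q02 = 0.
 apply/eqP/negPn/negP => q.
 have E5 := zi 5%N; have E6 := zi 6%N; rewrite /= Z0 Z1 H11 H12 H22 in E5 E6.
 have F5 : e0 = - (e1 * e2 / 3 + 2 * e2 ^+ 3 / 27).
  have n6 : 6 != 0 :> K by rewrite pnatr_eq0.
  apply: (mulfI (mulf_neq0 n6 q)); rewrite -[LHS]subr0 -E5; field; by rewrite ?n9 ?n27 ?n3.
 have F6 : (e1 + e2 ^+ 2 / 3) ^+ 2 = 0.
  have n23 : - (2 / 3) != 0 :> K by rewrite oppr_eq0 mulf_neq0 ?invr_eq0.
  apply: (mulfI (mulf_neq0 n23 q)); rewrite mulr0 -E6 F5; field; by rewrite ?n9 ?n27 ?n3.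
 move/eqP: F6; rewrite expf_eq0 /= addr_eq0 => /eqP F6.
 by apply: ne; rewrite F5 F6; split; field; rewrite ?n3 ?n27.
by rewrite H11 H12 H22 Z02 !mulr0.
Qed.

Section PlanarBir.
Variables (f g : 'I_4 -> {mpoly K[4]}) (h k : {mpoly K[4]}).
Hypothesis B : bir f g h k.
Notation T := (pol f).
Notation S := (pol g).

(** For a plane m through <u, v> the cubic m.g contains the image curve of the line. One condition
    on m in this pencil makes m.g vanish on the whole plane a of that curve, and then a.f(x) = 0
    forces m.g(f(x)) = h(x) m(x) = 0. The excluded relations between [e0], [e1], [e2] say that the
    line contains a base point. *)
Lemma planar_line_residual u v : pev h u != 0 -> indep2 u v ->
 cross (T u u u) (T u u v) (T u v v) != 0 -> forall e0 e1 e2,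
 T v v v = e0 *: T u u u + e1 *: T u u v + e2 *: T u v v ->
 ~ (3 * e1 + e2 ^+ 2 = 0 /\ 27 * e0 = e2 ^+ 3) ->
 exists m : V, m != 0 /\ forall x, dot (cross (T u u u) (T u u v) (T u v v)) (cub T x) = 0 ->
  pev h x * dot m x = 0.
Proof.
move=> hu ind n0 e0 e1 e2 e3 nd.
name c0 E0 := (T u u u).
name c1 E1 := (T u u v).
name c2 E2 := (T u v v).
rewrite -E0 -E1 -E2 in n0 e3 *.
have Ct t : cub T (u + t *: v) = (1 + e0 * t ^+ 3) *: c0 + (3 * t + e1 * t ^+ 3) *: c1
  + (3 * t ^+ 2 + e2 * t ^+ 3) *: c2.
 by rewrite cubD cubZ !stZ2 !stZ3 /cub e3 -E0 -E1 -E2; vring.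
have [b [d hd]] := indep2_basis ind.
pose m1 := cross u v b; pose m2 := cross u v d.
have m1u : dot m1 u = 0 by rewrite dot_cross det4_14.
have m1v : dot m1 v = 0 by rewrite dot_cross det4_24.
have m2u : dot m2 u = 0 by rewrite dot_cross det4_14.
have m2v : dot m2 v = 0 by rewrite dot_cross det4_24.
(* [mF] kills the coefficient of r s^2; then on the line t = 0, the tangent of the image cubic at
   [c0], only s^3 survives. *)
have [m [m0 mu mv mF]] : exists m, [/\ m != 0, dot m u = 0, dot m v = 0 & dot m (S c0 c1 c1) = 0].
 have [z|nz] := eqVneq (dot m1 (S c0 c1 c1)) 0.
  exists m1; split=> //; apply: contraNneq hd => e; by rewrite -dot_cross -/m1 e dot0l.
 exists (dot m2 (S c0 c1 c1) *: m1 - dot m1 (S c0 c1 c1) *: m2); split.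
 - apply: contraNneq nz => /(congr1 (fun x => dot x b)).
  rewrite dotDl dotNl !dotZl dot0l /m1 /m2 !dot_cross det4_34 mulr0 sub0r (det4_swap34 u v b d) mulrN opprK => /eqP.
  by rewrite mulf_eq0 (negPf hd) orbF => /eqP; rewrite -dot_cross => ->.
 - by rewrite dotDl dotNl !dotZl m1u m2u !mulr0 subrr.
 - by rewrite dotDl dotNl !dotZl m1v m2v !mulr0 subrr.
 - by rewrite dotDl dotNl !dotZl mulrC subrr.
exists m; split=> // x xP.
pose F x y z := dot m (S x y z).
have F_curve t : F (cub T (u + t *: v)) (cub T (u + t *: v)) (cub T (u + t *: v)) = 0.
 by rewrite /F -/(cub S _) (bir_cub B) dotZr dotDr dotZr mu mv mulr0 addr0 mulr0.
have [a1 [_ [ch _]]] := bir_chain B u v.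
have F001 : F c0 c0 c1 = 0.
 have := congr1 (dot m) ch; rewrite dotDr !dotZr mu mv !mulr0 addr0 => /eqP.
 by rewrite mulf_eq0 pnatr_eq0 /= /cub -E0 -E1 => /eqP.
have F000 : F c0 c0 c0 = 0.
 by have := F_curve 0; rewrite scale0r addr0 /cub -E0.
have F011 : F c0 c1 c1 = 0 by [].
have FL r s t : F (r *: c0 + s *: c1 + t *: c2) (r *: c0 + s *: c1 + t *: c2) (r *: c0 + s *: c1 + t *: c2) =
 s ^+ 3 * F c1 c1 c1 + t * (3 * F c0 c0 c2 * r ^+ 2 + 6 * F c0 c1 c2 * r * s + 3 * F c1 c1 c2 * s ^+ 2
  + 3 * F c0 c2 c2 * r * t + 3 * F c1 c2 c2 * s * t + F c2 c2 c2 * t ^+ 2).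
 rewrite /F -/(cub S _) !cubD !cubZ !stD1 !stD2 !stZ1 !stZ2 !stZ3.
 rewrite (st12 S c0 c1 c2) /cub !dotDr !dotZr !dotDr !dotZr.
 rewrite -!/(F _ _ _) F000 F001 F011; ring.
have n3 : 3 != 0 :> K by rewrite pnatr_eq0.
(* The tangent line meets the image cubic once more, at the parameter -3/e2, or at [v] if [e2] is 0.
   By injectivity this point is not [c0], so its coordinate s is nonzero. *)
have F111 : F c1 c1 c1 = 0.
 have [z2|nz2] := eqVneq e2 0.
  have Fv : F (T v v v) (T v v v) (T v v v) = 0.
   by rewrite /F -/(cub T v) -/(cub S _) (bir_cub B) dotZr mv mulr0.
  move: Fv; rewrite e3 FL z2 mul0r addr0 => /eqP; rewrite mulf_eq0 => /orP[|/eqP//].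
  rewrite expf_eq0 /= => /eqP z1.
  have e00 : e0 != 0 by apply/eqP => z0; apply: nd; split; rewrite ?z0 ?z1 ?z2 !expr0n ?mulr0 ?addr0.
  have [|r er] := @bir_inj _ _ _ _ _ B u v e0^-1 hu.
   by rewrite /cub e3 z1 z2 !scale0r !addr0 scalerA mulVf // scale1r -E0.
  have [|/eqP] := ind 1 (- r); last by rewrite oner_eq0.
  by rewrite scale1r er scaleNr subrr.
 have := F_curve (- (3 / e2)); rewrite Ct FL.
 have -> : 3 * (- (3 / e2)) ^+ 2 + e2 * (- (3 / e2)) ^+ 3 = 0 by field.
 rewrite mul0r addr0 => /eqP; rewrite mulf_eq0 => /orP[|/eqP//].
 rewrite expf_eq0 /= => /eqP z1.
 have z2 : 3 * (- (3 / e2)) ^+ 2 + e2 * (- (3 / e2)) ^+ 3 = 0 by field.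
 have := Ct (- (3 / e2)); rewrite z1 z2 !scale0r !addr0 => ec.
 have e00 : 1 + e0 * (- (3 / e2)) ^+ 3 != 0.
  apply/eqP => z0; apply: nd; split.
   have t0 : - (3 / e2 ^+ 3) * 3 != 0.
    by rewrite mulf_neq0 // oppr_eq0 mulf_neq0 // invr_eq0 expf_neq0.
   by apply: (mulfI t0); rewrite mulr0 -z1; field.
  have t0 : - (e2 ^+ 3)^-1 != 0 by rewrite oppr_eq0 invr_eq0 expf_neq0.
  apply: (mulfI t0); apply: (addrI 1); transitivity (0 : K); last by field.
  by rewrite -z0; field.
 have [|r er] := @bir_inj _ _ _ _ _ B u (u + - (3 / e2) *: v) (1 + e0 * (- (3 / e2)) ^+ 3)^-1 hu.
  by rewrite ec scalerA mulVf // scale1r /cub -E0.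
 have [|r1 /eqP] := ind (1 - r) (- r * - (3 / e2)).
  have := er; rewrite scalerDr scalerA => /eqP; rewrite -subr_eq0 => /eqP <-.
  by vring.
 have -> : r = 1 by apply/eqP; rewrite eq_sym -subr_eq0; apply/eqP.
 by rewrite mulN1r opprK mulf_eq0 invr_eq0 (negPf n3) (negPf nz2).
have n2 : 2 != 0 :> K by rewrite pnatr_eq0.
have [||Q00 Q01 Q02 Q11 [Q12 Q22]] := @conic_on_cubic e0 e1 e2 (3 * F c0 c0 c2) (3 * F c0 c1 c2)
  (3 / 2 * F c0 c2 c2) (3 * F c1 c1 c2) (3 / 2 * F c1 c2 c2) (F c2 c2 c2).
- move=> t t0 ct; apply: (mulfI ct); rewrite mulr0 -(F_curve t) Ct FL F111; by field; rewrite ?n2.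
- exact: nd.
have Fx : F (cub T x) (cub T x) (cub T x) = 0.
 have [r [s [t ->]]] := plane_span n0 xP; rewrite FL F111.
 have q02 : 3 * F c0 c2 c2 = 0 by transitivity (2 * (3 / 2 * F c0 c2 c2)); [field|rewrite Q02 mulr0].
 have q12 : 3 * F c1 c2 c2 = 0 by transitivity (2 * (3 / 2 * F c1 c2 c2)); [field|rewrite Q12 mulr0].
 have q01 : 6 * F c0 c1 c2 = 0.
  by transitivity (2 * (3 * F c0 c1 c2)); [ring|rewrite Q01 mulr0].
 by rewrite Q00 q01 Q11 q02 q12 Q22; ring.
by move: Fx; rewrite /F -/(cub S _) (bir_cub B) dotZr.
Qed.

(** Followed by the projection from the point a1 = a2 = a3 = 0, the map is linear up to the quadric
    [G]. *)
Definition jonq_form (f : 'I_4 -> {mpoly K[4]}) := exists (G : {mpoly K[4]}) (a1 a2 a3 l1 l2 l3 : V),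
 [/\ G \is 2.-homog, cross a1 a2 a3 != 0 & forall x,
   [/\ dot a1 (cub (pol f) x) = pev G x * dot l1 x, dot a2 (cub (pol f) x) = pev G x * dot l2 x
    & dot a3 (cub (pol f) x) = pev G x * dot l3 x]].

(** Otherwise every osculating plane would contain y1 and y2 besides [T u u u] and [T u u v], and
    these four vectors are independent for general u, v. *)
Lemma osculating_span y1 y2 : indep2 y1 y2 -> exists u v,
 let a := cross (T u u u) (T u u v) (T u v v) in (dot a y1 != 0) \/ (dot a y2 != 0).
Proof.
move=> ind; apply: NNPP => nh.
have h0 u v : dot (cross (T u u u) (T u u v) (T u v v)) y1 = 0 /\ dot (cross (T u u u) (T u u v) (T u v v)) y2 = 0.
 by split; apply/eqP/negPn/negP => hn; apply: nh; exists u, v; [left|right].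
have [u0 [v0 /dot_neq0[z0 hz0]]] := osculating_plane_ex B.
have [b [c hbc]] := indep2_basis ind.
have pid1 : pvec (fun w : V * V => w.1) by polynomial.
have pid2 : pvec (fun w : V * V => w.2) by polynomial.
have p1 : pfun (fun w : V * V => dot (cross (T w.1 w.1 w.1) (T w.1 w.1 w.2) (T w.1 w.2 w.2)) z0).
 by apply: pfun_dot; [apply: pvec_cross; apply: pvec_st|apply: pvec_const].
have p2 : pfun (fun w : V * V => det4 y1 y2 (T w.1 w.1 w.1) (T w.1 w.1 w.2)).
 by apply: pfun_det4; [apply: pvec_const|apply: pvec_const|apply: pvec_st|apply: pvec_st].
have [z [kz dz]] : exists z, pev k z != 0 /\ det4 y1 y2 z c != 0.
 have [zk hzk] := bir_h_ex (bir_sym B).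
 apply: (@pfun_nonzero2 _ _ (pev k) (fun z => det4 y1 y2 z c) zk b) => //; first by polynomial.
 by polynomial.
have [v1 hv1] := bir_dsurj B c (bir_h_comp_neq0 B kz).
have hz1 : det4 y1 y2 (T (cub S z) (cub S z) (cub S z)) (T (cub S z) (cub S z) v1) != 0.
 by rewrite hv1 -/(cub T _) (bir_cub (bir_sym B)) det4Z3 mulf_neq0.
have [[u v] /= [hu hv]] := @pfun_nonzero2 _ _ _ _ (u0, v0) (cub S z, v1) p1 p2 hz0 hz1.
case/eqP: hu; have [h1 h2] := h0 u v.
have := cramer4 y1 y2 (T u u u) (T u u v) z0; move/(congr1 (dot (cross (T u u u) (T u u v) (T u v v)))).
rewrite !dotDr !dotZr h1 h2 !(dot_cross _ _ _ (T u u u)) !(dot_cross _ _ _ (T u u v)) det4_14 det4_24 !mulr0 !addr0.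
by move/eqP; rewrite mulf_eq0 (negPf hv) => /eqP.
Qed.

(** [planar_line_residual] applies to a general line and [quadric_pencil] to the resulting family of
    planes; [osculating_span] extracts three independent planes from that family. *)
Lemma jonq_formP : (forall u v, det4 (T u u u) (T u u v) (T u v v) (T v v v) = 0) -> jonq_form f.
Proof.
move=> dz.
have pid2 : pvec (fun w : V * V => w.2) by polynomial.
pose a (w : V * V) := cross (T w.1 w.1 w.1) (T w.1 w.1 w.2) (T w.1 w.2 w.2).
have pa : pvec a by polynomial.
have [e he] := bir_h_ex B; have e0 := bir_h_neq0 B he.
have [u0 [v0 /dot_neq0[z0 hz0]]] := osculating_plane_ex B.
have pz0 : pfun (fun w => dot (a w) z0) by polynomial.
have ph : pfun (fun w : V * V => pev h w.1) by polynomial.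
have [[u1 v0'] /= [hu1 hz1]] := @pfun_nonzero2 _ _ _ _ (e, e) (u0, v0) ph pz0 he hz0.
have u10 := bir_h_neq0 B hu1.
have fu1 : ev f u1 != 0 by rewrite ev_pol; [apply: (bir_cub_neq0 B)|apply: bir_fh B].
have [D [pD [x0 Dx0] _ bf]] := base_free_line (bir_fh B) (bir_fc B) (bir_f0 B) u10 fu1.
have pz1 : pfun (fun v => dot (a (u1, v)) z0).
 by apply: pfun_dot; [apply: pvec_cross; apply: pvec_st; (apply: pvec_const || apply: pvec_id)|apply: pvec_const].
have [v1 [Dv1 {}hz1]] := pfun_nonzero2 pD pz1 Dx0 hz1.
pose C0 (w : V * V) := T w.1 w.1 w.1; pose C1 (w : V * V) := T w.1 w.1 w.2.
pose C2 (w : V * V) := T w.1 w.2 w.2; pose C3 (w : V * V) := T w.2 w.2 w.2.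
pose N w := det4 (C0 w) (C1 w) (C2 w) z0.
pose E0 w := det4 (C3 w) (C1 w) (C2 w) z0; pose E1 w := det4 (C0 w) (C3 w) (C2 w) z0.
pose E2 w := det4 (C0 w) (C1 w) (C3 w) z0.
have pC0 : pvec C0 by polynomial. have pC1 : pvec C1 by polynomial.
have pC3 : pvec C3 by apply: pvec_st.
have pcz : pvec (fun w : V * V => z0) by polynomial.
have pN : pfun N by polynomial.
have pE0 : pfun E0 by polynomial. have pE1 : pfun E1 by polynomial.
have pE2 : pfun E2 by apply: pfun_det4.
have aN w : dot (a w) z0 = N w by rewrite dot_cross.
have eC3 w : N w != 0 -> C3 w = (E0 w / N w) *: C0 w + (E1 w / N w) *: C1 w + (E2 w / N w) *: C2 w.
 move=> nw; have := cramer4 (C0 w) (C1 w) (C2 w) z0 (C3 w); rewrite (dz w.1 w.2) scale0r addr0 => ec.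
 by rewrite -[C3 w in LHS](scalerK nw) ec !scalerDr !scalerA ![_^-1 * _]mulrC.
(* Numerators of the two relations that characterize a base point on the line; a line off the base
   locus makes one of them nonzero. *)
pose X1 w := 3 * N w * E1 w + E2 w ^+ 2; pose X2 w := 27 * N w ^+ 2 * E0 w - E2 w ^+ 3.
have pX1 : pfun X1.
 by apply: pfunD; [apply: pfunM => //; apply: pfunM => //; apply: pfun_const|apply: pfunX].
have pX2 : pfun X2.
 apply: pfunB; last exact: pfunX.
 by apply: pfunM => //; apply: pfunM; [apply: pfun_const|apply: pfunX].
have good w : pev h w.1 != 0 -> N w != 0 -> (X1 w != 0) || (X2 w != 0) -> exists m : V, [/\ m != 0,
   forall x, dot (a w) (cub T x) = 0 -> pev h x * dot m x = 0 &
   exists x v, [/\ dot (a w) (cub T x) = 0, pev h x != 0 & dot (a w) (T x x v) != 0]].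
 case: w => u v hu nw xw; rewrite /= in hu.
 have a0 : a (u, v) != 0 by apply: contraNneq nw => z; rewrite -aN z dot0l.
 have [||m [m0 hm]] := @planar_line_residual u v hu _ a0 _ _ _ (eC3 (u, v) nw).
 - move=> s t z; apply: (det4_indep2 nw); rewrite /C0 /C1 /= -!stZ3 -stD3 z st03 //.
 - move=> [h1 h2]; move: xw; rewrite /X1 /X2.
  have -> : 3 * N (u, v) * E1 (u, v) + E2 (u, v) ^+ 2 =
    N (u, v) ^+ 2 * (3 * (E1 (u, v) / N (u, v)) + (E2 (u, v) / N (u, v)) ^+ 2) by field.
  have -> : 27 * N (u, v) ^+ 2 * E0 (u, v) - E2 (u, v) ^+ 3 =
    N (u, v) ^+ 3 * (27 * (E0 (u, v) / N (u, v)) - (E2 (u, v) / N (u, v)) ^+ 3) by field.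
  by rewrite h1 h2 subrr !mulr0 eqxx.
 exists m; split=> //.
 have [z hz] := dot_neq0 a0; have [v' hv'] := bir_dsurj B z hu.
 by exists u, v'; rewrite hv'; split=> //; rewrite dot_cross det4_14.
have n3 : 3 != 0 :> K by rewrite pnatr_eq0.
have n27 : 27 != 0 :> K by rewrite pnatr_eq0.
have nw1 : N (u1, v1) != 0 by rewrite -aN.
have xx : (X1 (u1, v1) != 0) || (X2 (u1, v1) != 0).
 apply/negPn/negP; rewrite negb_or !negbK => /andP[/eqP x1 /eqP x2].
 have := eC3 _ nw1; move: nw1 x1 x2; rewrite /X1 /X2.
 move: (N _) (E0 _) (E1 _) (E2 _) => n e1 e2 e3 n0 x1 x2; rewrite /C3 /C0 /C1 /C2 /= => ec.
 have F2 : e2 = - (e3 ^+ 2 / (3 * n)).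
  by apply: (mulfI (mulf_neq0 n3 n0)); rewrite -[RHS]addr0 -x1; field; rewrite ?n3 ?n0.
 have F1 : e1 = e3 ^+ 3 / (27 * n ^+ 2).
  apply: (mulfI (mulf_neq0 n27 (expf_neq0 2 n0))); rewrite -[LHS]subr0 -x2; field; by rewrite ?n27 ?n0.
 have [z|nz] := eqVneq e3 0.
  have := bf v1 Dv1 0 1; rewrite oner_eq0 orbT scale0r add0r scale1r (ev_pol _ (bir_fh B)) => /(_ isT)/eqP; apply.
  by rewrite /cub ec F1 F2 z !expr0n /= !mul0r oppr0 !mul0r !scale0r !addr0.
 have := bf v1 Dv1 1 (- (3 * n / e3)); rewrite oner_eq0 scale1r (ev_pol _ (bir_fh B)) => /(_ isT)/eqP; apply.
 rewrite cubD cubZ !stZ2 !stZ3 /cub ec F1 F2; apply/rowP => i; rewrite !mxE; field.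
 by rewrite ?n3 ?n27 ?n0 ?nz.
have [c [pc [w cw] hc]] : exists c : V * V -> K, [/\ pfun c, exists w, c w != 0 & forall w, c w != 0 ->
  exists m : V, [/\ m != 0,
   forall x, dot (a w) (cub T x) = 0 -> pev h x * dot m x = 0 &
   exists x v, [/\ dot (a w) (cub T x) = 0, pev h x != 0 & dot (a w) (T x x v) != 0]]].
 have [X [pX Xw hX]] : exists X, [/\ pfun X, X (u1, v1) != 0 & forall w, X w != 0 -> (X1 w != 0) || (X2 w != 0)].
  by case/orP: xx => xx; [exists X1|exists X2]; split=> // w ->; rewrite ?orbT.
 exists (fun w => pev h w.1 * N w * X w); split.
 - by polynomial.
 - by exists (u1, v1); rewrite !mulf_neq0.
 move=> w; rewrite !mulf_eq0 !negb_or => /andP[/andP[h1 h2] h3]; apply: good => //; exact: hX.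
have [G [Gh G0 hG]] := quadric_pencil B pa pc (ex_intro _ w cw) hc.
have span y1 y2 : indep2 y1 y2 -> exists a l, (forall x, dot a (cub T x) = pev G x * dot l x) /\
  (dot a y1 != 0 \/ dot a y2 != 0).
 move=> /osculating_span[u [v hy]]; have [l hl] := hG (u, v).
 by exists (a (u, v)), l.
(* Supplies two independent vectors orthogonal to the covectors already chosen; a covector not
   orthogonal to both of them is a new direction. *)
have ic (b' c' d e' : V) : det4 b' c' d e' != 0 -> indep2 (cross b' c' d) (cross b' c' e').
 move=> hd s t /(congr1 (fun z => (dot z e', dot z d))); rewrite !dotDl !dotZl !dot0l !dot_cross det4_34.
 rewrite det4_34 !mulr0 addr0 add0r => -[/eqP + /eqP]; rewrite !mulf_eq0 (negPf hd) orbF => /eqP-> /orP[/eqP->//|].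
 by rewrite det4_swap34 oppr_eq0 (negPf hd).
have a10 : a (u1, v1) != 0 by apply: contraNneq nw1 => z; rewrite -aN z dot0l.
have [l1 hl1] := hG (u1, v1); move: (a (u1, v1)) a10 hl1 => a1 a10 hl1.
have [b [c1 [d hd]]] := basis1 a10.
have [a2 [l2 [hl2 h2]]] := span _ _ (ic _ _ _ _ hd).
have ind12 : indep2 a1 a2.
 move=> s t z; have t0 : t = 0.
  have e1 := congr1 (fun x => dot x (cross a1 b c1)) z; have e2 := congr1 (fun x => dot x (cross a1 b d)) z.
  move: e1 e2; rewrite !dotDl !dotZl !dot0l ![dot a1 _]dotC !dot_cross !det4_14 !mulr0 !add0r => /eqP e1 /eqP e2.
  by move: e1 e2 h2; rewrite !mulf_eq0; case: (t =P 0) => //= _ /eqP-> /eqP->; rewrite !eqxx => -[].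
 split=> //; move/eqP: z; rewrite t0 scale0r addr0 scaler_eq0 (negPf a10) orbF => /eqP//.
have [b' [c' hd']] := indep2_basis ind12.
have [a3 [l3 [hl3 h3]]] := span _ _ (ic _ _ _ _ hd').
exists G, a1, a2, a3, l1, l2, l3; split=> //.
apply/eqP => /(indep2_cross ind12)[s [t z]]; move: h3.
by rewrite z !dotDl !dotZl ![dot _ (cross _ _ _)]dotC !dot_cross !det4_14 !det4_24 !mulr0 !addr0 eqxx => -[].
Qed.

End PlanarBir.
End PlanarLines.

(** * De Jonquieres forms as limits of determinantal maps *)

Section JonquieresLimit.
Variable K : numClosedFieldType.
Notation V := ('rV[K]_4).

Lemma linear_matrix (C : V -> V) : (forall x y, C (x + y) = C x + C y) ->
 (forall r x, C (r *: x) = r *: C x) -> exists N : 'M[K]_4, forall x, C x = x *m N.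
Proof.
move=> CD CZ; exists (\matrix_(i, j) C (evec K i) 0 j) => x.
have C0 : C 0 = 0 by rewrite -{1}(scale0r (0 : V)) CZ scale0r.
have -> : C x = \sum_i x 0 i *: C (evec K i).
 rewrite {1}[x]row_sum_delta; elim/big_rec2: _ => [|i a b _ <-]; first by rewrite C0.
 by rewrite CD CZ.
by apply/rowP => j; rewrite summxE mxE; apply: eq_bigr => i _; rewrite !mxE.
Qed.

Lemma basis_dot_ext (l1 l2 l3 l4 u w : V) : det4 l1 l2 l3 l4 != 0 ->
 dot l1 u = dot l1 w -> dot l2 u = dot l2 w -> dot l3 u = dot l3 w -> dot l4 u = dot l4 w -> u = w.
Proof.
move=> hd h1 h2 h3 h4; apply: dot_ext => z; apply: (mulfI hd).
by rewrite ![dot _ z]dotC -!dotZl (cramer4 l1 l2 l3 l4 z) !dotDl !dotZl h1 h2 h3 h4.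
Qed.

Lemma dual_basis (a1 a2 a3 a4 : V) : det4 a1 a2 a3 a4 != 0 -> exists b1 b2 b3 b4 : V, dot a1 b1 = 1 /\
 forall x, x = dot a1 x *: b1 + dot a2 x *: b2 + dot a3 x *: b3 + dot a4 x *: b4.
Proof.
move=> hd; pose d := (det4 a1 a2 a3 a4)^-1.
exists (- d *: cross a2 a3 a4), (d *: cross a1 a3 a4), (- d *: cross a1 a2 a4), (d *: cross a1 a2 a3); split=> [|x].
 rewrite dotC dotZl dot_cross (det4_swap34 a2 a3 a1 a4) (det4_swap23 a2 a1 a3 a4) (det4_swap12 a1 a2 a3 a4) /d; field; exact: hd.
apply: (basis_dot_ext hd); rewrite !dotDr !dotZr ![dot _ (cross _ _ _)]dotC !dot_cross;
 rewrite !(det4_14, det4_24, det4_34) !mulr0 ?addr0 ?add0r.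
- rewrite (det4_swap34 a2 a3 a1 a4) (det4_swap23 a2 a1 a3 a4) (det4_swap12 a1 a2 a3 a4) /d; field; exact: hd.
- rewrite (det4_swap34 a1 a3 a2 a4) (det4_swap23 a1 a2 a3 a4) /d; field; exact: hd.
- rewrite (det4_swap34 a1 a2 a3 a4) /d; field; exact: hd.
- rewrite /d; field; exact: hd.
Qed.

Lemma homog2_bilinear (p : {mpoly K[4]}) : p \is 2.-homog -> exists A : 'M[K]_4,
 (forall x y, dot (x *m A) y = dot (y *m A) x) /\ forall x, pev p x = dot (x *m A) x.
Proof.
move=> hp; pose t a b := ((p^`M(a)^`M(b))@_0 / 2 : K).
have tC a b : t a b = t b a by rewrite /t mderiv_comm.
have E x y : dot (x *m \matrix_(a, b) t a b) y = \sum_a \sum_b x 0 a * y 0 b * t a b.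
 rewrite dotE -(sum4 (fun b => (x *m \matrix_(a, b) t a b) 0 b * y 0 b)) exchange_big.
 apply: eq_bigr => b _; rewrite mxE mulr_suml; apply: eq_bigr => a _; rewrite mxE; ring.
exists (\matrix_(a, b) t a b); split=> [x y|x].
 by rewrite !E exchange_big; apply: eq_bigr => a _; apply: eq_bigr => b _; rewrite tC; ring.
rewrite E; have n2 : 2 != 0 :> K by rewrite pnatr_eq0.
apply: (mulfI n2); rewrite /pev -(euler_homog (fun j => x 0 j) hp) mulr_sumr; apply: eq_bigr => a _.
rewrite -[(_).@[_]]mul1r -(euler_homog (fun j => x 0 j) (mderiv_homog a hp)) !mulr_sumr; apply: eq_bigr => b _.
rewrite homog0_meval; last by do 2!apply: mderiv_homog.
by rewrite /t; field.
Qed.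

(** The rows U form the skew matrix of the cross product with x, whose maximal minors vanish
    identically. The first-order variation of the minors along W has the de Jonquieres shape: one
    form m times x1, x2, x3, and an arbitrary quadratic expression as fourth component. *)
Lemma skew_expansion (l1 l2 l3 l4 : V) (x1 x2 x3 n11 n12 n13 n21 n22 n23 n31 n32 n33 m1 m2 m3 : K) :
 let U1 := x3 *: l2 - x2 *: l3 in let U2 := x1 *: l3 - x3 *: l1 in let U3 := x2 *: l1 - x1 *: l2 in
 let W1 := n11 *: l1 + n21 *: l2 + n31 *: l3 + m1 *: l4 in
 let W2 := n12 *: l1 + n22 *: l2 + n32 *: l3 + m2 *: l4 in
 let W3 := n13 *: l1 + n23 *: l2 + n33 *: l3 + m3 *: l4 in
 let S l := det4 W1 U2 U3 l + det4 U1 W2 U3 l + det4 U1 U2 W3 l in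
 let D := det4 l1 l2 l3 l4 in let m := m1 * x1 + m2 * x2 + m3 * x3 in
 [/\ S l1 = - m * x1 * D, S l2 = - m * x2 * D, S l3 = - m * x3 * D &
  S l4 = (n11 * x1 * x1 + n12 * x1 * x2 + n13 * x1 * x3 + n21 * x2 * x1 + n22 * x2 * x2 + n23 * x2 * x3
    + n31 * x3 * x1 + n32 * x3 * x2 + n33 * x3 * x3) * D].
Proof. by move=> U1 U2 U3 W1 W2 W3 S D m; split; rewrite /S /D /m /U1 /U2 /U3 /W1 /W2 /W3 !det4E /minor2 !mxE; ring. Qed.

Lemma skew_det0 (l1 l2 l3 : V) (x1 x2 x3 : K) :
 cross (x3 *: l2 - x2 *: l3) (x1 *: l3 - x3 *: l1) (x2 *: l1 - x1 *: l2) = 0.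
Proof. by apply: dot_ext => y; rewrite dot_cross dot0l !det4E /minor2 !mxE; ring. Qed.

(** A first-order condition: the minors of U + e W are e c f up to terms of order e^2. *)
Definition det_limit (f : 'I_4 -> {mpoly K[4]}) := exists (U1 U2 U3 W1 W2 W3 : 'M[K]_4) (c : K),
 [/\ c != 0, forall x, cross (x *m U1) (x *m U2) (x *m U3) = 0 & forall x,
  cross (x *m W1) (x *m U2) (x *m U3) + cross (x *m U1) (x *m W2) (x *m U3)
   + cross (x *m U1) (x *m U2) (x *m W3) = c *: cub (pol f) x].

Section JonqBir.
Variables (f g : 'I_4 -> {mpoly K[4]}) (h k : {mpoly K[4]}).
Hypothesis B : bir f g h k.
Notation T := (pol f).
Notation S := (pol g).

(** From h a_i = G(f) l_i(f), the forms l_i(f) are proportional to the linear forms a_i; these are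
    coprime, so the common ratio is a quadric [Q]. *)
Lemma jonq_inverse : jonq_form g -> exists (Q : {mpoly K[4]}) (a1 a2 a3 l1 l2 l3 : V),
 [/\ Q \is 2.-homog, cross a1 a2 a3 != 0, cross l1 l2 l3 != 0 & forall x,
   [/\ dot l1 (cub T x) = dot a1 x * pev Q x, dot l2 (cub T x) = dot a2 x * pev Q x
    & dot l3 (cub T x) = dot a3 x * pev Q x]].
Proof.
move=> [G [a1 [a2 [a3 [l1 [l2 [l3 [Gh na hG]]]]]]]].
pose a (i : 'I_3) := if val i is 0%N then a1 else if val i is 1%N then a2 else a3.
pose l (i : 'I_3) := if val i is 0%N then l1 else if val i is 1%N then l2 else l3.
have hGi i y : dot (a i) (cub S y) = pev G y * dot (l i) y.
 by have [h1 h2 h3] := hG y; rewrite /a /l; case: (val i) => [|[|]].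
have [d hd] := cross_basis na.
have ind : indep2 a1 a2 := det4_indep2 hd.
have key i x : pev h x * dot (a i) x = pev G (cub T x) * dot (l i) (cub T x).
 by rewrite -hGi (bir_cub B) dotZr.
have [x0 hx0] := bir_h_ex B.
have a10 : a1 != 0.
 by apply: contraNneq hd => ->; rewrite det4_01.
have [x1 hx1] := dot_neq0 a10.
have pid := @pvec_id K 4.
have ph : pfun (pev h) by polynomial.
have pG : pfun (fun x => pev G (cub T x)) by polynomial.
have pa i : pfun (fun x => dot (a i) x) by polynomial.
have pl i : pfun (fun x => dot (l i) (cub T x)) by polynomial.
have G0 : exists x, pev G (cub T x) != 0.
 have [x [hx1' hx2]] := pfun_nonzero2 ph (pa ord0) hx0 hx1.
 exists x; apply: contraTneq isT => z; have /eqP := key ord0 x; rewrite z mul0r mulf_eq0 (negPf hx1').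
 by rewrite (negPf hx2).
have cr i j x : dot (l i) (cub T x) * dot (a j) x = dot (l j) (cub T x) * dot (a i) x.
 apply/eqP; rewrite -subr_eq0; apply/eqP; move: x.
 apply: (pfun_dense _ pG G0) => [|x gx]; first by polynomial.
 have [hx|hx] := eqVneq (pev h x) 0.
  have z i' : dot (l i') (cub T x) = 0.
   by have /esym/eqP := key i' x; rewrite hx mul0r mulf_eq0 (negPf gx) => /eqP.
  by rewrite !z !mul0r subrr.
 apply: (mulfI (mulf_neq0 hx gx)); rewrite mulr0 mulrBr.
 have -> : pev h x * pev G (cub T x) * (dot (l i) (cub T x) * dot (a j) x) =
  (pev G (cub T x) * dot (l i) (cub T x)) * (pev h x * dot (a j) x) by ring.
 have -> : pev h x * pev G (cub T x) * (dot (l j) (cub T x) * dot (a i) x) =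
  (pev G (cub T x) * dot (l j) (cub T x)) * (pev h x * dot (a i) x) by ring.
 by rewrite -!key; ring.
have [|||Q hQ] := @mpoly_cross_ratio K 3 4 (fun i => lin (a i)) (fun i => comb f (l i)).
- exact: (@coprime_lin _ _ a (@Ordinal 3 0 isT) (@Ordinal 3 1 isT)).
- by exists ord0; rewrite lin_eq0.
- move=> i j; apply: pev_inj => x; rewrite !pevM !pev_lin !(pev_comb_cub B) mulrC cr mulrC //.
have hQe i x : dot (l i) (cub T x) = dot (a i) x * pev Q x.
 by rewrite -(pev_comb_cub B) hQ pevM pev_lin.
have Qh : Q \is 2.-homog.
 apply: (homog_quot (e := 1) (lin_homog (a ord0))); first by rewrite lin_eq0.
 by rewrite -hQ; apply: comb_homog; apply: bir_fh B.
have Q0 : exists x, pev Q x != 0.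
 have [x [hx1' hx2]] := pfun_nonzero2 ph (pa ord0) hx0 hx1.
 exists x; apply: contraTneq isT => z; have /eqP := key ord0 x; rewrite hQe z !mulr0 mulf_eq0 (negPf hx1').
 by rewrite (negPf hx2).
exists Q, a1, a2, a3, l1, l2, l3; split=> //; last first.
 by move=> x; split; [apply: (hQe (@Ordinal 3 0 isT))|apply: (hQe (@Ordinal 3 1 isT))|apply: (hQe (@Ordinal 3 2 isT))].
have pQ : pfun (pev Q) by polynomial.
have rel r s t : r *: l1 + s *: l2 + t *: l3 = 0 -> r *: a1 + s *: a2 + t *: a3 = 0.
 move=> z; apply: dot_ext => x; rewrite dot0l; move: x.
 apply: (pfun_dense _ pQ Q0) => [|x qx].
  by polynomial.
 apply: (mulIf qx); rewrite mul0r -[RHS](dot0l (cub T x)) -z !dotDl !dotZl.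
 rewrite (hQe (@Ordinal 3 0 isT)) (hQe (@Ordinal 3 1 isT)) (hQe (@Ordinal 3 2 isT)) /a /=; ring.
have indl : indep2 l1 l2.
 move=> r s z; apply: ind; have := rel r s 0; rewrite !scale0r !addr0; exact.
apply: contraNneq na => /(indep2_cross indl)[r [s z]].
have := rel r s (-1); rewrite z scaleN1r subrr scaleN1r => /(_ erefl)/eqP; rewrite subr_eq0 => /eqP <-.
apply/eqP; apply: dot_ext => y; rewrite dot_cross dot0l det4D3 !det4Z3 det4_13 det4_23; ring.
Qed.

(** Lines through the centre go to lines, since three target coordinates keep constant ratios on
    them. By [rank2_line] such a line carries two base points counted with multiplicity, and a
    general one has none outside the centre. *)
Lemma jonq_center_double (Q : {mpoly K[4]}) (a1 a2 a3 l1 l2 l3 : V) : Q \is 2.-homog ->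
 cross a1 a2 a3 != 0 -> cross l1 l2 l3 != 0 -> (forall x,
   [/\ dot l1 (cub T x) = dot a1 x * pev Q x, dot l2 (cub T x) = dot a2 x * pev Q x
    & dot l3 (cub T x) = dot a3 x * pev Q x]) ->
 forall x, T (cross a1 a2 a3) (cross a1 a2 a3) x = 0.
Proof.
move=> Qh na nl hQ; set e := cross a1 a2 a3.
have ae1 : dot a1 e = 0 by rewrite dotC dot_cross det4_14.
have ae2 : dot a2 e = 0 by rewrite dotC dot_cross det4_24.
have ae3 : dot a3 e = 0 by rewrite dotC dot_cross det4_34.
have [A [As hA]] := homog2_bilinear Qh.
have [D [pD [x0 Dx0] De Df]] := elim_center (bir_fc B) (bir_f0 B) na.
have [o hpo] := bir_h_ex B.
have [b [c [d hd]]] := basis1 na.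
have pid := @pvec_id K 4.
have pT : pvec (fun x => T e e x) by polynomial.
have [w [hw Dw]] : exists w, pev h w * det4 e w c d != 0 /\ D w != 0.
 have p1 : pfun (fun w => det4 e w c d) by polynomial.
 have [w1 [h1 h2]] := pfun_nonzero2 (pfun_pev h pid) p1 hpo hd.
 by apply: (pfun_nonzero2 _ pD (u := w1) (v := x0)) => //; [apply: pfunM => //; apply: pfun_pev|rewrite mulf_neq0].
move=> x; apply/rowP => i; rewrite mxE; move: x.
apply: (@pfun_dense _ _ _ (fun w => pev h w * det4 e w c d * D w)).
- exact: pT.
- apply: pfunM => //; apply: pfunM; first exact: pfun_pev.
 by polynomial.
- by exists w; rewrite mulf_neq0.
move=> {w hw Dw o hpo} o; rewrite !mulf_eq0 !negb_or => /andP[/andP[ho hdo] Do].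
have ind : indep2 o e.
 move=> s t z; have [//|-> ->//] := det4_indep2 hdo (s := t) (t := s).
 by rewrite addrC.
have ind' := bir_indep_tangent B ho ind.
have base r : r != 0 -> cub T (r *: o + e) = 0 -> False.
 move=> r0; have -> : r *: o + e = r *: (o + r^-1 *: e) by rewrite scalerDr scalerA mulfV // scale1r.
 rewrite cubZ => /eqP; rewrite scaler_eq0 (negPf (expf_neq0 3 r0)) /= => /eqP z.
 case/eqP: Do; rewrite -(De o r^-1); apply: Df => j.
 by have := congr1 (fun v : V => v 0 j) z; rewrite -(ev_pol _ (bir_fh B)) !mxE.
(* on the line <o,e> the first three coordinates of f stay proportional to (a1 o, a2 o, a3 o) *)
have P j : j \in [:: (l1, a1); (l2, a2); (l3, a3)] -> [/\ dot j.1 (T o o o) = dot j.2 o * pev Q o,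
  3 * dot j.1 (T o o e) = dot j.2 o * (2 * dot (o *m A) e), 3 * dot j.1 (T o e e) = dot j.2 o * pev Q e
  & dot j.1 (T e e e) = 0].
 move=> hj; have hl x : dot j.1 (cub T x) = dot j.2 x * pev Q x.
  have [h1 h2 h3] := hQ x.
  by move: hj; rewrite !inE => /or3P[] /eqP->.
 have aj : dot j.2 e = 0 by move: hj; rewrite !inE => /or3P[] /eqP->.
 have E t : dot j.1 (T o o o) - dot j.2 o * pev Q o + t * (3 * dot j.1 (T o o e) - dot j.2 o * (2 * dot (o *m A) e))
   + t ^+ 2 * (3 * dot j.1 (T o e e) - dot j.2 o * pev Q e) + t ^+ 3 * dot j.1 (T e e e) = 0.
  have := hl (o + t *: e); rewrite cubD cubZ !stZ2 !stZ3 !dotDr !dotZr aj mulr0 addr0 hA.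
  rewrite mulmxDl -scalemxAl !dotDl !dotDr !dotZl !dotZr (As e o) -!hA /cub => /eqP.
  by rewrite -subr_eq0 => /eqP <-; ring.
 pose s := [:: dot j.1 (T o o o) - dot j.2 o * pev Q o;
  3 * dot j.1 (T o o e) - dot j.2 o * (2 * dot (o *m A) e);
  3 * dot j.1 (T o e e) - dot j.2 o * pev Q e; dot j.1 (T e e e)].
 have hs := @horner_rec_eq0 _ s _.
 have hz t : horner_rec s t = 0 by rewrite -[RHS](E t) /s /=; ring.
 split; [apply/eqP; rewrite -subr_eq0; apply/eqP; exact: (hs hz 0%N)
     |apply/eqP; rewrite -subr_eq0; apply/eqP; exact: (hs hz 1%N)
     |apply/eqP; rewrite -subr_eq0; apply/eqP; exact: (hs hz 2%N)| exact: (hs hz 3%N)].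
have [d' hd'] := cross_basis nl.
have n3 : 3 != 0 :> K by rewrite pnatr_eq0.
have rank y : (exists q, [/\ dot l1 y = dot a1 o * q, dot l2 y = dot a2 o * q & dot l3 y = dot a3 o * q]) ->
  exists s t, y = s *: T o o o + t *: T o o e.
 move=> [q [h1 h2 h3]]; apply: (indep2_cross ind'); apply: dot_ext => z; rewrite dot_cross dot0l.
 have m1 : (l1, a1) \in [:: (l1, a1); (l2, a2); (l3, a3)] by rewrite inE eqxx.
 have m2 : (l2, a2) \in [:: (l1, a1); (l2, a2); (l3, a3)] by rewrite !inE eqxx orbT.
 have m3 : (l3, a3) \in [:: (l1, a1); (l2, a2); (l3, a3)] by rewrite !inE eqxx !orbT.
 have [/= p1 p1' _ _] := P _ m1; have [/= p2 p2' _ _] := P _ m2; have [/= p3 p3' _ _] := P _ m3.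
 have E (l a : V) : 3 * dot l (T o o e) = dot a o * (2 * dot (o *m A) e) ->
   dot l (T o o e) = dot a o * (2 * dot (o *m A) e / 3).
  by move=> ee; apply: (mulfI n3); rewrite ee; field.
 have [b1 [b2 [b3 [b4 [_ bb]]]]] := dual_basis hd'.
 pose v := dot a1 o *: b1 + dot a2 o *: b2 + dot a3 o *: b3.
 have sp u q' : dot l1 u = dot a1 o * q' -> dot l2 u = dot a2 o * q' -> dot l3 u = dot a3 o * q' ->
   exists r, u = q' *: v + r *: b4.
  move=> e1 e2 e3; exists (dot d' u); rewrite {1}[u]bb e1 e2 e3 /v; apply/rowP => i0; rewrite !mxE; ring.
 have [r1 ->] := sp _ _ p1 p2 p3; have [r2 ->] := sp _ _ (E _ _ p1') (E _ _ p2') (E _ _ p3').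
 have [r3 ->] := sp _ _ h1 h2 h3.
 rewrite !det4E /minor2 !mxE; ring.
have m1 : (l1, a1) \in [:: (l1, a1); (l2, a2); (l3, a3)] by rewrite inE eqxx.
have m2 : (l2, a2) \in [:: (l1, a1); (l2, a2); (l3, a3)] by rewrite !inE eqxx orbT.
have m3 : (l3, a3) \in [:: (l1, a1); (l2, a2); (l3, a3)] by rewrite !inE eqxx !orbT.
have r2 : exists s t, T o e e = s *: T o o o + t *: T o o e.
 apply: rank; exists (pev Q e / 3).
 by split; apply: (mulfI n3); [have [_ _ -> _] := P _ m1|have [_ _ -> _] := P _ m2|have [_ _ -> _] := P _ m3]; rewrite /=; field.
have r3 : exists s t, T e e e = s *: T o o o + t *: T o o e.
 apply: rank; exists 0; rewrite !mulr0.
 by split; [have [] := P _ m1|have [] := P _ m2|have [] := P _ m3].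
case: (rank2_line B ho ind r2 r3) => [[r [z [zo _]]]|[r [s [rs [z1 z2]]]]].
 have [r0|r0] := eqVneq r 0; last by case: (base r r0 z).
 by move: zo; rewrite r0 scale0r add0r => ->; rewrite mxE.
have [r0|r0] := eqVneq r 0; last by case: (base r r0 z1).
have [s0|s0] := eqVneq s 0; last by case: (base s s0 z2).
by move: rs; rewrite r0 s0 eqxx.
Qed.

(** In a frame with b4 the double point, l4.f is quadratic in the first three coordinates with
    linear coefficients, and [Q] is linear in them with linear coefficients. These coefficients are
    the entries of W that [skew_expansion] asks for. *)
Lemma jonq_det_limit : jonq_form g -> det_limit f.
Proof.
move=> /jonq_inverse[Q [a1 [a2 [a3 [l1 [l2 [l3 [Qh na nl hQ]]]]]]]].
have Te := jonq_center_double Qh na nl hQ; set e := cross a1 a2 a3 in Te.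
have [A [As hA]] := homog2_bilinear Qh.
have [a4 ha] := cross_basis na; have [l4 hl] := cross_basis nl.
have [b1 [b2 [b3 [b4 [a1b1 bb]]]]] := dual_basis ha.
have ae1 : dot a1 e = 0 by rewrite dotC dot_cross det4_14.
have ae2 : dot a2 e = 0 by rewrite dotC dot_cross det4_24.
have ae3 : dot a3 e = 0 by rewrite dotC dot_cross det4_34.
have a4e : dot a4 e != 0 by rewrite dotC dot_cross.
have eb : e = dot a4 e *: b4 by rewrite {1}[e]bb ae1 ae2 ae3 !scale0r !add0r.
have Tb x : T b4 b4 x = 0.
 have := Te x; rewrite eb stZ1 stZ2 => /eqP; rewrite !scaler_eq0 (negPf a4e) /= => /eqP//.
have a1b4 : dot a1 b4 = 0.
 by move/eqP: ae1; rewrite eb dotZr mulf_eq0 (negPf a4e) => /eqP.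
have [z hz] : exists z : V -> V, forall x, z x = dot a1 x *: b1 + dot a2 x *: b2 + dot a3 x *: b3 by eexists.
have zx x : x = z x + dot a4 x *: b4 by rewrite hz -bb.
(* As b4 is a double point of the cubics and a point of [Q], expansion at z + a4 b4 leaves T(z, z, z
   + 3 a4 b4) and the bilinear value of [Q] at (z, z + 2 a4 b4). *)
have [y hy] : exists y : V -> V, forall x, y x = z x + (3 * dot a4 x) *: b4 by eexists.
have [y' hy'] : exists y : V -> V, forall x, y x = z x + (2 * dot a4 x) *: b4 by eexists.
have yD u v : y (u + v) = y u + y v by rewrite !hy !hz !dotDr; vring.
have yZ r u : y (r *: u) = r *: y u by rewrite !hy !hz !dotZr; vring.
have y'D u v : y' (u + v) = y' u + y' v by rewrite !hy' !hz !dotDr; vring.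
have y'Z r u : y' (r *: u) = r *: y' u by rewrite !hy' !hz !dotZr; vring.
have cubx x : cub T x = T (z x) (z x) (y x).
 rewrite {1}(zx x) cubD cubZ !stZ2 !stZ3 (st13 T b4 b4) Tb /cub Tb hy stD3 stZ3.
 by vring.
have Qb4 : pev Q b4 = 0.
 name p0 E0 := (dot l1 (T b1 b1 b1)).
 name p1 E1 := (dot l1 (T b1 b1 b4)).
 have hh t : horner_rec [:: pev Q b1 - p0; 2 * dot (b1 *m A) b4 - 3 * p1; pev Q b4] t = 0.
  have [+ _ _] := hQ (b1 + t *: b4); rewrite cubD cubZ !stZ2 !stZ3 (st13 T b4 b4) Tb /cub Tb.
  rewrite !scaler0 !addr0 !dotDr !dotZr -E0 -E1 a1b1 a1b4 mulr0 addr0 mul1r hA.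
  rewrite mulmxDl -scalemxAl !dotDl !dotDr !dotZl !dotZr (As b4 b1) -!hA => /eqP.
  by rewrite eq_sym -subr_eq0 => /eqP e0; rewrite -[RHS]e0 /=; ring.
 exact: (horner_rec_eq0 hh 2).
have Qx x : pev Q x = dot a1 x * dot (b1 *m A) (y' x) + dot a2 x * dot (b2 *m A) (y' x) + dot a3 x * dot (b3 *m A) (y' x).
 have -> : pev Q x = dot (z x *m A) (y' x).
  rewrite {1}(zx x) hA mulmxDl -scalemxAl !dotDl !dotDr !dotZl !dotZr (As b4) -(hA b4) Qb4.
  by rewrite hy' dotDr dotZr; ring.
 by rewrite {1}hz !mulmxDl -!scalemxAl !dotDl !dotZl.
have [U1 hU1] : exists N : 'M[K]_4, forall x, dot a3 x *: l2 - dot a2 x *: l3 = x *m N.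
 by apply: linear_matrix => [u v|r u]; rewrite ?dotDr ?dotZr; vring.
have [U2 hU2] : exists N : 'M[K]_4, forall x, dot a1 x *: l3 - dot a3 x *: l1 = x *m N.
 by apply: linear_matrix => [u v|r u]; rewrite ?dotDr ?dotZr; vring.
have [U3 hU3] : exists N : 'M[K]_4, forall x, dot a2 x *: l1 - dot a1 x *: l2 = x *m N.
 by apply: linear_matrix => [u v|r u]; rewrite ?dotDr ?dotZr; vring.
have hW b : exists N : 'M[K]_4, forall x, dot l4 (T b1 b (y x)) *: l1 + dot l4 (T b2 b (y x)) *: l2
  + dot l4 (T b3 b (y x)) *: l3 + (- dot (b *m A) (y' x)) *: l4 = x *m N.
 apply: linear_matrix => [u v|r u]; first by rewrite yD y'D !stD3 !dotDr; vring.
 by rewrite yZ y'Z !stZ3 !dotZr; vring.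
have [W1 hW1] := hW b1; have [W2 hW2] := hW b2; have [W3 hW3] := hW b3.
exists U1, U2, U3, W1, W2, W3, (det4 l1 l2 l3 l4); split=> // x.
 by rewrite -hU1 -hU2 -hU3 skew_det0.
rewrite -hU1 -hU2 -hU3 -hW1 -hW2 -hW3.
have [s1 s2 s3 s4] := skew_expansion l1 l2 l3 l4 (dot a1 x) (dot a2 x) (dot a3 x)
 (dot l4 (T b1 b1 (y x))) (dot l4 (T b1 b2 (y x))) (dot l4 (T b1 b3 (y x)))
 (dot l4 (T b2 b1 (y x))) (dot l4 (T b2 b2 (y x))) (dot l4 (T b2 b3 (y x)))
 (dot l4 (T b3 b1 (y x))) (dot l4 (T b3 b2 (y x))) (dot l4 (T b3 b3 (y x)))
 (- dot (b1 *m A) (y' x)) (- dot (b2 *m A) (y' x)) (- dot (b3 *m A) (y' x)).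
have [h1 h2 h3] := hQ x.
apply: (basis_dot_ext hl); rewrite dotZr ![dot _ (_ + _)]dotC !dotDl !dot_cross.
- by rewrite s1 h1 Qx; ring.
- by rewrite s2 h2 Qx; ring.
- by rewrite s3 h3 Qx; ring.
rewrite s4 cubx {1 2}hz !stD1 !stZ1 !stD2 !stZ2 !dotDr !dotZr !dotDr !dotZr; ring.
Qed.

End JonqBir.
End JonquieresLimit.

(** * Resultants and quartics along a nodal plane cubic *)

Section NodalPolynomials.
Variable K : numClosedFieldType.
Notation V := ('rV[K]_4).

Lemma poly_ext (p q : {poly K}) : (forall t, p.[t] = q.[t]) -> p = q.
Proof.
move=> e; apply/eqP; rewrite -subr_eq0; apply/negPn/negP => /poly_nonroot[t].
by rewrite hornerD hornerN e subrr eqxx.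
Qed.

(** u + v x is the remainder of p2^2 r modulo p, so with s, t the roots of p the value is p2 (u + v
    s) (u + v t) = p2^5 r(s) r(t). This is p2^2 times the resultant, and the extra factor makes
    nonvanishing imply that p2 is nonzero. *)
Definition normq (p0 p1 p2 r0 r1 r2 r3 : K) :=
 let u := p2 ^+ 2 * r0 - p2 * r2 * p0 + r3 * p1 * p0 in
 let v := p2 ^+ 2 * r1 - p2 * r2 * p1 + r3 * (p1 ^+ 2 - p0 * p2) in
 p2 * u ^+ 2 - p1 * u * v + p0 * v ^+ 2.

Lemma normq_lead p0 p1 p2 r0 r1 r2 r3 : normq p0 p1 p2 r0 r1 r2 r3 != 0 -> p2 != 0.
Proof. by apply: contraNneq => ->; apply/eqP; rewrite /normq; ring. Qed.

Lemma normq_root p0 p1 p2 r0 r1 r2 r3 t : p0 + p1 * t + p2 * t ^+ 2 = 0 ->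
 r0 + r1 * t + r2 * t ^+ 2 + r3 * t ^+ 3 = 0 -> normq p0 p1 p2 r0 r1 r2 r3 = 0.
Proof.
move=> hp hr; rewrite /normq.
set u := _ - _ + _ * p0; set v := _ - _ + _ * (_ - _).
have e : u + v * t = 0.
 have -> : u + v * t = p2 ^+ 2 * (r0 + r1 * t + r2 * t ^+ 2 + r3 * t ^+ 3)
   - (p0 + p1 * t + p2 * t ^+ 2) * (p2 * r2 + p2 * r3 * t - r3 * p1) by rewrite /u /v; ring.
 by rewrite hp hr; ring.
have -> : u = - (v * t) by apply/eqP; rewrite -addr_eq0 e.
transitivity (v ^+ 2 * (p0 + p1 * t + p2 * t ^+ 2)); first by ring.
by rewrite hp mulr0.
Qed.

Lemma quadratic_root (p0 p1 p2 : K) : p2 != 0 -> exists s t, forall x,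
 p0 + p1 * x + p2 * x ^+ 2 = p2 * (x - s) * (x - t).
Proof.
move=> p20; pose p := Poly [:: p0; p1; p2].
have sp : size p = 3%N by rewrite (PolyK (c := 0)).
have /closed_rootP[s /factor_theorem[q eq]] : size p != 1%N by rewrite sp.
have q0 : q != 0 by apply: contra_eqN sp => /eqP z; rewrite eq z mul0r size_poly0.
have sq : size q = 2%N by move: sp; rewrite eq size_mul ?polyXsubC_eq0 // size_XsubC addn2 /= => -[].
have /closed_rootP[t /factor_theorem[r er]] : size q != 1%N by rewrite sq.
have r0 : r != 0 by apply: contraNneq q0 => z; rewrite er z mul0r.
have sr : size r = 1%N by move: sq; rewrite er size_mul ?polyXsubC_eq0 // size_XsubC addn2 /= => -[].
have er2 := size1_polyC (eq_leq sr).
have E x : p0 + p1 * x + p2 * x ^+ 2 = r`_0 * (x - t) * (x - s).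
 transitivity p.[x]; first by rewrite /p horner_Poly /=; ring.
 by rewrite eq er !hornerE er2 hornerC coefC.
have ep2 : p2 = r`_0.
 have e0 := E 0; have e1 := E 1; have e2 := E 2.
 have n2 : 2 != 0 :> K by rewrite pnatr_eq0.
 apply: (mulfI n2).
 transitivity ((p0 + p1 * 2 + p2 * 2 ^+ 2) - 2 * (p0 + p1 * 1 + p2 * 1 ^+ 2) + (p0 + p1 * 0 + p2 * 0 ^+ 2)); first by ring.
 by rewrite e0 e1 e2; ring.
by exists s, t => x; rewrite E ep2; ring.
Qed.

Lemma normq_eq0 p0 p1 p2 r0 r1 r2 r3 : p2 != 0 -> normq p0 p1 p2 r0 r1 r2 r3 = 0 ->
 exists t, p0 + p1 * t + p2 * t ^+ 2 = 0 /\ r0 + r1 * t + r2 * t ^+ 2 + r3 * t ^+ 3 = 0.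
Proof.
move=> p20; have [s [t hst]] := quadratic_root p0 p1 p20.
have e0 := hst 0; have e1 := hst 1; have em := hst (-1).
have F0 : p0 = p2 * s * t by transitivity (p0 + p1 * 0 + p2 * 0 ^+ 2); [ring|rewrite e0; ring].
have F1 : p1 = - (p2 * (s + t)).
 transitivity (p0 + p1 * 1 + p2 * 1 ^+ 2 - p2 - p0); [ring|rewrite e1 F0; ring].
rewrite /normq; set u := _ - _ + _ * p0; set v := _ - _ + _ * (_ - _).
have -> : p2 * u ^+ 2 - p1 * u * v + p0 * v ^+ 2 = p2 * ((u + v * s) * (u + v * t)).
 by rewrite F0 F1; ring.
move=> /eqP; rewrite mulf_eq0 (negPf p20) /= mulf_eq0 => hh.
have fin x : p2 * (x - s) * (x - t) = 0 -> u + v * x = 0 ->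
  p0 + p1 * x + p2 * x ^+ 2 = 0 /\ r0 + r1 * x + r2 * x ^+ 2 + r3 * x ^+ 3 = 0.
 rewrite -hst => px ux; split=> //; apply: (mulfI (expf_neq0 2 p20)); rewrite mulr0.
 transitivity (u + v * x + (p0 + p1 * x + p2 * x ^+ 2) * (p2 * r2 + p2 * r3 * x - r3 * p1)).
  by rewrite /u /v; ring.
 by rewrite ux px mul0r addr0.
by case/orP: hh => /eqP ux; [exists s|exists t]; apply: fin => //; rewrite subrr ?mulr0 ?mul0r.
Qed.

(* a quartic through the nodal cubic (-r, p, p z) is a multiple of y0 p + r *)
Lemma nodal_quartic (p r e0 e1 e2 e3 e4 : {poly K}) :
 size p = 3%N -> (size r <= 4)%N -> coprimep p r -> (size e0 <= 1)%N -> (size e1 <= 2)%N ->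
 (size e2 <= 3)%N -> (size e3 <= 4)%N ->
 r ^+ 4 * e0 - r ^+ 3 * p * e1 + r ^+ 2 * p ^+ 2 * e2 - r * p ^+ 3 * e3 + p ^+ 4 * e4 = 0 ->
 [/\ e0 = 0, e1 = 0 & exists (a : K) (l : {poly K}), [/\ (size l <= 2)%N, e2 = a%:P * p, e3 = a%:P * r + l * p & e4 = l * r]].
Proof.
move=> sp sr co s0 s1 s2 s3 E.
have p0 : p != 0 by rewrite -size_poly_gt0 sp.
have cork n : coprimep p (r ^+ n) by apply: coprimep_expr.
have small (q : {poly K}) : p %| q -> (size q <= 2)%N -> q = 0.
 by move=> d s; apply/eqP; apply: contraLR d => q0; rewrite (contra (dvdp_leq q0)) // sp -ltnNge.
have z0 : e0 = 0.
 apply: small; last by apply: leq_trans s0 _.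
 rewrite -(Gauss_dvdpr _ (cork 4%N)).
 have -> : r ^+ 4 * e0 = p * (r ^+ 3 * e1 - r ^+ 2 * p * e2 + r * p ^+ 2 * e3 - p ^+ 3 * e4).
  by apply/eqP; rewrite -subr_eq0; apply/eqP; rewrite -[RHS]E; ring.
 exact: dvdp_mulIl.
have z1 : e1 = 0.
 apply: small => //; rewrite -(Gauss_dvdpr _ (cork 3%N)).
 have -> : r ^+ 3 * e1 = p * (r ^+ 2 * e2 - r * p * e3 + p ^+ 2 * e4).
  apply: (mulfI p0); apply/eqP; rewrite -subr_eq0 -oppr_eq0; apply/eqP; rewrite -[RHS]E z0; ring.
 exact: dvdp_mulIl.
have E2 : r ^+ 2 * e2 - r * p * e3 + p ^+ 2 * e4 = 0.
 by apply: (mulfI (expf_neq0 2 p0)); rewrite mulr0 -[RHS]E z0 z1; ring.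
have [a ea] : exists a, e2 = a%:P * p.
 have d2 : p %| e2.
  rewrite -(Gauss_dvdpr _ (cork 2%N)).
  have -> : r ^+ 2 * e2 = p * (r * e3 - p * e4).
   by apply/eqP; rewrite -subr_eq0; apply/eqP; rewrite -[RHS]E2; ring.
  exact: dvdp_mulIl.
 have [e20|e20] := eqVneq e2 0; first by exists 0; rewrite e20 mul0r.
 move: d2 => /dvdpP[q eq]; move: s2; rewrite eq.
 have q0 : q != 0 by apply: contraNneq e20 => z; rewrite eq z mul0r.
 rewrite size_mul // sp addn3 /= !ltnS => sq; exists q`_0.
 by rewrite -(size1_polyC _) // (leq_trans sq).
have E3 : r * (e3 - a%:P * r) = p * e4.
 apply: (mulfI p0); apply/eqP; rewrite -subr_eq0 -oppr_eq0; apply/eqP; rewrite -[RHS]E2 ea; ring.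
have /dvdpP[l el] : p %| e3 - a%:P * r by rewrite -(Gauss_dvdpr _ co) E3 dvdp_mulIl.
split=> //; exists a, l; split=> //.
- have [l0|l0] := eqVneq l 0; first by rewrite l0 size_poly0.
 have : (size (e3 - a%:P * r)%R <= 4)%N.
  rewrite (leq_trans (size_polyD _ _)) // geq_max s3 size_polyN mul_polyC.
  by rewrite (leq_trans (size_scale_leq _ _)).
 by rewrite el size_mul // sp addn3 /= !ltnS.
- by rewrite -el addrC subrK.
by apply: (mulfI p0); rewrite -E3 el; ring.
Qed.

Variable T : symtri K.

Definition poly_lin (d o u v : V) := Poly [:: dot d (T o o u); dot d (T o o v)].
Definition poly_quad (d o u v : V) := Poly [:: dot d (T o u u); 2 * dot d (T o u v); dot d (T o v v)].
Definition poly_cub (d u v : V) :=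
 Poly [:: dot d (cub T u); 3 * dot d (T u u v); 3 * dot d (T u v v); dot d (cub T v)].

Lemma poly_linE d o u v t : (poly_lin d o u v).[t] = dot d (T o o (u + t *: v)).
Proof. by rewrite horner_Poly /= stD3 stZ3 dotDr dotZr; ring. Qed.

Lemma poly_quadE d o u v t : (poly_quad d o u v).[t] = dot d (T o (u + t *: v) (u + t *: v)).
Proof.
rewrite horner_Poly /= !stD2 !stD3 !stZ2 !stZ3 (st23 T o u v) !dotDr !dotZr; ring.
Qed.

Lemma poly_cubE d u v t : (poly_cub d u v).[t] = dot d (cub T (u + t *: v)).
Proof. by rewrite horner_Poly /= cubD cubZ !stZ2 !stZ3 !dotDr !dotZr; ring. Qed.

Lemma size_poly_lin d o u v : (size (poly_lin d o u v) <= 2)%N. Proof. exact: size_Poly. Qed.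
Lemma size_poly_quad d o u v : (size (poly_quad d o u v) <= 3)%N. Proof. exact: size_Poly. Qed.
Lemma size_poly_cub d u v : (size (poly_cub d u v) <= 4)%N. Proof. exact: size_Poly. Qed.

Definition rho (o v1 v2 : V) :=
 let a := cross (T o o o) (T o o v1) (T o o v2) in
 normq (dot a (T o v1 v1)) (2 * dot a (T o v1 v2)) (dot a (T o v2 v2))
  (dot a (cub T v1)) (3 * dot a (T v1 v1 v2)) (3 * dot a (T v1 v2 v2)) (dot a (cub T v2)).

End NodalPolynomials.

(** * The birational map between two nodal plane cubics *)

Section NodalSection.
Variable K : numClosedFieldType.
Notation V := ('rV[K]_4).

Lemma coprime_noroot (p q : {poly K}) : p != 0 -> (forall t, p.[t] = 0 -> q.[t] = 0 -> False) -> coprimep p q.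
Proof.
move=> p0 h; rewrite coprimep_def; apply/negPn/negP => /closed_rootP[t]; rewrite root_gcd => /andP[/eqP h1 /eqP h2].
exact: (h t).
Qed.

Lemma pfun_poly (f : K^o -> K) : pfun f -> exists p : {poly K}, forall t, f t = p.[t].
Proof. by move=> pf; have [p hp] := pf 0 1; exists p => t; rewrite -hp add0r /GRing.scale /= mulr1. Qed.

Lemma pfun_horner (p : {poly K}) : pfun (fun t : K^o => p.[t]).
Proof.
move=> u v; exists (p \Po (u%:P + v *: 'X)) => t.
rewrite horner_comp !hornerE; congr (_.[_]); by rewrite /GRing.scale /= mulrC.
Qed.

Section Bir.
Variables (f g : 'I_4 -> {mpoly K[4]}) (h k : {mpoly K[4]}).
Hypothesis B : bir f g h k.
Notation T := (pol f).
Notation S := (pol g).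

(** In the plane n the curve a.f = 0 is parametrized by its slope at the node as c3 o - c2 (v1 + t
    v2); in the plane a the curve n.g = 0 has node b0 and parametrization -k3 b0 + k2 (b1 + z b2).
    The map f carries the first curve to the second, and injectivity makes z = m2(t) / m1(t) a
    Moebius function. The last clause matches the two parametrizations. *)
Lemma nodal_section o v1 v2 : pev h o != 0 -> rho T o v1 v2 != 0 ->
 let b0 := T o o o in let b1 := T o o v1 in let b2 := T o o v2 in
 let a := cross b0 b1 b2 in let n := cross o v1 v2 in
 let c2 := 3 *: poly_quad T a o v1 v2 in let c3 := poly_cub T a v1 v2 in
 let k2 := 3 *: poly_quad S n b0 b1 b2 in let k3 := poly_cub S n b1 b2 in
 [/\ cross b0 b1 b2 != 0, n != 0, dot n (cub S b0) = 0, dot n (S b0 b0 b1) = 0 & dot n (S b0 b0 b2) = 0] /\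
 [/\ size k2 = 3%N, coprimep k2 k3 & exists e0 m1 m2 N : {poly K},
  [/\ (size e0 <= 4)%N, (size m1 <= 2)%N, (size m2 <= 2)%N, N != 0 &
  [/\ forall t, N.[t] != 0 -> exists s, s != 0 /\
   cub S (e0.[t] *: b0 + (c2.[t] * m1.[t]) *: b1 + (c2.[t] * m2.[t]) *: b2)
    = s *: (c3.[t] *: o - c2.[t] *: (v1 + t *: v2)),
   m1 != 0, forall z, m2 - z *: m1 != 0 &
   exists2 r, r != 0 & forall t z, m2.[t] = z * m1.[t] ->
    [/\ e0.[t] = - (r * m1.[t] ^+ 3 * k3.[z]), c2.[t] * m1.[t] = r * m1.[t] ^+ 3 * k2.[z]
     & c2.[t] * m2.[t] = r * m1.[t] ^+ 3 * k2.[z] * z]]]].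
Proof.
move=> ho; rewrite /rho.
name b0 E0 := (T o o o).
name b1 E1 := (T o o v1).
name b2 E2 := (T o o v2).
rewrite /= -E0 -E1 -E2; name a Ea := (cross b0 b1 b2).
name n En := (cross o v1 v2).
rewrite -Ea -En => hr.
name A0 EA0 := (dot a (T o v1 v1)).
name A1 EA1 := (dot a (T o v1 v2)).
name A2 EA2 := (dot a (T o v2 v2)).
rewrite -EA0 -EA1 -EA2 in hr; have A20 := normq_lead hr.
have a0 : a != 0 by apply: contraNneq A20 => z; rewrite EA2 z dot0l.
have ab0 : dot a b0 = 0 by rewrite Ea dot_cross det4_14.
have ab1 : dot a b1 = 0 by rewrite Ea dot_cross det4_24.
have ab2 : dot a b2 = 0 by rewrite Ea dot_cross det4_34.
have no : dot n o = 0 by rewrite En dot_cross det4_14.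
have nv1 : dot n v1 = 0 by rewrite En dot_cross det4_24.
have nv2 : dot n v2 = 0 by rewrite En dot_cross det4_34.
have n3 : 3 != 0 :> K by rewrite pnatr_eq0.
have n9 : 9 != 0 :> K by rewrite pnatr_eq0.
have [b3 hb3] : exists d, det4 b0 b1 b2 d != 0 by apply: cross_basis; rewrite -Ea.
have ind01 := det4_indep2 hb3.
have indo : indep2 o v1.
 by move=> s t z; apply: ind01; rewrite E0 E1 -!stZ3 -stD3 z st03.
have n0 : n != 0.
 apply: contraNneq hb3; rewrite En => /(indep2_cross indo)[s [t e]].
 by rewrite E2 e stD3 !stZ3 -E0 -E1 det4D3 !det4Z3 det4_13 det4_23 !mulr0 addr0.
have Tv x y : T o o (x *: v1 + y *: v2) = x *: b1 + y *: b2 by rewrite stD3 !stZ3 E1 E2.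
have chain1 x y : dot n (S b0 b0 (x *: b1 + y *: b2)) = 0.
 have [al [be [ch _]]] := bir_chain B o (x *: v1 + y *: v2).
 have := congr1 (dot n) ch; rewrite Tv /cub -E0 dotZr dotDr !dotZr dotDr !dotZr no nv1 nv2 !mulr0 !addr0 mulr0 => /eqP.
 by rewrite mulf_eq0 (negPf n9) => /eqP.
have S001 : dot n (S b0 b0 b1) = 0 by rewrite -(chain1 1 0) scale1r scale0r addr0.
have S002 : dot n (S b0 b0 b2) = 0 by rewrite -(chain1 0 1) scale1r scale0r add0r.
have S000 : dot n (cub S b0) = 0.
 by rewrite E0 -/(cub T o) (bir_cub B) dotZr no mulr0.
have kb0 : pev k b0 != 0 by rewrite E0; apply: (bir_h_comp_neq0 (bir_sym B)).
(* The differential of g at b0 carries the plane a to the plane n, so the two linear forms are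
   proportional; its surjectivity gives [la] nonzero. *)
have [la la0 hla] : exists2 la, la != 0 & forall y, dot n (S b0 b0 y) = la * dot a y.
 have E y : dot n (S b0 b0 y) = dot n (S b0 b0 b3) / det4 b0 b1 b2 b3 * dot a y.
  apply: (mulfI hb3).
  have <- : dot n (S b0 b0 (det4 b0 b1 b2 b3 *: y)) = det4 b0 b1 b2 b3 * dot n (S b0 b0 y) by rewrite stZ3 dotZr.
  rewrite (cramer4 b0 b1 b2 b3 y) !stD3 !stZ3 !dotDr !dotZr.
  by rewrite S001 S002 -[S b0 b0 b0]/(cub S b0) S000 Ea dot_cross; field.
 exists (dot n (S b0 b0 b3) / det4 b0 b1 b2 b3) => //.
 apply/eqP => z; have [y hy] := dot_neq0 n0; have [v hv] := bir_dsurj (bir_sym B) y kb0.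
 by case/eqP: hy; rewrite -hv E z mul0r.
pose q2 (x y : K) := A0 * x ^+ 2 + 2 * A1 * x * y + A2 * y ^+ 2.
have q2E x y : q2 x y = dot a (T o (x *: v1 + y *: v2) (x *: v1 + y *: v2)).
 by rewrite !stD2 !stD3 !stZ2 !stZ3 (st23 T o v1 v2) !dotDr !dotZr -EA0 -EA1 -EA2 /q2; ring.
(* Second-order chain rule: the two nodes have the same tangent directions in the bases (v1, v2) and
   (b1, b2). *)
have K2E x y : 3 * dot n (S b0 (x *: b1 + y *: b2) (x *: b1 + y *: b2)) = - la * q2 x y.
 have [al [be [_ ch]]] := bir_chain B o (x *: v1 + y *: v2).
 have := congr1 (dot n) ch; rewrite Tv /cub -E0 dotDr !dotZr hla -q2E !dotDr !dotZr !dotDr !dotZr no nv1 nv2.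
 rewrite !mulr0 !addr0 mulr0 => e; apply: (mulfI n9); apply/eqP; rewrite -subr_eq0; apply/eqP.
 by rewrite -[RHS]e; ring.
name k30 Ek0 := (dot n (cub S b1)).
name k31 Ek1 := (dot n (S b1 b1 b2)).
name k32 Ek2 := (dot n (S b1 b2 b2)).
name k33 Ek3 := (dot n (cub S b2)).
pose q3 (x y : K) := k30 * x ^+ 3 + 3 * k31 * x ^+ 2 * y + 3 * k32 * x * y ^+ 2 + k33 * y ^+ 3.
have q3E x y : q3 x y = dot n (cub S (x *: b1 + y *: b2)).
 by rewrite cubD !cubZ !stZ1 !stZ2 !stZ3 !dotDr !dotZr -Ek0 -Ek1 -Ek2 -Ek3 /q3; ring.
have FE y0 x y : dot n (cub S (y0 *: b0 + (x *: b1 + y *: b2))) = - la * q2 x y * y0 + q3 x y.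
 rewrite cubD cubZ !stZ1 !stZ2 !dotDr !dotZr S000 chain1 -q3E -K2E; ring.
name c Ec := (poly_quad T a o v1 v2).
name c3 Ec3 := (poly_cub T a v1 v2).
rewrite -Ec -Ec3.
have cE t : c.[t] = q2 1 t by rewrite Ec poly_quadE q2E scale1r.
have c3E t : c3.[t] = dot a (cub T (v1 + t *: v2)) by rewrite Ec3 poly_cubE.
have ec t : c.[t] = A0 + 2 * A1 * t + A2 * t ^+ 2 by rewrite cE /q2; ring.
have sc : size c = 3%N by rewrite Ec (PolyK (c := 0)) //= -EA2.
have c0 : c != 0 by rewrite -size_poly_gt0 sc.
have nor t : c.[t] = 0 -> c3.[t] = 0 -> False.
 rewrite ec => h1 h2; case/eqP: hr; apply: (@normq_root _ _ _ _ _ _ _ _ t) => //.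
 by rewrite -h2 Ec3 horner_Poly /=; ring.
have coc : coprimep c c3 by apply: coprime_noroot.
have [s1 [s2 hss]] := quadratic_root A0 (2 * A1) A20.
have cs : c = A2 *: (('X - s1%:P) * ('X - s2%:P)).
 by apply: poly_ext => t; rewrite ec hss !hornerE /=; ring.
have A0s : A0 = A2 * s1 * s2 by transitivity (A0 + 2 * A1 * 0 + A2 * 0 ^+ 2); [ring|rewrite hss; ring].
have A1s : 2 * A1 = - (A2 * (s1 + s2)).
 transitivity (A0 + 2 * A1 * 1 + A2 * 1 ^+ 2 - A2 - A0); [ring|rewrite hss A0s; ring].
have q2s x y : q2 x y = A2 * (y - s1 * x) * (y - s2 * x).
 by rewrite /q2 -[2 * A1 * x]/(2 * A1 * x) A1s A0s; ring.
have [Q2 Q2d] : exists Q2 : {poly K} -> {poly K} -> {poly K}, forall x y, Q2 x y = A2 *: ((y - s1 *: x) * (y - s2 *: x)) by eexists.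
have Q2E x y t : (Q2 x y).[t] = q2 x.[t] y.[t] by rewrite q2s Q2d !hornerE /=; ring.
have [Q3 Q3d] : exists Q3 : {poly K} -> {poly K} -> {poly K}, forall x y,
  Q3 x y = k30 *: x ^+ 3 + (3 * k31) *: (x ^+ 2 * y) + (3 * k32) *: (x * y ^+ 2) + k33 *: y ^+ 3 by eexists.
have Q3E x y t : (Q3 x y).[t] = q3 x.[t] y.[t] by rewrite /q3 Q3d !(hornerE, horner_exp) /=; ring.
(* coordinates of psi(X), X = c3 o - 3 c w, in the frame (b0, b1, b2) *)
have [d0 [d1 [d2 hd]]] : exists d0 d1 d2, forall y, dot a y = 0 -> y = dot d0 y *: b0 + dot d1 y *: b1 + dot d2 y *: b2.
 pose D := (det4 b0 b1 b2 b3)^-1.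
 exists (- D *: cross b1 b2 b3), (D *: cross b0 b2 b3), (- D *: cross b0 b1 b3) => y ay.
 have := cramer4 b0 b1 b2 b3 y; rewrite -(dot_cross b0 b1 b2 y) -Ea ay scale0r addr0 => e.
 rewrite -[y in LHS](scalerK hb3) e !dotZl !dot_cross /D.
 have -> : det4 y b1 b2 b3 = - det4 b1 b2 b3 y by rewrite (det4_swap34 b1 b2 y b3) (det4_swap23 b1 y b2 b3) (det4_swap12 y b1 b2 b3) !opprK.
 have -> : det4 b0 y b2 b3 = det4 b0 b2 b3 y by rewrite (det4_swap34 b0 b2 y b3) (det4_swap23 b0 y b2 b3) opprK.
 have -> : det4 b0 b1 y b3 = - det4 b0 b1 b3 y by rewrite (det4_swap34 b0 b1 y b3) opprK.
 by vring.
have [u ud] : exists u : V -> {poly K}, forall d,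
  u d = 3 *: (c3 * poly_quad T d o v1 v2) - 3 *: (c * poly_cub T d v1 v2) by eexists.
have uE d t : (u d).[t] = dot d ((3 * c3.[t]) *: T o (v1 + t *: v2) (v1 + t *: v2) - (3 * c.[t]) *: cub T (v1 + t *: v2)).
 by rewrite ud hornerD hornerN !hornerZ !hornerM poly_quadE poly_cubE dotDr dotNr !dotZr; ring.
name et etd := (c3 ^+ 3 + 9 *: (c ^+ 2 * u d0)).
name th1 th1d := (- 3 *: c3 ^+ 2 + 3 *: (c * u d1)).
name th2 th2d := (- 3 *: (c3 ^+ 2 * 'X) + 3 *: (c * u d2)).
have [X Xd] : exists X : K -> V, forall t, X t = c3.[t] *: o - (3 * c.[t]) *: (v1 + t *: v2) by eexists.
have YE t : cub T (X t) = et.[t] *: b0 + (3 * c.[t]) *: (th1.[t] *: b1 + th2.[t] *: b2).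
 pose U := (3 * c3.[t]) *: T o (v1 + t *: v2) (v1 + t *: v2) - (3 * c.[t]) *: cub T (v1 + t *: v2).
 have aU : dot a U = 0.
  rewrite /U dotDr dotNr !dotZr -c3E.
  have -> : dot a (T o (v1 + t *: v2) (v1 + t *: v2)) = c.[t] by rewrite cE q2E scale1r.
  by ring.
 have := hd U aU; rewrite -!uE => eU.
 rewrite Xd -scaleNr cubD !cubZ !stZ1 !stZ2 !stZ3.
 have -> : T o o (v1 + t *: v2) = b1 + t *: b2 by rewrite -[v1]scale1r Tv scale1r.
 rewrite etd th1d th2d !(hornerE, horner_exp, hornerXn) /= /cub -E0 -/(cub T (v1 + t *: v2)).
 transitivity (c3.[t] ^+ 3 *: b0 - (9 * c3.[t] ^+ 2 * c.[t]) *: (b1 + t *: b2) + (9 * c.[t] ^+ 2) *: U).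
  by rewrite /U; vring.
 by rewrite eU; vring.
have nX t : dot n (X t) = 0.
 by rewrite Xd dotDr dotNr !dotZr dotDr dotZr no nv1 nv2 !mulr0 addr0 mulr0 subr0.
(* The image point lies on n.g = 0; the common factor 9 c^2 is divided out. *)
have rel : - la *: (Q2 th1 th2 * et) + 3 *: (c * Q3 th1 th2) = 0.
 have c20 : c ^+ 2 != 0 by rewrite expf_neq0.
 apply: (mulfI c20); rewrite mulr0; apply: poly_ext => t; rewrite horner0.
 have : dot n (cub S (cub T (X t))) = 0 by rewrite (bir_cub B) dotZr nX mulr0.
 rewrite YE scalerDr !scalerA FE => e.
 rewrite !(hornerE, horner_exp) /= Q2E Q3E; apply: (mulfI n9); rewrite mulr0 -[RHS]e /q2 /q3; ring.
(* Otherwise [c], of degree 2 and prime to [c3], would divide [c3 ^+ 2] times a linear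
   polynomial. *)
have th0 s : s \in [:: s1; s2] -> th2 - s *: th1 != 0.
 move=> hs; apply/eqP => z.
 have dv : c %| c3 ^+ 2 * ('X - s%:P).
  apply/dvdpP; exists (u d2 - s *: u d1); have n3' := n3.
  apply: (scalerI n3'); apply/eqP; rewrite -subr_eq0 -oppr_eq0; apply/eqP; rewrite -[RHS]z th1d th2d.
  by apply: poly_ext => t; rewrite !(hornerE, horner_exp) /=; ring.
 have := dv; rewrite (Gauss_dvdpr _ (coprimep_expr _ coc)) => /dvdp_leq; rewrite polyXsubC_eq0 => /(_ isT).
 by rewrite sc size_XsubC.
have Qth0 : Q2 th1 th2 != 0.
 rewrite Q2d scaler_eq0 negb_or A20 mulf_neq0 // th0 // ?inE ?eqxx ?orbT //.
name G Gd := (gcdp th1 th2).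
have G0 : G != 0.
 apply/eqP => z; move: z => /eqP; rewrite Gd gcdp_eq0 => /andP[/eqP t1 /eqP t2].
 by move: Qth0; rewrite t1 t2 Q2d !scaler0 subr0 mul0r scaler0 eqxx.
have dth1 : th1 = th1 %/ G * G by rewrite divpK // Gd dvdp_gcdl.
have dth2 : th2 = th2 %/ G * G by rewrite divpK // Gd dvdp_gcdr.
have com : coprimep (th1 %/ G) (th2 %/ G).
 by move: G0; rewrite Gd => G0; apply: coprimep_div_gcd; move: G0; rewrite gcdp_eq0 negb_and.
move: dth1 dth2 com; move: (th1 %/ G) (th2 %/ G) => m1 m2 dth1 dth2 com.
have Q2G : Q2 th1 th2 = G ^+ 2 * Q2 m1 m2.
 by rewrite dth1 dth2 !Q2d; apply: poly_ext => t; rewrite !(hornerE, horner_exp) /=; ring.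
have Q3G : Q3 th1 th2 = G ^+ 3 * Q3 m1 m2.
 by rewrite dth1 dth2 !Q3d; apply: poly_ext => t; rewrite !(hornerE, horner_exp) /=; ring.
have Qm0 : Q2 m1 m2 != 0 by apply: contraNneq Qth0 => z; rewrite Q2G z mulr0.
have pX : pvec (fun t : K^o => X t).
 have -> : (fun t : K^o => X t) = fun t => c3.[t] *: o - (3 * c.[t]) *: (v1 + t *: v2) by apply: functional_extensionality => t; apply: Xd.
 apply: pvecD; first by apply: pvecZ; [apply: pfun_horner|apply: pvec_const].
 apply: pvecN; apply: pvecZ; first by apply: pfunM; [apply: pfun_const|apply: pfun_horner].
 by apply: pvecD; [apply: pvec_const|apply: pvecZ; [apply: pfun_K|apply: pvec_const]].
have [HX hHX] : exists HX : {poly K}, forall t, pev h (X t) = HX.[t].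
 by apply: pfun_poly; apply: pfun_pev.
have HX0 : HX != 0.
 have r1 : c.[s1] = 0 by rewrite cs !hornerE /= subrr !(mul0r, mulr0).
 apply/eqP => z; have := hHX s1; rewrite z horner0 Xd r1 mulr0 scale0r subr0 (bir_hZ B) => /eqP.
 rewrite mulf_eq0 (negPf ho) orbF expf_eq0 /= => /eqP; exact: nor.
have [d hdd] := cross_basis (eq_ind _ (fun x => x != 0) n0 _ En).
(* Equal slopes at b0 mean equal image points by [rel], hence equal points on the first curve and
   equal parameters. *)
have [sm1 sm2] : (size m1 <= 2)%N /\ (size m2 <= 2)%N.
 apply: (rational_injective com (mulf_neq0 (mulf_neq0 c0 Qth0) HX0)) => s t.
 rewrite !hornerM !mulf_eq0 !negb_or -!hHX !Q2E => /andP[/andP[cs0 qs] hs] /andP[/andP[ct0 qt] ht] e.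
 have et' : th1.[s] * th2.[t] = th1.[t] * th2.[s].
  rewrite dth1 dth2 !hornerM; transitivity (m1.[s] * m2.[t] * (G.[s] * G.[t])); first by ring.
  by rewrite e; ring.
 have [r [r1 r2]] : exists r, th1.[s] = r * th1.[t] /\ th2.[s] = r * th2.[t].
  have [z|nz] := eqVneq th1.[t] 0.
   have z2 : th2.[t] != 0 by apply: contraNneq qt => z2; rewrite z z2 q2s; apply/eqP; ring.
   exists (th2.[s] / th2.[t]); rewrite divfK //; split=> //.
   by move/eqP: et'; rewrite z mul0r mulf_eq0 (negPf z2) orbF => /eqP->; rewrite mulr0.
  exists (th1.[s] / th1.[t]); rewrite divfK //; split=> //.
  by rewrite mulrAC et' mulrC mulKf.
 have relt x : - la * (q2 th1.[x] th2.[x] * et.[x]) + 3 * (c.[x] * q3 th1.[x] th2.[x]) = 0.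
  by have := congr1 (fun p : {poly K} => p.[x]) rel; rewrite !hornerE Q2E Q3E.
 have etE x : q2 th1.[x] th2.[x] != 0 -> et.[x] = 3 * c.[x] * q3 th1.[x] th2.[x] / (la * q2 th1.[x] th2.[x]).
  move=> qx; apply: (mulIf (mulf_neq0 la0 qx)); rewrite divfK ?mulf_neq0 //.
  by apply/eqP; rewrite -subr_eq0 -oppr_eq0; apply/eqP; rewrite -[RHS](relt x); ring.
 have q2r : q2 th1.[s] th2.[s] = r ^+ 2 * q2 th1.[t] th2.[t] by rewrite r1 r2 /q2; ring.
 have q3r : q3 th1.[s] th2.[s] = r ^+ 3 * q3 th1.[t] th2.[t] by rewrite r1 r2 /q3; ring.
 have r0 : r != 0 by apply: contraNneq qs => z; rewrite q2r z expr0n mul0r.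
 have Yst : cub T (X s) = (c.[s] * r / c.[t]) *: cub T (X t).
  rewrite !YE (etE s qs) (etE t qt) q2r q3r r1 r2; apply/rowP => i; rewrite !mxE; field.
  by rewrite ct0 la0 qt r0.
 have [r' er] := bir_inj B hs Yst.
 have e1 : c.[s] = r' * c.[t].
  have := congr1 (fun x => det4 o x v2 d) er; rewrite !Xd -!scaleNr !(det4D2, det4Z2) !(det4_12, det4_23) => e1.
  apply: (mulfI n3); apply: (mulIf hdd); apply/eqP; rewrite -subr_eq0 -oppr_eq0; apply/eqP.
  by move/eqP: e1; rewrite -subr_eq0 => /eqP e1; rewrite -[RHS]e1; ring.
 have e2 : c.[s] * s = r' * c.[t] * t.
  have := congr1 (fun x => det4 o v1 x d) er; rewrite !Xd -!scaleNr !(det4D3, det4Z3) !(det4_13, det4_23) => e2.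
  apply: (mulfI n3); apply: (mulIf hdd); apply/eqP; rewrite -subr_eq0 -oppr_eq0; apply/eqP.
  by move/eqP: e2; rewrite -subr_eq0 => /eqP e2; rewrite -[RHS]e2; ring.
 by apply: (mulfI cs0); rewrite e2 e1.
have rel2 : - la *: (Q2 m1 m2 * et) + 3 *: (c * G * Q3 m1 m2) = 0.
 apply: (mulfI (expf_neq0 2 G0)); rewrite mulr0 -[RHS]rel Q2G Q3G.
 by apply: poly_ext => t; rewrite !(hornerE, horner_exp) /=; ring.
have coe : coprimep c et.
 apply: coprime_noroot => // t ct; rewrite etd !(hornerE, horner_exp) /= ct ?expr0n !(mul0r, mulr0) addr0 => /eqP.
 by rewrite expf_eq0 /= => /eqP; apply: nor.
have sl s : (size (m2 - s *: m1)%R <= 2)%N.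
 by rewrite (leq_trans (size_polyD _ _)) // geq_max sm2 size_polyN (leq_trans (size_scale_leq _ _)).
(* [c] divides [Q2 m1 m2 * et] by [rel2] and is prime to [et], so it divides [Q2 m1 m2], whose
   degree is at most 2. *)
have [nu nu0 Qnu] : exists2 nu, nu != 0 & Q2 m1 m2 = nu *: c.
 have dv : c %| Q2 m1 m2.
  rewrite -(Gauss_dvdpl _ coe).
  have -> : Q2 m1 m2 * et = (3 / la) *: (c * G * Q3 m1 m2).
   apply: (scalerI la0); apply/eqP; rewrite -subr_eq0 -oppr_eq0; apply/eqP; rewrite -[RHS]rel2.
   by apply: poly_ext => t; rewrite !hornerE /=; field.
  by rewrite dvdpZr ?mulf_neq0 ?invr_eq0 // -mulrA dvdp_mulIl.
 have sQ : (size (Q2 m1 m2) <= 3)%N.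
  rewrite Q2d (leq_trans (size_scale_leq _ _)) // (leq_trans (size_polyMleq _ _)) //.
  by rewrite -subn1 leq_subLR; exact: leq_add (sl s1) (sl s2).
 move: dv => /dvdpP[q eq]; have q0 : q != 0 by apply: contraNneq Qm0 => z; rewrite eq z mul0r.
 move: sQ; rewrite eq size_mul // sc addn3 /= !ltnS => sq.
 exists q`_0; last by rewrite {1}(size1_polyC (leq_trans sq _)) // mul_polyC.
 by rewrite -polyC_eq0 -(size1_polyC (leq_trans sq _)).
have etG : et = (3 / (la * nu)) *: (G * Q3 m1 m2).
 apply: (mulfI c0); apply: (scalerI (mulf_neq0 la0 nu0)); apply/eqP; rewrite -subr_eq0 -oppr_eq0; apply/eqP; rewrite -[RHS]rel2 Qnu.
 by apply: poly_ext => t; rewrite !hornerE /=; field; rewrite la0 nu0.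
have Qs3 : size (Q2 m1 m2) = 3%N by rewrite Qnu size_scale.
have sf s : s \in [:: s1; s2] -> size (m2 - s *: m1)%R = 2%N.
 have nz1 : m2 - s1 *: m1 != 0 by apply: contraNneq Qm0 => z; rewrite Q2d z mul0r scaler0.
 have nz2 : m2 - s2 *: m1 != 0 by apply: contraNneq Qm0 => z; rewrite Q2d z mulr0 scaler0.
 move: Qs3; rewrite Q2d size_scale // size_mul //.
 have := sl s1; have := sl s2; rewrite !inE => l2 l1 e /orP[/eqP->|/eqP->]; apply/eqP; rewrite eqn_leq ?l1 ?l2 /=.
  rewrite ltnNge; apply/negP => le; have := leq_add le l2; move: e; by case: (_ + _)%N => [|[|[|[|]]]].
 rewrite ltnNge; apply/negP => le; have := leq_add l1 le; move: e; by case: (_ + _)%N => [|[|[|[|]]]].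
have k2E z : (3 *: poly_quad S n b0 b1 b2).[z] = - la * q2 1 z.
 by rewrite hornerZ poly_quadE -K2E scale1r.
have k3E z : (poly_cub S n b1 b2).[z] = q3 1 z by rewrite poly_cubE q3E scale1r.
have k2c : 3 *: poly_quad S n b0 b1 b2 = - la *: c.
 by apply: poly_ext => t; rewrite k2E hornerZ cE.
split=> //; rewrite k2c; split.
- by rewrite size_scale ?oppr_eq0.
- rewrite coprimepZl ?oppr_eq0 //; apply: coprime_noroot => // z cz kz.
 have zs : z \in [:: s1; s2].
  by move/eqP: cz; rewrite ec hss !mulf_eq0 (negPf A20) /= !subr_eq0 !inE.
 have /closed_rootP[t0] : size (m2 - z *: m1)%R != 1%N by rewrite sf.
 rewrite /root !hornerE subr_eq0 => /eqP m20.
 have ct0 : c.[t0] = 0.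
  have := Q2E m1 m2 t0; rewrite Qnu hornerZ m20 => e; apply: (mulfI nu0); rewrite mulr0 e.
  transitivity (m1.[t0] ^+ 2 * q2 1 z); first by rewrite /q2; ring.
  by rewrite -cE cz mulr0.
 have et0 : et.[t0] = 0.
  rewrite etG hornerZ hornerM Q3E m20; transitivity (3 / (la * nu) * (G.[t0] * (m1.[t0] ^+ 3 * q3 1 z))).
   by rewrite /q3; ring.
  by rewrite -k3E kz !mulr0.
 move: et0; rewrite etd !(hornerE, horner_exp) /= ct0 ?expr0n !(mul0r, mulr0) addr0 => /eqP.
 by rewrite expf_eq0 /= => /eqP; apply: nor.
(* After division by [G] the image point has coordinates (e0, c2 m1, c2 m2); the last witness
   excludes the zeros of [G], of [c], and of [h] along the curve. *)
exists ((3 / (la * nu)) *: Q3 m1 m2), m1, m2, (G * (c * HX)).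
split=> //.
- have s3 (x y z : {poly K}) : (size x <= 2)%N -> (size y <= 2)%N -> (size z <= 2)%N -> (size (x * y * z)%R <= 4)%N.
  move=> hx hy hz; rewrite (leq_trans (size_polyMleq _ _)) // -subn1 leq_subLR.
  have hxy : (size (x * y)%R <= 3)%N by rewrite (leq_trans (size_polyMleq _ _)) // -subn1 leq_subLR; exact: leq_add hx hy.
  exact: leq_add hxy hz.
 rewrite (leq_trans (size_scale_leq _ _)) // Q3d; do 3?[rewrite (leq_trans (size_polyD _ _)) // geq_max; apply/andP; split];
  rewrite (leq_trans (size_scale_leq _ _)) // ?[_ ^+ 3]exprSr ?[_ ^+ 2]expr2 ?mulrA; exact: s3.
- by rewrite !mulf_neq0.
split.
- move=> t; rewrite !hornerM !mulf_eq0 !negb_or -hHX => /andP[gt /andP[ct ht]].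
 exists (pev h (X t) / G.[t] ^+ 3); split; first by rewrite mulf_neq0 // invr_eq0 expf_neq0.
 have YG : cub T (X t) = G.[t] *: (((3 / (la * nu)) *: Q3 m1 m2).[t] *: b0
   + ((3 *: c).[t] * m1.[t]) *: b1 + ((3 *: c).[t] * m2.[t]) *: b2).
  rewrite YE etG dth1 dth2 !hornerE /=; vring.
 have := bir_cub B (X t); rewrite YG cubZ => e.
 apply: (scalerI (expf_neq0 3 gt)); rewrite e scalerA mulrCA mulfV ?expf_neq0 // mulr1.
 by rewrite Xd hornerZ.
- apply/eqP => z; have := Qs3; have := com; rewrite z coprime0p -size_poly_eq1 => /eqP s1'.
 rewrite Q2d !scaler0 !subr0 size_scale // size_mul ?s1' //; rewrite -size_poly_eq0 s1' //.
- move=> z; apply/eqP => /eqP; rewrite subr_eq0 => /eqP e.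
 have := Qs3; have := com; rewrite e => co'.
 have sz1 : (size m1 <= 1)%N.
  have [z0|z0] := eqVneq z 0.
   by move: co'; rewrite z0 scale0r coprimep0 -size_poly_eq1 => /eqP->.
  by move: co'; rewrite coprimepZr // coprimepp => /eqP->.
 have : (size (Q2 m1 (z *: m1)) <= 1)%N.
  by rewrite (size1_polyC sz1) Q2d -!mul_polyC -!polyCM -!polyCB -!polyCM size_polyC_leq1.
 by move=> s3 s3'; rewrite s3' in s3.
exists (- (3 / (la * nu))).
 by rewrite oppr_eq0 mulf_neq0 // invr_eq0 mulf_neq0.
move=> t z mz.
have cnu : nu * c.[t] = m1.[t] ^+ 2 * q2 1 z.
 rewrite -hornerZ -Qnu Q2E mz /q2; ring.
split.
- by rewrite hornerZ Q3E mz k3E /q3; ring.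
- rewrite !hornerZ (cE z); apply: (mulfI nu0); transitivity (3 * m1.[t] * (nu * c.[t])); first by ring.
 by rewrite cnu; field; rewrite la0 nu0.
- rewrite !hornerZ (cE z) mz; apply: (mulfI nu0); transitivity (3 * m1.[t] * z * (nu * c.[t])); first by ring.
 by rewrite cnu; field; rewrite la0 nu0.
Qed.

End Bir.
End NodalSection.

(** * Linear syzygies over a plane *)

Section Syzygies.
Variable K : numClosedFieldType.
Notation V := ('rV[K]_4).

(** m2 / m1 is not constant, so a general parameter avoids the finitely many fibres over roots of
    p. *)
Lemma rational_dense (m1 m2 N p : {poly K}) : m1 != 0 -> N != 0 -> (forall z, m2 - z *: m1 != 0) ->
 (forall t, N.[t] != 0 -> m1.[t] != 0 -> p.[m2.[t] / m1.[t]] = 0) -> p = 0.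
Proof.
move=> m10 N0 nc hp; apply/eqP/negPn/negP => p0; have [s hs] := poly_roots p0.
have q0 : m1 * N * \prod_(z <- s) (m2 - z *: m1) != 0.
 by rewrite !mulf_neq0 //; elim/big_rec: _ => [|z q _ q0]; rewrite ?oner_neq0 // mulf_neq0.
have [t] := poly_nonroot q0; rewrite !hornerM !mulf_eq0 !negb_or -andbA => /and3P[t1 t2].
rewrite horner_prod => /negP; apply.
have zs := hs _ (hp t t2 t1); rewrite (big_rem _ zs) /= !hornerE; apply/eqP.
by rewrite divfK // subrr mul0r.
Qed.

Lemma kernel_rows m n k (A : 'M[K]_(m, n)) : (k + n <= m)%N -> exists2 N : 'M_(k, m), N *m A = 0 & row_free N.
Proof.
move=> le; have rk : (k <= \rank (kermx A))%N.
 by rewrite mxrank_ker leq_subRL ?(leq_trans (rank_leq_col _)) //; have := rank_leq_col A; lia.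
exists (pid_mx k *m row_base (kermx A)).
 by apply/sub_kermxP; rewrite (submx_trans (submxMl _ _)) // eq_row_base.
rewrite /row_free mxrankMfree ?row_base_free // rank_pid_mx //.
Qed.

Lemma dual3 (a b c d : V) : det4 a b c d != 0 -> exists x0 x1 x2 : V,
 [/\ dot x0 a = 1, dot x0 b = 0 & dot x0 c = 0] /\ [/\ dot x1 a = 0, dot x1 b = 1 & dot x1 c = 0] /\
 [/\ dot x2 a = 0, dot x2 b = 0 & dot x2 c = 1].
Proof.
move=> hd; pose D := (det4 a b c d)^-1.
exists (- D *: cross b c d), (D *: cross a c d), (- D *: cross a b d).
rewrite !dotZl !dot_cross !(det4_14, det4_24, det4_34) (det4_swap34 b c a d) (det4_swap23 b a c d).
rewrite (det4_swap12 a b c d) (det4_swap34 a c b d) (det4_swap23 a b c d) (det4_swap34 a b c d) !opprK !mulr0 !mulNr !mulrN !opprK /D mulVf //.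
Qed.

Lemma cub_pencil (S : symtri K) (d b0 b1 b2 : V) (y p z : K) :
 dot d (cub S (y *: b0 + p *: (b1 + z *: b2))) = y ^+ 3 * dot d (cub S b0)
  + y ^+ 2 * p * (3 *: poly_lin S d b0 b1 b2).[z] + y * p ^+ 2 * (3 *: poly_quad S d b0 b1 b2).[z]
  + p ^+ 3 * (poly_cub S d b1 b2).[z].
Proof.
rewrite cubD !cubZ !hornerZ poly_linE poly_quadE poly_cubE !stZ1 !stZ2 !stZ3 !dotDr !dotZr; ring.
Qed.

Section Bir.
Variables (f g : 'I_4 -> {mpoly K[4]}) (h k : {mpoly K[4]}).
Hypothesis B : bir f g h k.
Notation T := (pol f).
Notation S := (pol g).

(** Orthogonality to g(y) is first imposed along the nodal cubic only, where it becomes 5 linear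
    equations in 8 unknowns. By [nodal_quartic] the defect on the plane is then a linear form times
    the equation of the curve, and multiples of [n] absorb it. *)
Lemma plane_syzygies o v1 v2 : pev h o != 0 -> rho T o v1 v2 != 0 ->
 let b0 := T o o o in let b1 := T o o v1 in let b2 := T o o v2 in
 exists n0 n1 n2 : 'I_3 -> V,
 (forall i y0 y1 y2, dot (y0 *: n0 i + y1 *: n1 i + y2 *: n2 i) (cub S (y0 *: b0 + y1 *: b1 + y2 *: b2)) = 0) /\
 (forall l : 'I_3 -> K, \sum_i l i *: n0 i = 0 -> \sum_i l i *: n1 i = 0 -> \sum_i l i *: n2 i = 0 -> forall i, l i = 0).
Proof.
move=> ho hr; have /= := nodal_section B ho hr; rewrite /=.
name b0 E0 := (T o o o).
name b1 E1 := (T o o v1).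
name b2 E2 := (T o o v2).
rewrite -E0 -E1 -E2.
name a Ea := (cross b0 b1 b2).
name n En := (cross o v1 v2).
rewrite -Ea -En.
name c2 Ec2 := (3 *: poly_quad T a o v1 v2).
name c3 Ec3 := (poly_cub T a v1 v2).
name k2 Ek2 := (3 *: poly_quad S n b0 b1 b2).
name k3 Ek3 := (poly_cub S n b1 b2).
rewrite -Ec2 -Ec3 -Ek2 -Ek3.
have sc2 : (size c2 <= 3)%N by rewrite Ec2 (leq_trans (size_scale_leq _ _)) // size_poly_quad.
have sc3 : (size c3 <= 4)%N by rewrite Ec3 size_poly_cub.
have sk3 : (size k3 <= 4)%N by rewrite Ek3 size_poly_cub.
move=> [[a0 n0 s000 s001 s002]] [sk2 cok [e0 [m1 [m2 [N [se0 sm1 sm2 N0 [hN m10 nc [r r0 hz]]]]]]]].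
have [v3 hv] : exists d, det4 o v1 v2 d != 0 by apply: cross_basis; rewrite -En.
have [x0 [x1 [x2 [[x00 x01 x02] [[x10 x11 x12] [x20 x21 x22]]]]]] := dual3 hv.
have no : dot n o = 0 by rewrite En dot_cross det4_14.
have nv1 : dot n v1 = 0 by rewrite En dot_cross det4_24.
have nv2 : dot n v2 = 0 by rewrite En dot_cross det4_34.
(* [Bij] is the value at the i-th of o, v1, v2 of the j-th coefficient. [B00] is absent because
   g(b0) is a multiple of o, which forces it to be 0; this also lets a factor [c2] be divided out of
   the relation. *)
have key B01 B02 B10 B11 B12 B20 B21 B22 :
  (forall t, B01 * (c3.[t] * m1.[t]) + B02 * (c3.[t] * m2.[t]) - B10 * e0.[t] - B20 * (t * e0.[t])
    - B11 * (c2.[t] * m1.[t]) - B12 * (c2.[t] * m2.[t]) - B21 * (t * (c2.[t] * m1.[t])) - B22 * (t * (c2.[t] * m2.[t])) = 0) ->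
  exists p0 p1 p2 : V, [/\ forall y0 y1 y2, dot (y0 *: p0 + y1 *: p1 + y2 *: p2) (cub S (y0 *: b0 + y1 *: b1 + y2 *: b2)) = 0,
   [/\ dot p0 v1 = B10 & dot p0 v2 = B20], [/\ dot p1 o = B01, dot p1 v1 = B11 & dot p1 v2 = B21]
   & [/\ dot p2 o = B02, dot p2 v1 = B12 & dot p2 v2 = B22]].
 move=> rel.
 have [G GE] : exists G : V -> K -> K -> K -> K, forall d y p z, G d y p z = dot d (cub S (y *: b0 + p *: (b1 + z *: b2))) by eexists.
 have [E EE] : exists E : K -> K -> K -> K, forall y p z, E y p z = y * (B10 * G x1 y p z + B20 * G x2 y p z)
   + p * ((B01 + B02 * z) * G x0 y p z + (B11 + B12 * z) * G x1 y p z + (B21 + B22 * z) * G x2 y p z) by eexists.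
 have [F0 F0E] : exists F : V -> K, forall d, F d = dot d (cub S b0) by eexists.
 have [F1 F1E] : exists F : V -> {poly K}, forall d, F d = 3 *: poly_lin S d b0 b1 b2 by eexists.
 have [F2 F2E] : exists F : V -> {poly K}, forall d, F d = 3 *: poly_quad S d b0 b1 b2 by eexists.
 have [F3 F3E] : exists F : V -> {poly K}, forall d, F d = poly_cub S d b1 b2 by eexists.
 have GF d y p z : G d y p z = y ^+ 3 * F0 d + y ^+ 2 * p * (F1 d).[z] + y * p ^+ 2 * (F2 d).[z] + p ^+ 3 * (F3 d).[z].
  by rewrite GE cub_pencil F0E F1E F2E F3E.
 have s1 d : (size (F1 d) <= 2)%N by rewrite F1E (leq_trans (size_scale_leq _ _)) // size_poly_lin.
 have s2 d : (size (F2 d) <= 3)%N by rewrite F2E (leq_trans (size_scale_leq _ _)) // size_poly_quad.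
 have s3 d : (size (F3 d) <= 4)%N by rewrite F3E size_poly_cub.
 have [Lm LE] : exists L : K -> K -> {poly K}, forall b c, L b c = b%:P + c *: 'X by eexists.
 have Lz b c z : (Lm b c).[z] = b + c * z by rewrite LE !hornerE.
 have sL b c : (size (Lm b c) <= 2)%N.
  rewrite LE (leq_trans (size_polyD _ _)) // geq_max (leq_trans (size_polyC_leq1 _)) //=.
  by rewrite (leq_trans (size_scale_leq _ _)) // size_polyX.
 have sD q (p p' : {poly K}) : (size p <= q)%N -> (size p' <= q)%N -> (size (p + p')%R <= q)%N.
  by move=> hp hp'; rewrite (leq_trans (size_polyD _ _)) // geq_max hp.
 have sM q b c (p : {poly K}) : (size p <= q)%N -> (size (Lm b c * p)%R <= q.+1)%N.
  move=> hp; rewrite (leq_trans (size_polyMleq _ _)) // -subn1 leq_subLR.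
  exact: leq_add (sL b c) hp.
 have sZ q c (p : {poly K}) : (size p <= q)%N -> (size (c *: p)%R <= q)%N.
  by move=> hp; rewrite (leq_trans (size_scale_leq _ _)).
 name ep0 ep0E := ((B10 * F0 x1 + B20 * F0 x2)%:P).
 have [ep1 ep1E] : exists p : {poly K}, p = B10 *: F1 x1 + B20 *: F1 x2
   + (F0 x0 *: Lm B01 B02 + F0 x1 *: Lm B11 B12 + F0 x2 *: Lm B21 B22) by eexists.
 have [ep2 ep2E] : exists p : {poly K}, p = B10 *: F2 x1 + B20 *: F2 x2
   + (Lm B01 B02 * F1 x0 + Lm B11 B12 * F1 x1 + Lm B21 B22 * F1 x2) by eexists.
 have [ep3 ep3E] : exists p : {poly K}, p = B10 *: F3 x1 + B20 *: F3 x2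
   + (Lm B01 B02 * F2 x0 + Lm B11 B12 * F2 x1 + Lm B21 B22 * F2 x2) by eexists.
 name ep4 ep4E := (Lm B01 B02 * F3 x0 + Lm B11 B12 * F3 x1 + Lm B21 B22 * F3 x2).
 have Eep y p z : E y p z = y ^+ 4 * ep0.[z] + y ^+ 3 * p * ep1.[z] + y ^+ 2 * p ^+ 2 * ep2.[z]
   + y * p ^+ 3 * ep3.[z] + p ^+ 4 * ep4.[z].
  by rewrite EE !GF ep0E ep1E ep2E ep3E ep4E !hornerE /= !Lz; ring.
 (* The quartic [E] along the parametrization (-k3, k2, k2 z) of the nodal cubic; its vanishing is
    checked at z = m2 / m1 and spread by [rational_dense]. *)
 have PZ : k3 ^+ 4 * ep0 - k3 ^+ 3 * k2 * ep1 + k3 ^+ 2 * k2 ^+ 2 * ep2 - k3 * k2 ^+ 3 * ep3 + k2 ^+ 4 * ep4 = 0.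
  apply: (rational_dense m10 N0 nc) => t nt mt.
  have mz : m2.[t] = m2.[t] / m1.[t] * m1.[t] by rewrite divfK.
  name z Ez := (m2.[t] / m1.[t]).
  rewrite -Ez in mz *; have [h1 h2 h3] := hz t z mz.
  transitivity (E (- k3.[z]) k2.[z] z); first by rewrite Eep !(hornerE, horner_exp) /=; ring.
  have [q [q0 hq]] := hN t nt.
  name ka Eka := (r * m1.[t] ^+ 3).
  have ka0 : ka != 0 by rewrite Eka mulf_neq0 // expf_neq0.
  have Yq : cub S ((- k3.[z]) *: b0 + k2.[z] *: (b1 + z *: b2)) = (q / ka ^+ 3) *: (c3.[t] *: o - c2.[t] *: (v1 + t *: v2)).
   apply: (scalerI (expf_neq0 3 ka0)); rewrite scalerA mulrCA mulfV ?expf_neq0 // mulr1 -hq -cubZ; congr (cub S _).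
   by rewrite h1 h2 h3 -Eka; vring.
  rewrite EE !GE Yq !dotZr !dotDr !dotNr !dotZr !dotDr !dotZr x00 x01 x02 x10 x11 x12 x20 x21 x22.
  apply: (mulfI ka0); transitivity (q / ka ^+ 3 * ((ka * - k3.[z]) * (- B10 * c2.[t] - B20 * (c2.[t] * t))
   + (ka * k2.[z]) * (B01 * c3.[t] - B11 * c2.[t] - B21 * (c2.[t] * t))
   + (ka * k2.[z] * z) * (B02 * c3.[t] - B12 * c2.[t] - B22 * (c2.[t] * t)))); first by ring.
  have g1 : ka * - k3.[z] = e0.[t] by rewrite h1 -Eka; ring.
  have g2 : ka * k2.[z] = c2.[t] * m1.[t] by rewrite h2 -Eka.
  have g3 : ka * k2.[z] * z = c2.[t] * m2.[t] by rewrite h3 -Eka.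
  rewrite g3 g1 g2; transitivity (q / ka ^+ 3 * (c2.[t] * 0)); last by ring.
  by rewrite -(rel t); ring.
 have [] := nodal_quartic sk2 sk3 cok _ _ _ _ PZ.
 - by rewrite ep0E size_polyC_leq1.
 - by rewrite ep1E; do !apply: (sD); apply: sZ.
 - by rewrite ep2E; do !apply: (sD); try apply: sZ; try apply: sM.
 - by rewrite ep3E; do !apply: (sD); try apply: sZ; try apply: sM.
 move=> z0 z1 [al [l [sl l2 l3 l4]]].
 have El y p z : E y p z = (al * y + p * l.[z]) * G n y p z.
  rewrite Eep z0 z1 l2 l3 l4 GF F0E F1E F2E F3E -Ek2 -Ek3 s000 hornerZ poly_linE stD3 stZ3 dotDr dotZr s001 s002.
  by rewrite !(hornerE, horner_exp) /=; ring.
 have lE z : l.[z] = l`_0 + l`_1 * z.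
  by rewrite (horner_coef_wide _ sl) !big_ord_recl big_ord0 /= expr0 mulr1 expr1 addr0.
 exists (B10 *: x1 + B20 *: x2 - al *: n), (B01 *: x0 + B11 *: x1 + B21 *: x2 - l`_0 *: n),
  (B02 *: x0 + B12 *: x1 + B22 *: x2 - l`_1 *: n); split.
 - move=> y0 y1 y2; have [W WE] : exists W : K -> V, forall t, W t = y0 *: b0 + t *: b1 + y2 *: b2 by eexists.
  have pW : pvec (fun t : K^o => W t).
   have -> : (fun t : K^o => W t) = fun t => y0 *: b0 + t *: b1 + y2 *: b2 by apply: functional_extensionality => t; apply: WE.
   by apply: pvecD; [apply: pvecD|]; [apply: pvec_const|apply: pvecZ; [apply: pfun_K|apply: pvec_const]|apply: pvec_const].
  rewrite -WE; have := @pfun_dense _ K^o (fun t => dot (y0 *: (B10 *: x1 + B20 *: x2 - al *: n) +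
   t *: (B01 *: x0 + B11 *: x1 + B21 *: x2 - l`_0 *: n) + y2 *: (B02 *: x0 + B12 *: x1 + B22 *: x2 - l`_1 *: n)) (cub S (W t))) (fun t => t).
  apply.
  + apply: pfun_dot; last exact: pvec_cub.
   by polynomial.
  + exact: pfun_K.
  + by exists 1; rewrite oner_neq0.
  move=> t t0; have zt : y2 = t * (y2 / t) by rewrite mulrC divfK.
  have eW : W t = y0 *: b0 + t *: (b1 + (y2 / t) *: b2) by rewrite WE scalerDr scalerA -zt addrA.
  have := El y0 t (y2 / t); rewrite EE !GE -eW lE => /eqP; rewrite -subr_eq0 => /eqP e.
  by rewrite -[RHS]e {1}zt !(dotDl, dotNl, dotZl); ring.
 - by rewrite !dotDl !dotNl !dotZl x11 x12 x21 x22 nv1 nv2; split; ring.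
 - by rewrite !dotDl !dotNl !dotZl x00 x01 x02 x10 x11 x12 x20 x21 x22 no nv1 nv2; split; ring.
 - by rewrite !dotDl !dotNl !dotZl x00 x01 x02 x10 x11 x12 x20 x21 x22 no nv1 nv2; split; ring.
pose P := [:: c3 * m1; c3 * m2; - e0; - ('X * e0); - (c2 * m1); - (c2 * m2); - ('X * (c2 * m1)); - ('X * (c2 * m2))].
have sP i : (size (P`_i)%R <= 5)%N.
 have sM (p q : {poly K}) i1 i2 : (size p <= i1)%N -> (size q <= i2)%N -> (i1 + i2 <= 6)%N -> (size (p * q)%R <= 5)%N.
  move=> hp hq hi; rewrite (leq_trans (size_polyMleq _ _)) // -subn1 leq_subLR.
  exact: leq_trans (leq_add hp hq) hi.
 have sX (p : {poly K}) : (size p <= 4)%N -> (size ('X * p)%R <= 5)%N.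
  by move=> hp; apply: (sM _ _ 2%N 4%N); rewrite ?size_polyX.
 have s4 (p : {poly K}) : (size p <= 2)%N -> (size (c2 * p)%R <= 4)%N.
  move=> hp; rewrite (leq_trans (size_polyMleq _ _)) // -subn1 leq_subLR; exact: leq_add sc2 hp.
 case: i => [|[|[|[|[|[|[|[|i]]]]]]]]; rewrite /P /= ?size_polyN ?nth_nil ?size_poly0 //.
 - exact: sM sc3 sm1 _.
 - exact: sM sc3 sm2 _.
 - exact: leq_trans se0 _.
 - exact: sX.
 - exact: leq_trans (s4 _ sm1) _.
 - exact: leq_trans (s4 _ sm2) _.
 - by apply: sX; apply: s4.
 - by apply: sX; apply: s4.
(* Eight polynomials of degree at most 4 have at least three independent linear relations. *)
have [Be hBe fBe] := @kernel_rows 8 5 3 (\matrix_(i, j) (P`_i)`_j) isT.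
have rel i t : \sum_j Be i j * (P`_j).[t] = 0.
 transitivity ((Be *m (\matrix_(i < 8, j < 5) (P`_i)`_j) *m (\col_(j < 5) t ^+ j)) i 0).
  rewrite -mulmxA mxE; apply: eq_bigr => j _; congr (_ * _); rewrite mxE (horner_coef_wide _ (sP j)).
  by apply: eq_bigr => l _; rewrite !mxE.
 by rewrite hBe mul0mx mxE.
have rel8 i t : Be i (inord 0) * (c3.[t] * m1.[t]) + Be i (inord 1) * (c3.[t] * m2.[t]) - Be i (inord 2) * e0.[t] - Be i (inord 3) * (t * e0.[t])
    - Be i (inord 4) * (c2.[t] * m1.[t]) - Be i (inord 5) * (c2.[t] * m2.[t]) - Be i (inord 6) * (t * (c2.[t] * m1.[t])) - Be i (inord 7) * (t * (c2.[t] * m2.[t])) = 0.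
 rewrite -[RHS](rel i t); transitivity (\sum_(j < 8) Be i (inord j) * (P`_j).[t]); last first.
  by apply: eq_bigr => j _; rewrite inord_val.
 rewrite -(big_mkord xpredT (fun j => Be i (inord j) * (P`_j).[t])) /index_iota /= !big_cons big_nil /= !hornerE /=.
 by ring.
have [n0' hn0] : exists n0 : 'I_3 -> V * V * V, forall i, let: (p0, p1, p2) := n0 i in
  [/\ forall y0 y1 y2, dot (y0 *: p0 + y1 *: p1 + y2 *: p2) (cub S (y0 *: b0 + y1 *: b1 + y2 *: b2)) = 0,
   [/\ dot p0 v1 = Be i (inord 2) & dot p0 v2 = Be i (inord 3)], [/\ dot p1 o = Be i (inord 0), dot p1 v1 = Be i (inord 4) & dot p1 v2 = Be i (inord 6)]
   & [/\ dot p2 o = Be i (inord 1), dot p2 v1 = Be i (inord 5) & dot p2 v2 = Be i (inord 7)]].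
 apply: (fin_all_exists (P := fun i (n : V * V * V) => let: (p0, p1, p2) := n in _)) => i.
 by have [p0 [p1 [p2 hp]]] := key _ _ _ _ _ _ _ _ (rel8 i); exists (p0, p1, p2).
exists (fun i => (n0' i).1.1), (fun i => (n0' i).1.2), (fun i => (n0' i).2); split=> [i|l l0 l1 l2 i].
 by have := hn0 i; case: (n0' i) => [[p0 p1] p2] [].
have lBe : (\row_i l i) *m Be = 0.
 have z d (n' : 'I_3 -> V) (b : 'I_3 -> K) : (forall i, dot (n' i) d = b i) -> \sum_i l i *: n' i = 0 -> \sum_i l i * b i = 0.
  move=> hb e; transitivity (dot (\sum_i l i *: n' i) d); last by rewrite e dot0l.
  rewrite (big_morph (fun x => dot x d) (fun x y => dotDl x y d) (dot0l d)).
  by apply: eq_bigr => i' _; rewrite dotZl hb.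
 apply/rowP => j; rewrite !mxE; under eq_bigr => i' _ do rewrite mxE.
 have cs : \sum_i' l i' * Be i' j = 0 <-> \sum_i' l i' * Be i' (inord j) = 0 by rewrite inord_val.
 apply/cs; case: j {cs} => -[|[|[|[|[|[|[|[|//]]]]]]]] hj /=.
 - by apply: (z o _ _ _ l1) => i'; have := hn0 i'; case: (n0' i') => [[p0 p1] p2] [] /= _ [? ?] [-> _ _] _.
 - by apply: (z o _ _ _ l2) => i'; have := hn0 i'; case: (n0' i') => [[p0 p1] p2] [] /= _ [? ?] _ [-> _ _].
 - by apply: (z v1 _ _ _ l0) => i'; have := hn0 i'; case: (n0' i') => [[p0 p1] p2] [] /= _ [-> ?] _ _.
 - by apply: (z v2 _ _ _ l0) => i'; have := hn0 i'; case: (n0' i') => [[p0 p1] p2] [] /= _ [? ->] _ _.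
 - by apply: (z v1 _ _ _ l1) => i'; have := hn0 i'; case: (n0' i') => [[p0 p1] p2] [] /= _ [? ?] [_ -> _] _.
 - by apply: (z v1 _ _ _ l2) => i'; have := hn0 i'; case: (n0' i') => [[p0 p1] p2] [] /= _ [? ?] _ [_ -> _].
 - by apply: (z v2 _ _ _ l1) => i'; have := hn0 i'; case: (n0' i') => [[p0 p1] p2] [] /= _ [? ?] [_ _ ->] _.
 - by apply: (z v2 _ _ _ l2) => i'; have := hn0 i'; case: (n0' i') => [[p0 p1] p2] [] /= _ [? ?] _ [_ _ ->].
have : \row_i l i = 0 by apply: (row_free_inj fBe); rewrite mul0mx.
by move=> /rowP/(_ i); rewrite !mxE.
Qed.

End Bir.
End Syzygies.

(** * From plane syzygies to a determinantal form *)

Section Gluing.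
Variable K : numClosedFieldType.
Notation V := ('rV[K]_4).

Lemma pfun_normq (W : lmodType K) (p0 p1 p2 r0 r1 r2 r3 : W -> K) : pfun p0 -> pfun p1 -> pfun p2 ->
 pfun r0 -> pfun r1 -> pfun r2 -> pfun r3 ->
 pfun (fun w => normq (p0 w) (p1 w) (p2 w) (r0 w) (r1 w) (r2 w) (r3 w)).
Proof. by move=> *; polynomial.
Qed.

Lemma pfun_rho (W : lmodType K) (T : symtri K) (o v1 v2 : W -> V) : pvec o -> pvec v1 -> pvec v2 ->
 pfun (fun w => rho T (o w) (v1 w) (v2 w)).
Proof.
move=> Po P1 P2.
have Pd (F : W -> V) : pvec F -> pfun (fun w => dot (cross (T (o w) (o w) (o w)) (T (o w) (o w) (v1 w)) (T (o w) (o w) (v2 w))) (F w)) by move=> *; polynomial.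
by apply: pfun_normq; do ?[apply: pfunM; first exact: pfun_const]; apply: Pd; (apply: pvec_st || apply: pvec_cub).
Qed.

(** Nonzero exactly when the image of the line <u, v> is a twisted cubic: the four vectors are, up
    to binomial factors, the coefficients of its parametrization. *)
Definition twist (S : symtri K) (u v : V) := det4 (S u u u) (S u u v) (S u v v) (S v v v).

Lemma pfun_twist (W : lmodType K) (S : symtri K) (u v : W -> V) : pvec u -> pvec v -> pfun (fun w => twist S (u w) (v w)).
Proof. by move=> *; polynomial.
Qed.

Lemma twistZ (S : symtri K) r u v : twist S (r *: u) v = r ^+ 6 * twist S u v.
Proof. rewrite /twist !stZ1 !stZ2 !stZ3 !(det4Z1, det4Z2, det4Z3, det4Z4); ring. Qed.

Section Twisted.
Variables (S : symtri K) (b0 b1 : V).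
Hypothesis tw : twist S b0 b1 != 0.

(** The five coefficients of a quartic in y0, y1 vanish. The first one makes m0 orthogonal to
    [S b0 b0 b0]; once m0 is known, the others give all values of m1 on a basis. *)
Lemma twisted_syzygy (m0 m1 : V) :
 (forall y0 y1, dot (y0 *: m0 + y1 *: m1) (cub S (y0 *: b0 + y1 *: b1)) = 0) ->
 dot m0 (S b0 b0 b0) = 0 /\
 (dot m0 (S b0 b0 b1) = 0 -> dot m0 (S b0 b1 b1) = 0 -> dot m0 (S b1 b1 b1) = 0 -> m0 = 0 /\ m1 = 0).
Proof.
move=> e.
have n3 : 3 != 0 :> K by rewrite pnatr_eq0.
have := @horner_rec_eq0 K [:: dot m0 (S b0 b0 b0); 3 * dot m0 (S b0 b0 b1) + dot m1 (S b0 b0 b0);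
  3 * (dot m0 (S b0 b1 b1) + dot m1 (S b0 b0 b1)); dot m0 (S b1 b1 b1) + 3 * dot m1 (S b0 b1 b1);
  dot m1 (S b1 b1 b1)].
case/(_ _)/Wrap => [t|h].
 rewrite -[RHS](e 1 t) !scale1r cubD cubZ !stZ2 !stZ3 !(dotDl, dotDr, dotZl, dotZr) /cub /=; ring.
have h0 := h 0; have h1 := h 1; have h2 := h 2; have h3 := h 3; have h4 := h 4; rewrite /= in h0 h1 h2 h3 h4.
split=> // z1 z2 z3; rewrite z1 mulr0 add0r in h1; rewrite z3 add0r in h3.
have q1 : dot m1 (S b0 b0 b1) = 0 by move/eqP: h2; rewrite z2 add0r mulf_eq0 (negPf n3) => /eqP.
have q2 : dot m1 (S b0 b1 b1) = 0 by move/eqP: h3; rewrite mulf_eq0 (negPf n3) => /eqP.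
have Z m : dot m (S b0 b0 b0) = 0 -> dot m (S b0 b0 b1) = 0 -> dot m (S b0 b1 b1) = 0 -> dot m (S b1 b1 b1) = 0 -> m = 0.
 by move=> r0 r1 r2 r3; apply: (basis_dot_ext tw); rewrite dot0r dotC.
by split; apply: Z.
Qed.

Lemma twisted_span (m : V) : (forall y0 y1, dot m (cub S (y0 *: b0 + y1 *: b1)) = 0) -> m = 0.
Proof.
move=> e; have h (y0 y1 : K) : dot (y0 *: m + y1 *: 0) (cub S (y0 *: b0 + y1 *: b1)) = 0.
 by rewrite scaler0 addr0 dotZl e mulr0.
have h' (y0 y1 : K) : dot (y0 *: 0 + y1 *: m) (cub S (y0 *: b0 + y1 *: b1)) = 0.
 by rewrite scaler0 add0r dotZl e mulr0.
by have [_ []] := twisted_syzygy h'; rewrite ?dot0l.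
Qed.

End Twisted.

Section Bir.
Variables (f g : 'I_4 -> {mpoly K[4]}) (h k : {mpoly K[4]}).
Hypothesis B : bir f g h k.
Notation T := (pol f).
Notation S := (pol g).

Lemma bir_basis o v1 v2 v3 : pev h o != 0 -> det4 o v1 v2 v3 != 0 ->
 det4 (T o o o) (T o o v1) (T o o v2) (T o o v3) != 0.
Proof.
move=> ho hd; have ind2 (a b c d : V) : indep2 a b -> det4 a b c d = 0 -> cross a b c = 0 \/ cross a b c != 0 /\ dot (cross a b c) d = 0.
 by move=> _ e; have [->|n0] := eqVneq (cross a b c) 0; [left|right; rewrite dot_cross].
have gen y : exists x, y = det4 x v1 v2 v3 *: T o o o + det4 o x v2 v3 *: T o o v1 + det4 o v1 x v3 *: T o o v2 + det4 o v1 v2 x *: T o o v3.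
 have [v hv] := bir_dsurj B ((det4 o v1 v2 v3)^-1 *: y) ho; exists v.
 by rewrite -!stZ3 -!stD3 -cramer4 stZ3 hv scalerA mulfV // scale1r.
have i1 := bir_indep_tangent B ho (det4_indep2 hd).
have n0 : cross (T o o o) (T o o v1) (T o o v2) != 0.
 apply/eqP => /(indep2_cross i1)[s [t e]].
 have z : T o o (v2 - (s *: o + t *: v1)) = 0.
  by rewrite stD3 -scaleN1r stZ3 stD3 !stZ3 e scaleN1r subrr.
 have /eqP := bir_dinj B ho z; rewrite subr_eq0 => /eqP e2.
 by case/eqP: hd; rewrite e2 det4D3 !det4Z3 det4_13 det4_23 !mulr0 addr0.
apply/eqP => e; have [y hy] := dot_neq0 n0; have [x ex] := gen y.
by case/eqP: hy; rewrite ex !dotDr !dotZr !dot_cross e det4_14 det4_24 det4_34 !mulr0 !addr0.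
Qed.

(** Restriction to the line <b0, b1> is injective on plane syzygies: if m0 = m1 = 0, then m2 is
    orthogonal to a twisted cubic, hence zero. So the three-dimensional space from [plane_syzygies]
    realizes every choice of the three values. *)
Lemma plane_syzygy_target o v1 v2 t1 t2 t3 : pev h o != 0 -> rho T o v1 v2 != 0 ->
 let b0 := T o o o in let b1 := T o o v1 in let b2 := T o o v2 in twist S b0 b1 != 0 ->
 exists m0 m1 m2,
 (forall y0 y1 y2, dot (y0 *: m0 + y1 *: m1 + y2 *: m2) (cub S (y0 *: b0 + y1 *: b1 + y2 *: b2)) = 0) /\
 [/\ dot m0 (S b0 b0 b1) = t1, dot m0 (S b0 b1 b1) = t2 & dot m0 (S b1 b1 b1) = t3].
Proof.
move=> ho hr /= tw; have /= [n0 [n1 [n2 [hn ind]]]] := plane_syzygies B ho hr.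
move: hn tw; have [b0 ->] : exists b, T o o o = b by eexists.
have [b1 ->] : exists b, T o o v1 = b by eexists.
have [b2 ->] : exists b, T o o v2 = b by eexists.
move=> hn tw.
have dsum (l : 'I_3 -> K) (n : 'I_3 -> V) x : dot (\sum_i l i *: n i) x = \sum_i l i * dot (n i) x.
 rewrite (big_morph (fun y => dot y x) (fun y z => dotDl y z x) (dot0l x)).
 by apply: eq_bigr => i' _; rewrite dotZl.
have hl (l : 'I_3 -> K) y0 y1 y2 : dot (y0 *: (\sum_i l i *: n0 i) + y1 *: (\sum_i l i *: n1 i) + y2 *: (\sum_i l i *: n2 i))
  (cub S (y0 *: b0 + y1 *: b1 + y2 *: b2)) = 0.
 rewrite !dotDl !dotZl !dsum !mulr_sumr -!big_split big1 // => i _ /=.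
 by transitivity (l i * 0); [rewrite -(hn i y0 y1 y2) !dotDl !dotZl; ring|rewrite mulr0].
pose c (j : 'I_3) := nth 0 [:: S b0 b0 b1; S b0 b1 b1; S b1 b1 b1] j.
pose A := \matrix_(i, j) dot (n0 i) (c j).
have uA : A \in unitmx.
 rewrite -row_free_unit -kermx_eq0; apply/eqP/row_matrixP => r; rewrite row0.
 have uA0 : row r (kermx A) *m A = 0 by rewrite -row_mul mulmx_ker row0.
 move: (row r (kermx A)) uA0 => u uA0.
 have zc (j : 'I_3) : dot (\sum_i u 0 i *: n0 i) (c j) = 0.
  rewrite dsum; have := congr1 (fun M : 'rV_3 => M 0 j) uA0; rewrite !mxE => e; rewrite -[RHS]e.
  by apply: eq_bigr => i _; rewrite mxE.
 have [] := @twisted_syzygy S b0 b1 tw (\sum_i u 0 i *: n0 i) (\sum_i u 0 i *: n1 i).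
  by move=> y0 y1; have := hl (u 0) y0 y1 0; rewrite !scale0r !addr0.
 move=> _ /(_ (zc (@Ordinal 3 0 isT)) (zc (@Ordinal 3 1 isT)) (zc (@Ordinal 3 2 isT)))[z0 z1].
 have z2 : \sum_i u 0 i *: n2 i = 0.
  apply: (twisted_span tw) => y0 y1.
  have H (t : K^o) : dot (\sum_i u 0 i *: n2 i) (cub S (y0 *: b0 + y1 *: b1 + t *: b2)) = 0.
   move: t; apply: (@pfun_dense _ K^o _ (fun t => t)).
   - by polynomial.
   - exact: pfun_K.
   - by exists 1; rewrite oner_neq0.
   move=> t t0; have := hl (u 0) y0 y1 t; rewrite z0 z1 !scaler0 !add0r dotZl => /eqP.
   by rewrite mulf_eq0 (negPf t0) => /eqP.
  by have := H 0; rewrite scale0r addr0.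
 by apply/rowP => i; rewrite (ind _ z0 z1 z2) mxE.
have [u hu] : exists u : 'rV_3, u *m A = \row_j nth 0 [:: t1; t2; t3] j.
 by exists ((\row_j nth 0 [:: t1; t2; t3] j) *m invmx A); rewrite mulmxKV.
exists (\sum_i u 0 i *: n0 i), (\sum_i u 0 i *: n1 i), (\sum_i u 0 i *: n2 i); split; first exact: hl.
have tc (j : 'I_3) : dot (\sum_i u 0 i *: n0 i) (c j) = nth 0 [:: t1; t2; t3] j.
 rewrite dsum; have := congr1 (fun M : 'rV_3 => M 0 j) hu; rewrite !mxE => e; rewrite -[RHS]e.
 by apply: eq_bigr => i _; rewrite mxE.
by split; [exact: (tc (@Ordinal 3 0 isT))|exact: (tc (@Ordinal 3 1 isT))|exact: (tc (@Ordinal 3 2 isT))].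
Qed.

(** Plane syzygies with the same three values agree on the common line <b0, b1>, and in each plane
    through it the remaining coefficient is unique and linear in the direction of the plane. The
    linear extension [C] from two directions therefore works on a general plane, hence
    everywhere. *)
Lemma syzygy_target o v1 v2 v3 t1 t2 t3 : pev h o != 0 -> det4 o v1 v2 v3 != 0 ->
 rho T o v1 v2 != 0 -> rho T o v1 v3 != 0 -> 
 let b0 := T o o o in let b1 := T o o v1 in twist S b0 b1 != 0 ->
 exists N : 'M[K]_4, (forall y, dot (y *m N) (cub S y) = 0) /\
 [/\ dot (b0 *m N) (S b0 b0 b1) = t1, dot (b0 *m N) (S b0 b1 b1) = t2 & dot (b0 *m N) (S b1 b1 b1) = t3].
Proof.
move=> ho hd hr2 hr3 /= tw.
have target v : rho T o v1 v != 0 -> _ := fun hr => plane_syzygy_target t1 t2 t3 ho hr tw.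
have hb := bir_basis ho hd.
move: hb tw target; have [b0 ->] : exists b, T o o o = b by eexists.
have [b1 ->] : exists b, T o o v1 = b by eexists.
have [bb bE] : exists b : V -> V, forall v, b v = T o o v by eexists.
rewrite -!bE => hb tw target.
have [m0 [m1 [m2 [h2 [e1 e2 e3]]]]] := target _ hr2; rewrite -bE in h2.
have uniq v : rho T o v1 v != 0 -> exists m, forall y0 y1 y2, dot (y0 *: m0 + y1 *: m1 + y2 *: m) (cub S (y0 *: b0 + y1 *: b1 + y2 *: bb v)) = 0.
 move=> /target[p0 [p1 [m [hp [f1 f2 f3]]]]]; rewrite -bE in hp.
 have [] := @twisted_syzygy S b0 b1 tw (p0 - m0) (p1 - m1).
  move=> y0 y1; have := hp y0 y1 0; have := h2 y0 y1 0; rewrite !scale0r !addr0 => g2 gp.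
  transitivity (0 - 0 : K); last by rewrite subr0.
  by rewrite -{1}gp -g2 !dotDl !dotZl !dotDl !dotNl; ring.
 rewrite !dotDl !dotNl e1 e2 e3 f1 f2 f3 !subrr => _ []// /eqP; rewrite subr_eq0 => /eqP u0 /eqP.
 by rewrite subr_eq0 => /eqP u1; exists m; rewrite -u0 -u1.
have [m3 h3] := uniq _ hr3.
pose D := (det4 b0 b1 (bb v2) (bb v3))^-1.
pose C y := D *: (det4 y b1 (bb v2) (bb v3) *: m0 + det4 b0 y (bb v2) (bb v3) *: m1
  + det4 b0 b1 y (bb v3) *: m2 + det4 b0 b1 (bb v2) y *: m3).
have [N hN] : exists N : 'M[K]_4, forall y, C y = y *m N.
 apply: linear_matrix => [x y|r x]; rewrite /C ?(det4D1, det4D2, det4D3, det4D4) ?(det4Z1, det4Z2, det4Z3, det4Z4); by vring.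
have C0 : b0 *m N = m0.
 by rewrite -hN /C !(det4_12, det4_13, det4_14) !scale0r !addr0 scalerA mulVf // scale1r.
have C1 : b1 *m N = m1.
 by rewrite -hN /C !(det4_12, det4_23, det4_24) !scale0r !addr0 add0r scalerA mulVf // scale1r.
have C2 : bb v2 *m N = m2.
 by rewrite -hN /C !(det4_13, det4_23, det4_34) !scale0r !addr0 !add0r scalerA mulVf // scale1r.
have C3 : bb v3 *m N = m3.
 by rewrite -hN /C !(det4_14, det4_24, det4_34) !scale0r !add0r scalerA mulVf // scale1r.
have bD s t x y : bb (s *: x + t *: y) = s *: bb x + t *: bb y by rewrite !bE stD3 !stZ3.
(* The first-order term in [s]: it prescribes [m] on the twisted cubic g(w), which spans, by values
   linear in [d]. *)
have lin1 (w d m : V) : (forall s, dot (w *m N + s *: m) (cub S (w + s *: d)) = 0) ->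
  3 * dot (w *m N) (S w w d) + dot m (cub S w) = 0.
 move=> e; have := @horner_rec_eq0 K [:: dot (w *m N) (cub S w); 3 * dot (w *m N) (S w w d) + dot m (cub S w);
  3 * (dot (w *m N) (S w d d) + dot m (S w w d)); dot (w *m N) (S d d d) + 3 * dot m (S w d d); dot m (S d d d)].
 case/(_ _)/Wrap => [t|/(_ 1%N)//].
 rewrite -[RHS](e t) cubD cubZ !stZ2 !stZ3 !(dotDl, dotDr, dotZl, dotZr) /cub /=; ring.
have Lv s t y0 y1 : let w := y0 *: b0 + y1 *: b1 in let d := bb (s *: v2 + t *: v3) in
  3 * dot (w *m N) (S w w d) + dot (d *m N) (cub S w) = 0.
 move=> w d; have wN : w *m N = y0 *: m0 + y1 *: m1 by rewrite mulmxDl -!scalemxAl C0 C1.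
 have l2 : 3 * dot (w *m N) (S w w (bb v2)) + dot m2 (cub S w) = 0 by apply: lin1 => r; rewrite wN; apply: h2.
 have l3 : 3 * dot (w *m N) (S w w (bb v3)) + dot m3 (cub S w) = 0 by apply: lin1 => r; rewrite wN; apply: h3.
 transitivity (s * 0 + t * 0 : K); last by rewrite !mulr0 addr0.
 have dN : d *m N = s *: m2 + t *: m3 by rewrite /d bD mulmxDl -!scalemxAl C2 C3.
 by rewrite dN -{1}l2 -l3 /d bD stD3 !stZ3 !(dotDl, dotDr, dotZl, dotZr); ring.
exists N; split; last by rewrite C0.
pose s y := det4 b0 b1 y (bb v3) * D; pose t y := det4 b0 b1 (bb v2) y * D.
apply: (@pfun_dense _ V _ (fun y => rho T o v1 (s y *: v2 + t y *: v3))).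
- by apply: pfun_dot; [apply: pvec_lin (mulmxr N)|apply: pvec_cub; apply: pvec_id].
- apply: pfun_rho; [apply: pvec_const|apply: pvec_const|].
 by apply: pvecD; apply: pvecZ; [|exact: pvec_const| |exact: pvec_const]; (apply: pfunM; last exact: pfun_const);
   apply: pfun_det4; (exact: pvec_const || exact: pvec_id).
- by exists (bb v2); rewrite /s /t det4_34 mul0r scale0r addr0 mulfV // scale1r.
move=> y /uniq[m hm]; set v := _ + _ in hm.
have em : m = bb v *m N.
 apply/eqP; rewrite -subr_eq0; apply/eqP; apply: (twisted_span tw) => y0 y1.
 have l1 : 3 * dot ((y0 *: b0 + y1 *: b1) *m N) (S (y0 *: b0 + y1 *: b1) (y0 *: b0 + y1 *: b1) (bb v)) + dot m (cub S (y0 *: b0 + y1 *: b1)) = 0.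
  by apply: lin1 => r; rewrite mulmxDl -!scalemxAl C0 C1; apply: hm.
 have /= l2 := Lv (s y) (t y) y0 y1; rewrite -/v in l2.
 rewrite dotDl dotNl; transitivity (0 - 0 : K); last by rewrite subrr.
 by rewrite -{1}l1 -l2; ring.
have ey : y = (det4 y b1 (bb v2) (bb v3) * D) *: b0 + (det4 b0 y (bb v2) (bb v3) * D) *: b1 + 1 *: bb v.
 have dD x : det4 b0 b1 (bb v2) (bb v3) * (x * D) = x by rewrite mulrCA mulfV ?mulr1.
 by apply: (scalerI hb); rewrite cramer4 /v bD scale1r !scalerDr !scalerA /s /t !dD addrA.
have := hm (det4 y b1 (bb v2) (bb v3) * D) (det4 b0 y (bb v2) (bb v3) * D) 1.
by rewrite -ey em -C0 -C1 !scalemxAl -!mulmxDl -ey.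
Qed.

End Bir.

(** Where the three linear syzygies are independent, they determine f(x) up to a scalar as their
    [cross]. *)
Definition det_form (f : 'I_4 -> {mpoly K[4]}) := exists N1 N2 N3 : 'M[K]_4,
 (exists x, cross (x *m N1) (x *m N2) (x *m N3) != 0) /\
 forall x, [/\ dot (x *m N1) (cub (pol f) x) = 0, dot (x *m N2) (cub (pol f) x) = 0 & dot (x *m N3) (cub (pol f) x) = 0].

Lemma cross_dep (a b c : V) : cross a b c = 0 -> exists s t r, (s != 0) || (t != 0) || (r != 0) /\ s *: a + t *: b + r *: c = 0.
Proof.
move=> e; have [ind|nind] := classic (indep2 a b).
 have [s [t ->]] := indep2_cross ind e; exists s, t, (-1); rewrite oppr_eq0 oner_neq0 !orbT scaleN1r subrr //.
apply: NNPP => nh; apply: nind => s t st; apply: NNPP => nz; apply: nh; exists s, t, 0.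
rewrite scale0r addr0 eqxx orbF; split=> //; apply/negPn/negP; rewrite negb_or !negbK => /andP[/eqP s0 /eqP t0].
exact: nz.
Qed.

Lemma common_kernel (a b y : V) : y != 0 -> exists y1, indep2 y y1 /\ dot a y1 = 0 /\ dot b y1 = 0.
Proof.
move=> /basis1[u [v [w hd]]].
have [N hN fN] := @kernel_rows K 3 2 1 (\matrix_(i, j) dot (nth 0 [:: a; b] j) (nth 0 [:: u; v; w] i)) isT.
name s Es := (N 0 (inord 0)).
name t Et := (N 0 (inord 1)).
name r Er := (N 0 (inord 2)).
have hz (j : 'I_2) : dot (nth 0 [:: a; b] j) (s *: u + t *: v + r *: w) = 0.
 have := congr1 (fun M : 'rV_2 => M 0 j) hN; rewrite !mxE => e; rewrite -[RHS]e !dotDr !dotZr.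
 transitivity (\sum_(i < 3) N 0 (inord i) * dot (nth 0 [:: a; b] j) (nth 0 [:: u; v; w] i)); last first.
  by apply: eq_bigr => i _; rewrite mxE inord_val.
 by rewrite !big_ord_recl big_ord0 /= -Es -Et -Er addr0 addrA.
exists (s *: u + t *: v + r *: w); split; last by split; [exact: (hz (@Ordinal 2 0 isT))|exact: (hz (@Ordinal 2 1 isT))].
move=> al be e.
have a0 : al = 0.
 have := congr1 (fun x => det4 x u v w) e; rewrite !(det4D1, det4Z1) !(det4_12, det4_13, det4_14) det4_01 !(mulr0, addr0, add0r) => /eqP.
 by rewrite mulf_eq0 (negPf hd) orbF => /eqP.
split=> //; apply/eqP/negPn/negP => be0.
move: e; rewrite a0 scale0r add0r => /eqP; rewrite scaler_eq0 (negPf be0) /= => /eqP e.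
have s0 : s = 0.
 have := congr1 (fun x => det4 y x v w) e; rewrite !(det4D2, det4Z2) !(det4_23, det4_24) det4_02 !(mulr0, addr0, add0r) => /eqP.
 by rewrite mulf_eq0 (negPf hd) orbF => /eqP.
have t0 : t = 0.
 have := congr1 (fun x => det4 y u x w) e; rewrite !(det4D3, det4Z3) !(det4_23, det4_34) det4_03 !(mulr0, addr0, add0r) => /eqP.
 by rewrite mulf_eq0 (negPf hd) orbF => /eqP.
have r0 : r = 0.
 have := congr1 (fun x => det4 y u v x) e; rewrite !(det4D4, det4Z4) !(det4_24, det4_34) det4_04 !(mulr0, addr0, add0r) => /eqP.
 by rewrite mulf_eq0 (negPf hd) orbF => /eqP.
have N0 : N = 0.
 apply/matrixP => i j; rewrite ord1 mxE -[j]inord_val; case: j => -[|[|[|//]]] hj /=; [by rewrite -Es|by rewrite -Et|by rewrite -Er].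
by move: fN; rewrite N0 /row_free mxrank0.
Qed.

(** Three dependent forms have a common kernel of dimension at least 2, so it leaves the line of
    [y]. *)
Lemma cross_zero_kernel (a b c y : V) : cross a b c = 0 -> y != 0 ->
 exists y1, indep2 y y1 /\ [/\ dot a y1 = 0, dot b y1 = 0 & dot c y1 = 0].
Proof.
move=> /cross_dep[s [t [r [nz e]]]] y0.
have ez x : s * dot a x + t * dot b x + r * dot c x = 0 by rewrite -!dotZl -!dotDl e dot0l.
have [r0|r0] := eqVneq r 0; last first.
 have [x [ix [xa xb]]] := common_kernel a b y0; exists x; split=> //; split=> //.
 by have /eqP := ez x; rewrite xa xb !mulr0 !add0r mulf_eq0 (negPf r0) => /eqP.
have [t0|t0] := eqVneq t 0; last first.
 have [x [ix [xa xb]]] := common_kernel a c y0; exists x; split=> //; split=> //.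
 by have /eqP := ez x; rewrite xa xb !mulr0 addr0 add0r mulf_eq0 (negPf t0) => /eqP.
have [x [ix [xa xb]]] := common_kernel b c y0; exists x; split=> //; split=> //.
move: nz; rewrite r0 t0 !eqxx !orbF => s0.
by have /eqP := ez x; rewrite xa xb !mulr0 !addr0 mulf_eq0 (negPf s0) => /eqP.
Qed.

Section Generic.
Variables (f g : 'I_4 -> {mpoly K[4]}) (h k : {mpoly K[4]}).
Hypothesis B : bir f g h k.
Notation T := (pol f).
Notation S := (pol g).

Lemma glue_data : (exists o v1 v2, rho T o v1 v2 != 0) -> (exists u v, twist S u v != 0) ->
 exists o v1 v2 v3, [/\ pev h o != 0, det4 o v1 v2 v3 != 0, rho T o v1 v2 != 0, rho T o v1 v3 != 0 &
  twist S (T o o o) (T o o v1) != 0].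
Proof.
move=> [o [v1 [v2 hr]]] [u0 [u1 hu]].
have [o' [v1' htw]] : exists o' v1', twist S (T o' o' o') (T o' o' v1') != 0.
 have [y0 hy0] := bir_h_ex (bir_sym B).
 have [w [hk tw]] : exists w, pev k w != 0 /\ twist S w u1 != 0.
  apply: (@pfun_nonzero2 _ V _ _ y0 u0) => //; first by polynomial.
  by polynomial.
 have hh := bir_h_comp_neq0 B hk.
 have [v hv] := bir_dsurj B u1 hh; exists (cub S w), v.
 by rewrite hv -/(cub T (cub S w)) (bir_cub (bir_sym B)) twistZ mulf_neq0 // expf_neq0.
have [x hx] := bir_h_ex B.
pose W : lmodType K := (V * V * V * V)%type.
have P1 : pvec (fun w : W => w.1.1.1) by polynomial.
have P2 : pvec (fun w : W => w.1.1.2) by polynomial.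
have P3 : pvec (fun w : W => w.1.2) by polynomial.
have P4 : pvec (fun w : W => w.2) by polynomial.
have F1 : pfun (fun w : W => pev h w.1.1.1) by polynomial.
have F2 : pfun (fun w : W => det4 w.1.1.1 w.1.1.2 w.1.2 w.2) by polynomial.
have F3 : pfun (fun w : W => rho T w.1.1.1 w.1.1.2 w.1.2) by apply: pfun_rho.
have F4 : pfun (fun w : W => rho T w.1.1.1 w.1.1.2 w.2) by apply: pfun_rho.
have F5 : pfun (fun w : W => twist S (T w.1.1.1 w.1.1.1 w.1.1.1) (T w.1.1.1 w.1.1.1 w.1.1.2)).
 by apply: pfun_twist; apply: pvec_st.
have [o0 hor] : exists o0 : V, o0 != 0 by exists x; apply: bir_h_neq0 B _ hx.
have [d1 [d2 [d3 hd]]] := basis1 hor.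
have [w1 [a1 b1]] := @pfun_nonzero2 _ W _ _ (x, 0, 0, 0) (o0, d1, d2, d3) F1 F2 hx hd.
have n1 : pev h w1.1.1.1 * det4 w1.1.1.1 w1.1.1.2 w1.1.2 w1.2 != 0 by rewrite mulf_neq0.
have [w2 [a2 b2]] := @pfun_nonzero2 _ W _ _ w1 (o, v1, v2, v2) (pfunM F1 F2) F3 n1 hr.
have n2 := mulf_neq0 a2 b2.
have [w3 [a3 b3]] := @pfun_nonzero2 _ W _ _ w2 (o, v1, v2, v2) (pfunM (pfunM F1 F2) F3) F4 n2 hr.
have n3 := mulf_neq0 a3 b3.
have [w4 [a4 b4]] := @pfun_nonzero2 _ W _ _ w3 (o', v1', 0, 0) (pfunM (pfunM (pfunM F1 F2) F3) F4) F5 n3 htw.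
exists w4.1.1.1, w4.1.1.2, w4.1.2, w4.2; split=> //; move: a4; rewrite !mulf_eq0 !negb_or => /andP[/andP[/andP[? ?] ?] ?] //.
Qed.

(** Syzygies of g with the three unit vectors as prescribed values are independent at b0, and their
    transposes are syzygies of f because f inverts g. If the latter were dependent everywhere, g
    would take the same value at b0 and at another general point. *)
Lemma nodal_det_form : (exists o v1 v2, rho T o v1 v2 != 0) -> (exists u v, twist S u v != 0) -> det_form f.
Proof.
move=> hr ht; have [o [v1 [v2 [v3 [ho hd r2 r3 tw]]]]] := glue_data hr ht.
have [N1 [s1 [e11 e12 e13]]] := syzygy_target B 1 0 0 ho hd r2 r3 tw.
have [N2 [s2 [e21 e22 e23]]] := syzygy_target B 0 1 0 ho hd r2 r3 tw.
have [N3 [s3 [e31 e32 e33]]] := syzygy_target B 0 0 1 ho hd r2 r3 tw.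
have kb : pev k (T o o o) != 0 by apply: (bir_h_comp_neq0 (bir_sym B)).
move: e11 e12 e13 e21 e22 e23 e31 e32 e33 tw kb; set b0 := T o o o; set b1 := T o o v1.
move=> e11 e12 e13 e21 e22 e23 e31 e32 e33 tw kb.
have b00 : b0 != 0 by apply: bir_h_neq0 (bir_sym B) _ kb.
have n0 : cross (b0 *m N1) (b0 *m N2) (b0 *m N3) != 0.
 apply/eqP => /cross_dep[s [t [r [nz e]]]].
 have ez x : s * dot (b0 *m N1) x + t * dot (b0 *m N2) x + r * dot (b0 *m N3) x = 0 by rewrite -!dotZl -!dotDl e dot0l.
 have := ez (S b0 b0 b1); have := ez (S b0 b1 b1); have := ez (S b1 b1 b1).
 rewrite e11 e12 e13 e21 e22 e23 e31 e32 e33 !mulr0 !mulr1 !addr0 !add0r => r0 t0 s0.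
 by move: nz; rewrite r0 s0 t0 !eqxx.
have tr (N : 'M[K]_4) x y : dot (x *m N^T) y = dot (y *m N) x.
 rewrite !dotE !mxE !sum4 !mxE; ring.
have tz (N : 'M[K]_4) : (forall y, dot (y *m N) (cub S y) = 0) -> forall x, dot (x *m N^T) (cub T x) = 0.
 move=> hN; have [x0 hx0] := bir_h_ex B.
 apply: (@pfun_dense _ V _ (fun x => pev h x)); [|by polynomial|by exists x0|].
  by apply: pfun_dot; [apply: pvec_lin (mulmxr N^T)|apply: pvec_cub; apply: pvec_id].
 move=> x hx; have := hN (cub T x); rewrite (bir_cub B) dotZr => /eqP; rewrite mulf_eq0 (negPf hx) /= => /eqP.
 by rewrite tr.
exists N1^T, N2^T, N3^T; split; last by move=> x; split; apply: tz.
apply: NNPP => nx; have cz x : cross (x *m N1^T) (x *m N2^T) (x *m N3^T) = 0.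
 by apply/eqP/negPn/negP => h0; apply: nx; exists x.
(* Along [y1] the pairing with g(b0) vanishes; then g(b0) and g(b0 + t y1) are both orthogonal to
   the three independent forms at b0 + t y1. *)
have [y1 [iy [z1 z2 z3]]] := cross_zero_kernel (cz (cub S b0)) b00.
rewrite !tr in z1 z2 z3.
pose c t := cross ((b0 + t *: y1) *m N1) ((b0 + t *: y1) *m N2) ((b0 + t *: y1) *m N3).
have [x0 hx0] := dot_neq0 n0.
have pN (N : 'M[K]_4) : pvec (fun t : K^o => (b0 + t *: y1) *m N).
 have -> : (fun t : K^o => (b0 + t *: y1) *m N) = fun t => b0 *m N + t *: (y1 *m N).
  by apply: functional_extensionality => t; rewrite mulmxDl -scalemxAl.
 by polynomial.
have [t [h1 h2]] : exists t : K^o, dot (c t) x0 * pev k (b0 + t *: y1) != 0 /\ t != 0.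
 apply: (@pfun_nonzero2 _ K^o _ _ 0 1); [| exact: pfun_K| |exact: oner_neq0].
  by polynomial.
 by rewrite /c scale0r addr0 mulf_neq0.
move: h1; rewrite mulf_eq0 negb_or => /andP[hc hk].
have ct : c t != 0 by apply: contraNneq hc => ->; rewrite dot0l.
have sb (N : 'M[K]_4) : (forall y, dot (y *m N) (cub S y) = 0) -> dot (y1 *m N) (cub S b0) = 0 ->
  dot (cub S b0) ((b0 + t *: y1) *m N) = 0.
 by move=> hN hz; rewrite dotC mulmxDl -scalemxAl dotDl dotZl hN hz mulr0 addr0.
have [r1 er1] := cross_unique ct (sb _ s1 z1) (sb _ s2 z2) (sb _ s3 z3).
have [r2' er2] := cross_unique ct (etrans (dotC _ _) (s1 _)) (etrans (dotC _ _) (s2 _)) (etrans (dotC _ _) (s3 _)).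
have r10 : r1 != 0.
 by apply: contraNneq (bir_cub_neq0 (bir_sym B) kb) => z; rewrite er1 z scale0r.
have [r er] : exists r, b0 + t *: y1 = r *: b0.
 by apply: (@bir_inj _ _ _ _ _ (bir_sym B) _ _ (r2' / r1)) => //; rewrite er1 scalerA divfK.
have [_ t0] : 1 - r = 0 /\ t = 0.
 by apply: iy; rewrite scalerBl scale1r addrAC er subrr.
by rewrite t0 eqxx in h2.
Qed.

End Generic.
End Gluing.

(** * Forms as functions, and common prime factors of families *)

Section HomogFunctions.
Variable K : numClosedFieldType.
Notation V := ('rV[K]_4).
Notation P4 := {mpoly K[4]}.

Definition hfun d (F : V -> K) := exists2 p : P4, p \is d.-homog & forall x, F x = pev p x.
Definition hvec d (F : V -> V) := forall i, hfun d (fun x => F x 0 i).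

Lemma hfun_ext d (F G : V -> K) : F =1 G -> hfun d F -> hfun d G.
Proof. by move=> e [p hp h]; exists p => // x; rewrite -e h. Qed.

Lemma hfunD d F G : hfun d F -> hfun d G -> hfun d (fun x => F x + G x).
Proof. by move=> [p hp eF] [q hq eG]; exists (p + q) => [|x]; rewrite ?rpredD // pevD eF eG. Qed.

Lemma hfunN d F : hfun d F -> hfun d (fun x => - F x).
Proof. by move=> [p hp eF]; exists (- p) => [|x]; rewrite ?rpredN // pevN eF. Qed.

Lemma hfunM d e F G : hfun d F -> hfun e G -> hfun (d + e) (fun x => F x * G x).
Proof. by move=> [p hp eF] [q hq eG]; exists (p * q) => [|x]; rewrite ?dhomogM // pevM eF eG. Qed.

Lemma hfunZ d c F : hfun d F -> hfun d (fun x => c * F x).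
Proof. by move=> [p hp eF]; exists (c *: p) => [|x]; rewrite ?rpredZ // pevZ eF. Qed.

Lemma hfun_const c : hfun 0 (fun _ => c).
Proof. by exists (c%:MP_[4] * 1); [rewrite mul_mpolyC rpredZ // dhomog1|move=> x; rewrite mulr1 pevC]. Qed.

Lemma hfun_dot a : hfun 1 (dot a).
Proof. by exists (lin a) => [|x]; rewrite ?lin_homog // pev_lin. Qed.

Lemma hfun_sum (I : Type) (r : seq I) d (F : I -> V -> K) :
 (forall i, hfun d (F i)) -> hfun d (fun x => \sum_(i <- r) F i x).
Proof.
move=> hF; elim: r => [|i r IH].
 by exists 0 => [|x]; rewrite ?rpred0 // big_nil /pev meval0.
by apply: hfun_ext (hfunD (hF i) IH) => x; rewrite big_cons.
Qed.

Lemma hfun_pfun d F : hfun d F -> pfun F.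
Proof. by move=> [p _ e]; apply: (pfunE (fun x => esym (e x))); apply: pfun_pev; apply: pvec_id. Qed.

Lemma hvec_id : hvec 1 id.
Proof. by move=> i; apply: hfun_ext (hfun_dot (evec K i)) => x; rewrite dotC dot_evec. Qed.

Lemma hvec_const a : hvec 0 (fun _ => a).
Proof. by move=> i; apply: hfun_const. Qed.

Lemma hvecD d F G : hvec d F -> hvec d G -> hvec d (fun x => F x + G x).
Proof. by move=> hF hG i; apply: hfun_ext (hfunD (hF i) (hG i)) => x; rewrite mxE. Qed.

Lemma hvecZ d e c F : hfun d c -> hvec e F -> hvec (d + e) (fun x => c x *: F x).
Proof. by move=> hc hF i; apply: hfun_ext (hfunM hc (hF i)) => x; rewrite mxE. Qed.

Lemma hvec_st (f : 'I_4 -> P4) d1 d2 d3 F1 F2 F3 : hvec d1 F1 -> hvec d2 F2 -> hvec d3 F3 ->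
 hvec (d1 + d2 + d3) (fun x => pol f (F1 x) (F2 x) (F3 x)).
Proof.
move=> h1 h2 h3 i; rewrite -addnA; apply: (@hfun_ext _ (fun x => \sum_a F1 x 0 a * \sum_b F2 x 0 b * \sum_c F3 x 0 c * tens f i a b c)).
 by move=> x; rewrite /= pol_funE.
apply: hfun_sum => a; apply: hfunM => //; apply: hfun_sum => b; apply: hfunM => //; apply: hfun_sum => c.
by rewrite -[d3]addn0; apply: hfunM => //; apply: hfun_const.
Qed.

Lemma hfun_det4 d1 d2 d3 d4 F1 F2 F3 F4 : hvec d1 F1 -> hvec d2 F2 -> hvec d3 F3 -> hvec d4 F4 ->
 hfun (d1 + d2 + d3 + d4) (fun x => det4 (F1 x) (F2 x) (F3 x) (F4 x)).
Proof.
move=> h1 h2 h3 h4; have m2 d e F G i j : hvec d F -> hvec e G -> hfun (d + e) (fun x => minor2 (F x) (G x) i j).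
 by move=> hF hG; apply: hfunD; [|apply: hfunN]; apply: hfunM.
apply: (hfun_ext (fun x => esym (det4E _ _ _ _))); rewrite -addnA.
by do !apply: hfunD; try apply: hfunN; apply: hfunM; apply: m2.
Qed.

Lemma hvec_cross d1 d2 d3 F1 F2 F3 : hvec d1 F1 -> hvec d2 F2 -> hvec d3 F3 ->
 hvec (d1 + d2 + d3) (fun x => cross (F1 x) (F2 x) (F3 x)).
Proof.
move=> h1 h2 h3 i; apply: (hfun_ext (fun x => esym (crossE _ _ _ _))); rewrite -[(_ + _ + _)%N]addn0.
by apply: hfun_det4 => //; apply: hvec_const.
Qed.

Lemma prime_pencil_root (p : P4) m v1 v2 : rprime p -> p \is m.-homog ->
 exists a b, ((a != 0) || (b != 0)) /\ pev p (a *: v1 + b *: v2) = 0.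
Proof.
move=> [p0 pu _] hp; have [z|nz] := eqVneq (pev p v2) 0.
 by exists 0, 1; rewrite scale0r scale1r add0r oner_neq0 orbT.
apply: NNPP => nh; have [q hq] := pfun_pev p (@pvec_id K 4) v1 v2.
have nr t : q.[t] != 0.
 rewrite -hq; apply/eqP => z; apply: nh; exists 1, t.
 by rewrite scale1r oner_neq0.
have sq : size q == 1%N.
 by apply: contraT => /closed_rootP[t /eqP qt]; have := nr t; rewrite qt eqxx.
have [c ec] : exists c, forall t, q.[t] = c.
 by exists q`_0 => t; rewrite {1}(size1_polyC (eq_leq (eqP sq))) hornerC.
case/eqP: nz; have [m0|mp] := posnP m.
 have := hp; rewrite m0 => /homog0_const e; case/negP: pu; rewrite e; apply: mpolyC_unit.
 by apply: contraNneq p0 => z; rewrite e z mpolyC0.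
have H (s : K^o) : pev p (v2 + s *: v1) - s ^+ m * c = 0.
 move: s; apply: (@pfun_dense _ K^o _ (fun s => s)).
 - apply: pfunB; first by polynomial.
  by polynomial.
 - exact: pfun_K.
 - by exists 1; rewrite oner_neq0.
 move=> s s0; have -> : v2 + s *: v1 = s *: (v1 + s^-1 *: v2) by rewrite scalerDr scalerA mulfV // scale1r addrC.
 by rewrite (pev_homogZ _ _ hp) hq ec subrr.
by have := H 0; rewrite scale0r addr0 expr0n gtn_eqF // mul0r subr0.
Qed.

(** If the forms of a general [p] had no common factor, [elim_center] would put their common zeros
    on a cone with vertex [e], yet these zeros project from [e] onto a dense set. So some prime of
    the fixed form [D] divides all of them; [D] has finitely many primes, so one serves all
    parameters. *)
Lemma pencil_prime (W : lmodType K) k (Phi : W -> 'I_k -> V -> K) (d : 'I_k -> nat) i0 (D : P4) (r : W -> K) :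
 (forall p i, hfun (d i) (Phi p i)) -> (forall i w, pfun (fun p => Phi p i w)) ->
 D != 0 -> D \is (d i0).-homog -> (forall p w, Phi p i0 w = pev D w) ->
 pfun r -> (exists p, r p != 0) ->
 (forall p, r p != 0 -> exists2 e, e != 0 & exists g : V -> K, [/\ pfun g, exists v, g v != 0 &
   forall v, g v != 0 -> exists t, forall i, Phi p i (v + t *: e) = 0]) ->
 exists q m, [/\ rprime q, q \is m.-homog & forall p i w, pev q w = 0 -> Phi p i w = 0].
Proof.
move=> hP pP D0 Dh PD pr [p0 rp0] hz; apply: NNPP => nh.
have [s [sp [u uu eD]]] := factorial_mpoly D0.
have sh q : q \in s -> exists m, q \is m.-homog.
 move=> qs; have e : q * (u * \prod_(y <- rem q s) y) = D by rewrite eD (big_rem q qs) /= mulrCA.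
 by apply: (@homog_factor _ _ q (u * \prod_(y <- rem q s) y) (d i0)); rewrite e.
have [t [pt [p1 tp1] ht]] : exists t : W -> K, [/\ pfun t, exists w, t w != 0 & forall w, t w != 0 ->
  forall q, q \in s -> q \in s -> exists i w', pev q w' = 0 /\ Phi w i w' != 0].
 apply: (@pfun_list _ W _ s (fun q w => q \in s -> exists i w', pev q w' = 0 /\ Phi w i w' != 0)) => q.
 have [qs|nqs] := boolP (q \in s); last first.
  by exists (fun _ => 1); split; [apply: pfun_const|exists 0; rewrite oner_neq0|].
 have [m hm] := sh q qs.
 have [p [i [w [qw pw]]]] : exists p i w, pev q w = 0 /\ Phi p i w != 0.
  apply: NNPP => nn; apply: nh; exists q, m; split=> //; first exact: sp.
  by move=> p i w qw; apply/eqP/negPn/negP => pw; apply: nn; exists p, i, w.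
 by exists (fun p => Phi p i w); split=> // [|p' hp' _]; [exists p|exists i, w].
have [p [tp rp]] := pfun_nonzero2 pt pr tp1 rp0.
have [Q hQ] : exists Q : 'I_k -> P4, forall i, Q i \is (d i).-homog /\ forall x, Phi p i x = pev (Q i) x.
 by apply: (fin_all_exists (P := fun i (q : P4) => q \is (d i).-homog /\ forall x, Phi p i x = pev q x)) => i; have [q q1 q2] := hP p i; exists q.
have QD : Q i0 = D by apply: pev_inj => x; rewrite -(proj2 (hQ i0)) PD.
have nc : ~ coprime_family Q.
 move=> cQ; have [e e0 [g [pg [v gv] hg]]] := hz p rp.
 have [|E [pE [x Ex] Ei Ez]] := elim_center cQ _ e0; first by exists i0; rewrite QD.
 case/eqP: Ex; apply: (pfun_dense pE pg); first by exists v.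
 by move=> w /hg[t' ht']; rewrite -(Ei w t'); apply: Ez => i; rewrite -(proj2 (hQ i)).
apply: nc => q pq hq; have qD : rdvd q D by rewrite -QD.
have [r' rs qr] := mpoly_prime_factor D0 pq qD uu eD sp.
have [i [w [rw /eqP]]] := ht p tp r' rs rs; apply.
have [c ec] := prime_rdvd_assoc pq (sp r' rs) qr; have [c' ec'] := hq i.
by rewrite (proj2 (hQ i)) ec' ec !pevM rw !mul0r.
Qed.

(** Otherwise [zero_set_divisor] makes a prime factor of the linear form divide every [f i]. *)
Lemma plane_not_base (f : 'I_4 -> P4) a : coprime_family f -> a != 0 -> exists2 x, dot a x = 0 & exists i, pev (f i) x != 0.
Proof.
move=> cf a0; apply: NNPP => nh.
have lu : lin a \isn't a GRing.unit.
 apply/negP => /mpoly_unitE[c c0 e]; have := pev_lin a 0; rewrite e pevC dot0r => z.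
 by rewrite z eqxx in c0.
have [|p pp pl] := exists_prime_divisor (@factorial_mpoly _ _) _ lu; first by rewrite lin_eq0.
apply: (cf p pp) => i; apply: zero_set_divisor => // x px; apply/eqP/negPn/negP => fx.
have e : pev p (\row_j x j) = 0 by rewrite /pev -[RHS]px; apply: meval_eq => j; rewrite mxE.
apply: nh; exists (\row_j x j).
 by have [c ec] := pl; rewrite -pev_lin ec pevM e mul0r.
exists i; rewrite /pev (_ : _.@[_] = (f i).@[x]) //; apply: meval_eq => j; by rewrite mxE.
Qed.

End HomogFunctions.

(** * Vanishing [rho]: lines mapped to lines *)

Section RankTwoLines.
Variable K : numClosedFieldType.
Notation V := ('rV[K]_4).
Notation P4 := {mpoly K[4]}.

Lemma hfun_dotv d (b : V) (F : V -> V) : hvec d F -> hfun d (fun x => dot b (F x)).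
Proof.
move=> hF; apply: (hfun_ext (fun x => esym (dotE _ _))).
by do !apply: hfunD; apply: hfunZ; apply: hF.
Qed.

Lemma det4_common (n a b c d : V) : n != 0 -> dot n a = 0 -> dot n b = 0 -> dot n c = 0 -> dot n d = 0 -> det4 a b c d = 0.
Proof.
move=> n0 na nb nc nd; apply/eqP/negPn/negP => hd; case/eqP: n0.
by apply: (basis_dot_ext hd); rewrite dot0r dotC.
Qed.

Section Bir.
Variables (f g : 'I_4 -> P4) (h k : P4).
Hypothesis B : bir f g h k.
Notation T := (pol f).
Notation S := (pol g).

(** A line through [o] in the plane <o, v1, v2> whose image lies on a line. *)
Definition rank2_in o v1 v2 := exists a b, ((a != 0) || (b != 0)) /\ let w := a *: v1 + b *: v2 in
 (exists s t, T o w w = s *: T o o o + t *: T o o w) /\ (exists s t, T w w w = s *: T o o o + t *: T o o w).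

Lemma rho_root o v p : rho T o v p = 0 -> let a := cross (T o o o) (T o o v) (T o o p) in dot a (T o p p) != 0 ->
 exists t, dot a (T o (v + t *: p) (v + t *: p)) = 0 /\ dot a (cub T (v + t *: p)) = 0.
Proof.
rewrite /rho /=; set a := cross _ _ _ => hr a0; have [t [h1 h2]] := normq_eq0 a0 hr; exists t; split.
 by rewrite -[RHS]h1 !stD2 !stD3 !stZ2 !stZ3 (st23 T o v p) !(dotDr, dotZr); ring.
by rewrite -[RHS]h2 cubD cubZ !stZ2 !stZ3 !(dotDr, dotZr); ring.
Qed.

(** For fixed [o], [rho_root] finds in each pencil v + t p a direction w with [T o w w] and
    [T w w w] in the span of [T o o o], [T o o p], [T o o w]. [pencil_prime] turns these zeros into
    one hypersurface independent of p, and varying p leaves the span of [T o o o] and [T o o w]. *)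
Lemma rank2_prime o x0 : (forall v1 v2, rho T o v1 v2 = 0) -> pev h o != 0 -> twist T o x0 != 0 ->
 exists q m, [/\ rprime q, q \is m.-homog & forall w, pev q w = 0 ->
  cross (T o o o) (T o o w) (T o w w) = 0 /\ cross (T o o o) (T o o w) (T w w w) = 0].
Proof.
move=> rz ho hx0.
pose P p w := det4 (T o o o) (T o o p) (T o o w) (T o w w).
pose Q p w := det4 (T o o o) (T o o p) (T o o w) (T w w w).
pose Phi p (i : 'I_3) w := nth 0 [:: P p w; Q p w; twist T o w] i.
have hv3 : hvec 1 (fun w : V => w) := @hvec_id K.
have hc x : hvec 0 (fun _ : V => x) := hvec_const x.
have h1 : hvec 1 (fun w => T o o w) by apply: (hvec_st f (hc o) (hc o) hv3).
have h2 : hvec 2 (fun w => T o w w) by apply: (hvec_st f (hc o) hv3 hv3).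
have h3 : hvec 3 (fun w => T w w w) by apply: (hvec_st f hv3 hv3 hv3).
have [D Dh DE] : hfun 6 (fun w => twist T o w) by apply: (hfun_det4 (hc _) h1 h2 h3).
have D0 : D != 0 by apply: contraNneq hx0 => z; rewrite DE z /pev meval0.
have [||||||||q [m [qp qh hq]]] := @pencil_prime K V 3 Phi (fun i : 'I_3 => nth 0%N [:: 3; 4; 6] i)%N (@Ordinal 3 2 isT) D
  (fun p => det4 (T o o o) (T o o p) (T o p p) (T x0 x0 x0)).
- move=> p; case=> -[|[|[|//]]] hi; rewrite /Phi /=.
 + exact: (hfun_det4 (hc _) (hc _) h1 h2).
 + exact: (hfun_det4 (hc _) (hc _) h1 h3).
 + by exists D.
- move=> [[|[|[|//]]] hi] w; rewrite /Phi /=; last exact: pfun_const.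
 + by polynomial.
 + by polynomial.
- exact: D0.
- exact: Dh.
- by move=> p w; rewrite /Phi /= DE.
- by polynomial.
- by exists x0.
- move=> p hp; have p0 : p != 0 by apply: contraNneq hp => ->; rewrite st03 det4_02.
 exists p => //; exists (fun v => det4 (T o o o) (T o o v) (T o o p) (T o p p)); split.
 + by polynomial.
 + have [v hv] := bir_dsurj B (T x0 x0 x0) ho; exists v; rewrite hv.
  by rewrite det4_swap23 oppr_eq0 det4_swap34 oppr_eq0.
 move=> v hv; have av : dot (cross (T o o o) (T o o v) (T o o p)) (T o p p) != 0 by rewrite dot_cross.
 have [t [e1 e2]] := rho_root (rz v p) av; exists t.
 set w := v + t *: p in e1 e2 *.
 have Pz x : dot (cross (T o o o) (T o o v) (T o o p)) x = - det4 (T o o o) (T o o p) (T o o w) x.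
  by rewrite dot_cross /w stD3 stZ3 det4D3 det4Z3 det4_23 mulr0 addr0; apply: det4_swap23.
 have z1 : P p w = 0 by apply/eqP; rewrite -oppr_eq0 -Pz e1.
 have z2 : Q p w = 0 by apply/eqP; rewrite -oppr_eq0 -Pz e2.
 case=> -[|[|[|//]]] hi; rewrite /Phi //=.
 have n0 : cross (T o o o) (T o o p) (T o o w) != 0.
  by apply/eqP => z; case/eqP: av; rewrite Pz -dot_cross z dot0l oppr0.
 by apply: (det4_common n0); rewrite dot_cross ?det4_14 ?det4_34.
exists q, m; split=> // w qw; split; apply: dot_ext => x; have [p hp] := bir_dsurj B x ho;
 rewrite dot_cross dot0l -hp det4_swap34 det4_swap23 opprK; [exact: (hq p (@Ordinal 3 0 isT) w qw)|exact: (hq p (@Ordinal 3 1 isT) w qw)].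
Qed.

(** If some line has a twisted cubic image, the directions come from [rank2_prime]. If all images
    are planar, the map is in de Jonquieres form, and on the line found by [rho_root] it is a
    quadric times a linear map. *)
Lemma rank2_family : (forall o v1 v2, rho T o v1 v2 = 0) -> exists G : V -> V -> V -> K,
 [/\ pfun (fun w : V * V * V => G w.1.1 w.1.2 w.2), exists o v1 v2, G o v1 v2 != 0 &
  forall o v1 v2, G o v1 v2 != 0 -> [/\ pev h o != 0, exists x, det4 o v1 v2 x != 0 & rank2_in o v1 v2]].
Proof.
move=> rz; pose W : lmodType K := (V * V * V)%type.
have Fh : pfun (fun w : W => pev h w.1.1) by polynomial.
have [o1 ho1] := bir_h_ex B; have o10 := bir_h_neq0 B ho1; have [d1 [d2 [d3 hd]]] := basis1 o10.
have Fd : pfun (fun w : W => det4 w.1.1 w.1.2 w.2 d3) by polynomial.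
have [w1 /andP w1h] : exists w : W, (pev h w.1.1 != 0) && (det4 w.1.1 w.1.2 w.2 d3 != 0) by exists (o1, d1, d2); rewrite ho1.
have {}w1h : pev h w1.1.1 * det4 w1.1.1 w1.1.2 w1.2 d3 != 0 by have [? ?] := w1h; rewrite mulf_neq0.
have [tw|ntw] := classic (forall u v, twist T u v = 0); last first.
 have [u [x0 hu]] : exists u x0, twist T u x0 != 0.
  apply: NNPP => nh; apply: ntw => u v; apply/eqP/negPn/negP => hu; apply: nh; by exists u, v.
 have Ft : pfun (fun w : W => twist T w.1.1 x0) by polynomial.
 exists (fun o v1 v2 => pev h o * det4 o v1 v2 d3 * twist T o x0); split.
 - by polynomial.
 - have [w [wa wb]] := @pfun_nonzero2 _ W _ _ w1 (u, 0, 0) (pfunM Fh Fd) Ft w1h hu.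
  by exists w.1.1, w.1.2, w.2; rewrite mulf_neq0.
 move=> o v1 v2; rewrite !mulf_eq0 !negb_or -andbA => /and3P[ho hdet ht]; split=> //; first by exists d3.
 have [q [m [qp qh hq]]] := rank2_prime (rz o) ho ht.
 have [a [b [ab qw]]] := prime_pencil_root v1 v2 qp qh; exists a, b; split=> //=.
 have iow : indep2 o (a *: v1 + b *: v2).
  have [a0|a0] := eqVneq a 0.
   have b0 : b != 0 by move: ab; rewrite a0 eqxx.
   apply: (@det4_indep2 _ _ _ v1 d3); rewrite det4D2 !det4Z2 a0 mul0r add0r mulf_neq0 //.
   by rewrite -oppr_eq0 -det4_swap23.
  apply: (@det4_indep2 _ _ _ v2 d3); rewrite det4D2 !det4Z2 det4_23 mulr0 addr0 mulf_neq0 //.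
 have [z1 z2] := hq _ qw; have ic := bir_indep_tangent B ho iow.
 by split; [exact: indep2_cross z1|exact: indep2_cross z2].
have [Gq [a1 [a2 [a3 [l1 [l2 [l3 [Gh na hG]]]]]]]] := jonq_formP B tw.
name e' Ee := (cross a1 a2 a3).
rewrite -Ee in na.
pose A (o v1 v2 : V) := cross (T o o o) (T o o v1) (T o o v2).
have F1 : pfun (fun w : W => dot (A w.1.1 w.1.2 w.2) (T w.1.1 w.2 w.2)) by polynomial.
have F2 : pfun (fun w : W => dot (A w.1.1 w.1.2 w.2) e') by polynomial.
exists (fun o v1 v2 => pev h o * det4 o v1 v2 d3 * dot (A o v1 v2) (T o v2 v2) * dot (A o v1 v2) e'); split.
- by polynomial.
- have [w2 h2] : exists w : W, dot (A w.1.1 w.1.2 w.2) (T w.1.1 w.2 w.2) != 0.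
  have [u [v /dot_neq0[y]]] := osculating_plane_ex B; rewrite dot_cross => hy.
  have [w [hw hwy]] : exists w : V, pev h w != 0 /\ det4 (T w w w) (T w w v) (T w v v) y != 0.
   apply: (@pfun_nonzero2 _ V _ _ o1 u) => //; first by polynomial.
   by polynomial.
  have [v1 hv1] := bir_dsurj B y hw; exists (w, v1, v) => /=.
  by rewrite /A dot_cross hv1 det4_swap23 oppr_eq0 det4_swap34 oppr_eq0.
 have [w3 h3] : exists w : W, dot (A w.1.1 w.1.2 w.2) e' != 0.
  have a1n : a1 != 0 by apply: contraNneq na; rewrite Ee => ->; apply/eqP; apply: dot_ext => x; rewrite dot_cross det4_01 dot0l.
  have [y1 hy1] := dot_neq0 a1n; have [z1 hz1] := bir_h_ex (bir_sym B).
  have [y [hk hy]] : exists y : V, pev k y != 0 /\ dot a1 y != 0.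
   by apply: (@pfun_nonzero2 _ V _ _ z1 y1) => //; [apply: pfun_pev; apply: pvec_id|apply: pfun_dot; [apply: pvec_const|apply: pvec_id]].
  have ie : indep2 (cub T (cub S y)) e'.
   rewrite (bir_cub (bir_sym B)) => s t e.
   have s0 : s = 0.
    have /eqP := congr1 (dot a1) e; rewrite dotDr !dotZr Ee (dotC a1 (cross _ _ _)) dot_cross det4_14 mulr0 addr0 dot0r.
    by rewrite !mulf_eq0 (negPf hk) (negPf hy) !orbF => /eqP.
   by split=> //; move/eqP: e; rewrite s0 scale0r add0r scaler_eq0 (negPf na) orbF => /eqP.
  have [c [d hcd]] := indep2_basis ie; have hh := bir_h_comp_neq0 B hk.
  have [v1 hv1] := bir_dsurj B c hh; have [v2 hv2] := bir_dsurj B d hh.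
  exists (cub S y, v1, v2) => /=; rewrite /A dot_cross hv1 hv2 det4_swap34 oppr_eq0 det4_swap23 oppr_eq0 //.
 have [w [wa wb]] := @pfun_nonzero2 _ W _ _ w1 w2 (pfunM Fh Fd) F1 w1h h2.
 have wab := mulf_neq0 wa wb.
 have [w' [wa' wb']] := @pfun_nonzero2 _ W _ _ w w3 (pfunM (pfunM Fh Fd) F1) F2 wab h3.
 by exists w'.1.1, w'.1.2, w'.2; rewrite mulf_neq0.
move=> o v1 v2; rewrite !mulf_eq0 !negb_or -!andbA => /and4P[ho hdet hA1 hA2]; split=> //; first by exists d3.
have [t [e1 e2]] := rho_root (rz o v1 v2) hA1.
name w Ew := (v1 + t *: v2).
rewrite -Ew in e1 e2; exists 1, t; rewrite oner_neq0 scale1r -Ew; split=> //=.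
name a Ea := (A o v1 v2).
rewrite -/(A o v1 v2) -Ea in e1 e2 hA2.
have ao : dot a (cub T o) = 0 by rewrite Ea /A dot_cross det4_14.
have aw : dot a (T o o w) = 0 by rewrite Ea /A dot_cross Ew stD3 stZ3 det4D4 det4Z4 det4_24 det4_34 mulr0 addr0.
have al r : dot a (cub T (o + r *: w)) = 0.
 by rewrite cubD cubZ !stZ2 !stZ3 !dotDr !dotZr ao aw e1 e2 !mulr0 !addr0.
have nd : det4 a1 a2 a3 a != 0 by rewrite -dot_cross -Ee dotC.
(* On this line a.f vanishes, and [a] completes a1, a2, a3 to a basis, so f is determined there by
   its three components with factor [Gq]. *)
have [b1 [b2 [b3 [b4 [_ bE]]]]] := dual_basis nd.
have [L LE] : exists L : V -> V, forall x, L x = dot l1 x *: b1 + dot l2 x *: b2 + dot l3 x *: b3 by eexists.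
have LD x y r : L (x + r *: y) = L x + r *: L y by rewrite !LE !dotDr !dotZr; vring.
have cE r : cub T (o + r *: w) = pev Gq (o + r *: w) *: L (o + r *: w).
 rewrite {1}[cub T _]bE al scale0r addr0; have [-> -> ->] := hG (o + r *: w).
 by rewrite LE !scalerDr !scalerA.
have [g0 [g1 [g2 gE]]] : exists g0 g1 g2, forall r, pev Gq (o + r *: w) = g0 + g1 * r + g2 * r ^+ 2.
 have [N [Ns hN]] := homog2_bilinear Gh; exists (dot (o *m N) o), (2 * dot (o *m N) w), (dot (w *m N) w) => r.
 by rewrite hN mulmxDl -scalemxAl !(dotDl, dotDr, dotZl, dotZr) (Ns w o); ring.
have Eq : [/\ cub T o = g0 *: L o, 3 *: T o o w = g0 *: L w + g1 *: L o, 3 *: T o w w = g1 *: L w + g2 *: L o & cub T w = g2 *: L w].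
 have C i : let s := [:: (cub T o - g0 *: L o) 0 i; (3 *: T o o w - (g0 *: L w + g1 *: L o)) 0 i;
   (3 *: T o w w - (g1 *: L w + g2 *: L o)) 0 i; (cub T w - g2 *: L w) 0 i] in forall j, s`_j = 0.
  apply: horner_rec_eq0 => r; have := congr1 (fun x : V => x 0 i) (cE r); rewrite cubD cubZ !stZ2 !stZ3 gE LD !mxE => /eqP.
  by rewrite -subr_eq0 => /eqP e; rewrite -[RHS]e /=; ring.
 split; apply/rowP => i; [move: (C i 0)|move: (C i 1)|move: (C i 2)|move: (C i 3)]; rewrite /= !mxE => /eqP;
  by rewrite subr_eq0 => /eqP.
move: Eq => [E0 E1 E2 E3].
have g00 : g0 != 0 by apply: contraNneq (bir_cub_neq0 B ho) => z; rewrite E0 z scale0r.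
have n3 : 3 != 0 :> K by rewrite pnatr_eq0.
have Lo : L o = g0^-1 *: T o o o by rewrite -[T o o o]/(cub T o) E0 scalerK.
have Lw : L w = (- g1 / g0 ^+ 2) *: T o o o + (3 / g0) *: T o o w.
 apply: (scalerI g00); rewrite scalerDr !scalerA; have -> : g0 *: L w = 3 *: T o o w - g1 *: L o by rewrite E1 addrK.
 by rewrite Lo; apply/rowP => i; rewrite !mxE; field.
split.
 exists (3^-1 * (g1 * (- g1 / g0 ^+ 2) + g2 / g0)), (g1 / g0); apply: (scalerI n3).
 by rewrite E2 Lw Lo; apply/rowP => i; rewrite !mxE; field.
exists (g2 * (- g1 / g0 ^+ 2)), (g2 * (3 / g0)); rewrite -[T w w w]/(cub T w) E3 Lw.
by vring.
Qed.

End Bir.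
End RankTwoLines.

(** * Vanishing [rho]: double base points and the double line *)

Section DoubleLine.
Variable K : numClosedFieldType.
Notation V := ('rV[K]_4).
Notation P4 := {mpoly K[4]}.

Section Bir.
Variables (f g : 'I_4 -> P4) (h k : P4).
Hypothesis B : bir f g h k.
Notation T := (pol f).
Notation S := (pol g).

Lemma ev_cub x : ev f x = cub T x.
Proof. by apply: ev_pol; apply: bir_fh B. Qed.

Lemma pfun_line3 (G : V -> V -> V -> K) u v w u' v' w' : pfun (fun w : V * V * V => G w.1.1 w.1.2 w.2) ->
 pfun (fun t : K^o => G (u + t *: u') (v + t *: v') (w + t *: w')).
Proof. by move=> pG; apply: (pfun_line (u, v, w) (u', v', w') pG). Qed.

Section DoublePoint.
Variable G : V -> V -> V -> K.
Hypotheses (pG : pfun (fun w : V * V * V => G w.1.1 w.1.2 w.2))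
 (hG : forall o v1 v2, G o v1 v2 != 0 -> [/\ pev h o != 0, exists x, det4 o v1 v2 x != 0 & rank2_in f o v1 v2]).

(** Through u + t v passes a line of the plane that is mapped to a line, so it carries two points of
    [L] or a base point double along it. Joins of two points of [L] account for finitely many [t],
    and a point of [L] that is double along the line for all other [t] is double in the plane. *)
Lemma double_point_list u v w (L : seq V) : G u v w != 0 ->
 (forall r s t, cub T (r *: u + s *: v + t *: w) = 0 -> [|| r != 0, s != 0 | t != 0] ->
   t != 0 /\ exists2 x, x \in L & r *: u + s *: v + t *: w = t *: x) ->
 exists p a b c, [/\ p = a *: u + b *: v + c *: w, c != 0, T p p u = 0, T p p v = 0 & T p p w = 0].
Proof.
move=> hg hL; apply: NNPP => nh.
have [_ [x0 hd] _] := hG hg; have iuv := det4_indep2 hd.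
(* A base point x in [L] with T x x (u + t v) = 0 for all [t] is the double point sought; any other
   one is avoided by a general [t]. *)
have [q1 [pq1 [t1 qt1] hq1]] : exists q : K^o -> K, [/\ pfun q, exists t, q t != 0 & forall t, q t != 0 ->
  forall x, x \in L -> forall a b c, x = a *: u + b *: v + c *: w -> c != 0 -> cub T x = 0 -> T x x (u + t *: v) != 0].
 apply: (@pfun_list _ K^o _ L (fun x t => forall a b c, x = a *: u + b *: v + c *: w -> c != 0 -> cub T x = 0 -> T x x (u + t *: v) != 0)) => x.
 have [nz|nnz] := classic (exists t : K, T x x (u + t *: v) != 0).
  have [t /dot_neq0[y hy]] := nz; exists (fun t => dot (T x x (u + t *: v)) y); split; last 2 first.
  - by exists t.
  - by move=> s hs a b c _ _ _; move: hs; apply: contraNneq => ->; rewrite dot0l.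
  apply: pfun_dot; last exact: pvec_const.
  by polynomial.
 have z t : T x x (u + t *: v) = 0 by apply/eqP/negPn/negP => nt; apply: nnz; exists t.
 exists (fun _ => 1); split; [exact: pfun_const|by exists 0; rewrite oner_neq0|].
 move=> t _ a b c ex c0 cx; case: nh; exists x, a, b, c.
 have xu : T x x u = 0 by have := z 0; rewrite scale0r addr0.
 have xv : T x x v = 0 by have := z 1; rewrite scale1r stD3 xu add0r.
 split=> //; apply: (scalerI c0); rewrite scaler0 -stZ3; transitivity (T x x (x - (a *: u + b *: v))).
  by congr (T x x _); rewrite {1}ex addrC addKr.
 by rewrite stD3 -scaleN1r stZ3 stD3 !stZ3 xu xv -/(cub T x) cx !(scaler0, addr0).
(* [q2] avoids the parameters for which u + t v lies on the join of two points of [L]. *)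
have [q2 [pq2 [t2 qt2] hq2]] : exists q : K^o -> K, [/\ pfun q, exists t, q t != 0 & forall t, q t != 0 ->
  forall z : V * V, z \in [seq (x, y) | x <- L, y <- L] -> forall c, c != 0 -> c *: (u + t *: v) = z.1 - z.2 -> False].
 apply: (@pfun_list _ K^o _ [seq (x, y) | x <- L, y <- L] (fun (z : V * V) t => forall c, c != 0 -> c *: (u + t *: v) = z.1 - z.2 -> False)) => z.
 have [[t0 [c0 [c00 e0]]]|nz] := classic (exists t0 c0, c0 != 0 /\ c0 *: (u + t0 *: v) = z.1 - z.2); last first.
  exists (fun _ => 1); split; [exact: pfun_const|by exists 0; rewrite oner_neq0|].
  by move=> t _ c c1 e; apply: nz; exists t, c.
 exists (fun t => t - t0); split; first by polynomial.
  by exists (t0 + 1); rewrite addrC addKr oner_neq0.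
 move=> t tt c c1; rewrite -e0 => e.
 have [e1 e2] : c - c0 = 0 /\ c * t - c0 * t0 = 0.
  apply: iuv; rewrite !scalerBl -!scalerA; move/eqP: e; rewrite -subr_eq0 => /eqP e.
  by rewrite -[RHS]e; vring.
 move/eqP: e1; rewrite subr_eq0 => /eqP e1; move: e2; rewrite e1 -mulrBr => /eqP.
 by rewrite mulf_eq0 (negPf c00) (negPf tt).
have pg : pfun (fun t : K^o => G (u + t *: v) v w).
 by have := pfun_line3 u v w v 0 0 pG; apply: pfunE => t; rewrite !scaler0 !addr0.
have g0 : G (u + 0 *: v) v w != 0 by rewrite scale0r addr0.
have [t3 [a3 b3]] := @pfun_nonzero2 _ K^o _ _ 0 t1 pg pq1 g0 qt1.
have ab3 := mulf_neq0 a3 b3.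
have [t [ab hq2t]] := @pfun_nonzero2 _ K^o _ _ t3 t2 (pfunM pg pq1) pq2 ab3 qt2.
move: ab; rewrite mulf_eq0 negb_or => /andP[hgt hq1t].
have [ho _ [a [b [ab [h2 h3]]]]] := hG hgt.
set o := u + t *: v in hgt ho h2 h3 *; set w' := a *: v + b *: w in h2 h3 *.
have iow : indep2 o w'.
 have [a0|a0] := eqVneq a 0.
  have b0 : b != 0 by move: ab; rewrite a0 eqxx.
  apply: (@det4_indep2 _ _ _ v x0); rewrite /o /w' a0 scale0r add0r det4D1 !det4Z1 det4Z2 det4Z2 det4_13 !mulr0 addr0.
  by rewrite det4_swap23 mulrN oppr_eq0 mulf_neq0.
 apply: (@det4_indep2 _ _ _ w x0); rewrite /o /w' det4D1 !det4Z1 !det4D2 !det4Z2 !(det4_12, det4_23) !(mulr0, addr0) mulf_neq0 //.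
have cE r : r *: o + w' = r *: u + (r * t + a) *: v + b *: w by rewrite /o /w'; vring.
have base r : cub T (r *: o + w') = 0 -> b != 0 /\ exists2 x, x \in L & r *: o + w' = b *: x.
 rewrite cE => e; apply: (hL _ _ _ e); have [z|b0] := eqVneq b 0; last by rewrite !orbT.
 have [r0|//] := eqVneq r 0; rewrite r0 mul0r add0r /= orbF.
 by move: ab; rewrite z eqxx orbF.
case: (rank2_line B ho iow h2 h3) => [[r /= [cp [po pw]]]|[r [s [rs [cr cs]]]]].
 have [b0 [x xL ex]] := base r cp.
 have xe : x = b^-1 *: (r *: o + w') by rewrite ex scalerK.
 have xc : x = (b^-1 * r) *: u + (b^-1 * (r * t + a)) *: v + 1 *: w.
  by rewrite xe cE; apply/rowP => i; rewrite !mxE; field.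
 have cx : cub T x = 0 by rewrite xe cubZ cp scaler0.
 have := hq1 t hq1t x xL _ _ _ xc (oner_neq0 _) cx; rewrite -/o xe stZ1 stZ2 po !scaler0 eqxx //.
have [b0 [x xL ex]] := base r cr; have [_ [y yL ey]] := base s cs.
have xyL : (x, y) \in [seq (x, y) | x <- L, y <- L] by apply: allpairs_f.
apply: (hq2 t hq2t (x, y) xyL (b^-1 * (r - s))); first by rewrite mulf_neq0 ?invr_eq0 // subr_eq0.
apply: (scalerI b0); rewrite /= scalerBr -ex -ey -/o scalerA mulVKf //.
by vring.
Qed.

Lemma double_point u v0 w0 : G u v0 w0 != 0 ->
 exists D1 : V -> K, [/\ pfun D1, exists v, D1 v != 0 & forall v, D1 v != 0 -> v != 0 /\
 exists D2 : V -> K, [/\ pfun D2, exists w, D2 w != 0 & forall w, D2 w != 0 ->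
 exists p a b c, [/\ p = a *: u + b *: v + c *: w, c != 0, T p p u = 0, T p p v = 0 & T p p w = 0]]].
Proof.
move=> hg0; have [hu _ _] := hG hg0; have u0 := bir_h_neq0 B hu.
have eu : ev f u != 0 by rewrite ev_cub; apply: bir_cub_neq0 B _ hu.
have [D [pD [x Dx] _ hD]] := base_free_line (bir_fh B) (bir_fc B) (bir_f0 B) u0 eu.
have pg : pfun (fun v : V => G u v w0).
 move=> v v'; have [q hq] := pfun_line3 u v w0 0 v' 0 pG 0 1; exists q => t.
 by rewrite -hq; congr (G _ _ _); rewrite ?scaler0 ?addr0 // add0r /GRing.scale /= mulr1.
have [v1 [a1 b1]] := @pfun_nonzero2 _ V _ _ x v0 pD pg Dx hg0.
exists (fun v => D v * G u v w0); split; [exact: pfunM|by exists v1; rewrite mulf_neq0|].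
move=> v; rewrite mulf_eq0 negb_or => /andP[Dv hg].
have [_ [x0 hd] _] := hG hg.
have v_0 : v != 0 by apply: contraNneq hd => ->; rewrite det4_02.
have [D' [pD' [y Dy] hD']] := plane_finite_base (bir_fh B) (bir_fc B) (bir_f0 B) u0 v_0 (hD v Dv).
have pg' : pfun (fun w : V => G u v w).
 move=> w w'; have [q hq] := pfun_line3 u v w 0 0 w' pG 0 1; exists q => t.
 by rewrite -hq; congr (G _ _ _); rewrite ?scaler0 ?addr0 // add0r /GRing.scale /= mulr1.
have [w1 [a2 b2]] := @pfun_nonzero2 _ V _ _ y w0 pD' pg' Dy hg; split=> //.
exists (fun w => D' w * G u v w); split; [exact: pfunM|by exists w1; rewrite mulf_neq0|].
move=> w; rewrite mulf_eq0 negb_or => /andP[Dw hgw].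
have [L hL] := hD' w Dw; apply: (double_point_list (L := L) hgw) => r s t.
by rewrite -ev_cub; apply: hL.
Qed.

(** A double base point w + x o satisfies Toww + 2 x Toow + x^2 Tooo = 0. Wedging with Tooo gives x
    as minus the quotient of the two determinants, the denominator doubled, whence the point p.
    [pencil_prime] makes p double for all w on a hypersurface. *)
Lemma double_prime o v0 w0 w1 : G o v0 w0 != 0 -> cross (T o o o) (T o o w1) (T o w1 w1) != 0 ->
 exists q m, [/\ rprime q, q \is m.-homog & forall w, pev q w = 0 -> forall u1 u2 x,
  let p := (2 * det4 (T o o o) (T o o w) u1 u2) *: w - det4 (T o o o) (T o w w) u1 u2 *: o in T p p x = 0].
Proof.
move=> hg /dot_neq0[y hy]; have [D1 [pD1 [v1 D1v1] hD1]] := double_point hg.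
have [ho _ _] := hG hg; have o0 := bir_h_neq0 B ho.
pose W : lmodType K := (V * V * V * V)%type.
pose X u1 u2 w := (2 * det4 (T o o o) (T o o w) u1 u2) *: w - det4 (T o o o) (T o w w) u1 u2 *: o.
pose Phi (p : W) (i : 'I_2) w := nth 0 [:: dot p.2 (T (X p.1.1.2 p.1.2 w) (X p.1.1.2 p.1.2 w) p.1.1.1);
  dot y (cross (T o o o) (T o o w) (T o w w))] i.
have hv3 : hvec 1 (fun w : V => w) := @hvec_id K.
have hc x : hvec 0 (fun _ : V => x) := hvec_const x.
have h1 : hvec 1 (fun w => T o o w) by apply: (hvec_st f (hc o) (hc o) hv3).
have h2 : hvec 2 (fun w => T o w w) by apply: (hvec_st f (hc o) hv3 hv3).
have hX u1 u2 : hvec 2 (X u1 u2).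
 apply: hvecD; first by apply: (hvecZ (d := 1)) => //; apply: hfunZ; apply: (hfun_det4 (hc _) h1 (hc _) (hc _)).
 move=> i; have hz := hvecZ (hfun_det4 (hc (T o o o)) h2 (hc u1) (hc u2)) (hc o) i.
 by apply: hfun_ext (hfunN hz) => w; rewrite !mxE.
have [D Dh DE] : hfun 3 (fun w => dot y (cross (T o o o) (T o o w) (T o w w))).
 by apply: hfun_dotv; apply: (hvec_cross (hc _) h1 h2).
have D0 : D != 0 by apply: contraNneq hy => z; rewrite dotC DE z /pev meval0.
have [||||||||q [m [qp qh hq]]] := @pencil_prime K W 2 Phi (fun i : 'I_2 => nth 0%N [:: 4; 3] i)%N (@Ordinal 2 1 isT) D
  (fun p => D1 p.1.1.1).
- move=> p; case=> -[|[|//]] hi; rewrite /Phi /=; last by exists D.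
 by apply: hfun_dotv; apply: (hvec_st f (hX _ _) (hX _ _) (hc _)).
- move=> [[|[|//]] hi] w; rewrite /Phi /=; last exact: pfun_const.
 by polynomial.
- exact: D0.
- exact: Dh.
- by move=> p w; rewrite /Phi /= DE.
- move=> p p'; exact: (pD1 p.1.1.1 p'.1.1.1).
- by exists (v1, 0, 0, 0).
- move=> p hp; have [p10 [D2 [pD2 hD2 hz]]] := hD1 _ hp.
 exists p.1.1.1 => //.
 exists D2; split=> // v /hz[q [a [b [c [eq c0 qo qv qw]]]]]; exists (b / c).
 set w := v + (b / c) *: p.1.1.1.
 have ew : w = c^-1 *: q - (a / c) *: o by rewrite eq /w; apply/rowP => i; rewrite !mxE; field.
 have c1 : T o o w = c^-1 *: T o o q - (a / c) *: T o o o by rewrite ew stD3 -scaleNr !stZ3 scaleNr.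
 have c2 : T o w w = (-2 * a / c ^+ 2) *: T o o q + (a / c) ^+ 2 *: T o o o.
  rewrite ew -!scaleNr stD2 !stD3 !stZ2 !stZ3 (st13 T q q o) qo (st23 T o q o).
  by apply/rowP => i; rewrite !mxE; field.
 have Xe : X p.1.1.2 p.1.2 w = (2 * det4 (T o o o) (T o o q) p.1.1.2 p.1.2 / c ^+ 2) *: q.
  rewrite /X c1 c2 -!scaleNr !(det4D2, det4Z2) det4_12 ew; apply/rowP => i; rewrite !mxE; field.
  by rewrite c0.
 case=> -[|[|//]] hi; rewrite /Phi /=.
  by rewrite Xe stZ1 stZ2 qv !scaler0 dot0r.
 apply/eqP; rewrite dotC dot_cross c1 c2 -!scaleNr !(det4D2, det4D3, det4Z2, det4Z3) !(det4_12, det4_13, det4_23).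
 by apply/eqP; ring.
exists q, m; split=> // w qw u1 u2 x; apply: dot_ext => b; rewrite dot0l dotC.
exact: (hq (x, u1, u2, b) (@Ordinal 2 0 isT) w qw).
Qed.

End DoublePoint.

(** Every cubic of the linear system is singular at [p]. *)
Definition triple_zero p := forall x, T p p x = 0.

(** A plane through [o] that misses the points of [L] still meets the hypersurface q = 0, and the
    double point attached to that direction lies in the plane. *)
Lemma double_points_avoid o q m (L : seq V) : pev h o != 0 -> rprime q -> q \is m.-homog ->
 (forall w, pev q w = 0 -> forall u1 u2 x,
  let p := (2 * det4 (T o o o) (T o o w) u1 u2) *: w - det4 (T o o o) (T o w w) u1 u2 *: o in T p p x = 0) ->
 (forall p, p \in L -> p != 0 /\ triple_zero p) ->
 exists p, [/\ p != 0, triple_zero p & forall x, x \in L -> forall c, p <> c *: x].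
Proof.
move=> ho qp qh hq hL; have o0 := bir_h_neq0 B ho; have [d1 [d2 [d3 hd]]] := basis1 o0.
have io p : p != 0 -> triple_zero p -> indep2 o p.
 move=> p0 pz s t e; have s0 : s = 0.
  apply/eqP/negPn/negP => s0; case/eqP: (bir_cub_neq0 B ho).
  have eo : o = (- t / s) *: p.
   apply: (scalerI s0); rewrite scalerA mulrCA mulfV // mulr1 scaleNr; apply/eqP.
   by rewrite -subr_eq0 opprK e.
  by rewrite eo cubZ [cub T p]pz scaler0.
 by split=> //; move/eqP: e; rewrite s0 scale0r add0r scaler_eq0 (negPf p0) orbF => /eqP.
pose W : lmodType K := (V * V)%type.
have [[v1 v2] hv] : exists w : W, forall x, x \in d3 :: L -> det4 o w.1 w.2 x != 0.
 apply: pfun_prod_seq => [x|x]; first by polynomial.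
 rewrite inE => /orP[/eqP->|/hL[x0 xz]]; first by exists (d1, d2).
 have [c [d hcd]] := indep2_basis (io x x0 xz); exists (c, d).
 by rewrite /= det4_swap34 oppr_eq0 det4_swap23 oppr_eq0.
rewrite /= in hv; have hd3 : det4 o v1 v2 d3 != 0 by apply: hv; rewrite inE eqxx.
have [a [b [ab qw]]] := prime_pencil_root v1 v2 qp qh; have := hq _ qw.
name w Ew := (a *: v1 + b *: v2).
rewrite -Ew => hw.
have [y hy] : exists y, det4 o w y d3 != 0.
 have [a0|a0] := eqVneq a 0.
  have b0 : b != 0 by move: ab; rewrite a0 eqxx.
  by exists v1; rewrite Ew det4D2 !det4Z2 a0 mul0r add0r mulf_neq0 // -oppr_eq0 -det4_swap23.
 by exists v2; rewrite Ew det4D2 !det4Z2 det4_23 mulr0 addr0 mulf_neq0.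
have iow := det4_indep2 hy.
have [u1 [u2 hu]] := indep2_basis (bir_indep_tangent B ho iow).
have := hw u1 u2; set M := det4 _ _ u1 u2; set N := det4 _ _ u1 u2; set p := _ - _ => pz.
have p0 : p != 0.
 apply/eqP => z; have [] := iow (- N) (2 * M); first by rewrite scaleNr addrC.
 by move=> _ /eqP; rewrite mulf_eq0 pnatr_eq0 /= (negPf hu).
exists p; split=> // x xL c e; have hx : det4 o v1 v2 x != 0 by apply: hv; rewrite inE xL orbT.
have pw : det4 o v1 v2 p = 0.
 by rewrite /p -scaleNr Ew !(det4D4, det4Z4) det4_14 det4_24 det4_34 !(mulr0, addr0).
move/eqP: pw; rewrite e det4Z4 mulf_eq0 (negPf hx) orbF => /eqP c0.
by case/eqP: p0; rewrite e c0 scale0r.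
Qed.

Lemma image_nondegenerate a : (forall x, dot a (cub T x) = 0) -> a = 0.
Proof.
move=> ha; apply/eqP/negPn/negP => a0; have [y hy] := dot_neq0 a0; have [z hz] := bir_h_ex (bir_sym B).
have [w [hw aw]] : exists w : V, pev k w != 0 /\ dot a w != 0.
 by apply: (@pfun_nonzero2 _ V _ _ z y) => //; [apply: pfun_pev; apply: pvec_id|apply: pfun_dot; [apply: pvec_const|apply: pvec_id]].
have := ha (cub S w); rewrite (bir_cub (bir_sym B)) dotZr => /eqP.
by rewrite mulf_eq0 (negPf hw) (negPf aw).
Qed.

Lemma triple_zero_sq p1 p2 p3 p4 s1 s2 s3 s4 x : triple_zero p1 -> triple_zero p2 -> triple_zero p3 -> triple_zero p4 ->
 let p := s1 *: p1 + s2 *: p2 + s3 *: p3 + s4 *: p4 in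
 T p p x = 2 *: ((s1 * s2) *: T p1 p2 x + (s1 * s3) *: T p1 p3 x + (s1 * s4) *: T p1 p4 x
  + (s2 * s3) *: T p2 p3 x + (s2 * s4) *: T p2 p4 x + (s3 * s4) *: T p3 p4 x).
Proof.
move=> z1 z2 z3 z4 /=; rewrite !stD1 !stD2 !stZ1 !stZ2 z1 z2 z3 z4.
rewrite (st12 T p1 p2) (st12 T p1 p3) (st12 T p1 p4) (st12 T p2 p3) (st12 T p2 p4) (st12 T p3 p4).
by vring.
Qed.

(** On the plane of three double points the map is a multiple of [T p1 p2 p3]; if this vector
    vanished, the whole plane would consist of base points. *)
Lemma triple_zero_plane p1 p2 p3 : triple_zero p1 -> triple_zero p2 -> triple_zero p3 -> cross p1 p2 p3 != 0 ->
 T p1 p2 p3 != 0.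
Proof.
move=> z1 z2 z3 n0; have [x nx [i fx]] := plane_not_base (bir_fc B) n0.
have [s1 [s2 [s3 ex]]] := plane_span n0 nx.
apply: contraNneq fx => e; have z0 : triple_zero 0 by move=> y; rewrite st01.
have ex' : x = s1 *: p1 + s2 *: p2 + s3 *: p3 + 0 *: 0 by rewrite scale0r addr0.
have [t12 t13 t23] : [/\ T p1 p2 x = 0, T p1 p3 x = 0 & T p2 p3 x = 0].
 have z r s t x' y' z' : x' = 0 -> y' = 0 -> z' = 0 -> r *: x' + s *: y' + t *: z' + 0 *: 0 = 0 :> V.
  by move=> -> -> ->; rewrite !scaler0 !addr0.
 rewrite ex' !stD3 !stZ3 !st03; split; apply: z; rewrite // ?(st23 T p1 p1 p2) ?(st13 T p2 p2 p1) ?(st23 T p1 p1 p3) ?(st23 T p1 p2 p3)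
  ?(st13 T p3 p3 p1) ?(st13 T p1 p3 p2) ?(st23 T p1 p2 p3) ?(st23 T p2 p2 p3) ?(st13 T p3 p3 p2) //; exact: z1 || exact: z2 || exact: z3.
have cx : cub T x = 0.
 have := triple_zero_sq s1 s2 s3 0 x z1 z2 z3 z0; rewrite /= -ex' /cub => ->.
 by rewrite t12 t13 t23 !(mulr0, scale0r, scaler0, addr0).
by move: cx; rewrite -ev_cub => /rowP/(_ i); rewrite !mxE => ->.
Qed.

(** The double point condition, tested on p1, p2, p3, reads bc = ac = ab = 0. *)
Lemma coplanar_triple_zero p1 p2 p3 p a b c : triple_zero p1 -> triple_zero p2 -> triple_zero p3 -> triple_zero p ->
 cross p1 p2 p3 != 0 -> p = a *: p1 + b *: p2 + c *: p3 -> exists r, [\/ p = r *: p1, p = r *: p2 | p = r *: p3].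
Proof.
move=> z1 z2 z3 z n0 ep; have z0 : triple_zero 0 by move=> y; rewrite st01.
have nz := triple_zero_plane z1 z2 z3 n0.
have n2 : 2 != 0 :> K by rewrite pnatr_eq0.
have ep' : p = a *: p1 + b *: p2 + c *: p3 + 0 *: 0 by rewrite scale0r addr0.
have E x := triple_zero_sq a b c 0 x z1 z2 z3 z0; rewrite /= -ep' in E.
have get r : 2 *: (r *: T p1 p2 p3) = 0 -> r = 0.
 by move=> /eqP; rewrite !scaler_eq0 (negPf n2) (negPf nz) orbF => /eqP.
have bc : b * c = 0.
 apply: get; rewrite -[RHS](z p1) E (st23 T p1 p1 p2) z1 (st23 T p1 p1 p3) z1 (st13 T p1 p3 p2) (st23 T p1 p2 p3).
 by rewrite !(mulr0, scale0r, scaler0, addr0, add0r).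
have ac : a * c = 0.
 apply: get; rewrite -[RHS](z p2) E (st13 T p2 p2 p1) z2 (st23 T p2 p2 p3) z2 (st23 T p1 p2 p3).
 by rewrite !(mulr0, scale0r, scaler0, addr0, add0r).
have ab : a * b = 0.
 apply: get; rewrite -[RHS](z p3) E (st13 T p3 p3 p1) z3 (st13 T p3 p3 p2) z3.
 by rewrite !(mulr0, scale0r, scaler0, addr0, add0r).
have [a0|a0] := eqVneq a 0; last first.
 move/eqP: ab; move/eqP: ac; rewrite !mulf_eq0 (negPf a0) /= => /eqP c0 /eqP b0.
 by exists a; apply: Or31; rewrite ep b0 c0 !scale0r !addr0.
have [b0|b0] := eqVneq b 0; first by exists c; apply: Or33; rewrite ep a0 b0 !scale0r !add0r.
move/eqP: bc; rewrite mulf_eq0 (negPf b0) /= => /eqP c0.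
by exists b; apply: Or32; rewrite ep a0 c0 !scale0r addr0 add0r.
Qed.

(** Suppose no join of two double points is double. Then no three of them are collinear and no four
    coplanar, and there are at least five. In the frame of four, the map is a combination of the
    four vectors T p_i p_j p_k; the fifth point puts these in the span of two, contrary to
    [image_nondegenerate]. *)
Lemma double_line_points o q m : pev h o != 0 -> rprime q -> q \is m.-homog ->
 (forall w, pev q w = 0 -> forall u1 u2 x,
  let p := (2 * det4 (T o o o) (T o o w) u1 u2) *: w - det4 (T o o o) (T o w w) u1 u2 *: o in T p p x = 0) ->
 exists p1 p2, [/\ indep2 p1 p2, triple_zero p1, triple_zero p2 & forall x, T p1 p2 x = 0].
Proof.
move=> ho qp qh hq; apply: NNPP => nd.
have next (L : seq V) : (forall p, p \in L -> p != 0 /\ triple_zero p) ->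
 exists p, [/\ p != 0, triple_zero p & forall x, x \in L -> forall c, p <> c *: x] := double_points_avoid ho qp qh hq.
have n2 : 2 != 0 :> K by rewrite pnatr_eq0.
have z0 : triple_zero 0 by move=> y; rewrite st01.
have nd' p p' : indep2 p p' -> triple_zero p -> triple_zero p' -> exists x, T p p' x != 0.
 move=> i z z'; apply: NNPP => nn; apply: nd; exists p, p'; split=> // x.
 by apply/eqP/negPn/negP => hx; apply: nn; exists x.
have [p1 [p10 z1 _]] := next [::] (fun _ e => False_ind _ (notF e)).
have [|p2 [p20 z2 n21]] := next [:: p1]; first by move=> p; rewrite !inE => /eqP->.
have i12 : indep2 p1 p2.
 move=> s t e; have t0 : t = 0.
  apply/eqP/negPn/negP => t0; apply: (n21 p1 _ (- s / t)); rewrite ?inE ?eqxx //.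
  by apply: (scalerI t0); rewrite scalerA mulrCA mulfV // mulr1 scaleNr; apply/eqP; rewrite -subr_eq0 opprK addrC e.
 by split=> //; move/eqP: e; rewrite t0 scale0r addr0 scaler_eq0 (negPf p10) orbF => /eqP.
have [|p3 [p30 z3 n3]] := next [:: p1; p2]; first by move=> p; rewrite !inE => /orP[]/eqP->.
have n123 : cross p1 p2 p3 != 0.
 apply/eqP => /(indep2_cross i12)[a [b e]].
 have [x hx] := nd' _ _ i12 z1 z2.
 have e' : p3 = a *: p1 + b *: p2 + 0 *: 0 + 0 *: 0 by rewrite !scale0r !addr0.
 have := triple_zero_sq a b 0 0 x z1 z2 z0 z0; rewrite /= -e' z3 !(mulr0, mul0r, scale0r, scaler0, addr0, st02) => /esym/eqP.
 rewrite !scaler_eq0 (negPf n2) (negPf hx) orbF /= mulf_eq0 => /orP[]/eqP r0.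
  by apply: (n3 p2 _ b); rewrite ?inE ?eqxx ?orbT // e r0 scale0r add0r.
 by apply: (n3 p1 _ a); rewrite ?inE ?eqxx ?orbT // e r0 scale0r addr0.
have [|p4 [p40 z4 n4]] := next [:: p1; p2; p3]; first by move=> p; rewrite !inE => /or3P[]/eqP->.
have hd : det4 p1 p2 p3 p4 != 0.
 rewrite -dot_cross; apply/eqP => /(plane_span n123)[a [b [c e]]].
 have [r [] er] := coplanar_triple_zero z1 z2 z3 z4 n123 e.
 - by apply: (n4 p1 _ r er); rewrite !inE eqxx.
 - by apply: (n4 p2 _ r er); rewrite !inE eqxx orbT.
 - by apply: (n4 p3 _ r er); rewrite !inE eqxx !orbT.
have [|p5 [p50 z5 n5]] := next [:: p1; p2; p3; p4]; first by move=> p; rewrite !inE => /or4P[]/eqP->.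
have span x : exists a b c d, x = a *: p1 + b *: p2 + c *: p3 + d *: p4.
 exists (det4 x p2 p3 p4 / det4 p1 p2 p3 p4), (det4 p1 x p3 p4 / det4 p1 p2 p3 p4), (det4 p1 p2 x p4 / det4 p1 p2 p3 p4), (det4 p1 p2 p3 x / det4 p1 p2 p3 p4).
 apply: (scalerI hd); rewrite (cramer4 p1 p2 p3 p4 x) !scalerDr !scalerA.
 by rewrite !(mulrC (det4 p1 p2 p3 p4)) !divfK.
have [a1 [a2 [a3 [a4 e5]]]] := span p5.
have n124 : cross p1 p2 p4 != 0 by apply: (@det4_cross _ _ _ _ p3); rewrite det4_swap34 oppr_eq0.
have n134 : cross p1 p3 p4 != 0 by apply: (@det4_cross _ _ _ _ p2); rewrite det4_swap34 oppr_eq0 det4_swap23 oppr_eq0.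
have n234 : cross p2 p3 p4 != 0.
 by apply: (@det4_cross _ _ _ _ p1); rewrite det4_swap34 oppr_eq0 det4_swap23 oppr_eq0 det4_swap12 oppr_eq0.
have out i r : i \in [:: p1; p2; p3; p4] -> p5 <> r *: i by move=> hi; apply: n5.
have m1 : p1 \in [:: p1; p2; p3; p4] by rewrite !inE eqxx.
have m2 : p2 \in [:: p1; p2; p3; p4] by rewrite !inE eqxx orbT.
have m3 : p3 \in [:: p1; p2; p3; p4] by rewrite !inE eqxx !orbT.
have m4 : p4 \in [:: p1; p2; p3; p4] by rewrite !inE eqxx !orbT.
have a40 : a4 != 0.
 apply/eqP => z; have [|r []] := @coplanar_triple_zero p1 p2 p3 p5 a1 a2 a3 z1 z2 z3 z5 n123; try exact: out.
 by rewrite e5 z scale0r addr0.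
have a30 : a3 != 0.
 apply/eqP => z; have [|r []] := @coplanar_triple_zero p1 p2 p4 p5 a1 a2 a4 z1 z2 z4 z5 n124; try exact: out.
 by rewrite e5 z scale0r addr0.
have a20 : a2 != 0.
 apply/eqP => z; have [|r []] := @coplanar_triple_zero p1 p3 p4 p5 a1 a3 a4 z1 z3 z4 z5 n134; try exact: out.
 by rewrite e5 z scale0r addr0.
have a10 : a1 != 0.
 apply/eqP => z; have [|r []] := @coplanar_triple_zero p2 p3 p4 p5 a2 a3 a4 z2 z3 z4 z5 n234; try exact: out.
 by rewrite e5 z scale0r add0r.
have E x := triple_zero_sq a1 a2 a3 a4 x z1 z2 z3 z4; rewrite /= -e5 in E.
(* [y] is orthogonal to two of the four vectors, and the relations at p1 and p2 make it orthogonal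
   to the other two. Its independence from p1 records that it is nonzero. *)
have [y [iy [yc3 yc4]]] := common_kernel (T p1 p2 p3) (T p1 p2 p4) p10.
have E1 : 2 * (a3 * a4 * dot y (T p1 p3 p4)) = 0.
 have := congr1 (dot y) (E p1); rewrite z5 dot0r (st23 T p1 p1 p2) z1 (st23 T p1 p1 p3) z1 (st23 T p1 p1 p4) z1.
 rewrite (st13 T p1 p3 p2) (st23 T p1 p2 p3) (st13 T p1 p4 p2) (st23 T p1 p2 p4) (st13 T p1 p4 p3) (st23 T p1 p3 p4).
 by rewrite !(dotDr, dotZr) dot0r (dotC y (T p1 p2 p3)) yc3 (dotC y (T p1 p2 p4)) yc4 !(mulr0, add0r) => <-.
have E2 : 2 * (a3 * a4 * dot y (T p2 p3 p4)) = 0.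
 have := congr1 (dot y) (E p2); rewrite z5 dot0r (st13 T p2 p2 p1) z2 (st23 T p2 p2 p3) z2 (st23 T p2 p2 p4) z2.
 rewrite (st23 T p1 p2 p3) (st23 T p1 p2 p4) (st13 T p2 p4 p3) (st23 T p2 p3 p4).
 by rewrite !(dotDr, dotZr) dot0r (dotC y (T p1 p2 p3)) yc3 (dotC y (T p1 p2 p4)) yc4 !(mulr0, add0r) => <-.
have k123 : dot y (T p1 p2 p3) = 0 by rewrite dotC.
have k124 : dot y (T p1 p2 p4) = 0 by rewrite dotC.
have k134 : dot y (T p1 p3 p4) = 0.
 by move/eqP: E1; rewrite !mulf_eq0 (negPf n2) (negPf a30) (negPf a40) => /eqP.
have k234 : dot y (T p2 p3 p4) = 0.
 by move/eqP: E2; rewrite !mulf_eq0 (negPf n2) (negPf a30) (negPf a40) => /eqP.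
have y0 : y = 0.
 apply: image_nondegenerate => x; have [s1 [s2 [s3 [s4 ex]]]] := span x.
 have := triple_zero_sq s1 s2 s3 s4 x z1 z2 z3 z4; rewrite /= -ex /cub => ->.
 have hT u v : dot y (T u v p1) = 0 -> dot y (T u v p2) = 0 -> dot y (T u v p3) = 0 -> dot y (T u v p4) = 0 -> dot y (T u v x) = 0.
  by move=> k1 k2 k3 k4; rewrite ex !stD3 !stZ3 !dotDr !dotZr k1 k2 k3 k4 !mulr0 !addr0.
 have d0 v : v = 0 -> dot y v = 0 by move=> ->; rewrite dot0r.
 rewrite !(dotZr, dotDr) !hT ?(st23 T p1 p1 p2) ?(st13 T p2 p2 p1) ?(st23 T p1 p1 p3) ?(st23 T p1 p2 p3)
  ?(st13 T p3 p3 p1) ?(st23 T p1 p1 p4) ?(st23 T p1 p2 p4) ?(st23 T p1 p3 p4) ?(st13 T p4 p4 p1) ?(st13 T p1 p3 p2) ?(st23 T p1 p2 p3)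
  ?(st23 T p2 p2 p3) ?(st13 T p3 p3 p2) ?(st13 T p1 p4 p2) ?(st23 T p1 p2 p4) ?(st23 T p2 p2 p4) ?(st23 T p2 p3 p4) ?(st13 T p4 p4 p2)
  ?(st13 T p1 p4 p3) ?(st23 T p1 p3 p4) ?(st13 T p2 p4 p3) ?(st23 T p2 p3 p4) ?(st23 T p3 p3 p4) ?(st13 T p4 p4 p3) //;
  try (apply: d0; exact: z1 || exact: z2 || exact: z3 || exact: z4).
 by rewrite !(mulr0, addr0).
have e1 : 0 *: p1 + 1 *: y = 0 by rewrite y0 scaler0 scale0r addr0.
by have [_ /eqP] := iy 0 1 e1; rewrite oner_eq0.
Qed.

Lemma double_line : (forall o v1 v2, rho T o v1 v2 = 0) ->
 exists p1 p2, [/\ indep2 p1 p2, triple_zero p1, triple_zero p2 & forall x, T p1 p2 x = 0].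
Proof.
move=> rz; have [G [pG [o [v1 [v2 hg]]] hG]] := rank2_family B rz.
have [u [v /dot_neq0[y]]] := osculating_plane_ex B; rewrite dot_cross => hy.
have pgo : pfun (fun w : V => G w v1 v2).
 move=> w w'; have [q hq] := pfun_line3 w v1 v2 w' 0 0 pG 0 1; exists q => t.
 by rewrite -hq; congr (G _ _ _); rewrite ?scaler0 ?addr0 // add0r /GRing.scale /= mulr1.
have [w [gw hw]] : exists w : V, G w v1 v2 != 0 /\ det4 (T w w w) (T w w v) (T w v v) y != 0.
 apply: (@pfun_nonzero2 _ V _ _ o u) => //.
 by polynomial.
have [|q [m [qp qh hq]]] := double_prime (w1 := v) pG hG gw; first by apply: det4_cross hw.
have [hh _ _] := hG _ _ _ gw; exact: double_line_points hh qp qh hq.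
Qed.

End Bir.
End DoubleLine.

(** * Structure of a map with a double base line *)

Section DoubleLineStructure.
Variable K : numClosedFieldType.
Notation V := ('rV[K]_4).
Notation P4 := {mpoly K[4]}.

Lemma det4_pairs (a b c d : V) : det4 c d a b = det4 a b c d.
Proof. by rewrite (det4_swap23 c a d b) (det4_swap12 a c d b) (det4_swap34 a c b d) (det4_swap23 a b c d) !opprK. Qed.

Lemma dual4 (b0 b1 b2 b3 : V) : det4 b0 b1 b2 b3 != 0 -> exists z0 z1 z2 z3 : V,
 (forall x, x = dot z0 x *: b0 + dot z1 x *: b1 + dot z2 x *: b2 + dot z3 x *: b3) /\
 [/\ [/\ dot z0 b0 = 1, dot z0 b1 = 0, dot z0 b2 = 0 & dot z0 b3 = 0],
   [/\ dot z1 b0 = 0, dot z1 b1 = 1, dot z1 b2 = 0 & dot z1 b3 = 0],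
   [/\ dot z2 b0 = 0, dot z2 b1 = 0, dot z2 b2 = 1 & dot z2 b3 = 0] &
   [/\ dot z3 b0 = 0, dot z3 b1 = 0, dot z3 b2 = 0 & dot z3 b3 = 1]].
Proof.
move=> hd; name D DE := ((det4 b0 b1 b2 b3)^-1).
have e0 x : dot (- D *: cross b1 b2 b3) x = D * det4 x b1 b2 b3.
 by rewrite dotZl dot_cross (det4_swap34 b1 b2 x b3) (det4_swap23 b1 x b2 b3) (det4_swap12 x b1 b2 b3); ring.
have e1 x : dot (D *: cross b0 b2 b3) x = D * det4 b0 x b2 b3.
 by rewrite dotZl dot_cross (det4_swap34 b0 b2 x b3) (det4_swap23 b0 x b2 b3); ring.
have e2 x : dot (- D *: cross b0 b1 b3) x = D * det4 b0 b1 x b3.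
 by rewrite dotZl dot_cross (det4_swap34 b0 b1 x b3); ring.
have e3 x : dot (D *: cross b0 b1 b2) x = D * det4 b0 b1 b2 x by rewrite dotZl dot_cross.
exists (- D *: cross b1 b2 b3), (D *: cross b0 b2 b3), (- D *: cross b0 b1 b3), (D *: cross b0 b1 b2).
split=> [x|].
 by apply: (scalerI hd); rewrite e0 e1 e2 e3 cramer4 !scalerDr !scalerA DE !mulVKf.
by rewrite !e0 !e1 !e2 !e3 !(det4_12, det4_13, det4_14, det4_23, det4_24, det4_34) !mulr0 DE mulVf.
Qed.

Section Bir.
Variables (f g : 'I_4 -> P4) (h k : P4).
Hypothesis B : bir f g h k.
Notation T := (pol f).
Notation S := (pol g).

Section Line.
Variables (p1 p2 : V).
Hypotheses (z11 : triple_zero f p1) (z22 : triple_zero f p2) (z12 : forall x, T p1 p2 x = 0).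

(** Terms of order at least 2 along the double line vanish; hence on a plane through the line the
    map is a square factor times a linear map. *)
Lemma double_line_cub u s t : cub T (u + (s *: p1 + t *: p2)) = cub T u + 3 *: (s *: T u u p1 + t *: T u u p2).
Proof.
have zd x : T x (s *: p1 + t *: p2) (s *: p1 + t *: p2) = 0.
 rewrite (st13 T (s *: p1 + t *: p2) (s *: p1 + t *: p2) x) stD2 !stD1 !stZ2 !stZ1 z11 z22 z12 (st12 T p1 p2) z12.
 by rewrite !(scaler0, addr0).
by rewrite cubD /cub !zd stD3 !stZ3 scaler0 !addr0.
Qed.

Lemma double_line_sq u s t i j : T (u + (s *: p1 + t *: p2)) (u + (s *: p1 + t *: p2)) (i *: p1 + j *: p2) = i *: T u u p1 + j *: T u u p2.
Proof.
have zd x s' t' : T x (s *: p1 + t *: p2) (s' *: p1 + t' *: p2) = 0.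
 rewrite (st13 T (s' *: p1 + t' *: p2) (s *: p1 + t *: p2) x) stD2 !stD1 !stZ2 !stZ1 z11 z22 z12 (st12 T p1 p2) z12.
 by rewrite !(scaler0, addr0).
by rewrite stD2 zd addr0 stD1 (st12 T u) zd addr0 stD3 !stZ3.
Qed.

(* A plane through the double line cuts a * psi in twice that line and one residual line. *)
Lemma double_line_ruled a p : indep2 p1 p2 -> p != 0 -> dot a (cub T p) = 0 ->
 exists q, indep2 p q /\ forall s t, dot a (cub T (s *: p + t *: q)) = 0.
Proof.
move=> i12 p0 ap; have [e0 [e1 hd]] := indep2_basis i12.
have hd' : det4 e0 e1 p1 p2 != 0.
 by rewrite det4_pairs.
have [Z0 [Z1 [Z2 [Z3 [zx _]]]]] := dual4 hd'.
name u Eu := (dot Z0 p *: e0 + dot Z1 p *: e1).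
have px : p = u + (dot Z2 p *: p1 + dot Z3 p *: p2) by rewrite {1}(zx p) Eu !addrA.
have [u0|u0] := eqVneq u 0.
 have pD s t : cub T (s *: p1 + t *: p2) = 0.
  by rewrite -[_ + _]add0r double_line_cub /cub !st01 !(scaler0, addr0).
 move: px; rewrite u0 add0r => px.
 have [t0|t0] := eqVneq (dot Z2 p) 0.
  have t1 : dot Z3 p != 0 by apply: contraNneq p0 => z; rewrite px t0 z !scale0r addr0.
  exists p1; split=> [s t|s t].
   rewrite px t0 scale0r add0r scalerA addrC => /i12[-> /eqP].
   by rewrite mulf_eq0 (negPf t1) orbF => /eqP.
  have -> : s *: p + t *: p1 = t *: p1 + (s * dot Z3 p) *: p2 by rewrite {1}px t0 scale0r add0r scalerA addrC.
  by rewrite pD dot0r.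
 exists p2; split=> [s t|s t].
  rewrite px scalerDr !scalerA -addrA -scalerDl => /i12[/eqP].
  by rewrite mulf_eq0 (negPf t0) orbF => /eqP->; rewrite mul0r add0r.
 have -> : s *: p + t *: p2 = (s * dot Z2 p) *: p1 + (s * dot Z3 p + t) *: p2.
  by rewrite {1}px scalerDr !scalerA -addrA -scalerDl.
 by rewrite pD dot0r.
have [i [j [ij e]]] : exists i j, (i != 0) || (j != 0) /\ i * dot a (T u u p1) + j * dot a (T u u p2) = 0.
 have [z|nz] := eqVneq (dot a (T u u p2)) 0; first by exists 0, 1; rewrite z oner_neq0 orbT mul0r mulr0 addr0.
 exists (dot a (T u u p2)), (- dot a (T u u p1)); rewrite nz; split=> //; ring.
exists (i *: p1 + j *: p2); split=> [s t|s t].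
 rewrite px => st.
 have s0 : s = 0.
  have c0 : dot Z0 p *: (s *: e0) + dot Z1 p *: (s *: e1) + (s * dot Z2 p + t * i) *: p1 + (s * dot Z3 p + t * j) *: p2 = 0.
   by rewrite -[RHS]st Eu; vring.
  apply/eqP/negPn/negP => s0; case/eqP: u0; rewrite Eu.
  have q0 : dot Z0 p = 0.
   have := congr1 (fun x => det4 x e1 p1 p2) c0; rewrite !(det4D1, det4Z1) !(det4_12, det4_13, det4_14) det4_01 !(mulr0, addr0) => /eqP.
   by rewrite !mulf_eq0 (negPf s0) (negPf hd') !orbF => /eqP.
  have q1 : dot Z1 p = 0.
   have := congr1 (fun x => det4 e0 x p1 p2) c0; rewrite !(det4D2, det4Z2) !(det4_12, det4_23, det4_24) det4_02 !(mulr0, addr0, add0r) => /eqP.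
   by rewrite !mulf_eq0 (negPf s0) (negPf hd') !orbF => /eqP.
  by rewrite q0 q1 !scale0r addr0.
 split=> //; move: st; rewrite s0 scale0r add0r scalerDr !scalerA => /i12[/eqP ti /eqP tj].
 move: ti tj; rewrite !mulf_eq0; case/orP: ij => /negPf->; rewrite orbF; first by move=> /eqP.
 by move=> _ /eqP.
have -> : s *: p + t *: (i *: p1 + j *: p2) = s *: u + ((s * dot Z2 p + t * i) *: p1 + (s * dot Z3 p + t * j) *: p2).
 by rewrite {1}px; vring.
move: ap; rewrite {1}px !double_line_cub cubZ !stZ1 !stZ2 !(dotDr, dotZr) => ap.
transitivity (s ^+ 3 * (dot a (cub T u) + 3 * (dot Z2 p * dot a (T u u p1) + dot Z3 p * dot a (T u u p2)))
 + 3 * s ^+ 2 * t * (i * dot a (T u u p1) + j * dot a (T u u p2))); first by ring.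
by rewrite ap e !mulr0 addr0.
Qed.

Section Basis.
Variables (e0 e1 Z0 Z1 Z2 Z3 : V).
Hypotheses (hd : det4 e0 e1 p1 p2 != 0)
 (zx : forall x, x = dot Z0 x *: e0 + dot Z1 x *: e1 + dot Z2 x *: p1 + dot Z3 x *: p2)
 (Z0E : [/\ dot Z0 e0 = 1, dot Z0 e1 = 0, dot Z0 p1 = 0 & dot Z0 p2 = 0])
 (Z1E : [/\ dot Z1 e0 = 0, dot Z1 e1 = 1, dot Z1 p1 = 0 & dot Z1 p2 = 0]).

(** At a general point x of the plane the differential carries a frame (x, p1, p2, y) to a frame,
    and its values on p1, p2 depend on u alone. *)
Lemma plane_image_nondegenerate u s t : pev h (u + (s *: p1 + t *: p2)) != 0 -> cross (cub T u) (T u u p1) (T u u p2) != 0.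
Proof.
name x Ex := (u + (s *: p1 + t *: p2)).
rewrite -Ex => hx.
have nx : cross x p1 p2 != 0.
 apply: contraNneq (bir_cub_neq0 B hx) => /cross_dep[a [b [c [nz e]]]].
 have a0 : a != 0.
  apply: contraTneq nz => a0; move: e; rewrite a0 scale0r add0r => e; rewrite eqxx /=.
  have := @det4_indep2 _ p1 p2 e0 e1 _ b c e; case.
   by rewrite det4_pairs.
  by move=> -> ->; rewrite eqxx.
 have ex : x = 0 + ((- b / a) *: p1 + (- c / a) *: p2).
  by apply: (scalerI a0); rewrite add0r scalerDr !scalerA ![a * _]mulrC !divfK //; apply/eqP; rewrite -subr_eq0 opprD !scaleNr !opprK addrA e.
 by rewrite ex double_line_cub /cub !st01 !(scaler0, addr0).
have [y hy] := cross_basis nx; have := bir_basis B hx hy.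
have q1 : T x x p1 = T u u p1.
 by have := double_line_sq u s t 1 0; rewrite -Ex !scale1r !scale0r !addr0.
have q2 : T x x p2 = T u u p2.
 by have := double_line_sq u s t 0 1; rewrite -Ex !scale1r !scale0r !add0r.
move: (T x x y) => w; rewrite q1 q2 -[T x x x]/(cub T x) Ex double_line_cub => hy'.
apply: (@det4_cross _ _ _ _ w); move: hy'; rewrite !(det4D1, det4Z1) det4_12 det4_13 !(mulr0, addr0) //.
Qed.

(** Planes through the double line go to planes. So the pull-back of such a plane by the inverse map
    vanishes only on the image plane or where [k] does, and [quadric_pencil] for the inverse gives
    the common quadric. *)
Lemma double_line_pencil : exists G m0 m1, [/\ G \is 2.-homog, G != 0, indep2 m0 m1 &
 forall y, dot Z0 (cub S y) = pev G y * dot m0 y /\ dot Z1 (cub S y) = pev G y * dot m1 y].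
Proof.
have [Z00 Z01 Z0p1 Z0p2] := Z0E; have [Z10 Z11 Z1p1 Z1p2] := Z1E.
pose W : lmodType K := (K^o * K^o)%type.
have [x0 hx0] := bir_h_ex B; name d0 Ed0 := (dot Z2 x0 *: p1 + dot Z3 x0 *: p2).
have P1 : pfun (fun w : W => w.1) by move=> u v; exists (u.1%:P + v.1 *: 'X) => t; rewrite !hornerE /=; congr (_ + _); rewrite /GRing.scale /= mulrC.
have P2 : pfun (fun w : W => w.2) by move=> u v; exists (u.2%:P + v.2 *: 'X) => t; rewrite !hornerE /=; congr (_ + _); rewrite /GRing.scale /= mulrC.
pose a (w : W) := w.2 *: Z0 - w.1 *: Z1.
pose c (w : W) := pev h (w.1 *: e0 + w.2 *: e1 + d0).
have [] := @quadric_pencil _ _ _ _ _ (bir_sym B) W a c.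
- by polynomial.
- by polynomial.
- by exists (dot Z0 x0, dot Z1 x0); rewrite /c /= Ed0 addrA -zx.
- move=> w hw; name u Eu := (w.1 *: e0 + w.2 *: e1).
 rewrite /c -Eu Ed0 in hw.
 have nz := plane_image_nondegenerate hw.
 have w0 : (w.1 != 0) || (w.2 != 0).
  apply: contraNT nz; rewrite negb_or !negbK => /andP[/eqP w1 /eqP w2].
  by rewrite Eu w1 w2 !scale0r addr0 /cub !st01; apply/eqP; apply: dot_ext => y; rewrite dot_cross det4_01 dot0l.
 exists (cross (cub T u) (T u u p1) (T u u p2)); split=> //.
  move=> y ay; have [->|ky] := eqVneq (pev k y) 0; first by rewrite mul0r.
  name x Ex := (cub S y).
  have [tau et] : exists tau, x = tau *: u + (dot Z2 x *: p1 + dot Z3 x *: p2).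
   have ex : w.2 * dot Z0 x = w.1 * dot Z1 x.
    by move/eqP: ay; rewrite /a -Ex dotDl dotNl !dotZl subr_eq0 => /eqP.
   have [w1|w1] := eqVneq w.1 0.
    have w2 : w.2 != 0 by move: w0; rewrite w1 eqxx.
    have x0' : dot Z0 x = 0 by move/eqP: ex; rewrite w1 mul0r mulf_eq0 (negPf w2) => /eqP.
    exists (dot Z1 x / w.2); rewrite {1}(zx x) Eu w1 x0' !scale0r !add0r scalerA divfK // addrA //.
   exists (dot Z0 x / w.1); rewrite {1}(zx x) Eu scalerDr !scalerA divfK // -!addrA; congr (_ + _).
   rewrite (_ : dot Z0 x / w.1 * w.2 = dot Z1 x) //; apply: (mulfI w1); rewrite -ex; field; exact: w1.
  have : dot (cross (cub T u) (T u u p1) (T u u p2)) (cub T x) = 0.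
   rewrite et double_line_cub cubZ !stZ1 !stZ2 !(dotDr, dotZr) !dot_cross det4_14 det4_24 det4_34.
   by rewrite !(mulr0, addr0).
  by rewrite Ex (bir_cub (bir_sym B)) dotZr.
 set x := u + _ in hw; have kx : pev k (cub T x) != 0.
  by rewrite (bir_h_comp (bir_sym B)) ?expf_neq0 //; apply: bir_cub_neq0 B _ hw.
 have a0 : a w != 0.
  case/orP: w0 => wi; [apply/eqP => /(congr1 (fun z => dot z e1))|apply/eqP => /(congr1 (fun z => dot z e0))];
   rewrite /a dotDl dotNl !dotZl ?Z01 ?Z11 ?Z00 ?Z10 dot0l !(mulr0, mulr1, subr0, sub0r) => /eqP; rewrite ?oppr_eq0; exact/negP.
 have [z hz] := dot_neq0 a0; have [v hv] := bir_dsurj (bir_sym B) z kx.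
 exists (cub T x), v; split=> //; last by rewrite hv.
 rewrite (bir_cub B) dotZr /x dotDr dotDr !dotZr /a !dotDl !dotNl !dotZl Z0p1 Z0p2 Z1p1 Z1p2 Eu !dotDr !dotZr Z00 Z01 Z10 Z11.
 by ring.
move=> G [Gh G0 hG].
have [m0 h0] := hG (0, 1); have [m1 h1] := hG (-1, 0).
have E0 y : dot Z0 (cub S y) = pev G y * dot m0 y by rewrite -h0 /a /= scale1r scale0r subr0.
have E1 y : dot Z1 (cub S y) = pev G y * dot m1 y by rewrite -h1 /a /= scaleN1r opprK scale0r add0r.
exists G, m0, m1; split=> // s t e.
have z : s *: Z0 + t *: Z1 = 0.
 apply: (image_nondegenerate (bir_sym B)) => y; rewrite dotDl !dotZl E0 E1.
 transitivity (pev G y * dot (s *: m0 + t *: m1) y); first by rewrite dotDl !dotZl; ring.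
 by rewrite e dot0l mulr0.
split; [have := congr1 (fun x => dot x e0) z|have := congr1 (fun x => dot x e1) z];
 by rewrite dotDl !dotZl ?Z00 ?Z10 ?Z01 ?Z11 dot0l !(mulr0, mulr1, addr0, add0r).
Qed.

(** As g inverts f, m0(f) : m1(f) = Z0 : Z1, and coprimality of Z0, Z1 yields the quadratic
    quotient. *)
Lemma double_line_quadric G m0 m1 : G \is 2.-homog -> G != 0 ->
 (forall y, dot Z0 (cub S y) = pev G y * dot m0 y /\ dot Z1 (cub S y) = pev G y * dot m1 y) ->
 exists2 q : P4, q \is 2.-homog & forall x, dot m0 (cub T x) = dot Z0 x * pev q x /\ dot m1 (cub T x) = dot Z1 x * pev q x.
Proof.
move=> Gh G0 hG.
have [Z00 Z01 Z0p1 Z0p2] := Z0E; have [Z10 Z11 Z1p1 Z1p2] := Z1E.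
have zz x : dot Z0 x * dot m1 (cub T x) = dot Z1 x * dot m0 (cub T x).
 have e x' : pev G (cub T x') * (dot Z0 x' * dot m1 (cub T x') - dot Z1 x' * dot m0 (cub T x')) = 0.
  have [h0 h1] := hG (cub T x'); rewrite (bir_cub B) !dotZr in h0 h1.
  transitivity (dot Z0 x' * (pev G (cub T x') * dot m1 (cub T x')) - dot Z1 x' * (pev G (cub T x') * dot m0 (cub T x'))); first by ring.
  by rewrite -h0 -h1; ring.
 have [y0 hy0] := pev_neq0 G0; have [y1 hy1] := bir_h_ex (bir_sym B).
 have [y [gy ky]] : exists y : V, pev G y != 0 /\ pev k y != 0.
  by apply: (@pfun_nonzero2 _ V _ _ y0 y1) => //; apply: pfun_pev; apply: pvec_id.
 apply/eqP; rewrite -subr_eq0; apply/eqP; move: x.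
 apply: (@pfun_dense _ V _ (fun x => pev G (cub T x))).
 - by polynomial.
 - by polynomial.
 - by exists (cub S y); rewrite (bir_cub (bir_sym B)) (pev_homogZ _ _ Gh) mulf_neq0 ?expf_neq0.
 by move=> x gx; have /eqP := e x; rewrite mulf_eq0 (negPf gx) => /eqP.
have iZ : indep2 Z0 Z1.
 move=> s t e; split; [have := congr1 (fun x => dot x e0) e|have := congr1 (fun x => dot x e1) e];
  by rewrite dotDl !dotZl ?Z00 ?Z10 ?Z01 ?Z11 dot0l !(mulr0, mulr1, addr0, add0r).
pose F (i : 'I_2) := lin (nth 0 [:: Z0; Z1] i); pose Gm (i : 'I_2) := comb f (nth 0 [:: m0; m1] i).
have cF : coprime_family F by apply: (@coprime_lin _ 2 (fun i => nth 0 [:: Z0; Z1] i) (@Ordinal 2 0 isT) (@Ordinal 2 1 isT)).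
have Z0n : Z0 != 0 by apply: contra_eq_neq Z00 => ->; rewrite dot0l eq_sym oner_neq0.
have [|i j|q hq] := @mpoly_cross_ratio _ 2 4 F Gm cF.
- by exists (@Ordinal 2 0 isT); rewrite /F lin_eq0.
- apply: pev_inj => x; rewrite !pevM !pev_lin !(pev_comb_cub B).
 by case: i => -[|[|//]] hi; case: j => -[|[|//]] hj //=.
have q0 := hq (@Ordinal 2 0 isT); have q1 := hq (@Ordinal 2 1 isT); rewrite /F /Gm /= in q0 q1.
exists q.
 apply: (homog_quot (e := 1) (lin_homog Z0)); first by rewrite lin_eq0.
 by rewrite -q0; apply: comb_homog; apply: bir_fh B.
by move=> x; rewrite -!(pev_comb_cub B) q0 q1 !pevM !pev_lin.
Qed.

End Basis.
End Line.
End Bir.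
End DoubleLineStructure.

(** * Matrices of rank one modulo a quadratic polynomial *)

Section RankOneModulo.
Variable K : numClosedFieldType.

Lemma minor_dvdp (M : 'I_3 -> 'I_3 -> {poly K}) (r : {poly K}) :
 (forall i k j l : 'I_3, (i < k)%N -> (j < l)%N -> r %| M i j * M k l - M i l * M k j) ->
 forall i k j l, r %| M i j * M k l - M i l * M k j.
Proof.
move=> hm i k j l; have [ik|ki|/val_inj->] := ltngtP i k; last by rewrite mulrC subrr dvdp0.
 have [jl|lj|/val_inj->] := ltngtP j l; [exact: hm| |by rewrite subrr dvdp0].
 by rewrite -dvdpNr opprB; apply: hm.
have [jl|lj|/val_inj->] := ltngtP j l; last by rewrite subrr dvdp0.
 by rewrite -dvdpNr opprB [M i l * _]mulrC [M i j * _]mulrC; apply: hm.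
by rewrite [M i j * _]mulrC [M i l * _]mulrC; apply: hm.
Qed.

(* Modulo a quadratic r, a matrix of rank one has its rows proportional to a generic combination of
  them, as soon as that combination is unimodular modulo r. *)
Lemma rank_one_mod (M : 'I_3 -> 'I_3 -> {poly K}) (r : {poly K}) (d : 'I_3 -> nat) : size r = 3%N ->
 (forall i k j l : 'I_3, (i < k)%N -> (j < l)%N -> r %| M i j * M k l - M i l * M k j) ->
 (forall t, exists i j, (M i j).[t] != 0) -> (forall j, (1 < d j)%N) ->
 (forall j, (size (M ord0 j) <= d j)%N) -> (forall i j, i != ord0 -> (size (M i j) <= (d j).+1)%N) ->
 exists (u : 'I_3 -> {poly K}) (p : {poly K}), [/\ p != 0, forall j, (size (u j) <= 2)%N &
  forall e, p.[e] != 0 -> forall i, i != ord0 -> exists (l : {poly K}) (m : 'I_3 -> {poly K}),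
   [/\ (size l <= 2)%N, forall j, (size (m j) <= d j - 1)%N &
    forall j, M i j = l * (M ord0 j + e *: u j) + r * m j]].
Proof.
move=> sr hm nz d1 s0 s1; have r0 : r != 0 by rewrite -size_poly_gt0 sr.
have mm := minor_dvdp hm.
have [c0 [c1 [c2 [c20 rE]]]] : exists c0 c1 c2, c2 != 0 /\ forall t, r.[t] = c0 + c1 * t + c2 * t ^+ 2.
 exists r`_0, r`_1, r`_2; split=> [|t]; first by move: r0; rewrite -lead_coef_eq0 lead_coefE sr.
 by rewrite horner_coef sr !big_ord_recl big_ord0 /= expr0 mulr1 expr1 addr0 addrA.
have [t1 [t2 ht]] := quadratic_root c0 c1 c20.
name i1 Ei1 := (@Ordinal 3 1 isT).
name i2 Ei2 := (@Ordinal 3 2 isT).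
pose W : lmodType K := (K^o * K^o * 'rV[K]_3)%type.
(* A combination of the three rows, weighted over the columns; general parameters make it nonzero at
   both roots of [r]. *)
have [N NE] : exists N : K -> W -> K, forall s w, N s w = \sum_j w.2 0 j * ((M ord0 j).[s] + w.1.1 * (M i1 j).[s] + w.1.2 * (M i2 j).[s]) by eexists.
have P1 : pfun (fun w : W => w.1.1) by move=> u v; exists (u.1.1%:P + v.1.1 *: 'X) => t; rewrite !hornerE /=; congr (_ + _); rewrite /GRing.scale /= mulrC.
have P2 : pfun (fun w : W => w.1.2) by move=> u v; exists (u.1.2%:P + v.1.2 *: 'X) => t; rewrite !hornerE /=; congr (_ + _); rewrite /GRing.scale /= mulrC.
have P3 j : pfun (fun w : W => w.2 0 j) by move=> u v; exists ((u.2 0 j)%:P + v.2 0 j *: 'X) => t; rewrite !hornerE /= !mxE; congr (_ + _); rewrite mulrC.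
have pN s : pfun (N s).
 apply: (pfunE (fun w => esym (NE s w))); apply: pfun_sum => j; apply: pfunM => //.
 by apply: pfunD; [apply: pfunD; first exact: pfun_const|]; apply: pfunM => //; apply: pfun_const.
have nN s : exists w, N s w != 0.
 have sel (a b : K) j : N s (a, b, \row_l (l == j)%:R) = (M ord0 j).[s] + a * (M i1 j).[s] + b * (M i2 j).[s].
  rewrite NE (bigD1 j) //= big1 ?addr0 ?mxE ?eqxx ?mul1r // => l lj.
  by rewrite mxE (negPf lj) mul0r.
 have [[j hj]|nj] := classic (exists j, (M ord0 j).[s] != 0).
  by exists (0, 0, \row_l (l == j)%:R); rewrite sel !mul0r !addr0.
 have z j : (M ord0 j).[s] = 0 by apply/eqP/negPn/negP => hj; apply: nj; exists j.
 have [i [j hij]] := nz s; have [ei|ei] : i = i1 \/ i = i2.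
  case: i hij => -[|[|[|//]]] hi hij; [|left|right]; [|by rewrite Ei1; apply: val_inj|by rewrite Ei2; apply: val_inj].
  by case/eqP: hij; rewrite -(z j); congr (_.[_]); congr (M _ _); apply: val_inj.
  by exists (1, 0, \row_l (l == j)%:R); rewrite sel z add0r mul1r mul0r addr0 -ei.
 by exists (0, 1, \row_l (l == j)%:R); rewrite sel z add0r mul1r mul0r add0r -ei.
have [w1 h1] := nN t1; have [w2 h2] := nN t2.
have [w [hw1 hw2]] := pfun_nonzero2 (pN t1) (pN t2) h1 h2.
have [v vE] : exists v : 'I_3 -> {poly K}, forall j, v j = w.1.1 *: M i1 j + w.1.2 *: M i2 j by eexists.
have [ka kaE] : exists ka : 'I_3 -> K, forall j, ka j = w.2 0 j by eexists.
have vr s j : r.[s] = 0 -> (v j %% r).[s] = (v j).[s].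
 by move=> rs; rewrite {2}(divp_eq (v j) r) hornerD hornerM rs mulr0 add0r.
pose A s := \sum_j ka j * (M ord0 j).[s]; pose Bv s := \sum_j ka j * (v j).[s].
have AB s : A s + Bv s = N s w.
 rewrite NE -big_split /=; apply: eq_bigr => j _; rewrite kaE vE !hornerE /=; ring.
pose p := ((A t1)%:P + Bv t1 *: 'X) * ((A t2)%:P + Bv t2 *: 'X).
exists (fun j => v j %% r), p; split.
- suff : p.[1] != 0 by apply: contraNneq => ->; rewrite horner0.
 by rewrite /p hornerM !hornerD !hornerC !hornerZ !hornerX !mulr1 !AB mulf_neq0.
- by move=> j; have := ltn_modp (v j) r; rewrite r0 sr.
move=> e; rewrite /p !hornerE /= mulf_eq0 negb_or => /andP[p1 p2] i i0.
have [f fE] : exists f : 'I_3 -> {poly K}, forall j, f j = M ord0 j + e *: (v j %% r) by eexists.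
name F FE := (\sum_j ka j *: f j).
have Fs s : r.[s] = 0 -> F.[s] = A s + e * Bv s.
 move=> rs; rewrite FE horner_sum mulr_sumr -big_split /=; apply: eq_bigr => j _.
 by rewrite hornerZ fE hornerD hornerZ vr //; ring.
have co : coprimep r F.
 apply: coprime_noroot => // t rt; rewrite (Fs t rt) => z.
 move/eqP: rt; rewrite rE ht !mulf_eq0 (negPf c20) /= !subr_eq0 => /orP[]/eqP et; move: z; rewrite et => /eqP; apply/negP.
  by rewrite mulrC.
 by rewrite mulrC.
(* [F] combines the entries of the perturbed row [f] and is invertible modulo [r]; this produces the
   multiplier [la] with row i equal to [la] times [f] modulo [r]. *)
have [gg hgg] : exists gg, r %| 1 - gg * F.
 have /Bezout_eq1_coprimepP[[x y] /= exy] := co; exists y; rewrite -exy addrK; exact: dvdp_mulIr.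
name Q QE := (\sum_j ka j *: M i j).
have dZ c (q : {poly K}) : r %| q -> r %| c *: q by move=> rq; rewrite -mul_polyC dvdp_mull.
have fM l j : r %| f l * M i j - M i l * f j.
 have vv : r %| v l * M i j - M i l * v j.
  have -> : v l * M i j - M i l * v j = w.1.1 *: (M i1 l * M i j - M i1 j * M i l) + w.1.2 *: (M i2 l * M i j - M i2 j * M i l).
   by rewrite !vE -!mul_polyC; ring.
  by rewrite dvdp_add // dZ.
 have ml q : v q %% r = v q - v q %/ r * r by rewrite {2}(divp_eq (v q) r) addrC addKr.
 have -> : f l * M i j - M i l * f j = (M ord0 l * M i j - M ord0 j * M i l) + e *: (v l * M i j - M i l * v j)
   - e *: ((v l %/ r * M i j - M i l * (v j %/ r)) * r).
  by rewrite !fE !ml -!mul_polyC; ring.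
 by apply: dvdp_sub; [apply: dvdp_add; [exact: mm|apply: dZ; exact: vv]|apply: dZ; exact: dvdp_mulIr].
name la laE := ((gg * Q) %% r).
have key j : r %| M i j - la * f j.
 have -> : M i j - la * f j = (1 - gg * F) * M i j + gg * (F * M i j - Q * f j) + (gg * Q) %/ r * f j * r.
  have e1 := divp_eq (gg * Q) r; rewrite -laE in e1.
  have -> : (gg * Q) %/ r * f j * r = (gg * Q - la) * f j by rewrite mulrAC; congr (_ * _); apply/eqP; rewrite eq_sym subr_eq; apply/eqP.
  by ring.
 rewrite dvdp_add ?dvdp_mulIr // dvdp_add //; first by rewrite dvdp_mulr.
 apply: dvdp_mull; have -> : F * M i j - Q * f j = \sum_l ka l *: (f l * M i j - M i l * f j).
  rewrite FE QE !mulr_suml -sumrB; apply: eq_bigr => l _; by rewrite scalerBr !scalerAl.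
 by elim/big_ind: _ => [|x y|l _]; [exact: dvdp0|exact: dvdp_add|rewrite -mul_polyC dvdp_mull].
have sla : (size la <= 2)%N by have := ltn_modp (gg * Q) r; rewrite r0 sr -laE.
exists la, (fun j => (M i j - la * f j) %/ r); split=> // j; last first.
 by rewrite -fE [r * _]mulrC divpK ?key // addrC subrK.
rewrite size_divp // sr; have sv : (size (v j %% r)%R <= 2)%N by have := ltn_modp (v j) r; rewrite r0 sr.
have sf : (size (f j) <= d j)%N.
 rewrite fE (leq_trans (size_polyD _ _)) // geq_max s0 (leq_trans (size_scale_leq _ _)) // (leq_trans sv) //.
have : (size (M i j - la * f j)%R <= (d j).+1)%N.
 rewrite (leq_trans (size_polyD _ _)) // geq_max s1 //= size_polyN (leq_trans (size_polyMleq _ _)) //.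
 by rewrite -subn1 leq_subLR; exact: leq_trans (leq_add sla sf) _.
move=> hh; rewrite leq_subLR (leq_trans hh) //; have := d1 j; case: (d j) => // n _; by rewrite subn1 /= add2n.
Qed.

End RankOneModulo.

(** * Maps with a double base line as limits of the family [sfam] *)

Section RuledLimit.
Variable K : numClosedFieldType.
Notation V := ('rV[K]_4).
Notation P4 := {mpoly K[4]}.

Definition det3 (a1 a2 a3 b1 b2 b3 c1 c2 c3 : K) : K :=
 a1 * (b2 * c3 - b3 * c2) - a2 * (b1 * c3 - b3 * c1) + a3 * (b1 * c2 - b2 * c1).

Lemma pfun_det3 (W : lmodType K) (a1 a2 a3 b1 b2 b3 c1 c2 c3 : W -> K) : pfun a1 -> pfun a2 -> pfun a3 ->
 pfun b1 -> pfun b2 -> pfun b3 -> pfun c1 -> pfun c2 -> pfun c3 ->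
 pfun (fun w => det3 (a1 w) (a2 w) (a3 w) (b1 w) (b2 w) (b3 w) (c1 w) (c2 w) (c3 w)).
Proof. by move=> *; polynomial.
Qed.

Lemma det3_dep a1 a2 a3 b1 b2 b3 c1 c2 c3 : det3 a1 a2 a3 b1 b2 b3 c1 c2 c3 = 0 ->
 exists s t r, (s != 0) || (t != 0) || (r != 0) /\
  [/\ s * a1 + t * b1 + r * c1 = 0, s * a2 + t * b2 + r * c2 = 0 & s * a3 + t * b3 + r * c3 = 0].
Proof.
move=> e; pose v (x y z : K) : V := x *: evec K q0 + y *: evec K q1 + z *: evec K q2.
have ve x y z : [/\ v x y z 0 q0 = x, v x y z 0 q1 = y, v x y z 0 q2 = z & v x y z 0 q3 = 0].
 by rewrite /v !mxE /=; split; ring.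
have /cross_dep[s [t [r [nz z]]]] : cross (v a1 a2 a3) (v b1 b2 b3) (v c1 c2 c3) = 0.
 apply: dot_ext => x; rewrite dot_cross dot0l det4E /minor2.
 have [-> -> -> ->] := ve a1 a2 a3; have [-> -> -> ->] := ve b1 b2 b3; have [-> -> -> ->] := ve c1 c2 c3.
 by transitivity (det3 a1 a2 a3 b1 b2 b3 c1 c2 c3 * x 0 q3); [rewrite /det3; ring|rewrite e mul0r].
exists s, t, r; split=> //.
have C j := congr1 (fun x : V => x 0 j) z.
have := C q0; have := C q1; have := C q2; rewrite !mxE.
have := ve a1 a2 a3; have := ve b1 b2 b3; have := ve c1 c2 c3; rewrite !mxE.
by move=> [-> -> -> _] [-> -> -> _] [-> -> -> _].
Qed.

Lemma hfun_dot2 d e (F G : V -> V) : hvec d F -> hvec e G -> hfun (d + e) (fun x => dot (F x) (G x)).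
Proof.
move=> hF hG; apply: (hfun_ext (fun x => esym (dotE _ _))).
by do !apply: hfunD; apply: hfunM.
Qed.

Lemma hvec_mulmx d (F : V -> V) (N : 'M[K]_4) : hvec d F -> hvec d (fun x => F x *m N).
Proof.
move=> hF j; apply: (@hfun_ext _ _ (fun x => dot (\row_i N i j) (F x))); last exact: hfun_dotv.
by move=> x; rewrite mxE sum4 dotE !mxE; ring.
Qed.

Definition poly3 (a b c : K) : {poly K} := Poly [:: a; b; c].
Arguments poly3 : simpl never.

Lemma poly3E a b c t : (poly3 a b c).[t] = a + b * t + c * t ^+ 2.
Proof. by rewrite horner_Poly /=; ring. Qed.

Lemma size_poly3 a b c : (size (poly3 a b c) <= 3)%N. Proof. exact: size_Poly. Qed.

Lemma size_poly2 a b : (size (poly3 a b 0) <= 2)%N.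
Proof. by rewrite (_ : poly3 a b 0 = Poly [:: a; b]) ?size_Poly //; apply: poly_ext => t; rewrite poly3E horner_Poly /=; ring. Qed.

Section Bir.
Variables (f g : 'I_4 -> P4) (h k : P4).
Hypothesis B : bir f g h k.
Notation T := (pol f).
Notation S := (pol g).
Variables (p1 p2 : V).
Hypotheses (z11 : triple_zero f p1) (z22 : triple_zero f p2) (z12 : forall x, T p1 p2 x = 0).
Variables (e0 e1 Z0 Z1 Z2 Z3 : V).
Hypotheses (hd : det4 e0 e1 p1 p2 != 0)
 (zx : forall x, x = dot Z0 x *: e0 + dot Z1 x *: e1 + dot Z2 x *: p1 + dot Z3 x *: p2)
 (Z0E : [/\ dot Z0 e0 = 1, dot Z0 e1 = 0, dot Z0 p1 = 0 & dot Z0 p2 = 0])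
 (Z1E : [/\ dot Z1 e0 = 0, dot Z1 e1 = 1, dot Z1 p1 = 0 & dot Z1 p2 = 0])
 (Z2E : [/\ dot Z2 e0 = 0, dot Z2 e1 = 0, dot Z2 p1 = 1 & dot Z2 p2 = 0])
 (Z3E : [/\ dot Z3 e0 = 0, dot Z3 e1 = 0, dot Z3 p1 = 0 & dot Z3 p2 = 1]).
Variables (G : P4) (m0 m1 m2 m3 g0 g1 g2 g3 : V) (q : P4) (N : 'M[K]_4).
Hypotheses (hG : forall y, dot Z0 (cub S y) = pev G y * dot m0 y /\ dot Z1 (cub S y) = pev G y * dot m1 y)
 (hq : forall x, dot m0 (cub T x) = dot Z0 x * pev q x /\ dot m1 (cub T x) = dot Z1 x * pev q x)
 (Ns : forall x y, dot (x *m N) y = dot (y *m N) x) (qN : forall x, pev q x = dot (x *m N) x)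
 (gx : forall y, y = dot m0 y *: g0 + dot m1 y *: g1 + dot m2 y *: g2 + dot m3 y *: g3)
 (M0E : [/\ dot m0 g0 = 1, dot m0 g1 = 0, dot m0 g2 = 0 & dot m0 g3 = 0])
 (M1E : [/\ dot m1 g0 = 0, dot m1 g1 = 1, dot m1 g2 = 0 & dot m1 g3 = 0])
 (M2E : [/\ dot m2 g0 = 0, dot m2 g1 = 0, dot m2 g2 = 1 & dot m2 g3 = 0])
 (M3E : [/\ dot m3 g0 = 0, dot m3 g1 = 0, dot m3 g2 = 0 & dot m3 g3 = 1]).

(* Rows of the 3 x 3 matrix expressing, in the coordinates (s, x2, x3), the restriction of the map to
  the plane of the vectors [s *: u + x2 *: p1 + x3 *: p2]. *)
Definition row_q u (j : 'I_3) : K := nth 0 [:: dot (u *m N) u; 2 * dot (u *m N) p1; 2 * dot (u *m N) p2] j.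
Definition row_m m u (j : 'I_3) : K := nth 0 [:: dot m (cub T u); 3 * dot m (T u u p1); 3 * dot m (T u u p2)] j.
Definition mrow u (i : 'I_3) := nth (row_q u) [:: row_q u; row_m m2 u; row_m m3 u] i.
Notation U y := (dot m0 y *: e0 + dot m1 y *: e1).
Notation R0 u j := (row_q u (@Ordinal 3 j isT)).
Notation R2 u j := (row_m m2 u (@Ordinal 3 j isT)).
Notation R3 u j := (row_m m3 u (@Ordinal 3 j isT)).

Lemma row_q_first (i : V) (z u : V) : (forall x, dot i (cub T x) = dot z x * pev q x) -> dot z p1 = 0 -> dot z p2 = 0 ->
 [/\ dot i (cub T u) = dot z u * R0 u 0, 3 * dot i (T u u p1) = dot z u * R0 u 1 &
   3 * dot i (T u u p2) = dot z u * R0 u 2].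
Proof.
move=> hi zp1 zp2; rewrite /row_q /=.
have E s t : dot i (cub T u) + 3 * (s * dot i (T u u p1) + t * dot i (T u u p2))
  = dot z u * (dot (u *m N) u + 2 * (s * dot (u *m N) p1 + t * dot (u *m N) p2) + pev q (s *: p1 + t *: p2)).
 have := hi (u + (s *: p1 + t *: p2)); rewrite (double_line_cub z11 z22 z12) !(dotDr, dotZr) zp1 zp2 !mulr0 !addr0 => ->.
 congr (_ * _); rewrite !qN !mulmxDl -!scalemxAl !(dotDl, dotDr, dotZl, dotZr) (Ns p1 u) (Ns p2 u); ring.
split.
- by have := E 0 0; rewrite !mul0r !addr0 !mulr0 !addr0 => ->; rewrite !scale0r addr0 qN mul0mx dot0l addr0.
- have C (s : K) : horner_rec [:: dot i (cub T u) - dot z u * dot (u *m N) u; 3 * dot i (T u u p1) - dot z u * (2 * dot (u *m N) p1); - (dot z u * pev q p1)] s = 0.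
  have := E s 0; rewrite scale0r addr0 !mul0r !addr0 !qN -scalemxAl dotZl dotZr => /eqP; rewrite -subr_eq0 => /eqP e.
  by rewrite -[RHS]e /=; ring.
 by have /= /eqP := horner_rec_eq0 C 1; rewrite subr_eq0 => /eqP.
- have C (s : K) : horner_rec [:: dot i (cub T u) - dot z u * dot (u *m N) u; 3 * dot i (T u u p2) - dot z u * (2 * dot (u *m N) p2); - (dot z u * pev q p2)] s = 0.
  have := E 0 s; rewrite scale0r add0r !mul0r !add0r !qN -scalemxAl dotZl dotZr => /eqP; rewrite -subr_eq0 => /eqP e.
  by rewrite -[RHS]e /=; ring.
 by have /= /eqP := horner_rec_eq0 C 1; rewrite subr_eq0 => /eqP.
Qed.

Lemma plane_image u s a b : s *: cub T u + 3 *: (a *: T u u p1 + b *: T u u p2) =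
 (s * R0 u 0 + a * R0 u 1 + b * R0 u 2) *: (dot Z0 u *: g0 + dot Z1 u *: g1)
 + (s * R2 u 0 + a * R2 u 1 + b * R2 u 2) *: g2 + (s * R3 u 0 + a * R3 u 1 + b * R3 u 2) *: g3.
Proof.
have [_ _ z01 z02] := Z0E; have [_ _ z03 z04] := Z1E.
have [a0 a1 a2] := row_q_first u (fun x => proj1 (hq x)) z01 z02.
have [b0 b1 b2] := row_q_first u (fun x => proj2 (hq x)) z03 z04.
rewrite [LHS]gx !(dotDr, dotZr) a0 b0.
have -> : s * (dot Z0 u * R0 u 0) + 3 * (a * dot m0 (T u u p1) + b * dot m0 (T u u p2)) = dot Z0 u * (s * R0 u 0 + a * R0 u 1 + b * R0 u 2).
 by transitivity (s * (dot Z0 u * R0 u 0) + a * (3 * dot m0 (T u u p1)) + b * (3 * dot m0 (T u u p2))); [ring|rewrite a1 a2; ring].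
have -> : s * (dot Z1 u * R0 u 0) + 3 * (a * dot m1 (T u u p1) + b * dot m1 (T u u p2)) = dot Z1 u * (s * R0 u 0 + a * R0 u 1 + b * R0 u 2).
 by transitivity (s * (dot Z1 u * R0 u 0) + a * (3 * dot m1 (T u u p1)) + b * (3 * dot m1 (T u u p2))); [ring|rewrite b1 b2; ring].
rewrite /row_m /=; vring.
Qed.

(** The determinant of the linear map induced on a plane of the pencil; [cof0], [cof1], [cof2] are
    Cramer's numerators for the right-hand side (1, b, c). *)
Definition delta u := det3 (R0 u 0) (R2 u 0) (R3 u 0) (R0 u 1) (R2 u 1) (R3 u 1) (R0 u 2) (R2 u 2) (R3 u 2).
Definition cof0 u b c := det3 1 b c (R0 u 1) (R2 u 1) (R3 u 1) (R0 u 2) (R2 u 2) (R3 u 2).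
Definition cof1 u b c := det3 (R0 u 0) (R2 u 0) (R3 u 0) 1 b c (R0 u 2) (R2 u 2) (R3 u 2).
Definition cof2 u b c := det3 (R0 u 0) (R2 u 0) (R3 u 0) (R0 u 1) (R2 u 1) (R3 u 1) 1 b c.
(** The inverse map computed plane by plane with Cramer's rule, a map of degree 5. *)
Definition chi y := cof0 (U y) (dot m2 y) (dot m3 y) *: U y +
 (cof1 (U y) (dot m2 y) (dot m3 y) *: p1 + cof2 (U y) (dot m2 y) (dot m3 y) *: p2).

Lemma dot_ZU y : dot Z0 (U y) = dot m0 y /\ dot Z1 (U y) = dot m1 y.
Proof.
have [z00 z01 _ _] := Z0E; have [z10 z11' _ _] := Z1E.
by rewrite !(dotDr, dotZr) z00 z01 z10 z11'; split; ring.
Qed.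

Lemma cub_chi y : cub T (chi y) = (cof0 (U y) (dot m2 y) (dot m3 y) ^+ 2 * delta (U y)) *: y.
Proof.
rewrite /chi (double_line_cub z11 z22 z12); have [u0 u1] := dot_ZU y; move: u0 u1; set u := U y => u0 u1.
name s Es := (cof0 u (dot m2 y) (dot m3 y)).
name a Ea := (cof1 u (dot m2 y) (dot m3 y)).
name b Eb := (cof2 u (dot m2 y) (dot m3 y)).
rewrite -Es -Ea -Eb cubZ !stZ1 !stZ2.
transitivity (s ^+ 2 *: (s *: cub T u + 3 *: (a *: T u u p1 + b *: T u u p2))).
 by vring.
rewrite plane_image u0 u1.
have k0 : s * R0 u 0 + a * R0 u 1 + b * R0 u 2 = delta u by rewrite Es Ea Eb /cof0 /cof1 /cof2 /delta /det3; ring.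
have k2 : s * R2 u 0 + a * R2 u 1 + b * R2 u 2 = delta u * dot m2 y by rewrite Es Ea Eb /cof0 /cof1 /cof2 /delta /det3; ring.
have k3 : s * R3 u 0 + a * R3 u 1 + b * R3 u 2 = delta u * dot m3 y by rewrite Es Ea Eb /cof0 /cof1 /cof2 /delta /det3; ring.
by rewrite k0 k2 k3 -[RHS]scalerA; congr (_ *: _); transitivity (delta u *: (dot m0 y *: g0 + dot m1 y *: g1 + dot m2 y *: g2 + dot m3 y *: g3));
 [vring|rewrite -gx].
Qed.

Lemma hvec_U : hvec 1 (fun y => U y).
Proof. by apply: hvecD; apply: (hvecZ (d := 1) (e := 0)); try exact: hvec_const; apply: hfun_dot. Qed.

Lemma hfun_rows j : [/\ hfun (2 - (j != ord0 :> 'I_3)) (fun y => row_q (U y) j), hfun (3 - (j != ord0)) (fun y => row_m m2 (U y) j) &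
 hfun (3 - (j != ord0)) (fun y => row_m m3 (U y) j)].
Proof.
have hc x : hvec 0 (fun _ : V => x) := hvec_const x.
have hU := hvec_U.
have hm m (j' : 'I_3) : hfun (3 - (j' != ord0)) (fun y => row_m m (U y) j').
 case: j' => -[|[|[|//]]] hj; rewrite /row_m /=.
 - by apply: hfun_dotv; apply: (hvec_st f hU hU hU).
 - by apply: hfunZ; apply: hfun_dotv; apply: (hvec_st f hU hU (hc _)).
 - by apply: hfunZ; apply: hfun_dotv; apply: (hvec_st f hU hU (hc _)).
split=> //; case: j => -[|[|[|//]]] hj; rewrite /row_q /=.
- by apply: (hfun_dot2 (d := 1) (e := 1)) => //; apply: hvec_mulmx.
- by apply: hfunZ; apply: (hfun_dot2 (d := 1) (e := 0)) => //; apply: hvec_mulmx.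
- by apply: hfunZ; apply: (hfun_dot2 (d := 1) (e := 0)) => //; apply: hvec_mulmx.
Qed.

Lemma hfun_cof0 : hfun 4 (fun y => cof0 (U y) (dot m2 y) (dot m3 y)).
Proof.
have [A1 A2 A3] := hfun_rows (@Ordinal 3 1 isT); have [B1 B2 B3] := hfun_rows (@Ordinal 3 2 isT).
rewrite /cof0 /det3; have h2 := hfun_dot m2; have h3 := hfun_dot m3.
apply: hfunD; [apply: hfunD|].
- apply: hfunZ; apply: hfunD; [|apply: hfunN]; exact: (hfunM (d := 2) (e := 2)).
- apply: hfunN; apply: (hfunM (d := 1) (e := 3)) => //; apply: hfunD; [|apply: hfunN];
  [exact: (hfunM (d := 1) (e := 2))|exact: (hfunM (d := 2) (e := 1))].
- apply: (hfunM (d := 1) (e := 3)) => //; apply: hfunD; [|apply: hfunN];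
  [exact: (hfunM (d := 1) (e := 2))|exact: (hfunM (d := 2) (e := 1))].
Qed.

Lemma hfun_cof12 : hfun 5 (fun y => cof1 (U y) (dot m2 y) (dot m3 y)) /\ hfun 5 (fun y => cof2 (U y) (dot m2 y) (dot m3 y)).
Proof.
have h2 := hfun_dot m2; have h3 := hfun_dot m3.
have gen (j : 'I_3) : j != ord0 -> hfun 5 (fun y => det3 1 (dot m2 y) (dot m3 y) (row_q (U y) ord0) (row_m m2 (U y) ord0) (row_m m3 (U y) ord0)
  (row_q (U y) j) (row_m m2 (U y) j) (row_m m3 (U y) j)).
 move=> j0; have [A1 A2 A3] := hfun_rows ord0; have [] := hfun_rows j; rewrite j0 => B1 B2 B3.
 rewrite /det3; apply: hfunD; [apply: hfunD|].
 - by apply: hfunZ; apply: hfunD; [|apply: hfunN]; exact: (hfunM (d := 3) (e := 2)).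
 - by apply: hfunN; apply: (hfunM (d := 1) (e := 4)) => //; apply: hfunD; [|apply: hfunN];
   [exact: (hfunM (d := 2) (e := 2))|exact: (hfunM (d := 3) (e := 1))].
 - by apply: (hfunM (d := 1) (e := 4)) => //; apply: hfunD; [|apply: hfunN];
   [exact: (hfunM (d := 2) (e := 2))|exact: (hfunM (d := 3) (e := 1))].
have o0 : @Ordinal 3 0 isT = ord0 by apply: val_inj.
split.
 apply: hfun_ext (hfunN (gen (@Ordinal 3 2 isT) isT)) => y; rewrite /cof1 -!o0 /det3; ring.
apply: hfun_ext (gen (@Ordinal 3 1 isT) isT) => y; rewrite /cof2 -!o0 /det3; ring.
Qed.

Lemma hvec_chi : hvec 5 chi.
Proof.
have [h1 h2] := hfun_cof12.
apply: hvecD; first by apply: (hvecZ (d := 4)); [exact: hfun_cof0|exact: hvec_U].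
by apply: hvecD; apply: (hvecZ (d := 5) (e := 0)) => //; apply: hvec_const.
Qed.

Lemma chi_nondegenerate : exists y, cof0 (U y) (dot m2 y) (dot m3 y) != 0 /\ delta (U y) != 0.
Proof.
have [x hx] := bir_h_ex B.
name u Eu := (dot Z0 x *: e0 + dot Z1 x *: e1).
have nz : cross (cub T u) (T u u p1) (T u u p2) != 0.
 apply: (plane_image_nondegenerate B z11 z22 z12 hd (s := dot Z2 x) (t := dot Z3 x)).
 by rewrite Eu addrA -zx.
have du : delta u != 0.
 apply/eqP => /det3_dep[s [t [r [str [k0 k2 k3]]]]].
 have := plane_image u s t r; rewrite k0 k2 k3 !scale0r !addr0 => e.
 have [y hy] := cross_basis nz.
 have n3 : 3 != 0 :> K by rewrite pnatr_eq0.
 have s0 : s = 0.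
  have := congr1 (fun v => det4 v (T u u p1) (T u u p2) y) e; rewrite !(det4D1, det4Z1) !(det4_12, det4_13) det4_01 !(mulr0, addr0) => /eqP.
  by rewrite mulf_eq0 (negPf hy) orbF => /eqP.
 have t0 : t = 0.
  have := congr1 (fun v => det4 (cub T u) v (T u u p2) y) e; rewrite !(det4D2, det4Z2) !(det4_12, det4_23) det4_02 !(mulr0, addr0, add0r) => /eqP.
  by rewrite !mulf_eq0 (negPf hy) (negPf n3) orbF => /eqP.
 have r0 : r = 0.
  have := congr1 (fun v => det4 (cub T u) (T u u p1) v y) e; rewrite !(det4D3, det4Z3) !(det4_13, det4_23) det4_03 !(mulr0, addr0, add0r) => /eqP.
  by rewrite !mulf_eq0 (negPf hy) (negPf n3) orbF => /eqP.
 by move: str; rewrite s0 t0 r0 !eqxx.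
have [b [c hbc]] : exists b c, cof0 u b c != 0.
 apply: NNPP => nh; have z b c : cof0 u b c = 0 by apply/eqP/negPn/negP => hbc; apply: nh; exists b, c.
 case/eqP: du; transitivity (R0 u 0 * cof0 u 0 0 + R2 u 0 * (cof0 u 1 0 - cof0 u 0 0) + R3 u 0 * (cof0 u 0 1 - cof0 u 0 0)).
  by rewrite /delta /cof0 /det3; ring.
 by rewrite !z subrr !mulr0 !addr0.
have [a0 a1 a2 a3] := M0E; have [b0 b1 b2 b3] := M1E; have [c0 c1 c2 c3] := M2E; have [d0 d1 d2 d3] := M3E.
exists (dot Z0 x *: g0 + dot Z1 x *: g1 + b *: g2 + c *: g3).
rewrite !(dotDr, dotZr) a0 a1 a2 a3 b0 b1 b2 b3 c0 c1 c2 c3 d0 d1 d2 d3 !(mulr0, mulr1, addr0, add0r) -Eu.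
by split.
Qed.

(** f(chi y) is a multiple of y, so chi is proportional to g, and coprimality of g makes the ratio a
    form of degree 5 - 3. The coordinate [Z0] gives the formula for [cof0]. *)
Lemma chi_ratio : exists r : P4, [/\ r \is 2.-homog, r != 0, forall y, chi y = pev r y *: cub S y &
 forall y, cof0 (U y) (dot m2 y) (dot m3 y) = pev r y * pev G y].
Proof.
have [y0 [s0 d0]] := chi_nondegenerate.
have [c Ec] : exists c : V -> K, forall y, c y = cof0 (U y) (dot m2 y) (dot m3 y) ^+ 2 * delta (U y) by eexists.
have c0 : c y0 != 0 by rewrite Ec mulf_neq0 // expf_neq0.
have pc : pfun c.
 apply: (pfunE (fun y => esym (Ec y))); apply: pfunM; first by apply: pfunX; apply: hfun_pfun hfun_cof0.
 have [A1 A2 A3] := hfun_rows (@Ordinal 3 0 isT); have [B1 B2 B3] := hfun_rows (@Ordinal 3 1 isT); have [C1 C2 C3] := hfun_rows (@Ordinal 3 2 isT).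
 by apply: pfun_det3; apply: hfun_pfun; eassumption.
have [X hX] : exists X : 'I_4 -> P4, forall i, X i \is 5.-homog /\ forall y, chi y 0 i = pev (X i) y.
 by apply: (fin_all_exists (P := fun i (p : P4) => p \is 5.-homog /\ forall y, chi y 0 i = pev p y)) => i; have [p hp1 hp2] := hvec_chi i; exists p.
have gE i y : pev (g i) y = cub S y 0 i by rewrite -(ev_cub (bir_sym B)) mxE.
have [|r hr] := @mpoly_cross_ratio _ 4 4 g X (bir_gc B) (bir_g0 B).
 move=> i j; apply: pev_inj => y; rewrite !pevM !gE -(proj2 (hX i)) -(proj2 (hX j)).
 apply/eqP; rewrite -subr_eq0; apply/eqP; move: y; apply: (@pfun_dense _ V _ c) => //; last 2 first.
 - by exists y0.
 - move=> y cy; have e : pev h (chi y) *: chi y = c y ^+ 3 *: cub S y.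
   by rewrite -(bir_cub B) cub_chi -Ec cubZ.
  have ei l : c y ^+ 3 * cub S y 0 l = pev h (chi y) * chi y 0 l.
   by have := congr1 (fun v : V => v 0 l) e; rewrite !mxE => ->.
  apply: (mulfI (expf_neq0 3 cy)); rewrite mulr0 mulrBr !mulrA !ei; ring.
 have pX l : pfun (fun y => chi y 0 l) by apply: hfun_pfun (hvec_chi l).
 have pS l : pfun (fun y => cub S y 0 l) by polynomial.
 by polynomial.
have [i0 gi0] := bir_g0 B.
have rE y : chi y = pev r y *: cub S y.
 by apply/rowP => i; rewrite (proj2 (hX i)) hr pevM gE !mxE mulrC.
exists r; split=> //.
- by apply: (homog_quot (bir_gh B i0) gi0); rewrite -hr; apply: (proj1 (hX i0)).
- apply: contraNneq c0 => z; have e := cub_chi y0; rewrite rE z /pev meval0 scale0r /cub st01 in e.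
 move/esym/eqP: e; rewrite -Ec scaler_eq0 => /orP[//|/eqP y00].
 case/eqP: d0; rewrite y00 !dot0r !scale0r addr0 /delta /row_q /row_m /= /cub !st01 !mul0mx !dot0l !dot0r /det3; ring.
have [m00 _ _ _] := M0E.
move=> y; apply/eqP; rewrite -subr_eq0; apply/eqP; move: y; apply: (@pfun_dense _ V _ (dot m0)).
- by apply: pfunB; [apply: hfun_pfun hfun_cof0|apply: pfunM; apply: pfun_pev; apply: pvec_id].
- by polynomial.
- by exists g0; rewrite m00 oner_neq0.
move=> y my; have := congr1 (dot Z0) (rE y).
have [u0 _] := dot_ZU y; have [_ _ zp1 zp2] := Z0E; have [hy _] := hG y.
rewrite /chi dotDr dotZr u0 dotDr !dotZr zp1 zp2 !mulr0 !addr0 hy => e.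
by apply: (mulIf my); rewrite mul0r mulrBl e mulrA subrr.
Qed.

(** Cofactors are affine in (b, c), so chi = r g is affine along [v]. By injectivity g is not
    constant on a general such line, so degrees force r to be constant on it. *)
Lemma ratio_shift r v y (t : K) : (forall y, chi y = pev r y *: cub S y) -> dot m0 v = 0 -> dot m1 v = 0 -> v != 0 ->
 pev r (y + t *: v) = pev r y.
Proof.
move=> hr v0 v1 vn; have [m00 _ _ _] := M0E; have [y0 hy0] := bir_h_ex (bir_sym B).
apply/eqP; rewrite -subr_eq0; apply/eqP; move: y; apply: (@pfun_dense _ V _ (fun y => pev k y * dot m0 y)).
- by polynomial.
- by polynomial.
- have [w [kw mw]] : exists w : V, pev k w != 0 /\ dot m0 w != 0.
  apply: (@pfun_nonzero2 _ V _ _ y0 g0) => //; last by rewrite m00 oner_neq0.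
   by polynomial.
  by polynomial.
 by exists w; rewrite mulf_neq0.
move=> y; rewrite mulf_eq0 negb_or => /andP[ky my]; apply/eqP; rewrite subr_eq0; apply/eqP.
have [C hC] : exists C : V, forall s, chi (y + s *: v) = chi y + s *: C.
 pose dc (c : V -> K -> K -> K) := c (U y) (dot m2 v) (dot m3 v) - c (U y) 0 0.
 exists (dc cof0 *: U y + (dc cof1 *: p1 + dc cof2 *: p2)) => s.
 rewrite /chi !(dotDr, dotZr) v0 v1 !mulr0 !addr0 /dc; set u := U y.
 have a0 b c b' c' : cof0 u (b + s * b') (c + s * c') = cof0 u b c + s * (cof0 u b' c' - cof0 u 0 0) by rewrite /cof0 /det3; ring.
 have a1 b c b' c' : cof1 u (b + s * b') (c + s * c') = cof1 u b c + s * (cof1 u b' c' - cof1 u 0 0) by rewrite /cof1 /det3; ring.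
 have a2 b c b' c' : cof2 u (b + s * b') (c + s * c') = cof2 u b c + s * (cof2 u b' c' - cof2 u 0 0) by rewrite /cof2 /det3; ring.
 by rewrite a0 a1 a2; vring.
have [rt hrt] : exists p : {poly K}, forall s, pev r (y + s *: v) = p.[s] by apply: (pfun_pev r (@pvec_id K 4)).
have hphi i : exists p : {poly K}, forall s, cub S (y + s *: v) 0 i = p.[s] by apply: (pvec_cub S (@pvec_id K 4) i).
have prod i p : (forall s, cub S (y + s *: v) 0 i = p.[s]) -> (size (rt * p)%R <= 2)%N.
 move=> hp; have -> : rt * p = Poly [:: chi y 0 i; C 0 i].
  apply: poly_ext => s; rewrite hornerM -hrt -hp horner_Poly /=.
  by have := congr1 (fun x : V => x 0 i) (hC s); rewrite hr !mxE => ->; ring.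
 exact: size_Poly.
have [[i [p [hp sp]]]|ns] := classic (exists i p, (forall s, cub S (y + s *: v) 0 i = p.[s]) /\ (1 < size p)%N).
 have sr : (size rt <= 1)%N.
  have [->|rt0] := eqVneq rt 0; first by rewrite size_poly0.
  have p0 : p != 0 by rewrite -size_poly_gt0; apply: leq_ltn_trans sp.
  have := prod i p hp; rewrite size_mul //; move: sp; case: (size p) => [|[|n]] // _.
  by rewrite !addnS /= ltnS; case: (size rt) => [|[|m]].
 have er0 : pev r y = rt.[0] by rewrite -hrt scale0r addr0.
 by rewrite hrt er0 (size1_polyC sr) !hornerC.
have cst : cub S y = 1 *: cub S (y + 1 *: v).
 rewrite scale1r; apply/rowP => i; have [p hp] := hphi i.
 have sp : (size p <= 1)%N by rewrite leqNgt; apply/negP => sp; apply: ns; exists i, p.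
 have er0 : cub S y 0 i = p.[0] by rewrite -hp scale0r addr0.
 by rewrite hp er0 (size1_polyC sp) !hornerC.
have [l el] := bir_inj (bir_sym B) ky cst.
have l1 : l = 1.
 have := congr1 (dot m0) el; rewrite dotZr dotDr dotZr v0 mulr0 addr0 => e.
 by apply: (mulIf my); rewrite -e mul1r.
case/eqP: vn; move: el; rewrite l1 !scale1r => /eqP.
by rewrite -subr_eq0 opprD addrA subrr add0r oppr_eq0 => /eqP.
Qed.

(** By [ratio_shift] the quadric r depends only on the plane of the pencil, so it divides all the
    cofactors there. *)
Lemma cofactor_ratio : exists r : P4, [/\ r \is 2.-homog, exists w0 w1, pev r (w0 *: g0 + w1 *: g1) != 0 &
 forall w0 w1 b c, let u := w0 *: e0 + w1 *: e1 in let y0 := w0 *: g0 + w1 *: g1 in let y := y0 + b *: g2 + c *: g3 in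
 [/\ cof0 u b c = pev r y0 * pev G y, cof1 u b c = pev r y0 * dot Z2 (cub S y) & cof2 u b c = pev r y0 * dot Z3 (cub S y)]].
Proof.
have [r [rh r0 hr hc]] := chi_ratio.
have [a0 a1 a2 a3] := M0E; have [b0 b1 b2 b3] := M1E; have [c0 c1 c2 c3] := M2E; have [d0 d1 d2 d3] := M3E.
have n2 : g2 != 0 by apply: contra_eq_neq c2 => ->; rewrite dot0r eq_sym oner_neq0.
have n3 : g3 != 0 by apply: contra_eq_neq d3 => ->; rewrite dot0r eq_sym oner_neq0.
have sh y b c : pev r (y + b *: g2 + c *: g3) = pev r y.
 by rewrite (ratio_shift _ _ hr a3 b3 n3) (ratio_shift _ _ hr a2 b2 n2).
exists r; split=> //.
 by have [y hy] := pev_neq0 r0; exists (dot m0 y), (dot m1 y); rewrite -(sh _ (dot m2 y) (dot m3 y)) -gx.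
move=> w0 w1 b c /=; name y0 Ey0 := (w0 *: g0 + w1 *: g1).
name y Ey := (y0 + b *: g2 + c *: g3).
rewrite -Ey0 -Ey; have ry : pev r y = pev r y0 by rewrite Ey; apply: sh.
have [em0 em1 em2 em3] : [/\ dot m0 y = w0, dot m1 y = w1, dot m2 y = b & dot m3 y = c].
 by rewrite Ey Ey0 !(dotDr, dotZr) a0 a1 a2 a3 b0 b1 b2 b3 c0 c1 c2 c3 d0 d1 d2 d3 !(mulr0, mulr1, addr0, add0r).
have := hc y; rewrite em0 em1 em2 em3 ry => e0'; split=> //.
 have [z20 z21 z2p1 z2p2] := Z2E; have := congr1 (dot Z2) (hr y); rewrite /chi em0 em1 em2 em3 ry !(dotDr, dotZr).
 by rewrite z20 z21 z2p1 z2p2 => <-; ring.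
have [z20 z21 z2p1 z2p2] := Z3E; have := congr1 (dot Z3) (hr y); rewrite /chi em0 em1 em2 em3 ry !(dotDr, dotZr).
by rewrite z20 z21 z2p1 z2p2 => <-; ring.
Qed.

Definition row_poly (E0 E1 : V) (i j : 'I_3) : {poly K} :=
 nth 0 (nth [::] [:: [:: poly3 (dot (E0 *m N) E0) (2 * dot (E0 *m N) E1) (dot (E1 *m N) E1);
   poly3 (2 * dot (E0 *m N) p1) (2 * dot (E1 *m N) p1) 0; poly3 (2 * dot (E0 *m N) p2) (2 * dot (E1 *m N) p2) 0];
  [:: poly_cub T m2 E0 E1; 3 *: poly_quad T m2 p1 E0 E1; 3 *: poly_quad T m2 p2 E0 E1];
  [:: poly_cub T m3 E0 E1; 3 *: poly_quad T m3 p1 E0 E1; 3 *: poly_quad T m3 p2 E0 E1]] i) j.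

Lemma row_polyE E0 E1 i j t : (row_poly E0 E1 i j).[t] = mrow (E0 + t *: E1) i j.
Proof.
have hm m p : (3 *: poly_quad T m p E0 E1).[t] = 3 * dot m (T (E0 + t *: E1) (E0 + t *: E1) p).
 by rewrite hornerZ poly_quadE (st13 T (E0 + t *: E1) (E0 + t *: E1) p).
case: i => -[|[|[|//]]] hi; case: j => -[|[|[|//]]] hj; rewrite /row_poly /mrow /row_q /row_m /=.
- by rewrite poly3E !mulmxDl -!scalemxAl !(dotDl, dotDr, dotZl, dotZr) (Ns E1 E0); ring.
- by rewrite poly3E !mulmxDl -!scalemxAl !(dotDl, dotDr, dotZl, dotZr); ring.
- by rewrite poly3E !mulmxDl -!scalemxAl !(dotDl, dotDr, dotZl, dotZr); ring.
- by rewrite poly_cubE.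
- by rewrite hm.
- by rewrite hm.
- by rewrite poly_cubE.
- by rewrite hm.
- by rewrite hm.
Qed.

Lemma size_row_poly E0 E1 i j : (size (row_poly E0 E1 i j) <= nth 0 [:: 3; 2; 2] j + (i != ord0))%N.
Proof.
have hm m p : (size (3 *: poly_quad T m p E0 E1) <= 3)%N by rewrite (leq_trans (size_scale_leq _ _)) // size_poly_quad.
case: i => -[|[|[|//]]] hi; case: j => -[|[|[|//]]] hj; rewrite /row_poly /=;
 first [exact: size_poly2|exact: size_poly3|exact: hm|exact: size_poly_cub].
Qed.

(** The cofactors are affine in (b, c): up to sign, their values at (0, 0) and their differences
    with (1, 0) and (0, 1) are the nine minors of order 2. *)
Lemma row_minor_dvdp E0 E1 (r : {poly K}) :
 (forall b c, exists d0 d1 d2 : {poly K}, forall t, let u := E0 + t *: E1 in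
   [/\ cof0 u b c = r.[t] * d0.[t], cof1 u b c = r.[t] * d1.[t] & cof2 u b c = r.[t] * d2.[t]]) ->
 forall i n j l : 'I_3, (i < n)%N -> (j < l)%N ->
  r %| row_poly E0 E1 i j * row_poly E0 E1 n l - row_poly E0 E1 i l * row_poly E0 E1 n j.
Proof.
move=> hc i n j l il jl.
have [D DE] : exists D : 'I_3 -> 'I_3 -> 'I_3 -> 'I_3 -> V -> K, forall i n j l u,
  D i n j l u = mrow u i j * mrow u n l - mrow u i l * mrow u n j by eexists.
suff [d hdv] : exists d : {poly K}, forall t, D i n j l (E0 + t *: E1) = r.[t] * d.[t].
 apply/dvdpP; exists d; apply: poly_ext => t; by rewrite !(hornerD, hornerN, hornerM) !row_polyE [d.[t] * _]mulrC -hdv DE.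
have [A0 [A1 [A2 hA]]] := hc 0 0; have [B0 [B1 [B2 hB]]] := hc 1 0; have [C0 [C1 [C2 hC]]] := hc 0 1.
have sub (F : V -> K) (a b : {poly K}) x y : (forall t, x (E0 + t *: E1) = r.[t] * a.[t]) -> (forall t, y (E0 + t *: E1) = r.[t] * b.[t]) ->
  (forall u, F u = x u - y u) -> exists d : {poly K}, forall t, F (E0 + t *: E1) = r.[t] * d.[t].
 by move=> hx hy hF; exists (a - b) => t; rewrite hF hx hy hornerD hornerN mulrBr.
have neg (F : V -> K) (a : {poly K}) x : (forall t, x (E0 + t *: E1) = r.[t] * a.[t]) ->
  (forall u, F u = - x u) -> exists d : {poly K}, forall t, F (E0 + t *: E1) = r.[t] * d.[t].
 by move=> hx hF; exists (- a) => t; rewrite hF hx hornerN mulrN.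
have pos (F : V -> K) (a : {poly K}) x : (forall t, x (E0 + t *: E1) = r.[t] * a.[t]) ->
  (forall u, F u = x u) -> exists d : {poly K}, forall t, F (E0 + t *: E1) = r.[t] * d.[t].
 by move=> hx hF; exists a => t; rewrite hF hx.
have a0 t := let: And3 p _ _ := hA t in p; have a1 t := let: And3 _ p _ := hA t in p; have a2 t := let: And3 _ _ p := hA t in p.
have b0 t := let: And3 p _ _ := hB t in p; have b1 t := let: And3 _ p _ := hB t in p; have b2 t := let: And3 _ _ p := hB t in p.
have c0 t := let: And3 p _ _ := hC t in p; have c1 t := let: And3 _ p _ := hC t in p; have c2 t := let: And3 _ _ p := hC t in p.
move: i n j l il jl => [[|[|[|//]]] hi] [[|[|[|//]]] hk] [[|[|[|//]]] hj] [[|[|[|//]]] hl] //= _ _.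
- by apply: (sub (D _ _ _ _) _ _ (fun u => cof2 u 0 1) (fun u => cof2 u 0 0) c2 a2) => u; rewrite DE /cof2 /mrow /row_q /row_m /det3 /=; ring.
- by apply: (sub (D _ _ _ _) _ _ (fun u => cof1 u 0 0) (fun u => cof1 u 0 1) a1 c1) => u; rewrite DE /cof1 /mrow /row_q /row_m /det3 /=; ring.
- by apply: (sub (D _ _ _ _) _ _ (fun u => cof0 u 0 1) (fun u => cof0 u 0 0) c0 a0) => u; rewrite DE /cof0 /mrow /row_q /row_m /det3 /=; ring.
- by apply: (sub (D _ _ _ _) _ _ (fun u => cof2 u 0 0) (fun u => cof2 u 1 0) a2 b2) => u; rewrite DE /cof2 /mrow /row_q /row_m /det3 /=; ring.
- by apply: (sub (D _ _ _ _) _ _ (fun u => cof1 u 1 0) (fun u => cof1 u 0 0) b1 a1) => u; rewrite DE /cof1 /mrow /row_q /row_m /det3 /=; ring.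
- by apply: (sub (D _ _ _ _) _ _ (fun u => cof0 u 0 0) (fun u => cof0 u 1 0) a0 b0) => u; rewrite DE /cof0 /mrow /row_q /row_m /det3 /=; ring.
- by apply: (pos (D _ _ _ _) _ (fun u => cof2 u 0 0) a2) => u; rewrite DE /cof2 /mrow /row_q /row_m /det3 /=; ring.
- by apply: (neg (D _ _ _ _) _ (fun u => cof1 u 0 0) a1) => u; rewrite DE /cof1 /mrow /row_q /row_m /det3 /=; ring.
- by apply: (pos (D _ _ _ _) _ (fun u => cof0 u 0 0) a0) => u; rewrite DE /cof0 /mrow /row_q /row_m /det3 /=; ring.
Qed.

(** Normal form of a ruled map with double line l0 = l1 = 0: on a plane where l0 : l1 is constant it
    is a square times a linear map. *)
Definition sfam (h0 h1 h2 h3 l0 l1 l2 l3 L L' : V) (r0 r1 r2 : K) (x : V) : V :=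
 (dot l0 x * dot L x + dot l1 x * dot L' x) *: (dot l0 x *: h0 + dot l1 x *: h1)
 + (r0 * dot l0 x ^+ 2 + r1 * dot l0 x * dot l1 x + r2 * dot l1 x ^+ 2) *: (dot l2 x *: h2 + dot l3 x *: h3).

Lemma pvec_dense (W : lmodType K) (F1 F2 : W -> V) (c : W -> K) : pvec F1 -> pvec F2 -> pfun c -> (exists w, c w != 0) ->
 (forall w, c w != 0 -> F1 w = F2 w) -> forall w, F1 w = F2 w.
Proof.
move=> P1 P2 pc c0 e w; apply/rowP => i; apply/eqP; rewrite -subr_eq0; apply/eqP; move: w.
apply: (pfun_dense (g := c)) => //; first by apply: pfunB.
by move=> w /e->; rewrite subrr.
Qed.

Lemma pvec_sfam (W : lmodType K) (h0 h1 h2 h3 l0 l1 l2 l3 L L' : W -> V) (r0 r1 r2 : W -> K) (x : W -> V) :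
 pvec h0 -> pvec h1 -> pvec h2 -> pvec h3 -> pvec l0 -> pvec l1 -> pvec l2 -> pvec l3 -> pvec L -> pvec L' ->
 pfun r0 -> pfun r1 -> pfun r2 -> pvec x ->
 pvec (fun w => sfam (h0 w) (h1 w) (h2 w) (h3 w) (l0 w) (l1 w) (l2 w) (l3 w) (L w) (L' w) (r0 w) (r1 w) (r2 w) (x w)).
Proof. by move=> *; polynomial.
Qed.

(** If the matrix vanished at a plane of the pencil, that plane would consist of base points. *)
Lemma mrow_nonzero a b : (a != 0) || (b != 0) -> exists i j, mrow (a *: e0 + b *: e1) i j != 0.
Proof.
move=> ab; name u Eu := (a *: e0 + b *: e1).
rewrite -Eu; apply: NNPP => nh; have z i j : mrow u i j = 0 by apply/eqP/negPn/negP => hz; apply: nh; exists i, j.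
have nx : cross u p1 p2 != 0.
 have [a0|a0] := eqVneq a 0.
  have b0 : b != 0 by move: ab; rewrite a0 eqxx.
  apply: (@det4_cross _ _ _ _ e0); rewrite Eu a0 scale0r add0r det4Z1 mulf_neq0 //.
  by rewrite det4_swap34 oppr_eq0 det4_swap23 oppr_eq0 det4_swap12 oppr_eq0.
 apply: (@det4_cross _ _ _ _ e1); rewrite Eu det4D1 !det4Z1 det4_14 mulr0 addr0 mulf_neq0 //.
 by rewrite det4_swap34 oppr_eq0 det4_swap23 oppr_eq0.
have [x hx [i fi]] := plane_not_base (bir_fc B) nx; have [s [t [r ex]]] := plane_span nx hx.
have : cub T x = 0.
 rewrite ex -addrA (double_line_cub z11 z22 z12) cubZ !stZ1 !stZ2.
 transitivity (s ^+ 2 *: (s *: cub T u + 3 *: (t *: T u u p1 + r *: T u u p2))); first by vring.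
 have z' j : [/\ row_q u j = 0, row_m m2 u j = 0 & row_m m3 u j = 0].
  by split; [exact: (z (@Ordinal 3 0 isT))|exact: (z (@Ordinal 3 1 isT))|exact: (z (@Ordinal 3 2 isT))].
 rewrite plane_image; have [-> -> ->] := z' (@Ordinal 3 0 isT); have [-> -> ->] := z' (@Ordinal 3 1 isT); have [-> -> ->] := z' (@Ordinal 3 2 isT).
 by rewrite !(mulr0, addr0, scale0r, scaler0).
by rewrite -(ev_cub B) => /rowP/(_ i); rewrite !mxE => z'; rewrite z' eqxx in fi.
Qed.

(** Along the pencil the matrix has rank one modulo the quadratic r(t). When its first row is
    unimodular modulo r, the map has the shape of [sfam]. The first row may vanish at a root of r;
    adding e u repairs this, and so f is obtained as a limit. *)
Lemma double_line_limit_basis : exists (Q : V -> V) (p : {poly K}), p != 0 /\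
 forall e, p.[e] != 0 -> exists h0 h1 h2 h3 l0 l1 l2 l3 L L' r0 r1 r2, forall x,
  cub T x + e *: Q x = sfam h0 h1 h2 h3 l0 l1 l2 l3 L L' r0 r1 r2 x.
Proof.
have [r [rh [b0 [b1 rb]] hr]] := cofactor_ratio.
have [Nr [Nrs hNr]] := homog2_bilinear rh.
(* A parameter on the pencil whose point at infinity is not a root of [r], so that [rP] has degree
   exactly 2. *)
have [a0 [a1 [L0 [L1 [hL0 hL1 hab]]]]] : exists a0 a1 L0 L1, [/\ forall x, dot Z0 x = a0 * dot L0 x + b0 * dot L1 x,
  forall x, dot Z1 x = a1 * dot L0 x + b1 * dot L1 x & forall t, (a0 + t * b0 != 0) || (a1 + t * b1 != 0)].
 have [bz|bn] := eqVneq b0 0; last first.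
  exists 0, 1, (Z1 - (b1 / b0) *: Z0), (b0^-1 *: Z0); split=> [x|x|t].
  - by rewrite dotZl mul0r add0r mulVKf.
  - by rewrite dotDl dotNl !dotZl; field.
  - by rewrite add0r mulf_eq0 (negPf bn) orbF; have [->|//] := eqVneq t 0; rewrite mul0r addr0 oner_neq0.
 have bn : b1 != 0.
  apply: contraNneq rb => z; rewrite bz z !scale0r addr0 hNr mul0mx dot0l //.
 exists 1, 0, Z0, (b1^-1 *: Z1); split=> [x|x|t].
 - by rewrite bz mul0r mul1r addr0.
 - by rewrite mul0r add0r dotZl mulVKf.
 - by rewrite bz mulr0 addr0 oner_neq0.
have L0n : exists x, dot L0 x != 0.
 apply: NNPP => nh; have z x : dot L0 x = 0 by apply/eqP/negPn/negP => hx; apply: nh; exists x.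
 have [z00 z01 _ _] := Z0E; have [z10 z11' _ _] := Z1E.
 have k1 : b0 * dot L1 e0 = 1 by rewrite -z00 hL0 z mulr0 add0r.
 have k2 : b1 * dot L1 e0 = 0 by rewrite -z10 hL1 z mulr0 add0r.
 have k3 : b1 * dot L1 e1 = 1 by rewrite -z11' hL1 z mulr0 add0r.
 have l0 : dot L1 e0 != 0 by apply: contra_eq_neq k1 => ->; rewrite mulr0 eq_sym oner_neq0.
 by move/eqP: k2; rewrite mulf_eq0 (negPf l0) orbF => /eqP b10; move/eqP: k3; rewrite b10 mul0r eq_sym oner_eq0.
name E0 EE0 := (a0 *: e0 + a1 *: e1).
name E1 EE1 := (b0 *: e0 + b1 *: e1).
name Y0 EY0 := (a0 *: g0 + a1 *: g1).
name Y1 EY1 := (b0 *: g0 + b1 *: g1).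
have uE t : E0 + t *: E1 = (a0 + t * b0) *: e0 + (a1 + t * b1) *: e1 by rewrite EE0 EE1; vring.
have yE t : Y0 + t *: Y1 = (a0 + t * b0) *: g0 + (a1 + t * b1) *: g1 by rewrite EY0 EY1; vring.
name rP ErP := (poly3 (dot (Y0 *m Nr) Y0) (2 * dot (Y0 *m Nr) Y1) (dot (Y1 *m Nr) Y1)).
have rPE t : rP.[t] = pev r (Y0 + t *: Y1).
 by rewrite ErP poly3E hNr !mulmxDl -!scalemxAl !(dotDl, dotDr, dotZl, dotZr) (Nrs Y1 Y0); ring.
have sr : size rP = 3%N by rewrite ErP /poly3 (PolyK (c := 0)) //= -hNr EY1.
have pL b c : pvec (fun t : K^o => Y0 + t *: Y1 + b *: g2 + c *: g3) by polynomial.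
have dv b c : exists d0 d1 d2 : {poly K}, forall t, let u := E0 + t *: E1 in
   [/\ cof0 u b c = rP.[t] * d0.[t], cof1 u b c = rP.[t] * d1.[t] & cof2 u b c = rP.[t] * d2.[t]].
 have [d0 h0] := pfun_poly (pfun_pev G (pL b c)).
 have [d1 h1] := pfun_poly (pfun_dot (@pvec_const _ K^o _ Z2) (pvec_cub S (pL b c))).
 have [d2 h2] := pfun_poly (pfun_dot (@pvec_const _ K^o _ Z3) (pvec_cub S (pL b c))).
 exists d0, d1, d2 => t /=; have := hr (a0 + t * b0) (a1 + t * b1) b c; rewrite /= -uE -yE.
 by rewrite -rPE -h0 -h1 -h2.
have [||j|j|i j i0|u [p [p0 su hp]]] := @rank_one_mod _ (row_poly E0 E1) rP (fun j => nth 0%N [:: 3; 2; 2] j)%N sr.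
- exact: row_minor_dvdp.
- by move=> t; have [i [j hij]] := mrow_nonzero (hab t); exists i, j; rewrite row_polyE uE.
- by case: j => -[|[|[|//]]].
- by have := size_row_poly E0 E1 ord0 j; rewrite addn0.
- by have := size_row_poly E0 E1 i j; rewrite i0 addn1.
name o0 Eo0 := (@Ordinal 3 0 isT).
name o1 Eo1 := (@Ordinal 3 1 isT).
name o2 Eo2 := (@Ordinal 3 2 isT).
(* [Q] is the effect on the map of adding [u] to the first row. *)
have [Q QE] : exists Q : V -> V, forall x, Q x =
  (dot L0 x * ((u o0)`_0 * dot L0 x + (u o0)`_1 * dot L1 x) + dot Z2 x * ((u o1)`_0 * dot L0 x + (u o1)`_1 * dot L1 x)
   + dot Z3 x * ((u o2)`_0 * dot L0 x + (u o2)`_1 * dot L1 x)) *: (dot L0 x *: Y0 + dot L1 x *: Y1) by eexists.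
exists Q, p; split=> // e pe.
have [|l2 [n2 [sl2 sn2 h2]]] := hp e pe o1; first by rewrite Eo1.
have [|l3 [n3 [sl3 sn3 h3]]] := hp e pe o2; first by rewrite Eo2.
have [F FE] : exists F : 'I_3 -> {poly K}, forall j, F j = row_poly E0 E1 ord0 j + e *: u j by eexists.
have sF j : (size (F j) <= nth 0 [:: 3; 2; 2] j)%N.
 rewrite FE (leq_trans (size_polyD _ _)) // geq_max; have := size_row_poly E0 E1 ord0 j; rewrite addn0 => -> /=.
 by rewrite (leq_trans (size_scale_leq _ _)) // (leq_trans (su j)) //; case: j => -[|[|[|//]]].
have H2 (q' : {poly K}) t : (size q' <= 2)%N -> q'.[t] = q'`_0 + q'`_1 * t.
 by move=> sq; rewrite (horner_coef_wide _ sq) !big_ord_recl big_ord0 /= expr0 mulr1 expr1 addr0.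
have H3 (q' : {poly K}) t : (size q' <= 3)%N -> q'.[t] = q'`_0 + q'`_1 * t + q'`_2 * t ^+ 2.
 by move=> sq; rewrite (horner_coef_wide _ sq) !big_ord_recl big_ord0 /= expr0 mulr1 expr1 addr0 addrA.
have H1 (q' : {poly K}) t : (size q' <= 1)%N -> q'.[t] = q'`_0.
 by move=> sq; rewrite (horner_coef_wide _ sq) !big_ord_recl big_ord0 /= expr0 mulr1 addr0.
exists (Y0 + l2`_0 *: g2 + l3`_0 *: g3), (Y1 + l2`_1 *: g2 + l3`_1 *: g3), g2, g3, L0, L1,
 ((n2 o0)`_0 *: L0 + (n2 o0)`_1 *: L1 + (n2 o1)`_0 *: Z2 + (n2 o2)`_0 *: Z3),
 ((n3 o0)`_0 *: L0 + (n3 o0)`_1 *: L1 + (n3 o1)`_0 *: Z2 + (n3 o2)`_0 *: Z3),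
 ((F o0)`_0 *: L0 + (F o0)`_1 *: L1 + (F o1)`_0 *: Z2 + (F o2)`_0 *: Z3),
 ((F o0)`_2 *: L1 + (F o1)`_1 *: Z2 + (F o2)`_1 *: Z3), rP`_0, rP`_1, rP`_2.
have pd z : pfun (fun x : V => dot z x) by polynomial.
apply: (@pvec_dense V _ _ (dot L0)) => //.
- apply: pvecD; first by polynomial.
 apply: pvecZ; first exact: pfun_const.
 rewrite (functional_extensionality _ _ QE).
 apply: pvecZ; last by polynomial.
 by polynomial.
- by polynomial.
move=> x z0; name t Et := (dot L1 x / dot L0 x).
have tz : dot L1 x = dot L0 x * t by rewrite Et mulrC divfK.
name ut Eut := (E0 + t *: E1).
have ex : x = dot L0 x *: ut + (dot Z2 x *: p1 + dot Z3 x *: p2).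
 rewrite {1}(zx x) addrA; congr (_ + _ + _); rewrite hL0 hL1 tz Eut EE0 EE1; vring.
have [z00 z01 _ _] := Z0E; have [z10 z11' _ _] := Z1E.
have gu : dot Z0 ut *: g0 + dot Z1 ut *: g1 = Y0 + t *: Y1.
 rewrite Eut EE0 EE1 EY0 EY1 !(dotDr, dotZr) z00 z01 z10 z11'; vring.
have fq i : row_q ut i = (F i).[t] - e * (u i).[t].
 by rewrite FE hornerD hornerZ addrK row_polyE -Eut.
have fm2 i : row_m m2 ut i = l2.[t] * (F i).[t] + rP.[t] * (n2 i).[t].
 by have := congr1 (fun p : {poly K} => p.[t]) (h2 i); rewrite row_polyE Eo1 -Eut hornerD !hornerM -FE.
have fm3 i : row_m m3 ut i = l3.[t] * (F i).[t] + rP.[t] * (n3 i).[t].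
 by have := congr1 (fun p : {poly K} => p.[t]) (h3 i); rewrite row_polyE Eo2 -Eut hornerD !hornerM -FE.
have cx : cub T x = dot L0 x ^+ 2 *: ((dot L0 x * row_q ut o0 + dot Z2 x * row_q ut o1 + dot Z3 x * row_q ut o2) *: (Y0 + t *: Y1)
  + (dot L0 x * row_m m2 ut o0 + dot Z2 x * row_m m2 ut o1 + dot Z3 x * row_m m2 ut o2) *: g2
  + (dot L0 x * row_m m3 ut o0 + dot Z2 x * row_m m3 ut o1 + dot Z3 x * row_m m3 ut o2) *: g3).
 rewrite Eo0 Eo1 Eo2 -gu -plane_image {1}ex (double_line_cub z11 z22 z12) cubZ !stZ1 !stZ2.
 by vring.
name x0 Ex0 := (dot L0 x).
name x2 Ex2 := (dot Z2 x).
name x3 Ex3 := (dot Z3 x).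
rewrite cx QE /sfam !(dotDl, dotZl) tz -Ex0 -Ex2 -Ex3 !fq !fm2 !fm3.
rewrite (H3 (F o0)); last by have := sF o0; rewrite Eo0.
rewrite (H2 (F o1)); last by have := sF o1; rewrite Eo1.
rewrite (H2 (F o2)); last by have := sF o2; rewrite Eo2.
rewrite (H2 (u o0)) // (H2 (u o1)) // (H2 (u o2)) // (H2 l2) // (H2 l3) //.
rewrite (H2 (n2 o0)); last by have := sn2 o0; rewrite Eo0.
rewrite (H1 (n2 o1)); last by have := sn2 o1; rewrite Eo1.
rewrite (H1 (n2 o2)); last by have := sn2 o2; rewrite Eo2.
rewrite (H2 (n3 o0)); last by have := sn3 o0; rewrite Eo0.
rewrite (H1 (n3 o1)); last by have := sn3 o1; rewrite Eo1.
rewrite (H1 (n3 o2)); last by have := sn3 o2; rewrite Eo2.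
rewrite (H3 rP) ?sr //.
by vring.
Qed.

End Bir.
End RuledLimit.

(** * Consequences of the identical vanishing of [rho] *)

Section RhoZero.
Variable K : numClosedFieldType.
Notation V := ('rV[K]_4).
Notation P4 := {mpoly K[4]}.
Variables (f g : 'I_4 -> P4) (h k : P4).
Hypothesis B : bir f g h k.
Notation T := (pol f).
Hypothesis rz : forall o v1 v2, rho T o v1 v2 = 0.

Lemma rho_zero_ruled a p : p != 0 -> dot a (cub T p) = 0 ->
 exists q, indep2 p q /\ forall s t, dot a (cub T (s *: p + t *: q)) = 0.
Proof.
have [p1 [p2 [i12 z11 z22 z12]]] := double_line B rz; exact: double_line_ruled z11 z22 z12 _ _ i12.
Qed.

Lemma rho_zero_limit : exists (Q : V -> V) (p : {poly K}), p != 0 /\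
 forall e, p.[e] != 0 -> exists h0 h1 h2 h3 l0 l1 l2 l3 L L' r0 r1 r2, forall x,
  cub T x + e *: Q x = sfam h0 h1 h2 h3 l0 l1 l2 l3 L L' r0 r1 r2 x.
Proof.
have [p1 [p2 [i12 z11 z22 z12]]] := double_line B rz.
have [e0 [e1 hd']] := indep2_basis i12.
have hd : det4 e0 e1 p1 p2 != 0 by rewrite det4_pairs.
have [Z0 [Z1 [Z2 [Z3 [zx [E0 E1 E2 E3]]]]]] := dual4 hd.
have [G [m0 [m1 [Gh G0 im hG]]]] := double_line_pencil B z11 z22 z12 hd zx E0 E1.
have [q qh hq] := double_line_quadric B E0 E1 Gh G0 hG.
have [N [Ns qN]] := homog2_bilinear qh.
have [m2 [m3 hm]] := indep2_basis im.
have [g0 [g1 [g2 [g3 [_ [[a0 a1 a2 a3] [b0 b1 b2 b3] [c0 c1 c2 c3] [d0 d1 d2 d3]]]]]]] := dual4 hm.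
have gx y : y = dot m0 y *: g0 + dot m1 y *: g1 + dot m2 y *: g2 + dot m3 y *: g3.
 apply: (basis_dot_ext hm); rewrite !dotDr !dotZr ![dot _ g0]dotC ![dot _ g1]dotC ![dot _ g2]dotC ![dot _ g3]dotC;
  by rewrite ?a0 ?a1 ?a2 ?a3 ?b0 ?b1 ?b2 ?b3 ?c0 ?c1 ?c2 ?c3 ?d0 ?d1 ?d2 ?d3 !(mulr0, mulr1, addr0, add0r).
apply: (double_line_limit_basis B z11 z22 z12 hd zx E0 E1 E2 E3 hG hq Ns qN gx); rewrite ![dot _ g0]dotC ![dot _ g1]dotC ![dot _ g2]dotC ![dot _ g3]dotC.
- by rewrite a0 b0 c0 d0.
- by rewrite a1 b1 c1 d1.
- by rewrite a2 b2 c2 d2.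
- by rewrite a3 b3 c3 d3.
Qed.

End RhoZero.

(** * Coefficients of a cubic map and forms in them *)

Section Coordinates.
Variable K : numClosedFieldType.
Notation V := ('rV[K]_4).
Notation P4 := {mpoly K[4]}.

Section PolynomialIn.
Variables (X : Type) (n : nat) (c : X -> 'I_n -> K).

Definition gfun d (F : X -> K) := exists2 P : {mpoly K[n]}, P \is d.-homog & forall x, F x = P.@[c x].

Lemma gfun_ext d F G : F =1 G -> gfun d F -> gfun d G.
Proof. by move=> e [p hp h]; exists p => // x; rewrite -e h. Qed.

Lemma gfunD d F G : gfun d F -> gfun d G -> gfun d (fun x => F x + G x).
Proof. by move=> [p hp eF] [q hq eG]; exists (p + q) => [|x]; rewrite ?rpredD // mevalD eF eG. Qed.

Lemma gfunN d F : gfun d F -> gfun d (fun x => - F x).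
Proof. by move=> [p hp eF]; exists (- p) => [|x]; rewrite ?rpredN // mevalN eF. Qed.

Lemma gfunM d e F G : gfun d F -> gfun e G -> gfun (d + e) (fun x => F x * G x).
Proof. by move=> [p hp eF] [q hq eG]; exists (p * q) => [|x]; rewrite ?dhomogM // mevalM eF eG. Qed.

Lemma gfunZ d a F : gfun d F -> gfun d (fun x => a * F x).
Proof. by move=> [p hp eF]; exists (a *: p) => [|x]; rewrite ?rpredZ // mevalZ eF. Qed.

Lemma gfunX d m F : gfun d F -> gfun (d * m) (fun x => F x ^+ m).
Proof.
move=> hF; elim: m => [|m IH]; last by rewrite mulnS; apply: gfun_ext (gfunM hF IH) => x; rewrite exprS.
by rewrite muln0; exists 1 => [|x]; rewrite ?dhomog1 // meval1 expr0.
Qed.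

Lemma gfun_sum (I : Type) (r : seq I) (Q : pred I) d (F : I -> X -> K) :
 (forall i, gfun d (F i)) -> gfun d (fun x => \sum_(i <- r | Q i) F i x).
Proof.
move=> hF; elim: r => [|i r IH].
 by exists 0 => [|x]; rewrite ?rpred0 // big_nil meval0.
case: (boolP (Q i)) => qi; last by apply: gfun_ext IH => x; rewrite big_cons (negPf qi).
by apply: gfun_ext (gfunD (hF i) IH) => x; rewrite big_cons qi.
Qed.

Lemma gfun_prod (I : eqType) (r : seq I) (F : I -> X -> K) :
 (forall i, gfun 1 (F i)) -> gfun (size r) (fun x => \prod_(i <- r) F i x).
Proof.
move=> hF; elim: r => [|i r IH].
 by exists 1 => [|x]; rewrite ?dhomog1 // big_nil meval1.
by apply: gfun_ext (gfunM (hF i) IH) => x; rewrite big_cons.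
Qed.

Lemma gfun_det m (A : X -> 'M[K]_m) : (forall i j, gfun 1 (fun x => A x i j)) -> gfun m (fun x => \det (A x)).
Proof.
move=> hA; apply: gfun_sum => s; apply: gfunZ.
have := @gfun_prod _ (index_enum 'I_m) (fun i x => A x i (s i)) (fun i => hA i (s i)).
by rewrite [size _](_ : _ = m) // -[RHS](card_ord m) cardT enumT.
Qed.

Definition gvec d (F : X -> V) := forall i, gfun d (fun x => F x 0 i).

Lemma gfun_dot d e (F G : X -> V) : gvec d F -> gvec e G -> gfun (d + e) (fun x => dot (F x) (G x)).
Proof.
by move=> hF hG; apply: (gfun_ext (fun x => esym (dotE _ _))); do !apply: gfunD; apply: gfunM.
Qed.

Lemma gvec_cross d1 d2 d3 F1 F2 F3 : gvec d1 F1 -> gvec d2 F2 -> gvec d3 F3 ->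
 gvec (d1 + d2 + d3) (fun x => cross (F1 x) (F2 x) (F3 x)).
Proof.
move=> h1 h2 h3 i; apply: (gfun_ext (fun x => esym (crossE _ _ _ _))).
have hc a : gvec 0 (fun _ : X => a).
 by move=> j; exists (a 0 j *: 1) => [|x]; rewrite ?rpredZ ?dhomog1 // mevalZ meval1 mulr1.
have m2 d e F G j l : gvec d F -> gvec e G -> gfun (d + e) (fun x => minor2 (F x) (G x) j l).
 by move=> hF hG; apply: gfunD; [|apply: gfunN]; apply: gfunM.
apply: (gfun_ext (fun x => esym (det4E _ _ _ _))); rewrite -[(_ + _ + _)%N]addn0 -addnA.
by do !apply: gfunD; try apply: gfunN; apply: gfunM; apply: m2.
Qed.

End PolynomialIn.

Definition qco (f : 'I_4 -> P4) (k : 'I_256) : K :=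
 (f (inord (k %/ 64)))@_(U_(inord (k %/ 16 %% 4)) + U_(inord (k %/ 4 %% 4)) + U_(inord (k %% 4)))%MM.

Definition qidx (i a b c : 'I_4) : 'I_256 := inord (64 * i + 16 * a + 4 * b + c).

Lemma qco_idx (f : 'I_4 -> P4) i a b c : qco f (qidx i a b c) = (f i)@_(U_(a) + U_(b) + U_(c))%MM.
Proof.
have v : nat_of_ord (qidx i a b c) = (64 * i + 16 * a + 4 * b + c)%N.
 by rewrite inordK //; have := ltn_ord i; have := ltn_ord a; have := ltn_ord b; have := ltn_ord c; lia.
have e1 : ((64 * i + 16 * a + 4 * b + c) %/ 64 = i)%N by have := ltn_ord a; have := ltn_ord b; have := ltn_ord c; lia.
have e2 : ((64 * i + 16 * a + 4 * b + c) %/ 16 %% 4 = a)%N by have := ltn_ord a; have := ltn_ord b; have := ltn_ord c; lia.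
have e3 : ((64 * i + 16 * a + 4 * b + c) %/ 4 %% 4 = b)%N by have := ltn_ord b; have := ltn_ord c; lia.
have e4 : ((64 * i + 16 * a + 4 * b + c) %% 4 = c)%N by have := ltn_ord c; lia.
by rewrite /qco v e1 e2 e3 e4 !inord_val.
Qed.

(** The factor 1, 2 or 6 produced by differentiating the monomial x_a x_b x_c along its own
    variables. *)
Definition mult3 (a b c : 'I_4) : nat := ((b == c).+1 * ((a == c) + (a == b)).+1)%N.

Lemma tens_coeff (f : 'I_4 -> P4) i a b c : tens f i a b c = (f i)@_(U_(a) + U_(b) + U_(c))%MM *+ mult3 a b c / 6.
Proof.
rewrite /tens !mcoeff_mderiv add0m !mnmDE !mnm1E mnm0E -!mulrnA.
rewrite [(U_(c) + _)%MM]addmC -addmA [(U_(c) + _)%MM]addmC addmA [(U_(b) + _)%MM]addmC muln1 mulnC.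
by rewrite /mult3 [c == b]eq_sym [c == a]eq_sym [b == a]eq_sym.
Qed.

Definition polar (F : V -> V) x y z := F (x + y + z) - F (x + y) - F (x + z) - F (y + z) + F x + F y + F z.

Lemma polar_cub (T : symtri K) x y z : polar (cub T) x y z = 6 *: T x y z.
Proof.
have s2 a b : (T b a a = T a a b) * (T a b a = T a a b) by rewrite st12 st23.
have s3 : (T y x z = T x y z) * (T x z y = T x y z) * (T z x y = T x y z) * (T y z x = T x y z) * (T z y x = T x y z).
 by rewrite (st12 T y z x) (st23 T y x z) (st12 T x z y) (st12 T x y z) (st23 T x y z).
rewrite /polar /cub !(stD1, stD2, stD3) !s3 !(s2 x, s2 y, s2 z).
by vring.
Qed.

Lemma pol_evec (f : 'I_4 -> P4) i a b c : pol f (evec K a) (evec K b) (evec K c) 0 i = tens f i a b c.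
Proof.
rewrite /= pol_funE (bigD1 a) //= evecE eqxx mul1r [X in _ + X]big1 ?addr0 => [|l la]; last by rewrite evecE (negPf la) mul0r.
rewrite (bigD1 b) //= evecE eqxx mul1r [X in _ + X]big1 ?addr0 => [|l la]; last by rewrite evecE (negPf la) mul0r.
rewrite (bigD1 c) //= evecE eqxx mul1r [X in _ + X]big1 ?addr0 // => l la; by rewrite evecE (negPf la) mul0r.
Qed.

(** Coordinates recovered from values by polarization, so that families can be given by functions.
    The factor 6 of [polar] cancels the one in [tens]. *)
Definition qcF (F : V -> V) (k : 'I_256) : K :=
 let a := inord (k %/ 16 %% 4) in let b := inord (k %/ 4 %% 4) in let c := inord (k %% 4) in
 (mult3 a b c)%:R^-1 * polar F (evec K a) (evec K b) (evec K c) 0 (inord (k %/ 64)).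

Lemma mult3_neq0 a b c : (mult3 a b c)%:R != 0 :> K. Proof. by rewrite pnatr_eq0. Qed.

Lemma qcF_ev (f : 'I_4 -> P4) : (forall i, f i \is 3.-homog) -> qcF (ev f) =1 qco f.
Proof.
move=> fh k; have -> : qcF (ev f) k = qcF (cub (pol f)) k by rewrite /qcF /polar !(ev_pol _ fh).
rewrite /qcF polar_cub mxE pol_evec tens_coeff /qco -[_ *+ mult3 _ _ _]mulr_natr; field.
by rewrite mult3_neq0.
Qed.

Lemma pfun_qcF (W : lmodType K) (F : W -> V -> V) k : (forall x, pvec (fun w => F w x)) -> pfun (fun w => qcF (F w) k).
Proof.
move=> pF; apply: pfunM; first exact: pfun_const.
have pp x y z : pvec (fun w => polar (F w) x y z) by polynomial.
exact: pp.
Qed.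

Lemma gvec_pol d1 d2 d3 (F1 F2 F3 : ('I_4 -> P4) -> V) : gvec qco d1 F1 -> gvec qco d2 F2 -> gvec qco d3 F3 ->
 gvec qco (1 + d1 + d2 + d3) (fun f => pol f (F1 f) (F2 f) (F3 f)).
Proof.
move=> h1 h2 h3 i; apply: (@gfun_ext _ _ _ _ (fun f => \sum_a \sum_b \sum_c (tens f i a b c * F1 f 0 a * F2 f 0 b * F3 f 0 c))).
 move=> f; rewrite /= pol_funE; apply: eq_bigr => a _; rewrite mulr_sumr; apply: eq_bigr => b _.
 by rewrite !mulr_sumr; apply: eq_bigr => c _; ring.
apply: gfun_sum => a; apply: gfun_sum => b; apply: gfun_sum => c; do 3!apply: gfunM => //.
exists (((mult3 a b c)%:R / 6) *: 'X_(qidx i a b c)) => [|f].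
 by rewrite rpredZ // dhomogX /= mdeg1.
by rewrite mevalZ mevalXU qco_idx tens_coeff -mulr_natr; ring.
Qed.

(** 28 = 7 * 4: [normq] is homogeneous of degree 7, and each argument has degree 4 in the map, three
    from the covector [a] and one from the vector paired with it. *)
Lemma gfun_rho o v1 v2 : gfun qco 28 (fun f => rho (pol f) o v1 v2).
Proof.
have hc a : gvec qco 0 (fun _ => a).
 by move=> j; exists (a 0 j *: 1) => [|x]; rewrite ?rpredZ ?dhomog1 // mevalZ meval1 mulr1.
have hT x y z : gvec qco 1 (fun f => pol f x y z) by apply: (gvec_pol (d1 := 0) (d2 := 0) (d3 := 0)).
pose a f := cross (pol f o o o) (pol f o o v1) (pol f o o v2).
have ha : gvec qco 3 a by apply: (gvec_cross (d1 := 1) (d2 := 1) (d3 := 1)).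
have h4 x y z : gfun qco 4 (fun f => dot (a f) (pol f x y z)) by apply: (gfun_dot (d := 3) (e := 1)).
rewrite /rho /normq -/a.
have Zc n x y z : gfun qco 4 (fun f => n%:R * dot (a f) (pol f x y z)) by apply: gfunZ.
have M12 F G H : gfun qco 4 F -> gfun qco 4 G -> gfun qco 4 H -> gfun qco 12 (fun f => F f * G f * H f).
 by move=> hF hG hH; apply: (gfunM (d := 8) (e := 4)) => //; apply: (gfunM (d := 4) (e := 4)).
have X12 F G : gfun qco 4 F -> gfun qco 4 G -> gfun qco 12 (fun f => F f ^+ 2 * G f).
 by move=> hF hG; apply: (gfunM (d := 8) (e := 4)) => //; apply: (gfunX (d := 4) 2).
set p0 := fun f => dot (a f) (pol f o v1 v1).
have := h4 o v1 v1; have := Zc 2%N o v1 v2; have := h4 o v2 v2; have := h4 v1 v1 v1; have := Zc 3%N v1 v1 v2; have := Zc 3%N v1 v2 v2; have := h4 v2 v2 v2.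
move=> R3 R2 R1 R0 P2 P1 P0.
have hu := gfunD (gfunD (X12 _ _ P2 R0) (gfunN (M12 _ _ _ P2 R2 P0))) (M12 _ _ _ R3 P1 P0).
have hv := gfunD (gfunD (X12 _ _ P2 R1) (gfunN (M12 _ _ _ P2 R2 P1))) (gfunM (d := 4) (e := 8) R3 (gfunD (gfunX (d := 4) 2 P1) (gfunN (gfunM (d := 4) (e := 4) P0 P2)))).
apply: gfunD; [apply: gfunD|].
- exact: (gfunM (d := 4) (e := 24) P2 (gfunX (d := 12) 2 hu)).
- apply: gfunN; exact: (gfunM (d := 16) (e := 12) (gfunM (d := 4) (e := 12) P1 hu) hv).
- exact: (gfunM (d := 4) (e := 24) P0 (gfunX (d := 12) 2 hv)).
Qed.

End Coordinates.

(** * Birationality of a general member of a family *)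

Section BirationalFamilies.
Variable K : numClosedFieldType.
Notation V := ('rV[K]_4).
Notation P4 := {mpoly K[4]}.

Definition twistF (F : V -> V) u v := det4 (polar F u u u) (polar F u u v) (polar F u v v) (polar F v v v).

Lemma polar_ext F1 F2 : F1 =1 F2 -> forall x y z : V, polar F1 x y z = polar F2 x y z.
Proof. by move=> e x y z; rewrite /polar !e. Qed.

Lemma twistF_cub (T : symtri K) u v : twistF (cub T) u v != 0 -> twist T u v != 0.
Proof.
apply: contraNneq => e; rewrite /twistF !polar_cub !(det4Z1, det4Z2, det4Z3, det4Z4).
by move: e; rewrite /twist => ->; rewrite !mulr0.
Qed.

Lemma pfun_twistF (W : lmodType K) (F : W -> V -> V) u v : (forall x, pvec (fun w => F w x)) ->
 pfun (fun w => twistF (F w) u v).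
Proof. by move=> *; polynomial.
Qed.

Lemma hvec_ev F : hvec 3 F -> exists2 f : 'I_4 -> P4, forall i, f i \is 3.-homog & forall x, ev f x = F x.
Proof.
move=> hF; have [f hf] := fin_all_exists2 hF.
by move=> ef; exists f => // x; apply/rowP => i; rewrite mxE ef.
Qed.

(** A base point on the line would be a linear relation between the four vectors of [twist]; a line
    free of base points excludes a common factor. *)
Lemma twist_base_free (f : 'I_4 -> P4) u v : (forall i, f i \is 3.-homog) -> twist (pol f) u v != 0 ->
 coprime_family f /\ exists i, f i != 0.
Proof.
move=> fh tw.
have bf s t : (s != 0) || (t != 0) -> ev f (s *: u + t *: v) != 0.
 apply: contraTneq => e; have := e; rewrite ev_pol // cubD !cubZ !(stZ1, stZ2, stZ3) => e2.
 have d1 := congr1 (fun y => det4 y (pol f u u v) (pol f u v v) (pol f v v v)) e2.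
 have d4 := congr1 (fun y => det4 (pol f u u u) (pol f u u v) (pol f u v v) y) e2.
 move: d1 d4; rewrite /cub !(det4D1, det4D4, det4Z1, det4Z4, det4_12, det4_13, det4_14, det4_24, det4_34).
 have z1 a b c : det4 0 a b c = 0 :> K by rewrite -(scale0r (0 : V)) det4Z1 mul0r.
 have z4 a b c : det4 a b c 0 = 0 :> K by rewrite -(scale0r (0 : V)) det4Z4 mul0r.
 rewrite -/(twist (pol f) u v) z1 z4 !(mulr0, addr0, add0r, mul0r) => /eqP; rewrite mulf_eq0 (negPf tw) orbF expf_eq0 /= => s0 /eqP.
 by rewrite mulf_eq0 (negPf tw) orbF expf_eq0 /= negb_or !negbK s0.
split; first exact: line_coprime fh bf.
apply: NNPP => h; have := bf 1 0; rewrite oner_eq0 /= => /(_ isT)/eqP; apply; apply/rowP => i.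
rewrite !mxE; have -> : f i = 0 by apply/eqP/negPn/negP => fi; apply: h; exists i.
by rewrite /pev meval0.
Qed.

Lemma mpoly_parallel_id (f g : 'I_4 -> P4) :
 (forall x i j, ev g (ev f x) 0 i * x 0 j = ev g (ev f x) 0 j * x 0 i) ->
 exists h, forall x, ev g (ev f x) = pev h x *: x.
Proof.
move=> par; pose c i := g i \mPo [tuple f j | j < 4].
have ce i x : pev (c i) x = ev g (ev f x) 0 i.
 rewrite /pev /c comp_mpoly_meval mxE; apply: meval_eq => j.
 by rewrite tnth_map tnth_ord_tuple mxE.
have xe (i : 'I_4) (x : V) : pev 'X_i x = x 0 i by rewrite /pev mevalXU.
have lx i : lin (evec K i) = 'X_i by apply: pev_inj => x; rewrite pev_lin dotC dot_evec xe.
have [h hc] : exists h, forall i, c i = 'X_i * h.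
 apply: mpoly_cross_ratio.
 - have := @coprime_lin K 4 (fun i => evec K i) q0 q1.
  rewrite (_ : (fun i => lin (evec K i)) = fun i => 'X_i); last by apply: functional_extensionality.
  apply => s t /rowP e; have := e q0; have := e q1; rewrite !mxE /= !(mulr0, mulr1, addr0, add0r).
  by move=> -> ->.
 - by exists q0; apply/eqP => z; have := xe q0 (evec K q0); rewrite z /pev meval0 evecE eqxx => /eqP; rewrite eq_sym oner_eq0.
 - by move=> i j; apply: pev_inj => x; rewrite /pev !mevalM -!/(pev _ _) !ce !xe mulrC par mulrC.
exists h => x; apply/rowP => i; rewrite -ce hc /pev mevalM mulrC [RHS]mxE; congr (_ * _); exact: xe.
Qed.

Definition par2 (x y : V) := forall i j, x 0 i * y 0 j = x 0 j * y 0 i.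

Lemma par2Z c x : par2 (c *: x) x.
Proof. by move=> i j; rewrite !mxE; ring. Qed.

(** Parallelism makes both composites multiples of the identity, the two [twistF] conditions give
    coprimality, and one nonzero value makes both multipliers nonzero. *)
Lemma bir_values F G u v u' v' x0 : hvec 3 F -> hvec 3 G ->
 (forall x, par2 (G (F x)) x) -> (forall x, par2 (F (G x)) x) ->
 twistF F u v != 0 -> twistF G u' v' != 0 -> G (F x0) != 0 ->
 exists f g h k, bir f g h k /\ forall x, ev f x = F x.
Proof.
move=> /hvec_ev[f fh ef] /hvec_ev[g gh eg] GF FG tF tG n0.
have tf : twist (pol f) u v != 0.
 by apply: twistF_cub; rewrite /twistF !(@polar_ext _ F) // => x; rewrite -ev_pol.
have tg : twist (pol g) u' v' != 0.
 by apply: twistF_cub; rewrite /twistF !(@polar_ext _ G) // => x; rewrite -ev_pol.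
have [fc f0] := twist_base_free fh tf; have [gc g0] := twist_base_free gh tg.
have [h hh] : exists h, forall x, ev g (ev f x) = pev h x *: x.
 by apply: mpoly_parallel_id => x i j; rewrite ef eg; apply: GF.
have [k kk] : exists k, forall x, ev f (ev g x) = pev k x *: x.
 by apply: mpoly_parallel_id => x i j; rewrite ef eg; apply: FG.
have evZ (p : 'I_4 -> P4) : (forall i, p i \is 3.-homog) -> forall c x, ev p (c *: x) = c ^+ 3 *: ev p x.
 by move=> ph c x; rewrite !ev_pol // cubZ.
have hx : pev h x0 != 0.
 by apply: contraNneq n0 => z; rewrite -ef -eg hh z scale0r.
have fx : ev f x0 != 0.
 by apply: contraNneq n0 => z; have := evZ g gh 0 0; rewrite scale0r expr0n /= scale0r -ef -eg z => ->.
have kx : pev k (ev f x0) != 0.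
 apply: contraNneq fx => z; have := kk (ev f x0); rewrite z scale0r hh evZ // => /eqP.
 by rewrite scaler_eq0 expf_eq0 (negPf hx).
exists f, g, h, k; split=> //; split=> //.
 by apply: contraNneq hx => ->; rewrite /pev meval0.
by apply: contraNneq kx => ->; rewrite /pev meval0.
Qed.

Lemma bir_family (W : lmodType K) (F G : W -> V -> V) w1 u v w2 u' v' w3 x0 :
 (forall w, hvec 3 (F w)) -> (forall w, hvec 3 (G w)) ->
 (forall x, pvec (fun w => F w x)) -> (forall x, pvec (fun w => G w x)) ->
 (forall x, pvec (fun w => G w (F w x))) ->
 (forall w x, par2 (G w (F w x)) x) -> (forall w x, par2 (F w (G w x)) x) ->
 twistF (F w1) u v != 0 -> twistF (G w2) u' v' != 0 -> G w3 (F w3 x0) != 0 ->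
 exists c : W -> K, [/\ pfun c, exists w, c w != 0 &
  forall w, c w != 0 -> exists f g h k, bir f g h k /\ forall x, ev f x = F w x].
Proof.
move=> hF hG pF pG pGF GF FG n1 n2 n3.
have [i n4] : exists i, G w3 (F w3 x0) 0 i != 0.
 by apply: NNPP => h; case/eqP: n3; apply/rowP => i; rewrite [RHS]mxE; apply/eqP/negPn/negP => ?; apply: h; exists i.
have P1 := pfun_twistF u v pF; have P2 := pfun_twistF u' v' pG.
have [w4 [a1 a2]] := pfun_nonzero2 P1 P2 n1 n2.
have [w5 [b1 b2]] := pfun_nonzero2 (pfunM P1 P2) (pGF x0 i) (mulf_neq0 a1 a2) n4.
exists (fun w => twistF (F w) u v * twistF (G w) u' v' * G w (F w x0) 0 i); split.
- by apply: pfunM; [apply: pfunM|apply: pGF].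
- by exists w5; apply: mulf_neq0.
- move=> w; rewrite !mulf_eq0 !negb_or => /andP[/andP[c1 c2] c3].
 apply: (bir_values (G := G w) (u := u) (v := v) (u' := u') (v' := v') (x0 := x0)) => //.
 by apply: contraNneq c3 => ->; rewrite mxE.
Qed.

End BirationalFamilies.

(** * The family of determinantal maps *)

Section DeterminantalFamily.
Variable K : numClosedFieldType.
Notation V := ('rV[K]_4).

Definition vec4 (a b c d : K) : V := a *: evec K q0 + b *: evec K q1 + c *: evec K q2 + d *: evec K q3.

Lemma vec4E a b c d : [/\ vec4 a b c d 0 q0 = a, vec4 a b c d 0 q1 = b, vec4 a b c d 0 q2 = c & vec4 a b c d 0 q3 = d].
Proof. by split; rewrite /vec4 !mxE /= !(mulr0, mulr1, addr0, add0r). Qed.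

Lemma vec4_eta (x : V) : vec4 (x 0 q0) (x 0 q1) (x 0 q2) (x 0 q3) = x.
Proof. by have [e0 e1 e2 e3] := vec4E (x 0 q0) (x 0 q1) (x 0 q2) (x 0 q3); apply/rowP; apply: ord4P. Qed.

Lemma vec4_linear (a b c d a' b' c' d' k : K) : [/\ vec4 a b c d + vec4 a' b' c' d' = vec4 (a + a') (b + b') (c + c') (d + d'),
 k *: vec4 a b c d = vec4 (k * a) (k * b) (k * c) (k * d), - vec4 a b c d = vec4 (- a) (- b) (- c) (- d) &
 dot (vec4 a b c d) (vec4 a' b' c' d') = a * a' + b * b' + c * c' + d * d'].
Proof.
split; try by rewrite /vec4; vring.
by rewrite dotE; have [-> -> -> ->] := vec4E a b c d; have [-> -> -> ->] := vec4E a' b' c' d'.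
Qed.

Lemma vec4D (a b c d a' b' c' d' : K) : vec4 a b c d + vec4 a' b' c' d' = vec4 (a + a') (b + b') (c + c') (d + d').
Proof. by have [] := vec4_linear a b c d a' b' c' d' 0. Qed.

Lemma vec4Z (a b c d k : K) : k *: vec4 a b c d = vec4 (k * a) (k * b) (k * c) (k * d).
Proof. by have [] := vec4_linear a b c d 0 0 0 0 k. Qed.

Lemma vec4N (a b c d : K) : - vec4 a b c d = vec4 (- a) (- b) (- c) (- d).
Proof. by have [] := vec4_linear a b c d 0 0 0 0 0. Qed.

Lemma dot_vec4 (a b c d a' b' c' d' : K) : dot (vec4 a b c d) (vec4 a' b' c' d') = a * a' + b * b' + c * c' + d * d'.
Proof. by have [] := vec4_linear a b c d a' b' c' d' 0. Qed.

Lemma det4_vec4 a b c d a' b' c' d' a2 b2 c2 d2 a3 b3 c3 d3 :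
 det4 (vec4 a b c d) (vec4 a' b' c' d') (vec4 a2 b2 c2 d2) (vec4 a3 b3 c3 d3) =
 a3 * - det3 b c d b' c' d' b2 c2 d2 + b3 * det3 a c d a' c' d' a2 c2 d2 - c3 * det3 a b d a' b' d' a2 b2 d2
 + d3 * det3 a b c a' b' c' a2 b2 c2.
Proof.
have [e00 e01 e02 e03] := vec4E a b c d; have [e10 e11 e12 e13] := vec4E a' b' c' d'.
have [e20 e21 e22 e23] := vec4E a2 b2 c2 d2; have [e30 e31 e32 e33] := vec4E a3 b3 c3 d3.
rewrite det4E /minor2 e00 e01 e02 e03 e10 e11 e12 e13 e20 e21 e22 e23 e30 e31 e32 e33 /det3; ring.
Qed.

Lemma cross_vec4 a b c d a' b' c' d' a2 b2 c2 d2 :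
 cross (vec4 a b c d) (vec4 a' b' c' d') (vec4 a2 b2 c2 d2) =
 vec4 (- det3 b c d b' c' d' b2 c2 d2) (det3 a c d a' c' d' a2 c2 d2) (- det3 a b d a' b' d' a2 b2 d2)
  (det3 a b c a' b' c' a2 b2 c2).
Proof.
apply: dot_ext => x; rewrite dot_cross -(vec4_eta x) det4_vec4 dotE.
by have [-> -> -> ->] := vec4E (- det3 b c d b' c' d' b2 c2 d2) (det3 a c d a' c' d' a2 c2 d2)
 (- det3 a b d a' b' d' a2 b2 d2) (det3 a b c a' b' c' a2 b2 c2);
 have [-> -> -> ->] := vec4E (x 0 q0) (x 0 q1) (x 0 q2) (x 0 q3); ring.
Qed.

Definition det_par : lmodType K := ('M[K]_4 * 'M[K]_4 * 'M[K]_4)%type.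

Definition detF (w : det_par) (x : V) : V := cross (x *m w.1.1) (x *m w.1.2) (x *m w.2).

(** Transposition exchanges source and target in the three bilinear relations between x and its
    image, so it parametrizes the inverse maps. *)
Definition det_tr (w : det_par) : det_par := (w.1.1^T, w.1.2^T, w.2^T).

Lemma hvec_detF w : hvec 3 (detF w).
Proof.
by apply: (@hvec_cross K 1 1 1 (mulmx^~ w.1.1) (mulmx^~ w.1.2) (mulmx^~ w.2)); apply: (hvec_mulmx _ (@hvec_id K)).
Qed.

Lemma pvec_mulmx (W : lmodType K) (v : W -> V) (A : W -> 'M[K]_4) : pvec v -> (forall i j, pfun (fun w => A w i j)) ->
 pvec (fun w => v w *m A w).
Proof.
move=> pv pA j; apply: (@pfunE _ _ (fun w => \sum_i v w 0 i * A w i j)); first by move=> w; rewrite mxE.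
by apply: pfun_sum => i; apply: pfunM; [apply: pv|apply: pA].
Qed.

Lemma pfun_det_par i j : [/\ pfun (fun w : det_par => w.1.1 i j), pfun (fun w : det_par => w.1.2 i j) & pfun (fun w : det_par => w.2 i j)].
Proof.
by split=> u v; [exists ((u.1.1 i j)%:P + (v.1.1 i j) *: 'X)|exists ((u.1.2 i j)%:P + (v.1.2 i j) *: 'X)
 |exists ((u.2 i j)%:P + (v.2 i j) *: 'X)] => t; rewrite !mxE !hornerE mulrC.
Qed.

Lemma pvec_detF (v : det_par -> V) : pvec v -> pvec (fun w => detF w (v w)) /\ pvec (fun w => detF (det_tr w) (v w)).
Proof.
move=> pv; split; apply: pvec_cross; apply: pvec_mulmx => // i j; try by have [] := pfun_det_par i j.
- by apply: (@pfunE _ _ (fun w : det_par => w.1.1 j i)) => [w|]; [rewrite mxE|have [] := pfun_det_par j i].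
- by apply: (@pfunE _ _ (fun w : det_par => w.1.2 j i)) => [w|]; [rewrite mxE|have [] := pfun_det_par j i].
- by apply: (@pfunE _ _ (fun w : det_par => w.2 j i)) => [w|]; [rewrite mxE|have [] := pfun_det_par j i].
Qed.

Lemma dot_trmx (x y : V) (A : 'M[K]_4) : dot x (y *m A^T) = dot (x *m A) y.
Proof.
rewrite !dotE !mxE !sum4 !mxE; ring.
Qed.

Lemma cross_par (a b c x : V) : dot x a = 0 -> dot x b = 0 -> dot x c = 0 -> par2 (cross a b c) x.
Proof.
move=> ha hb hc; have [->|n0] := eqVneq (cross a b c) 0; first by move=> i j; rewrite !mxE !mul0r.
by have [k ->] := cross_unique n0 ha hb hc => i j; rewrite !mxE; ring.
Qed.

Lemma detF_par w x : par2 (detF (det_tr w) (detF w x)) x.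
Proof.
by apply: cross_par; rewrite /= dot_trmx /detF dotC dot_cross ?det4_14 ?det4_24 ?det4_34.
Qed.

Lemma mul_delta (x : V) i j : x *m delta_mx i j = x 0 i *: evec K j.
Proof.
apply/rowP => l; rewrite !mxE (bigD1 i) //= big1 ?addr0 => [|m ml]; first by rewrite mxE !eqxx.
by rewrite mxE (negPf ml) mulr0.
Qed.

(** Chosen so that the line of the first two coordinate vectors goes to a twisted cubic. *)
Definition twisted_cubic_par : det_par :=
 (delta_mx q0 q0 + delta_mx q1 q1, delta_mx q0 q1 + delta_mx q1 q2, delta_mx q0 q2 + delta_mx q1 q3).

(** The standard Cremona involution: the relations are x0 y0 = xi yi. *)
Definition cremona_par : det_par :=
 (delta_mx q0 q0 - delta_mx q1 q1, delta_mx q0 q0 - delta_mx q2 q2, delta_mx q0 q0 - delta_mx q3 q3).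

Lemma detF_twisted x : detF twisted_cubic_par x =
 vec4 (- x 0 q1 ^+ 3) (x 0 q0 * x 0 q1 ^+ 2) (- (x 0 q0 ^+ 2 * x 0 q1)) (x 0 q0 ^+ 3).
Proof.
rewrite /detF /= !mulmxDr !mul_delta.
rewrite (_ : _ + _ = vec4 (x 0 q0) (x 0 q1) 0 0); last by rewrite /vec4 !scale0r !addr0.
rewrite (_ : _ + _ = vec4 0 (x 0 q0) (x 0 q1) 0); last by rewrite /vec4 !scale0r !addr0 add0r.
rewrite (_ : _ + _ = vec4 0 0 (x 0 q0) (x 0 q1)); last by rewrite /vec4 !scale0r !add0r.
rewrite cross_vec4 /det3; congr vec4; ring.
Qed.

Lemma twistF_line F (u v p0 p1 p2 p3 : V) :
 (forall a b, F (a *: u + b *: v) = a ^+ 3 *: p0 + (a ^+ 2 * b) *: p1 + (a * b ^+ 2) *: p2 + b ^+ 3 *: p3) ->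
 det4 p0 p1 p2 p3 != 0 -> twistF F u v != 0.
Proof.
move=> h nd.
have e x a b : x = a *: u + b *: v -> F x = a ^+ 3 *: p0 + (a ^+ 2 * b) *: p1 + (a * b ^+ 2) *: p2 + b ^+ 3 *: p3 by move=> ->.
have P0 : polar F u u u = 6 *: p0.
 rewrite /polar (e (u + u + u) 3 0) ?(e (u + u) 2 0) ?(e u 1 0); by vring.
have P1 : polar F u u v = 2 *: p1.
 rewrite /polar (e (u + u + v) 2 1) ?(e (u + u) 2 0) ?(e (u + v) 1 1) ?(e u 1 0) ?(e v 0 1); by vring.
have P2 : polar F u v v = 2 *: p2.
 rewrite /polar (e (u + v + v) 1 2) ?(e (v + v) 0 2) ?(e (u + v) 1 1) ?(e u 1 0) ?(e v 0 1); by vring.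
have P3 : polar F v v v = 6 *: p3.
 rewrite /polar (e (v + v + v) 0 3) ?(e (v + v) 0 2) ?(e v 0 1); by vring.
by rewrite /twistF P0 P1 P2 P3 det4Z1 det4Z2 det4Z3 det4Z4 !mulf_neq0 // pnatr_eq0.
Qed.

Lemma det_tr_tr w : det_tr (det_tr w) = w.
Proof. by case: w => [[a b] c]; rewrite /det_tr /= !trmxK. Qed.

Lemma detF_cremona : detF (det_tr cremona_par) (detF cremona_par (vec4 1 1 1 1)) != 0.
Proof.
have -> : det_tr cremona_par = cremona_par by rewrite /det_tr /cremona_par /= !linearB /= !trmx_delta.
have e : detF cremona_par (vec4 1 1 1 1) = vec4 1 1 1 1.
 have [e0 e1 e2 e3] := vec4E 1 1 1 1; rewrite /detF /= !mulmxBr !mul_delta e0 e1 e2 e3.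
 rewrite (_ : _ - _ = vec4 1 (-1) 0 0); last by rewrite /vec4 !scale0r !addr0 scaleNr.
 rewrite (_ : _ - _ *: evec K q2 = vec4 1 0 (-1) 0); last by rewrite /vec4 !scale0r !addr0 scaleNr.
 rewrite (_ : _ - _ *: evec K q3 = vec4 1 0 0 (-1)); last by rewrite /vec4 !scale0r !addr0 scaleNr.
 rewrite cross_vec4 /det3; congr vec4; ring.
have n0 : vec4 1 1 1 1 != 0.
 by apply/eqP => /rowP/(_ q0)/eqP; rewrite /vec4 !mxE /= !(mulr0, mulr1, addr0) oner_eq0.
by rewrite e e n0.
Qed.

Lemma det_family : exists c : det_par -> K, [/\ pfun c, exists w, c w != 0 &
 forall w, c w != 0 -> exists f g h k, bir f g h k /\ forall x, ev f x = detF w x].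
Proof.
have tw : twistF (detF twisted_cubic_par) (evec K q0) (evec K q1) != 0.
 apply: (@twistF_line _ _ _ (vec4 0 0 0 1) (vec4 0 0 (-1) 0) (vec4 0 1 0 0) (vec4 (-1) 0 0 0)).
  move=> a b; rewrite detF_twisted !mxE /=; apply/rowP => i; rewrite /vec4 !mxE; ring.
 by rewrite det4_vec4 (_ : _ + _ = 1) ?oner_eq0 // /det3; ring.
apply: (@bir_family _ _ detF (fun w => detF (det_tr w)) twisted_cubic_par (evec K q0) (evec K q1)
 (det_tr twisted_cubic_par) (evec K q0) (evec K q1) cremona_par (vec4 1 1 1 1)) => //.
- exact: hvec_detF.
- by move=> w; apply: hvec_detF.
- by move=> x; have [] := pvec_detF (@pvec_const K _ 4 x).
- by move=> x; have [] := pvec_detF (@pvec_const K _ 4 x).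
- by move=> x; apply: (pvec_detF _).2; have [] := pvec_detF (@pvec_const K _ 4 x).
- exact: detF_par.
- by move=> w x; have := detF_par (det_tr w) x; rewrite det_tr_tr.
- by rewrite det_tr_tr.
- exact: detF_cremona.
Qed.

End DeterminantalFamily.

(** * The family [sfam] and its inverse *)

Section RuledFamily.
Variable K : numClosedFieldType.
Notation V := ('rV[K]_4).

Section Inverse.
Variables (h0 h1 h2 h3 l0 l1 l2 l3 L L' : V) (r0 r1 r2 : K).

(** [cov0] to [cov3] form the dual frame of l0, ..., l3, scaled by their determinant. *)
Definition cov0 := - cross l1 l2 l3.
Definition cov1 := cross l0 l2 l3.
Definition cov2 := - cross l0 l1 l3.
Definition cov3 := cross l0 l1 l2.

Lemma dual_expand x : det4 l0 l1 l2 l3 *: x = dot l0 x *: cov0 + dot l1 x *: cov1 + dot l2 x *: cov2 + dot l3 x *: cov3.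
Proof.
apply: dot_ext => z; rewrite dotZl -dotZr (cramer4 l0 l1 l2 l3 z) !dotDr !dotDl !dotZr !dotZl /cov0 /cov1 /cov2 /cov3.
rewrite !dotNl !dot_cross [dot x l0]dotC [dot x l1]dotC [dot x l2]dotC [dot x l3]dotC.
rewrite [in det4 z l1 l2 l3]det4_swap12 (det4_swap23 l1 l2 z l3) (det4_swap34 l1 l2 l3 z).
rewrite (det4_swap23 l0 l2 z l3) (det4_swap34 l0 l2 l3 z) (det4_swap34 l0 l1 l3 z); ring.
Qed.

Lemma dual_cov : [/\ dot l0 cov0 = det4 l0 l1 l2 l3, dot l1 cov1 = det4 l0 l1 l2 l3,
 dot l2 cov2 = det4 l0 l1 l2 l3 & dot l3 cov3 = det4 l0 l1 l2 l3].
Proof.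
rewrite ![dot _ cov0]dotC ![dot _ cov1]dotC ![dot _ cov2]dotC ![dot _ cov3]dotC /cov0 /cov1 /cov2 /cov3 !dotNl !dot_cross.
split=> //.
- by rewrite (det4_swap34 l1 l2 l0 l3) (det4_swap23 l1 l0 l2 l3) (det4_swap12 l0 l1 l2 l3) !opprK.
- by rewrite (det4_swap34 l0 l2 l1 l3) (det4_swap23 l0 l1 l2 l3) opprK.
- by rewrite (det4_swap34 l0 l1 l2 l3) opprK.
Qed.

Lemma dual_cov0 : [/\ (dot l0 cov1 = 0) * (dot l0 cov2 = 0) * (dot l0 cov3 = 0), (dot l1 cov0 = 0) * (dot l1 cov2 = 0) * (dot l1 cov3 = 0),
 (dot l2 cov0 = 0) * (dot l2 cov1 = 0) * (dot l2 cov3 = 0) & (dot l3 cov0 = 0) * (dot l3 cov1 = 0) * (dot l3 cov2 = 0)].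
Proof.
by do !split; rewrite dotC /cov0 /cov1 /cov2 /cov3 ?dotNl dot_cross ?(det4_14, det4_24, det4_34) ?oppr0.
Qed.

Definition slin (m : V) n0 n1 := n0 * dot L m + n1 * dot L' m.
Definition squad n0 n1 := n0 * slin cov0 n0 n1 + n1 * slin cov1 n0 n1.
(** Inversion of [sfam]: n0 : n1 is l0 : l1, and n2 : n3 is l2 : l3. The two blocks are weighted by
    the quadratic coefficients of [sfam]; the first of these is affine in l2, l3 once l0, l1 are
    known, and solving for the ratio of the weights gives [scub] : [squad]. *)
Definition scub n0 n1 n2 n3 := det4 l0 l1 l2 l3 * (r0 * n0 ^+ 2 + r1 * n0 * n1 + r2 * n1 ^+ 2)
 - slin cov2 n0 n1 * n2 - slin cov3 n0 n1 * n3.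
Definition sinv_coord n0 n1 n2 n3 : V := scub n0 n1 n2 n3 *: (n0 *: cov0 + n1 *: cov1)
 + squad n0 n1 *: (n2 *: cov2 + n3 *: cov3).
Definition sinv y := sinv_coord (det4 y h1 h2 h3) (det4 h0 y h2 h3) (det4 h0 h1 y h3) (det4 h0 h1 h2 y).

Lemma sinv_sfam x : par2 (sinv (sfam h0 h1 h2 h3 l0 l1 l2 l3 L L' r0 r1 r2 x)) x.
Proof.
rewrite /sfam; have := dual_expand x.
have LD : det4 l0 l1 l2 l3 * dot L x = dot l0 x * dot L cov0 + dot l1 x * dot L cov1 + dot l2 x * dot L cov2 + dot l3 x * dot L cov3.
 by rewrite -dotZr dual_expand !dotDr !dotZr.
have LD' : det4 l0 l1 l2 l3 * dot L' x = dot l0 x * dot L' cov0 + dot l1 x * dot L' cov1 + dot l2 x * dot L' cov2 + dot l3 x * dot L' cov3.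
 by rewrite -dotZr dual_expand !dotDr !dotZr.
move: LD LD'; set a0 := dot l0 x; set a1 := dot l1 x; set a2 := dot l2 x; set a3 := dot l3 x.
set D := det4 l0 l1 l2 l3 => LD LD' ex.
name A EA := (a0 * dot L x + a1 * dot L' x).
name r Er := (r0 * a0 ^+ 2 + r1 * a0 * a1 + r2 * a1 ^+ 2).
rewrite -EA -Er /sinv !(det4D1, det4D2, det4D3, det4D4, det4Z1, det4Z2, det4Z3, det4Z4).
rewrite !(det4_12, det4_13, det4_14, det4_23, det4_24, det4_34) !(mulr0, addr0, add0r).
name E EE := (det4 h0 h1 h2 h3).
rewrite -EE; name q Eq := (squad a0 a1).
have DA : D * A = q + slin cov2 a0 a1 * a2 + slin cov3 a0 a1 * a3.
 by rewrite EA mulrDr !(mulrCA D) LD LD' Eq /squad /slin; ring.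
have es : scub (A * (a0 * E)) (A * (a1 * E)) (r * (a2 * E)) (r * (a3 * E)) = E ^+ 2 * A * r * q.
 transitivity (E ^+ 2 * A * r * (D * A - slin cov2 a0 a1 * a2 - slin cov3 a0 a1 * a3)).
  by rewrite /scub -/D Er /slin; ring.
 by rewrite DA; ring.
have eq : squad (A * (a0 * E)) (A * (a1 * E)) = E ^+ 2 * A ^+ 2 * q by rewrite Eq /squad /slin; ring.
rewrite /sinv_coord es eq.
have -> : (E ^+ 2 * A * r * q) *: ((A * (a0 * E)) *: cov0 + (A * (a1 * E)) *: cov1) +
  (E ^+ 2 * A ^+ 2 * q) *: ((r * (a2 * E)) *: cov2 + (r * (a3 * E)) *: cov3) = (E ^+ 3 * A ^+ 2 * r * q * D) *: x.
 by rewrite -[RHS]scalerA ex; vring.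
exact: par2Z.
Qed.

Lemma sfam_sinv y : par2 (sfam h0 h1 h2 h3 l0 l1 l2 l3 L L' r0 r1 r2 (sinv y)) y.
Proof.
rewrite /sinv; have := cramer4 h0 h1 h2 h3 y.
set n0 := det4 y h1 h2 h3; set n1 := det4 h0 y h2 h3; set n2 := det4 h0 h1 y h3; set n3 := det4 h0 h1 h2 y.
set E := det4 h0 h1 h2 h3 => ey.
name s Es := (scub n0 n1 n2 n3).
name q Eq := (squad n0 n1).
rewrite /sinv_coord -Es -Eq; have [k0 k1 k2 k3] := dual_cov; have [z0 z1 z2 z3] := dual_cov0.
rewrite /sfam !(dotDr, dotZr) k0 k1 k2 k3 !z0 !z1 !z2 !z3 !(mulr0, addr0, add0r).
move: k0 k1 k2 k3; set D := det4 l0 l1 l2 l3 => _ _ _ _.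
name r Er := (r0 * n0 ^+ 2 + r1 * n0 * n1 + r2 * n1 ^+ 2).
have DR : D * r = s + slin cov2 n0 n1 * n2 + slin cov3 n0 n1 * n3 by rewrite Es /scub -/D -Er; ring.
have eA : s * (n0 * D) * (s * (n0 * dot L cov0 + n1 * dot L cov1) + q * (n2 * dot L cov2 + n3 * dot L cov3)) +
  s * (n1 * D) * (s * (n0 * dot L' cov0 + n1 * dot L' cov1) + q * (n2 * dot L' cov2 + n3 * dot L' cov3)) = D ^+ 2 * s * q * r.
 transitivity (D * s * q * (D * r)); last by ring.
 rewrite DR; transitivity (D * s * (s * squad n0 n1 + q * (slin cov2 n0 n1 * n2 + slin cov3 n0 n1 * n3))).
  by rewrite /squad /slin; ring.
 by rewrite -Eq; ring.
rewrite eA; have -> : r0 * (s * (n0 * D)) ^+ 2 + r1 * (s * (n0 * D)) * (s * (n1 * D)) + r2 * (s * (n1 * D)) ^+ 2 = D ^+ 2 * s ^+ 2 * r.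
 by rewrite Er; ring.
set w := (X in par2 X _); have -> : w = (D ^+ 3 * s ^+ 2 * q * r * E) *: y.
 by rewrite -[RHS]scalerA ey /w; vring.
exact: par2Z.
Qed.

Lemma hvec_sfam : hvec 3 (sfam h0 h1 h2 h3 l0 l1 l2 l3 L L' r0 r1 r2).
Proof.
have hd := @hfun_dot K; have c (a : V) l : hvec 1 (fun x => dot l x *: a).
 by apply: (hvecZ (d := 1) (e := 0)) => //; apply: hvec_const.
have q (a b : V) : hfun 2 (fun x => dot a x * dot b x) by apply: (hfunM (d := 1) (e := 1)); apply: hd.
apply: hvecD.
 apply: (hvecZ (d := 2) (e := 1)); first by apply: hfunD.
 by apply: (@hvecD _ 1).
apply: (hvecZ (d := 2) (e := 1)); last by apply: (@hvecD _ 1).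
apply: (@hfunD _ 2); first apply: (@hfunD _ 2).
- exact: hfunZ (q l0 l0).
- by apply: (@hfun_ext K 2 (fun x => r1 * (dot l0 x * dot l1 x))) => [x|]; [rewrite mulrA|apply: hfunZ].
- exact: hfunZ (q l1 l1).
Qed.

Lemma hvec_sinv : hvec 3 sinv.
Proof.
pose n0 y := det4 y h1 h2 h3; pose n1 y := det4 h0 y h2 h3; pose n2 y := det4 h0 h1 y h3; pose n3 y := det4 h0 h1 h2 y.
have hi := @hvec_id K; have hc := @hvec_const K.
have H0 : hfun 1 n0 by apply: (hfun_det4 (d1 := 1) (d2 := 0) (d3 := 0) (d4 := 0)).
have H1 : hfun 1 n1 by apply: (hfun_det4 (d1 := 0) (d2 := 1) (d3 := 0) (d4 := 0)).
have H2 : hfun 1 n2 by apply: (hfun_det4 (d1 := 0) (d2 := 0) (d3 := 1) (d4 := 0)).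
have H3 : hfun 1 n3 by apply: (hfun_det4 (d1 := 0) (d2 := 0) (d3 := 0) (d4 := 1)).
have hl m : hfun 1 (fun y => slin m (n0 y) (n1 y)).
 by apply: (hfun_ext _ (hfunD (hfunZ (dot L m) H0) (hfunZ (dot L' m) H1))) => y; rewrite /slin; ring.
have hq : hfun 2 (fun y => squad (n0 y) (n1 y)) by apply: hfunD; apply: (hfunM (d := 1) (e := 1)).
have hs : hfun 2 (fun y => scub (n0 y) (n1 y) (n2 y) (n3 y)).
 apply: hfunD; last by apply: hfunN; apply: (hfunM (d := 1) (e := 1)).
 apply: hfunD; last by apply: hfunN; apply: (hfunM (d := 1) (e := 1)).
 apply: hfunZ; apply: (@hfunD _ 2); first apply: (@hfunD _ 2).
 - exact: hfunZ (hfunM H0 H0).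
 - by apply: (@hfun_ext K 2 (fun y => r1 * (n0 y * n1 y))) => [y|]; [rewrite mulrA|apply: hfunZ; apply: hfunM H0 H1].
 - exact: hfunZ (hfunM H1 H1).
have cz n (m : V) : hfun 1 n -> hvec 1 (fun y => n y *: m) by move=> hn; apply: (hvecZ (d := 1) (e := 0)).
by apply: hvecD; apply: (hvecZ (d := 2) (e := 1)) => //; apply: hvecD; apply: cz.
Qed.

End Inverse.

Lemma pvec_sinv (W : lmodType K) (h0 h1 h2 h3 l0 l1 l2 l3 L L' : W -> V) (r0 r1 r2 : W -> K) (y : W -> V) :
 pvec h0 -> pvec h1 -> pvec h2 -> pvec h3 -> pvec l0 -> pvec l1 -> pvec l2 -> pvec l3 -> pvec L -> pvec L' ->
 pfun r0 -> pfun r1 -> pfun r2 -> pvec y ->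
 pvec (fun w => sinv (h0 w) (h1 w) (h2 w) (h3 w) (l0 w) (l1 w) (l2 w) (l3 w) (L w) (L' w) (r0 w) (r1 w) (r2 w) (y w)).
Proof.
move=> p0 p1 p2 p3 P0 P1 P2 P3 PL PL' R0 R1 R2 Py.
have sl c n n' : pvec c -> pfun n -> pfun n' -> pfun (fun w => slin (L w) (L' w) (c w) (n w) (n' w)) by move=> *; polynomial.
apply: pvecD; apply: pvecZ.
- apply: pfunB; last by polynomial.
 apply: pfunB; last by polynomial.
 apply: pfunM; first exact: pfun_det4.
 by polynomial.
- by polynomial.
- by polynomial.
- by polynomial.
Qed.

(** Ten rows hold h0 to h3, l0 to l3, L and L'; the first three entries of the last row hold r0, r1,
    r2. *)
Definition ruled_par : lmodType K := 'M[K]_(11, 4).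

Definition at_row T (F : V -> V -> V -> V -> V -> V -> V -> V -> V -> V -> K -> K -> K -> T) (w : ruled_par) : T :=
 let e k := row (inord k) w in
 F (e 0) (e 1) (e 2) (e 3) (e 4) (e 5) (e 6) (e 7) (e 8) (e 9) (e 10 0 q0) (e 10 0 q1) (e 10 0 q2).

Definition ruledF := at_row (@sfam K).
Definition ruledG := at_row sinv.

Lemma pvec_row i : pvec (fun w : ruled_par => row i w).
Proof. by move=> j u v; exists ((u i j)%:P + (v i j) *: 'X) => t; rewrite !mxE !hornerE mulrC. Qed.

Lemma pvec_ruledF (y : ruled_par -> V) : pvec y -> pvec (fun w => ruledF w (y w)).
Proof. by move=> py; apply: pvec_sfam => //; try apply: pvec_row. Qed.

Lemma pvec_ruledG (y : ruled_par -> V) : pvec y -> pvec (fun w => ruledG w (y w)).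
Proof. by move=> py; apply: pvec_sinv => //; try apply: pvec_row. Qed.

Lemma ruled_par_ex (h0 h1 h2 h3 l0 l1 l2 l3 L L' : V) (r0 r1 r2 : K) : exists w : ruled_par,
 forall T (F : V -> V -> V -> V -> V -> V -> V -> V -> V -> V -> K -> K -> K -> T),
  at_row F w = F h0 h1 h2 h3 l0 l1 l2 l3 L L' r0 r1 r2.
Proof.
pose s := [:: h0; h1; h2; h3; l0; l1; l2; l3; L; L'; vec4 r0 r1 r2 0].
exists (\matrix_(i < 11) nth 0 s i) => T F; rewrite /at_row !rowK !inordK //=.
by have [-> -> -> _] := vec4E r0 r1 r2 0.
Qed.

(** Both frames are the standard one, L = x0, L' = 0 and r = x1^2. This monomial map witnesses
    birationality and also separates the family from determinantal maps. *)
Lemma ruled_example : exists w : ruled_par,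
 (forall x0 x1 x2 x3, ruledF w (vec4 x0 x1 x2 x3) = vec4 (x0 ^+ 3) (x0 ^+ 2 * x1) (x1 ^+ 2 * x2) (x1 ^+ 2 * x3)) /\
 (forall x0 x1 x2 x3, ruledG w (vec4 x0 x1 x2 x3) = vec4 (x0 * x1 ^+ 2) (x1 ^+ 3) (x0 ^+ 2 * x2) (x0 ^+ 2 * x3)).
Proof.
pose e0 := vec4 1 0 0 (0 : K); pose e1 := vec4 0 1 0 (0 : K); pose e2 := vec4 0 0 1 (0 : K); pose e3 := vec4 0 0 0 (1 : K).
have z0 : 0 = vec4 0 0 0 (0 : K) by rewrite /vec4 !scale0r !addr0.
have [w hw] := ruled_par_ex e0 e1 e2 e3 e0 e1 e2 e3 e0 0 0 0 1.
have Fv x0 x1 x2 x3 : ruledF w (vec4 x0 x1 x2 x3) = vec4 (x0 ^+ 3) (x0 ^+ 2 * x1) (x1 ^+ 2 * x2) (x1 ^+ 2 * x3).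
 by rewrite /ruledF hw /sfam z0 /e0 /e1 /e2 /e3 !dot_vec4 !(vec4Z, vec4D); congr vec4; ring.
have C0 : cov0 e1 e2 e3 = e0 by rewrite /cov0 cross_vec4 vec4N /det3; congr vec4; ring.
have C1 : cov1 e0 e2 e3 = e1 by rewrite /cov1 cross_vec4 /det3; congr vec4; ring.
have C2 : cov2 e0 e1 e3 = e2 by rewrite /cov2 cross_vec4 vec4N /det3; congr vec4; ring.
have C3 : cov3 e0 e1 e2 = e3 by rewrite /cov3 cross_vec4 /det3; congr vec4; ring.
have Gv x0 x1 x2 x3 : ruledG w (vec4 x0 x1 x2 x3) = vec4 (x0 * x1 ^+ 2) (x1 ^+ 3) (x0 ^+ 2 * x2) (x0 ^+ 2 * x3).
 rewrite /ruledG hw /sinv /sinv_coord /squad /scub /slin C0 C1 C2 C3 z0 /e0 /e1 /e2 /e3 !dot_vec4 !det4_vec4 /det3.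
 by rewrite !(vec4Z, vec4D); congr vec4; ring.
by exists w.
Qed.

Lemma ruled_family : exists c : ruled_par -> K, [/\ pfun c, exists w, c w != 0 &
 forall w, c w != 0 -> exists f g h k, bir f g h k /\ forall x, ev f x = ruledF w x].
Proof.
have [w [Fv Gv]] := ruled_example.
pose u : V := vec4 1 0 1 0; pose v : V := vec4 0 1 0 1.
have uv a b : a *: u + b *: v = vec4 a b a b by rewrite !(vec4Z, vec4D); congr vec4; ring.
have ex (x : V) : exists x0 x1 x2 x3, x = vec4 x0 x1 x2 x3.
 by exists (x 0 q0), (x 0 q1), (x 0 q2), (x 0 q3); rewrite vec4_eta.
apply: (@bir_family _ ruled_par ruledF ruledG w u v w u v w (vec4 1 1 1 1)).
- by move=> w'; apply: hvec_sfam.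
- by move=> w'; apply: hvec_sinv.
- by move=> x; apply: pvec_ruledF; apply: pvec_const.
- by move=> x; apply: pvec_ruledG; apply: pvec_const.
- by move=> x; apply: pvec_ruledG; apply: pvec_ruledF; apply: pvec_const.
- by move=> w' x; apply: sinv_sfam.
- by move=> w' x; apply: sfam_sinv.
- apply: (@twistF_line _ _ _ _ (vec4 1 0 0 0) (vec4 0 1 0 0) (vec4 0 0 1 0) (vec4 0 0 0 1)).
  by move=> a b; rewrite uv Fv !(vec4Z, vec4D); congr vec4; ring.
 by rewrite det4_vec4 (_ : _ + _ = 1) ?oner_eq0 // /det3; ring.
- apply: (@twistF_line _ _ _ _ (vec4 0 0 1 0) (vec4 0 0 0 1) (vec4 1 0 0 0) (vec4 0 1 0 0)).
  by move=> a b; rewrite uv Gv !(vec4Z, vec4D); congr vec4; ring.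
 by rewrite det4_vec4 (_ : _ + _ = 1) ?oner_eq0 // /det3; ring.
- have n0 (a b c d : K) : a != 0 -> vec4 a b c d != 0.
  move=> a0; apply/eqP => z; have := congr1 (dot (vec4 1 0 0 0)) z.
  by rewrite dot_vec4 dot0r !mul0r !addr0 mul1r; apply/eqP.
 by rewrite Fv Gv; apply: n0; rewrite !(expr1n, mulr1) oner_eq0.
Qed.

End RuledFamily.

(** * Ruled maps have vanishing [rho] *)

Section Closures.
Variable K : numClosedFieldType.
Notation V := ('rV[K]_4).
Notation P4 := {mpoly K[4]}.

Lemma cross_onto (a : V) : a 0 q0 != 0 -> exists b1 b2 b3, a = cross b1 b2 b3.
Proof.
move=> a0; exists (vec4 (a 0 q1 / a 0 q0 ^+ 2) (- (a 0 q0)^-1) 0 0), (vec4 (- a 0 q2) 0 (a 0 q0) 0), (vec4 (- a 0 q3) 0 0 (a 0 q0)).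
by rewrite cross_vec4 -[LHS]vec4_eta /det3; congr vec4; field.
Qed.

Lemma dependent_cross (s t r : K) (x1 x2 x3 : V) : (s != 0) || (t != 0) || (r != 0) -> s *: x1 + t *: x2 + r *: x3 = 0 ->
 cross x1 x2 x3 = 0.
Proof.
move=> nz e0; apply: dot_ext => x4; rewrite dot_cross dot0l.
have f1 := congr1 (fun y => det4 y x2 x3 x4) e0; have f2 := congr1 (fun y => det4 x1 y x3 x4) e0.
have f3 := congr1 (fun y => det4 x1 x2 y x4) e0; move: f1 f2 f3.
rewrite !(det4D1, det4D2, det4D3, det4Z1, det4Z2, det4Z3, det4_12, det4_13, det4_23, det4_01, det4_02, det4_03).
rewrite !(mulr0, addr0, add0r) => /eqP; rewrite mulf_eq0 => /orP[/eqP s0 /eqP|/eqP//].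
rewrite mulf_eq0 => /orP[/eqP t0 /eqP|/eqP//]; rewrite mulf_eq0 => /orP[/eqP r0|/eqP//].
by move: nz; rewrite s0 t0 r0 eqxx.
Qed.

Lemma dot_line_coeffs (T : symtri K) a (x y : V) : (forall s t, dot a (cub T (s *: x + t *: y)) = 0) ->
 [/\ dot a (cub T x) = 0, dot a (T x x y) = 0, dot a (T x y y) = 0 & dot a (cub T y) = 0].
Proof.
move=> hl; have h0 := hl 1 0; have h1 := hl 0 1; have hp := hl 1 1; have hm := hl 1 (-1).
move: h0 h1 hp hm; rewrite !cubD !cubZ !(stZ1, stZ2, stZ3) !dotDr !dotZr => h0 h1 hp hm.
have n3 : 6 != 0 :> K by rewrite pnatr_eq0.
have h0' : dot a (cub T x) = 0 by rewrite -[RHS]h0; ring.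
have h1' : dot a (cub T y) = 0 by rewrite -[RHS]h1; ring.
split=> //; apply: (mulfI n3); rewrite mulr0.
 by transitivity ((0 : K) - 0 - 2 * dot a (cub T y)); [rewrite -{1}hp -hm; ring|rewrite h1'; ring].
by transitivity ((0 : K) + 0 - 2 * dot a (cub T x)); [rewrite -{1}hp -hm; ring|rewrite h0'; ring].
Qed.

(** A ruling of a.f through the node o has a direction q with a.T(o, o, q) = 0, so it lies in the
    plane <o, v1, v2>. Its slope there is a common root of the quadratic and cubic parts, and the
    resultant vanishes. *)
Lemma rho_zero_of_ruled (f g : 'I_4 -> P4) h k (G : P4) : bir f g h k -> G != 0 ->
 (forall a, pev G a != 0 -> forall p, p != 0 -> dot a (cub (pol f) p) = 0 ->
   exists q, indep2 p q /\ forall s t, dot a (cub (pol f) (s *: p + t *: q)) = 0) ->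
 forall o v1 v2, rho (pol f) o v1 v2 = 0.
Proof.
move=> B G0 hG o0 v10 v20; set T := pol f; set S := pol g; apply/eqP/negPn/negP => rz.
pose W : lmodType K := (V * V * V)%type.
have p1 : pvec (fun w : W => w.1.1) by polynomial.
have p2 : pvec (fun w : W => w.1.2) by polynomial.
have p3 : pvec (fun w : W => w.2) by polynomial.
(* A covector general for [G] is a [cross] of y, y1, y2 with y general; the differential of f at
   g(y) then realizes it as a plane [a] of the kind used in [rho]. *)
have [y [y1 [y2 [ky Gy]]]] : exists y y1 y2, pev k y != 0 /\ pev G (cross y y1 y2) != 0.
 have [a aG] : exists a : V, pev G a != 0 /\ a 0 q0 != 0.
  have [a ha] := pev_neq0 G0; have [b [b1 b2]] : exists b : V, pev G b != 0 /\ dot (evec K q0) b != 0.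
   apply: (@pfun_nonzero2 _ V _ _ a (evec K q0)) => //; last by rewrite dot_evec evecE oner_eq0.
    by polynomial.
   by polynomial.
  by exists b; split=> //; rewrite -dot_evec dotC.
 have [z hz] := bir_h_ex (bir_sym B).
 have [b1 [b2 [b3 eb]]] : exists b1 b2 b3, a = cross b1 b2 b3 by case: aG => _; apply: cross_onto.
 have [w [w1 w2]] : exists w : W, pev k w.1.1 != 0 /\ pev G (cross w.1.1 w.1.2 w.2) != 0.
  apply: (@pfun_nonzero2 _ W _ _ (z, 0, 0) (b1, b2, b3)) => //=; last by rewrite -eb; case: aG.
   exact: pfun_pev.
  by polynomial.
 by exists w.1.1, w.1.2, w.2.
have ho : pev h (S y y y) != 0 by apply: (bir_h_comp_neq0 B).
have [u1 e1] := bir_dsurj B ((pev k y)^-1 *: y1) ho; have [u2 e2] := bir_dsurj B y2 ho.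
pose c (w : W) := cross (T w.1.1 w.1.1 w.1.1) (T w.1.1 w.1.1 w.1.2) (T w.1.1 w.1.1 w.2).
have pc : pvec c by polynomial.
have [w1 [a1 a2]] : exists w : W, rho T w.1.1 w.1.2 w.2 != 0 /\ pev G (c w) != 0.
 apply: (@pfun_nonzero2 _ W _ _ (o0, v10, v20) (S y y y, u1, u2)) => //; first exact: pfun_rho.
  exact: pfun_pev.
 rewrite /c /= e1 e2 -/(cub S y) -/(cub T (cub S y)) (bir_cub (bir_sym B)).
 rewrite (_ : cross _ _ _ = cross y y1 y2) //; apply: dot_ext => x.
 by rewrite !dot_cross det4Z1 det4Z2 mulrA mulfV // mul1r.
have [w [/andP[b1 b2] b3]] : exists w : W, (rho T w.1.1 w.1.2 w.2 != 0) && (pev G (c w) != 0) /\ pev h w.1.1 != 0.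
 have [w [c1 c2]] : exists w : W, rho T w.1.1 w.1.2 w.2 * pev G (c w) != 0 /\ pev h w.1.1 != 0.
  apply: (@pfun_nonzero2 _ W _ _ w1 (S y y y, 0, 0)) => //.
  - by apply: pfunM; [apply: pfun_rho|apply: pfun_pev].
  - exact: pfun_pev.
  - by rewrite mulf_neq0.
 by exists w; move: c1; rewrite mulf_eq0 negb_or.
case: w b1 b2 b3 => [[o v1] v2] /= rw + ho'; rewrite /c /=; set a := cross _ _ _ => Ga.
have a0 : a != 0.
 by apply: contraNneq rw => z; rewrite /rho -/a z !dot0l; apply/eqP; rewrite /normq; ring.
have o0' : o != 0 by apply: contraNneq a0 => z; apply/eqP/dot_ext => x; rewrite /a z st01 dot_cross det4_01 dot0l.
have [|q [iq hq]] := hG a Ga o o0'; first by rewrite dot_cross det4_14.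
have D4 x : dot a x = det4 (T o o o) (T o o v1) (T o o v2) x by rewrite dot_cross.
have [_ d1 _ _] := dot_line_coeffs hq.
have nc : cross o v1 v2 != 0.
 have [x hx] := dot_neq0 a0; have [v ev] := bir_dsurj B x ho'.
 apply: contraNneq hx => z; rewrite D4 -ev.
 have [s [t [r [nz e]]]] := cross_dep z.
 have e' : s *: T o o o + t *: T o o v1 + r *: T o o v2 = 0 by rewrite -!stZ3 -!stD3 e st03.
 by rewrite -dot_cross (dependent_cross nz e') dot0l.
have dq : dot (cross o v1 v2) q = 0.
 rewrite dot_cross; apply/eqP/negPn/negP => nd.
 by have := bir_basis B ho' nd; rewrite -D4 d1 eqxx.
have [r [s [t eq]]] := plane_span nc dq; pose w := s *: v1 + t *: v2.
have hw : forall s' t' : K, dot a (cub T (s' *: o + t' *: w)) = 0.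
 move=> s' t'; rewrite -(hq (s' - t' * r) t') eq; congr (dot a (cub T _)).
 by vring.
have [_ _ f2 f3] := dot_line_coeffs hw; move: f2 f3; rewrite /w cubD !cubZ !(stD2, stD3) !(stZ1, stZ2, stZ3) !dotDr !dotZr (st23 T o v1 v2) => f2 f3.
(* A ruling of infinite slope would annihilate the leading coefficient of the quadratic part, which
   [normq_lead] excludes. *)
have [s0|s0] := eqVneq s 0.
 have t0 : t != 0.
  apply/eqP => t0; have [|z] := iq r (-1); first by rewrite eq s0 t0 !scale0r !addr0 scaleN1r subrr.
  by move/eqP; rewrite oppr_eq0 oner_eq0.
 move: (normq_lead rw); case/negP; apply/eqP/(mulfI t0)/(mulfI t0).
 by rewrite !mulr0 -[RHS]f2 s0; ring.
case/eqP: rw; rewrite /rho -/a; apply: (@normq_root _ _ _ _ _ _ _ _ (t / s)).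
 apply: (mulfI s0); apply: (mulfI s0); rewrite !mulr0 -[RHS]f2. field; exact: s0.
apply: (mulfI s0); apply: (mulfI s0); apply: (mulfI s0); rewrite !mulr0 -[RHS]f3; field; exact: s0.
Qed.

End Closures.

(** * Membership in the closure of a family *)

Section ClosureCriteria.
Variable K : numClosedFieldType.
Notation V := ('rV[K]_4).
Notation P4 := {mpoly K[4]}.

Definition in_closure (W : Type) (F : W -> V -> V) (f : 'I_4 -> P4) := forall d (P : {mpoly K[256]}), P \is d.-homog ->
 (forall w, P.@[qcF (F w)] = 0) -> P.@[qco f] = 0.

Lemma qcF_ext F G : F =1 G -> qcF F =1 qcF G :> ('I_256 -> K).
Proof. by move=> e k; rewrite /qcF (polar_ext e). Qed.

Lemma qcF_cub (f : 'I_4 -> P4) : (forall i, f i \is 3.-homog) -> qcF (cub (pol f)) =1 qco f.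
Proof. by move=> fh k; rewrite -(qcF_ev fh); apply: qcF_ext => x; rewrite ev_pol. Qed.

Lemma meval_qco n (P : {mpoly K[256]}) (f : 'I_4 -> P4) (F : n -> V -> V) w : (forall i, f i \is 3.-homog) ->
 (forall x, cub (pol f) x = F w x) -> P.@[qco f] = P.@[qcF (F w)].
Proof. by move=> fh e; apply: meval_eq => k; rewrite -(qcF_cub fh); apply: qcF_ext. Qed.

(** A form vanishing on the family vanishes along the curve f + e Q + e^2 R for all but finitely
    many e, hence also at e = 0. *)
Lemma in_closure_limit (W : Type) (F : W -> V -> V) (f : 'I_4 -> P4) (Q R : V -> V) (p : {poly K}) :
 (forall i, f i \is 3.-homog) -> p != 0 ->
 (forall e, p.[e] != 0 -> exists w, forall x, cub (pol f) x + e *: Q x + e ^+ 2 *: R x = F w x) -> in_closure F f.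
Proof.
move=> fh p0 he d P hP vP; pose G (e : K^o) x := cub (pol f) x + e *: Q x + e ^+ 2 *: R x.
have qD e k : qcF (G e) k = qcF (cub (pol f)) k + e * qcF Q k + e ^+ 2 * qcF R k.
 by rewrite /qcF /polar !mxE; ring.
have z : forall e : K^o, P.@[qcF (G e)] = 0.
 apply: (@pfun_dense _ _ _ (fun e : K^o => p.[e])).
 - apply: pfun_meval => k; apply: (pfunE (fun e => esym (qD e k))); apply: pfunD; first apply: pfunD.
  + exact: pfun_const.
  + by polynomial.
  + by polynomial.
 - by move=> u v; exists (p \Po (u%:P + v *: 'X)) => t; rewrite horner_comp !hornerE mulrC.
 - by have [t ht] := poly_nonroot p0; exists t.
 - by move=> e /he[w hw]; rewrite -(vP w); apply: meval_eq => k; apply: qcF_ext.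
by rewrite -(z 0); apply: meval_qco => // x; rewrite /G scale0r expr0n scale0r !addr0.
Qed.

Lemma in_closure_member (W : Type) (F : W -> V -> V) (f : 'I_4 -> P4) w :
 (forall i, f i \is 3.-homog) -> (forall x, cub (pol f) x = F w x) -> in_closure F f.
Proof. by move=> fh e d P _ vP; rewrite -(vP w); apply: meval_qco. Qed.

Lemma detF_scale (N1 N2 N3 : 'M[K]_4) c x : detF (c *: N1, N2, N3) x = c *: detF (N1, N2, N3) x.
Proof. by apply: dot_ext => z; rewrite /detF /= -scalemxAr dotZl !dot_cross det4Z1. Qed.

(** The minors of U + e W are e (c f + e R + e^2 C); dividing the first matrix by e c gives members
    that tend to f. *)
Lemma det_limit_closure (f : 'I_4 -> P4) : (forall i, f i \is 3.-homog) -> det_limit f -> in_closure (@detF K) f.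
Proof.
move=> fh [U1 [U2 [U3 [W1 [W2 [W3 [c [c0 hU hW]]]]]]]].
pose R x := cross (x *m W1) (x *m W2) (x *m U3) + cross (x *m W1) (x *m U2) (x *m W3) + cross (x *m U1) (x *m W2) (x *m W3).
pose C x := cross (x *m W1) (x *m W2) (x *m W3).
have key e x : detF (U1 + e *: W1, U2 + e *: W2, U3 + e *: W3) x = e *: (c *: cub (pol f) x + e *: R x + e ^+ 2 *: C x).
 rewrite -hW; transitivity (cross (x *m U1) (x *m U2) (x *m U3) + e *: (cross (x *m W1) (x *m U2) (x *m U3) +
  cross (x *m U1) (x *m W2) (x *m U3) + cross (x *m U1) (x *m U2) (x *m W3) + e *: R x + e ^+ 2 *: C x)); last by rewrite hU add0r.
 rewrite /detF /R /C /= !mulmxDr -!scalemxAr; apply: dot_ext => z.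
 rewrite !(dotDl, dotZl) !dot_cross !(det4D1, det4D2, det4D3, det4Z1, det4Z2, det4Z3); ring.
apply: (@in_closure_limit _ _ f (fun x => c^-1 *: R x) (fun x => c^-1 *: C x) 'X) => // [|e]; first by rewrite polyX_eq0.
rewrite hornerX => e0; exists ((e * c)^-1 *: (U1 + e *: W1), U2 + e *: W2, U3 + e *: W3) => x.
by rewrite detF_scale key; apply/rowP => i; rewrite !mxE; field; rewrite c0.
Qed.

Section Birational.
Variables (f g : 'I_4 -> P4) (h k : P4).
Hypothesis B : bir f g h k.

(** The minors are proportional to f, which has no common factor, so they are f times a polynomial;
    both have degree 3, and the polynomial is a constant. *)
Lemma det_form_closure : det_form f -> in_closure (@detF K) f.
Proof.
move=> [N1 [N2 [N3 [[x0 hx0] hN]]]]; have fh := bir_fh B.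
have [m mh em] := hvec_ev (hvec_detF (N1, N2, N3)).
have par x : par2 (detF (N1, N2, N3) x) (cub (pol f) x).
 by have [a b c] := hN x; apply: cross_par; rewrite dotC.
have [r hr] : exists r, forall i, m i = f i * r.
 apply: mpoly_cross_ratio; [exact: bir_fc B|exact: bir_f0 B|move=> i j].
 apply: pev_inj => x; rewrite /pev !mevalM -!/(pev _ _) mulrC [RHS]mulrC.
 have := par x j i; rewrite -em -ev_pol // !mxE => ->; by rewrite mulrC.
have [j fj] := bir_f0 B; have [c rc] : exists c, r = c%:MP.
 have [r0|r0] := eqVneq r 0; first by exists 0; rewrite r0 mpolyC0.
 have rh : r \is 0.-homog by apply: (homog_quot (bir_fh B j) fj); rewrite -hr mh.
 by exists r@_0; apply/mpolyP => n; rewrite mcoeffC; have [->|n0] := eqVneq 0%MM n;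
  rewrite ?mulr1 // mulr0; apply: (dhomog_nemf_coeff rh); rewrite mdeg_eq0 eq_sym.
have e x : detF (N1, N2, N3) x = c *: cub (pol f) x.
 by apply/rowP => i; rewrite -em -ev_pol // !mxE hr rc /pev mevalM mevalC mulrC.
have c0 : c != 0 by apply: contraNneq hx0 => z; apply/eqP; have := e x0; rewrite z scale0r.
apply: (@in_closure_member _ _ f (c^-1 *: N1, N2, N3)) => // x.
by rewrite detF_scale e scalerA mulVf // scale1r.
Qed.

Lemma twist_zero_closure : (forall u v, twist (pol g) u v = 0) -> in_closure (@detF K) f.
Proof.
move=> tz; apply: (det_limit_closure (bir_fh B)); apply: (jonq_det_limit B).
exact: (jonq_formP (bir_sym B)).
Qed.

(** Three cases: [rho] of f vanishes; or g maps every line to a plane curve, and f is a limit of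
    determinantal maps; or plane syzygies of g glue to a determinantal form of f. *)
Lemma bir_closures : (forall o v1 v2, rho (pol f) o v1 v2 = 0) \/ in_closure (@detF K) f.
Proof.
have [rz|rn] := classic (forall o v1 v2, rho (pol f) o v1 v2 = 0); [by left|right].
have [tz|tn] := classic (forall u v, twist (pol g) u v = 0); first exact: twist_zero_closure.
apply/det_form_closure/(nodal_det_form B); apply: NNPP => nn; [apply: rn => o v1 v2|apply: tn => u v];
 by apply/eqP/negPn/negP => z; apply: nn; do ?eexists; exact: z.
Qed.

Lemma ruled_closure : (forall o v1 v2, rho (pol f) o v1 v2 = 0) -> in_closure (@ruledF K) f.
Proof.
move=> rz; have [Q [p [p0 hp]]] := rho_zero_limit B rz.
apply: (in_closure_limit (Q := Q) (R := fun _ => 0) (bir_fh B) p0) => e /hp.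
move=> [h0 [h1 [h2 [h3 [l0 [l1 [l2 [l3 [L [L' [r0 [r1 [r2 e1]]]]]]]]]]]]].
have [w hw] := ruled_par_ex h0 h1 h2 h3 l0 l1 l2 l3 L L' r0 r1 r2.
by exists w => x; rewrite e1 scaler0 addr0 /ruledF hw.
Qed.

End Birational.

Definition line_ruled (f : 'I_4 -> P4) := forall a p, p != 0 -> dot a (cub (pol f) p) = 0 ->
 exists q, indep2 p q /\ forall s t, dot a (cub (pol f) (s *: p + t *: q)) = 0.

Lemma sfam_polar h0 h1 h2 h3 l0 l1 l2 l3 L L' r0 r1 r2 (p q x : V) :
 dot l0 p = 0 -> dot l1 p = 0 -> dot l0 q = 0 -> dot l1 q = 0 ->
 polar (sfam h0 h1 h2 h3 l0 l1 l2 l3 L L' r0 r1 r2) p q x = 0.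
Proof.
move=> e0 e1 e2 e3; rewrite /polar /sfam !(dotDr, e0, e1, e2, e3) !(add0r, addr0).
by vring.
Qed.

(** The line l0 = l1 = 0 of a general member is double, because the polar form vanishes as soon as
    two arguments lie on it; [double_line_ruled] then applies. *)
Lemma ruled_family_line : exists c : ruled_par K -> K, [/\ pfun c, exists w, c w != 0 &
 forall w, c w != 0 -> exists f g h k, [/\ bir f g h k, line_ruled f & forall x, ev f x = ruledF w x]].
Proof.
have [c [pc [w0 cw0] hc]] := ruled_family K; pose D := at_row (fun _ _ _ _ l0 l1 l2 l3 _ _ _ _ _ => det4 l0 l1 l2 l3 : K).
have pD : pfun D by apply: pfun_det4; apply: pvec_row.
have [w1 hw1] := ruled_par_ex 0 0 0 0 (evec K q0) (evec K q1) (evec K q2) (evec K q3) 0 0 0 0 0.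
have D1 : D w1 != 0 by rewrite /D hw1 det4E /minor2 !evecE /= !(mulr0, mulr1, subr0, addr0) oner_neq0.
have [w [a1 a2]] := pfun_nonzero2 pc pD cw0 D1.
exists (fun w => c w * D w); split; [exact: pfunM|by exists w; apply: mulf_neq0|].
move=> {w a1 a2} w; rewrite mulf_eq0 negb_or => /andP[/hc[f [g [h [k [B e]]]]] Dw].
exists f, g, h, k; split=> // a p p0 ap.
pose l i := row (inord i) w; have Dl : det4 (l 4) (l 5) (l 6) (l 7) != 0 by [].
have [z0 z1 z2 z3] := dual_cov0 (l 4) (l 5) (l 6) (l 7); have [k0 k1 k2 k3] := dual_cov (l 4) (l 5) (l 6) (l 7).
set p1 := cov2 (l 4) (l 5) (l 7) in z0 z1 z2 z3 k2; set p2 := cov3 (l 4) (l 5) (l 6) in z0 z1 z2 z3 k3.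
have i12 : indep2 p1 p2.
 move=> s t st; have e6 := congr1 (dot (l 6)) st; have e7 := congr1 (dot (l 7)) st; move: e6 e7.
 rewrite !(dotDr, dotZr) k2 k3 !z2 !z3 !dot0r !(mulr0, addr0, add0r) => /eqP; rewrite mulf_eq0 (negPf Dl) orbF => /eqP ->.
 by move=> /eqP; rewrite mulf_eq0 (negPf Dl) orbF => /eqP.
have n6 : 6 != 0 :> K by rewrite pnatr_eq0.
have pz p' q' x : dot (l 4) p' = 0 -> dot (l 5) p' = 0 -> dot (l 4) q' = 0 -> dot (l 5) q' = 0 -> pol f p' q' x = 0.
 move=> b1 b2 b3 b4; apply: (scalerI n6); rewrite scaler0 -polar_cub (@polar_ext _ _ (ruledF w)) => [|y]; last by rewrite -e (ev_pol _ (bir_fh B)).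
 exact: sfam_polar.
by apply: (double_line_ruled _ _ _ i12 p0 ap) => x; apply: pz; rewrite ?z0 ?z1.
Qed.

End ClosureCriteria.

(** * Separation of the two components, and minors of linear matrices *)

Section Examples.
Variable K : numClosedFieldType.
Notation V := ('rV[K]_4).
Notation P4 := {mpoly K[4]}.

(** Of the 16 products x_i psi_j, those of (q1, q0) and (q3, q2) are left out: in the monomial
    example they coincide with those of (q0, q1) and (q2, q3). *)
Definition syz_pairs : seq ('I_4 * 'I_4) :=
 [:: (q0, q0); (q2, q0); (q3, q0); (q0, q1); (q1, q1); (q2, q1); (q3, q1); (q0, q2); (q1, q2); (q2, q2);
   (q0, q3); (q1, q3); (q2, q3); (q3, q3)].

Definition syz_pair (m : 'I_14) := nth (q0, q0) syz_pairs m.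

Definition syz_mx (T : symtri K) (x : nat -> V) : 'M[K]_14 :=
 \matrix_(m, k) (x k 0 (syz_pair m).1 * cub T (x k) 0 (syz_pair m).2).

Lemma gfun_syz x : gfun (@qco K) 14 (fun f => \det (syz_mx (pol f) x)).
Proof.
apply: gfun_det => m k.
apply: (@gfun_ext _ _ _ _ _ (fun f => x k 0 (syz_pair m).1 * cub (pol f) (x k) 0 (syz_pair m).2)) => [f|]; first by rewrite mxE.
apply: gfunZ.
have hc a : gvec (@qco K) 0 (fun _ => a).
 by move=> j; exists (a 0 j *: 1) => [|y]; rewrite ?rpredZ ?dhomog1 // mevalZ meval1 mulr1.
exact: (gvec_pol (d1 := 0) (d2 := 0) (d3 := 0)).
Qed.

(** Two linear conditions on three syzygies leave a combination with zero entries at the two omitted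
    pairs; its other entries form a relation between the rows. *)
Lemma syz_det_zero (T : symtri K) (N1 N2 N3 : 'M[K]_4) x :
 (forall y, cub T y = cross (y *m N1) (y *m N2) (y *m N3)) -> \det (syz_mx T x) = 0.
Proof.
move=> hT; have [|s [t [r [nz [e1 e2 _]]]]] := @det3_dep K (N1 q1 q0) (N1 q3 q2) 0 (N2 q1 q0) (N2 q3 q2) 0 (N3 q1 q0) (N3 q3 q2) 0.
 by rewrite /det3; ring.
name M EM := (s *: N1 + t *: N2 + r *: N3).
have M10 : M q1 q0 = 0 by rewrite EM !mxE.
have M32 : M q3 q2 = 0 by rewrite EM !mxE.
have xM y : dot (y *m M) (cub T y) = 0.
 rewrite EM !mulmxDr -!scalemxAr hT [dot _ (cross _ _ _)]dotC !dotDr !dotZr !dot_cross det4_14 det4_24 det4_34; ring.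
have [M0|M0] := eqVneq M 0.
 rewrite (_ : syz_mx T x = 0) ?det0 //; apply/matrixP => m k; rewrite [LHS]mxE hT.
 rewrite (dependent_cross nz) ?mxE ?mulr0 // !scalemxAr -!mulmxDr -EM M0 mulmx0 //.
apply/eqP/det0P; exists (\row_m M (syz_pair m).1 (syz_pair m).2).
 apply: contraNneq M0 => z; apply/eqP/matrixP => i j; rewrite [RHS]mxE.
 have zp p : p \in syz_pairs -> M p.1 p.2 = 0.
  move=> hp; have lt : (index p syz_pairs < 14)%N by rewrite (index_mem p syz_pairs).
  by have /rowP/(_ (Ordinal lt)) := z; rewrite !mxE /syz_pair /= nth_index.
 have : (i, j) \in [:: (q1, q0), (q3, q2) & syz_pairs] by move: i j; do 2 apply: ord4P.
 by rewrite 2!in_cons => /or3P[/eqP[-> ->]|/eqP[-> ->]|/zp].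
apply/rowP => k; rewrite !mxE -[RHS](xM (x k)) dotE !mxE !sum4 !big_ord_recl big_ord0 !mxE /syz_pair /= M10 M32.
ring.
Qed.

(** At the points (1, t, t^5, t^25) with t = 2^k the 14 products are powers of t, and 5 and 25 are
    spaced so that the exponents are distinct: the matrix is a transposed Vandermonde matrix. *)
Lemma syz_det_neq0 (T : symtri K) :
 (forall x0 x1 x2 x3, cub T (vec4 x0 x1 x2 x3) = vec4 (x0 ^+ 3) (x0 ^+ 2 * x1) (x1 ^+ 2 * x2) (x1 ^+ 2 * x3)) ->
 exists x, \det (syz_mx T x) != 0.
Proof.
move=> hT; pose t k : K := 2 ^+ k.
exists (fun k => vec4 1 (t k) (t k ^+ 5) (t k ^+ 25)).
pose w (i : 'I_4) := nth 0%N [:: 0; 1; 5; 25]%N i; pose v (i : 'I_4) := nth 0%N [:: 0; 1; 7; 27]%N i.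
pose e m := (w (syz_pair m).1 + v (syz_pair m).2)%N.
have eE : syz_mx T (fun k => vec4 1 (t k) (t k ^+ 5) (t k ^+ 25)) = (Vandermonde 14 (\row_m 2 ^+ e m))^T.
 apply/matrixP => m k; rewrite [LHS]mxE hT.
 have tv i : vec4 1 (t k) (t k ^+ 5) (t k ^+ 25) 0 i = t k ^+ w i.
  by move: i; have [a b c d] := vec4E 1 (t k) (t k ^+ 5) (t k ^+ 25); apply: ord4P; rewrite ?a ?b ?c ?d.
 have tw i : vec4 (1 ^+ 3) (1 ^+ 2 * t k) (t k ^+ 2 * t k ^+ 5) (t k ^+ 2 * t k ^+ 25) 0 i = t k ^+ v i.
  move: i; have [a b c d] := vec4E (1 ^+ 3) (1 ^+ 2 * t k) (t k ^+ 2 * t k ^+ 5) (t k ^+ 2 * t k ^+ 25).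
  by apply: ord4P; rewrite ?a ?b ?c ?d -?exprD ?expr1n ?mul1r.
 by rewrite tv tw -exprD 2![RHS]mxE [X in X ^+ k]mxE /t -!exprM mulnC.
rewrite eE matrix.det_tr det_Vandermonde; apply/prodf_neq0 => i _; apply/prodf_neq0 => j ij.
rewrite !mxE subr_eq0 -!natrX eqr_nat eqn_exp2l //.
have ue : uniq [seq (w p.1 + v p.2)%N | p <- syz_pairs] by [].
have ne (l : 'I_14) : e l = nth 0%N [seq (w p.1 + v p.2)%N | p <- syz_pairs] l by rewrite (nth_map (q0, q0)).
by rewrite !ne nth_uniq //; apply: contraTneq ij => ->; rewrite ltnn.
Qed.

(** The monomial map shows that the minor is not identically zero on the ruled family; a general
    member is then birational and line-ruled with nonzero minor, while the minor vanishes on all of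
    [detF]. *)
Lemma ruled_not_det_closure : exists (f g : 'I_4 -> P4) h k,
 [/\ bir f g h k, line_ruled f & ~ in_closure (@detF K) f].
Proof.
have [w0 [Fw _]] := ruled_example K; have [f0 fh0 e0] := hvec_ev (hvec_sfam _ _ _ _ _ _ _ _ _ _ _ _ _ : hvec 3 (ruledF w0)).
have fc : forall x, cub (pol f0) x = ruledF w0 x by move=> x; rewrite -ev_pol.
have [x hx] : exists x, \det (syz_mx (pol f0) x) != 0 by apply: syz_det_neq0 => *; rewrite fc Fw.
have [P hP eP] := gfun_syz x; have [c [pc [w1 c1] hc]] := ruled_family_line K.
have pP : pfun (fun w : ruled_par K => P.@[qcF (ruledF w)]).
 by apply: pfun_meval => k; apply: (pfun_qcF (F := @ruledF K)) => y; apply: pvec_ruledF; apply: pvec_const.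
have n0 : P.@[qcF (ruledF w0)] != 0 by rewrite -(meval_qco _ fh0 fc) -eP.
have [w [cw Pw]] := pfun_nonzero2 pc pP c1 n0; have [f [g [h [k [B lr e]]]]] := hc w cw.
exists f, g, h, k; split=> // cl; case/eqP: Pw.
have fw y : cub (pol f) y = ruledF w y by rewrite -e (ev_pol _ (bir_fh B)).
rewrite -(meval_qco _ (bir_fh B) fw); apply: cl hP _ => u.
have [m mh em] := hvec_ev (hvec_detF u).
have mw y : cub (pol m) y = detF u y by rewrite -em ev_pol.
by rewrite -(meval_qco _ mh mw) -eP; apply: (@syz_det_zero _ u.1.1 u.1.2 u.2).
Qed.

Lemma normq_mid p0 p2 r1 : normq p0 0 p2 0 r1 0 0 = p0 * (p2 ^+ 2 * r1) ^+ 2 :> K.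
Proof. rewrite /normq; ring. Qed.

(** The point (1, 1, 1, 1) is fixed, and the two directions are chosen so that only p0 = -2/27, p2 =
    -4/27 and r1 = -2/3 survive among the arguments of [normq]. *)
Lemma cremona_rho (T : symtri K) : (forall x0 x1 x2 x3, cub T (vec4 x0 x1 x2 x3) =
  vec4 (x1 * x2 * x3) (x0 * x2 * x3) (x0 * x1 * x3) (x0 * x1 * x2)) ->
 rho T (vec4 1 1 1 1) (vec4 1 0 0 (-1)) (vec4 0 1 2 0) != 0.
Proof.
move=> hT; have n6 : 6 != 0 :> K by rewrite pnatr_eq0.
(* The permanent of order 3 is the full polarization of a product of three coordinates. *)
pose per x y z x' y' z' x2 y2 z2 : K := x * (y' * z2 + z' * y2) + y * (x' * z2 + z' * x2) + z * (x' * y2 + y' * x2).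
have tT a b c d a' b' c' d' a2 b2 c2 d2 : T (vec4 a b c d) (vec4 a' b' c' d') (vec4 a2 b2 c2 d2) =
  6^-1 *: vec4 (per b c d b' c' d' b2 c2 d2) (per a c d a' c' d' a2 c2 d2) (per a b d a' b' d' a2 b2 d2)
   (per a b c a' b' c' a2 b2 c2).
 apply: (scalerI n6); rewrite -polar_cub /polar !vec4D !hT scalerA mulfV // scale1r.
 by rewrite !(vec4D, vec4N) /per; congr vec4; ring.
have o0 : T (vec4 1 1 1 1) (vec4 1 1 1 1) (vec4 1 1 1 1) = vec4 1 1 1 1 by rewrite tT vec4Z /per; congr vec4; field.
have o1 : T (vec4 1 1 1 1) (vec4 1 1 1 1) (vec4 1 0 0 (-1)) = 3^-1 *: vec4 (-1) 0 0 1.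
 by rewrite tT !vec4Z /per; congr vec4; field.
have o2 : T (vec4 1 1 1 1) (vec4 1 1 1 1) (vec4 0 1 2 0) = 3^-1 *: vec4 3 2 1 3.
 by rewrite tT !vec4Z /per; congr vec4; field.
rewrite /rho /cub o0 o1 o2 !tT.
have -> : cross (vec4 1 1 1 1) (3^-1 *: vec4 (-1) 0 0 1) (3^-1 *: vec4 3 2 1 3) = 9^-1 *: vec4 (-1) 4 (- 2) (-1) :> V.
 by rewrite !vec4Z cross_vec4 /det3; congr vec4; field.
rewrite !(dotZl, dotZr, dot_vec4) /per.
set p0 := _ * (_ * _); set p1 := 2 * _; set p2 := _ * (_ * _); set r0 := _ * (_ * _); set r1 := 3 * _; set r2 := 3 * _; set r3 := _ * (_ * _).
have -> : p0 = - (2 / 27) by rewrite /p0; field.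
have -> : p1 = 0 by rewrite /p1; field.
have -> : p2 = - (4 / 27) by rewrite /p2; field.
have -> : r0 = 0 by rewrite /r0; field.
have -> : r1 = - (2 / 3) by rewrite /r1; field.
have -> : r2 = 0 by rewrite /r2; field.
have -> : r3 = 0 by rewrite /r3; field.
by rewrite normq_mid !(mulf_neq0, expf_neq0, oppr_eq0, invr_eq0, pnatr_eq0).
Qed.

Lemma det_not_ruled : exists (f g : 'I_4 -> P4) h k w, [/\ bir f g h k, forall x, ev f x = detF w x &
 exists o v1 v2, rho (pol f) o v1 v2 != 0].
Proof.
have [f0 fh0 e0] := hvec_ev (hvec_detF (cremona_par K)).
have fc x : cub (pol f0) x = detF (cremona_par K) x by rewrite -ev_pol.
have [P hP eP] := gfun_rho (vec4 1 1 1 1) (vec4 1 0 0 (-1)) (vec4 0 1 2 0 : V).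
have [c [pc [w1 c1] hc]] := det_family K.
have pP : pfun (fun w : det_par K => P.@[qcF (detF w)]).
 by apply: pfun_meval => k; apply: (pfun_qcF (F := @detF K)) => y; have [] := pvec_detF (@pvec_const K _ 4 y).
have n0 : P.@[qcF (detF (cremona_par K))] != 0.
 rewrite -(meval_qco _ fh0 fc) -eP; apply: cremona_rho => x0 x1 x2 x3; rewrite fc /detF /= !mulmxBr !mul_delta.
 have [a0 a1 a2 a3] := vec4E x0 x1 x2 x3; rewrite a0 a1 a2 a3.
 rewrite (_ : _ - _ = vec4 x0 (- x1) 0 0); last by rewrite /vec4 !scale0r !addr0 scaleNr.
 rewrite (_ : _ - _ *: evec K q2 = vec4 x0 0 (- x2) 0); last by rewrite /vec4 !scale0r !addr0 scaleNr.
 rewrite (_ : _ - _ *: evec K q3 = vec4 x0 0 0 (- x3)); last by rewrite /vec4 !scale0r !addr0 scaleNr.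
 rewrite cross_vec4 /det3; congr vec4; ring.
have [w [cw Pw]] := pfun_nonzero2 pc pP c1 n0; have [f [g [h [k [B e]]]]] := hc w cw.
exists f, g, h, k, w; split=> //; exists (vec4 1 1 1 1), (vec4 1 0 0 (-1)), (vec4 0 1 2 0).
by rewrite eP (@meval_qco K _ P f (@detF K) w (bir_fh B)) // => y; rewrite -e (ev_pol _ (bir_fh B)).
Qed.

Lemma pev_det n (A : 'M[P4]_n) x : pev (\det A) x = \det (\matrix_(i, j) pev (A i j) x).
Proof. by rewrite /pev -det_map_mx; congr (\det _); apply/matrixP => i j; rewrite !mxE. Qed.

Lemma det_mx33 (a : nat -> nat -> K) : \det (\matrix_(i < 3, j < 3) a i j) =
 det3 (a 0 0) (a 0 1) (a 0 2) (a 1 0) (a 1 1) (a 1 2) (a 2 0) (a 2 1) (a 2 2).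
Proof.
by rewrite (expand_det_row _ 0) !big_ord_recl big_ord0 /cofactor !(expand_det_row _ 0) !big_ord_recl !big_ord0 /cofactor
 !det_mx11 !mxE /bump /= /det3; ring.
Qed.

Definition mcol (M : 'M[P4]_(4, 3)) x j : V :=
 vec4 (pev (M q0 j) x) (- pev (M q1 j) x) (pev (M q2 j) x) (- pev (M q3 j) x).

(* The alternating signs of the cofactors are absorbed into the rows of M. *)
Lemma minors_cross (M : 'M[P4]_(4, 3)) x i :
 pev (\det (row' i M)) x = - cross (mcol M x (inord 0)) (mcol M x (inord 1)) (mcol M x (inord 2)) 0 i.
Proof.
pose p m j := pev (M (inord m) (inord j)) x.
have e : pev (\det (row' i M)) x = \det (\matrix_(k < 3, j < 3) p (bump i k) j).
 by rewrite pev_det; congr (\det _); apply/matrixP => k j; rewrite !mxE /p inord_val -[bump i k]/(nat_of_ord (lift i k)) inord_val.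
have ep (q : 'I_4) j : pev (M q (inord j)) x = p q j by rewrite /p inord_val.
have v4 a b c d (l : 'I_4) : vec4 a b c d 0 l = nth a [:: a; b; c; d] l.
 by have [a0 a1 a2 a3] := vec4E a b c d; move: l; apply: ord4P.
rewrite e (det_mx33 (fun k j => p (bump i k) j)) /mcol !ep cross_vec4 v4 {e}.
by move: i; apply: ord4P; rewrite /det3 /bump /=; ring.
Qed.

Lemma minors_family (M : 'M[P4]_(4, 3)) : (forall i j, M i j \is 1.-homog) ->
 exists w : det_par K, forall x i, pev (\det (row' i M)) x = detF w x 0 i.
Proof.
move=> hM; have hN j : exists N : 'M[K]_4, forall x, mcol M x j = x *m N.
 have [[a0 e0] [a1 e1] [a2 e2] [a3 e3]] : [/\ exists a, M q0 j = lin a, exists a, M q1 j = lin a, exists a, M q2 j = lin a & exists a, M q3 j = lin a].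
  by split; apply: homog1_lin.
 by apply: linear_matrix => [u v|r u]; rewrite /mcol e0 e1 e2 e3 !pev_lin !(dotDr, dotZr) ?vec4D ?vec4Z; congr vec4; ring.
have [[N0 h0] [N1 h1] [N2 h2]] : [/\ exists N : 'M[K]_4, forall x, mcol M x (inord 0) = x *m N,
  exists N : 'M[K]_4, forall x, mcol M x (inord 1) = x *m N & exists N : 'M[K]_4, forall x, mcol M x (inord 2) = x *m N] by [].
exists (- N0, N1, N2) => x i; rewrite minors_cross h0 h1 h2 -[- N0]scaleN1r detF_scale mxE mulN1r //.
Qed.

Lemma family_minors (w : det_par K) : exists M : 'M[P4]_(4, 3), (forall i j, M i j \is 1.-homog) /\
 forall x i, pev (\det (row' i M)) x = - detF w x 0 i.
Proof.
pose N j := nth w.1.1 [:: w.1.1; w.1.2; w.2] j.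
exists (\matrix_(i, j) lin ((-1) ^+ i *: row i (N j)^T)); split=> [i j|x i]; first by rewrite mxE lin_homog.
rewrite minors_cross; have e j : (j < 3)%N -> mcol (\matrix_(i, j) lin ((-1) ^+ i *: row i (N j)^T)) x (inord j) = x *m N j.
 move=> j3; have p (l : 'I_4) : pev (lin ((-1) ^+ l *: row l (N j)^T)) x = (-1) ^+ l * (x *m N j) 0 l.
  by rewrite pev_lin dotZl dotE !mxE sum4; ring.
 by rewrite /mcol !mxE inordK // !p -[RHS]vec4_eta /=; congr vec4; ring.
by rewrite !e.
Qed.

End Examples.

(** The same field as [CC], with the structure over which the preceding sections are stated. *)
Definition KC : numClosedFieldType := (Rdefinitions.R)[i].

(** * Translation to [Bir33] and its Zariski topology *)

Section Components.
Notation K := KC.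
Notation V := ('rV[K]_4).

Definition row4 (p : pt4) : V := \row_i p i.

Lemma zclosureP S psi : zclosure S psi <->
 forall d (P : {mpoly K[256]}), P \is d.-homog -> (forall f, S f -> P.@[qco f] = 0) -> P.@[@qco K psi] = 0.
Proof.
split=> [cl d P hP vP | h Z [F [hF eZ]] sZ].
 apply: (cl (fun f => P.@[@qco K f] = 0)) => //; exists (eq P); split=> [Q <-|f]; first by exists d.
 by split=> [e Q <-|]; [exact: e|apply].
by apply/eZ => P FP; have [d hP] := hF P FP; apply: h hP _ => f /sZ/eZ; apply.
Qed.

Lemma zclosure_closed S : zclosed (zclosure S).
Proof.
exists (fun P => (exists d, P \is d.-homog) /\ forall f, S f -> P.@[@qco K f] = 0); split=> [P []//|psi].
split=> [/zclosureP h P [[d hP]]|h]; first exact: h hP.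
by apply/zclosureP => d P hP vP; apply: h; split=> //; exists d.
Qed.

(** If an equation of each closed set is nonzero somewhere on the family, a general member in [S]
    satisfies neither equation. Otherwise one closed set contains the family, hence its closure. *)
Lemma family_irreducible (W : lmodType K) (F : W -> V -> V) (c : W -> K) (S : quad -> Prop) :
 (forall x, pvec (fun w => F w x)) -> pfun c -> (exists w, c w != 0) ->
 (forall w, c w != 0 -> exists f : quad, [/\ S f, forall i, f i \is 3.-homog & forall x, cub (pol f : symtri K) x = F w x]) ->
 (forall f, S f -> in_closure F f) -> zirreducible S.
Proof.
move=> pF pc [w0 cw0] hS cl; split; first by have [f [Sf _ _]] := hS w0 cw0; exists f.
move=> Z1 Z2 [F1 [h1 e1]] [F2 [h2 e2]] S12.
have pP (P : {mpoly K[256]}) : pfun (fun w => P.@[qcF (F w)]).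
 by apply: pfun_meval => k; apply: pfun_qcF.
have [v1|u1] := classic (forall P, F1 P -> forall w, P.@[qcF (F w)] = 0).
 by left=> f Sf; apply/e1 => P FP; have [d hP] := h1 P FP; apply: (cl f Sf d P hP) => w; apply: v1.
have [v2|u2] := classic (forall P, F2 P -> forall w, P.@[qcF (F w)] = 0).
 by right=> f Sf; apply/e2 => P FP; have [d hP] := h2 P FP; apply: (cl f Sf d P hP) => w; apply: v2.
have [P1 u1'] := not_all_ex_not _ _ u1; have [P2 u2'] := not_all_ex_not _ _ u2.
have [FP1 n1] := imply_to_and _ _ u1'; have [FP2 n2] := imply_to_and _ _ u2'.
have [w1 /eqP m1] := not_all_ex_not _ _ n1; have [w2 /eqP m2] := not_all_ex_not _ _ n2.
have [w3 [a1 a2]] := pfun_nonzero2 (pP P1) (pP P2) m1 m2.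
have [w [b1 b2]] := pfun_nonzero2 (pfunM (pP P1) (pP P2)) pc (mulf_neq0 a1 a2) cw0.
have [f [Sf fh ef]] := hS w b2; case/eqP: b1.
by have [/e1/(_ _ FP1)|/e2/(_ _ FP2)] := S12 f Sf; rewrite -!(meval_qco _ fh ef) => ->; rewrite ?mul0r ?mulr0.
Qed.

Lemma no_common_factorP (f : quad) : (exists i, f i != 0) -> no_common_factor f <-> coprime_family (f : 'I_4 -> {mpoly K[4]}).
Proof.
move=> [i fi]; split=> [h p [p0 pu _] hp|h g hg].
 by have [c ec] := h p hp; case/negP: pu; rewrite ec mpolyC_unit //; apply: contraNneq p0 => z; rewrite ec z mpolyC0.
have g0 : g != 0 by apply: contraNneq fi => z; have [q ->] := hg i; rewrite z mul0r.
have [gu|gu] := boolP ((g : {mpoly K[4]}) \is a GRing.unit); first by have [c _ ->] := mpoly_unitE gu; exists c.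
have [p pp [b eb]] := exists_prime_divisor (@factorial_mpoly K 4) g0 gu.
by case: (h p pp) => j; have [q ->] := hg j; exists (b * q); rewrite mulrA -eb.
Qed.

Lemma comp_is_idP (f g : quad) : comp_is_id f g <-> exists2 h : {mpoly K[4]}, h != 0 & forall x : V, ev f (ev g x) = pev h x *: x.
Proof.
have e i (x : V) : pev (qcomp f g i : {mpoly K[4]}) x = ev f (ev g x) 0 i.
 rewrite /pev comp_mpoly_meval mxE; apply: meval_eq => j.
 by rewrite tnth_map tnth_ord_tuple mxE.
split=> [[h [h0 eh]]|[h h0 eh]]; exists h => //.
 by move=> x; apply/rowP => i; rewrite -e eh /pev mevalM mevalXU mxE.
by split=> // i; apply: (@pev_inj K) => x; rewrite e eh /pev mevalM mevalXU mxE.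
Qed.

Lemma inverse33P psi phi : degree3 psi /\ inverse33 psi phi <-> exists h k, @bir K psi phi h k.
Proof.
split=> [[[fh [f0 fc]] [[gh [g0 gc]] [/comp_is_idP[h h0 eh] /comp_is_idP[k k0 ek]]]]|[h [k B]]].
 by exists h, k; split=> //; apply/no_common_factorP.
have f0 := bir_f0 B; have g0 := bir_g0 B.
do !split=> //; try exact: bir_fh B; try exact: bir_gh B.
- by apply/no_common_factorP => //; apply: bir_fc B.
- by apply/no_common_factorP => //; apply: bir_gc B.
- by apply/comp_is_idP; exists h; [apply: bir_h0 B|apply: bir_gf B].
- by apply/comp_is_idP; exists k; [apply: bir_k0 B|apply: bir_fg B].
Qed.

Lemma Bir33P psi : Bir33 psi <-> exists phi h k, @bir K psi phi h k.
Proof.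
split=> [[d [phi i]]|[phi /inverse33P[d i]]]; last by split=> //; exists phi.
by exists phi; apply/inverse33P.
Qed.

Lemma dot_sum (n : nat) (g : 'I_4 -> {mpoly K[n]}) (l : pt4) y (v : V) : (forall i, (g i).@[y] = v 0 i) ->
 (\sum_(i < 4) l i *: g i).@[y] = dot (row4 l) v.
Proof.
move=> e; have -> : dot (row4 l) v = \sum_(i < 4) l i * v 0 i by rewrite dotE sum4 !(mxE _ _ 0).
by rewrite raddf_sum; apply: eq_bigr => i _; rewrite /= mevalZ e.
Qed.

Lemma pullback_eval (psi : quad) (a : pt4) (x : pt4) : (plane_pullback psi a).@[x] = dot (row4 a) (ev psi (row4 x)).
Proof. by apply: (@dot_sum 4) => i; rewrite mxE; apply: meval_eq => j; rewrite mxE. Qed.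

Lemma row4K (x : V) : row4 (fun i => x 0 i) = x. Proof. by apply/rowP => i; rewrite mxE. Qed.

Lemma lin_indep2P (p q : pt4) : lin_indep2 p q <-> indep2 (row4 p) (row4 q).
Proof.
split=> h s t e; apply: h; last by apply/rowP => i; rewrite !mxE.
by move=> i; have /rowP/(_ i) := e; rewrite !mxE.
Qed.

Lemma row4_line s t (p q : pt4) : row4 (fun i => s * p i + t * q i) = s *: row4 p + t *: row4 q.
Proof. by apply/rowP => i; rewrite !mxE. Qed.

(** Equations for ruledness: they make [ruled33] closed inside [Bir33]. In the converse direction
    the double line rules every a.psi, and the open condition is that the first coordinate of a be
    nonzero, which keeps a.psi nonzero. *)
Lemma ruled33P psi : ruled33 psi <-> Bir33 psi /\ forall o v1 v2, rho (@pol K psi) o v1 v2 = 0.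
Proof.
split=> [[Bp [G [G0 hG]]]|[Bp rz]]; (split; first by []); have [phi [h [k B]]] := (Bir33P psi).1 Bp;
 have ce x : cub (@pol K psi) x = ev psi x by rewrite (ev_pol _ (bir_fh B)).
 apply: (rho_zero_of_ruled B G0) => a Ga p p0; rewrite ce => ap.
 have [_ [_ R]] := hG (fun i => a 0 i) Ga.
 have [||q [iq hq]] := R (fun i => p 0 i).
 - by apply: NNPP => n; case/eqP: p0; apply/rowP => i; rewrite [RHS]mxE; apply: NNPP => /eqP pi; apply: n; exists i.
 - by rewrite pullback_eval !row4K.
 exists (row4 q); split=> [|s t]; first by rewrite -[p]row4K; apply/lin_indep2P.
 by have := hq s t; rewrite pullback_eval row4_line !row4K ce.
exists 'X_q0; split=> [|a]; first by apply/eqP => /(congr1 (meval (fun _ => 1))); rewrite mevalXU meval0 => /eqP; rewrite oner_eq0.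
rewrite mevalXU => a0; have hom : plane_pullback psi a \is 3.-homog.
 by apply: rpred_sum => i _; apply: rpredZ; apply: bir_fh B i.
split=> //; split=> [|p [i pi] ap].
 apply: contraNneq a0 => z; have : row4 a = 0.
  apply: (image_nondegenerate B) => x; rewrite ce -[x]row4K -pullback_eval z meval0 //.
 by move/rowP/(_ q0); rewrite !mxE => ->.
have [||q [iq hq]] := @rho_zero_ruled _ _ _ _ _ B rz (row4 a) (row4 p).
- by apply: contraNneq pi => /rowP/(_ i); rewrite !mxE => ->.
- by rewrite ce -pullback_eval.
exists (fun i => q 0 i); split=> [|s t]; first by apply/lin_indep2P; rewrite row4K.
by rewrite pullback_eval row4_line row4K -ce.
Qed.

Lemma line_ruled_rho (f g : quad) h k : @bir K f g h k -> line_ruled (f : 'I_4 -> {mpoly K[4]}) -> ruled33 f.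
Proof.
move=> B lr; apply/ruled33P; split; first by apply/Bir33P; exists g, h, k.
by apply: (rho_zero_of_ruled B (oner_neq0 _)) => a _; apply: lr.
Qed.

Lemma det_member (f g : quad) h k w : @bir K f g h k -> (forall x, ev f x = detF w x) -> det33 f.
Proof.
move=> B e; split; first by apply/Bir33P; exists g, h, k.
have [M [hM eM]] := family_minors w; exists M, (-1); split; first exact: hM.
split=> [|i]; first by rewrite oppr_eq0 oner_eq0.
apply: (@pev_inj K) => x; have /rowP/(_ i) := e x.
by rewrite scaleN1r {2}/pev mevalN -/(pev _ x) eM opprK mxE.
Qed.

(** Minors of linear matrices are members of [detF] once signs and the scalar are absorbed;
    conversely, birational members are dense in that family. *)
Lemma det33_closure (psi : quad) : zclosure det33 psi <-> in_closure (@detF K) psi.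
Proof.
split=> [/zclosureP h d P hP vP|h].
 apply: h hP _ => f [/Bir33P[g [h [k B]]] [M [c [hM [c0 eM]]]]]; have [w hw] := minors_family hM.
 have := vP (c *: w.1.1, w.1.2, w.2); rewrite -(@meval_qco K _ P f (@detF K) _ (bir_fh B)) // => x.
 rewrite detF_scale; case: w hw => [[w1 w2] w3] hw; rewrite -(ev_pol _ (bir_fh B)); apply/rowP => i.
 by rewrite !mxE eM /pev mevalZ -/(pev _ x) hw.
apply/zclosureP => d P hP vP; apply: h hP _; have [c [pc c0 hc]] := det_family K.
apply: (pfun_dense _ pc c0) => [|w /hc[f [g [h [k [B e]]]]]].
 by apply: pfun_meval => k; apply: (pfun_qcF (F := @detF K)) => y; have [] := pvec_detF (@pvec_const K _ 4 y).
rewrite -(@meval_qco K _ P f (@detF K) w (bir_fh B)) => [|x]; first by apply: vP; apply: det_member B e.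
by rewrite -(ev_pol _ (bir_fh B)).
Qed.

(** A general line has a plane image under phi, so [twist] of phi vanishes on a dense set of pairs,
    hence identically. *)
Lemma deJonquieres_closure psi : deJonquieres33 psi -> zclosure det33 psi.
Proof.
move=> [[d3 _] [phi [inv [p [_ [G [G0 hG]]]]]]]; have [h [k B]] := (inverse33P psi phi).1 (conj d3 inv).
apply/det33_closure/(twist_zero_closure B) => u v.
have pJ : pfun (fun w : V * V => G.@[join8 (fun i => w.1 0 i) (fun i => w.2 0 i)]).
 apply: pfun_meval => j; rewrite /join8; have [j4|j4] := boolP (j < 4)%N; rewrite ?j4 ?(negPf j4).
  by polynomial.
 by polynomial.
have [|y hy] := @meval_neq0 K _ G; first exact: G0.
apply: (@pfun_dense _ (V * V)%type (fun w => twist (@pol K phi) w.1 w.2) _ _ pJ _ _ (u, v)).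
- apply: pfun_twist; first by polynomial.
 by polynomial.
- exists (row4 (fun i => y (inord i)), row4 (fun i => y (inord (i + 4)))); rewrite (@meval_eq _ _ _ y) // => j.
 rewrite /join8 /=; case: ltnP => j4; rewrite mxE inordK //; first by rewrite inord_val.
  by rewrite subnK // inord_val.
 by have := ltn_ord j; lia.
move=> {u v} [u v] /= Guv; have [[l [[i li] hl]] _] := hG _ _ Guv.
have line s t : dot (row4 l) (cub (@pol K phi) (s *: u + t *: v)) = 0.
 rewrite -(ev_pol _ (bir_gh B)); pose st (j : 'I_2) := if j == ord0 then s else t.
 rewrite -(@dot_sum 2 (restr_line phi (fun i => u 0 i) (fun i => v 0 i)) l st) ?hl ?meval0 // => m.
 rewrite mxE /restr_line comp_mpoly_meval; apply: meval_eq => j.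
 by rewrite tnth_map tnth_ord_tuple mevalD !mevalM !mevalC !mevalXU !mxE /st /= mulrC [t * _]mulrC.
have [a0 a1 a2 a3] := dot_line_coeffs line.
apply/eqP/negPn/negP => tw; case/eqP: li; have /rowP/(_ i) : row4 l = 0; last by rewrite !mxE.
by apply: (basis_dot_ext tw); rewrite dot0r dotC.
Qed.

Definition ruled_closed (f : quad) := forall o v1 v2, rho (@pol K f) o v1 v2 = 0.

Lemma zclosed_ruled : zclosed ruled_closed.
Proof.
exists (fun P => P \is 28.-homog /\ exists o v1 v2, forall f, rho (@pol K f) o v1 v2 = P.@[@qco K f]).
split=> [P [hP _]|psi]; first by exists 28.
split=> [h P [_ [o [v1 [v2 <-]]]]|h o v1 v2]; first exact: h.
by have [P hP e] := @gfun_rho K o v1 v2; rewrite e; apply: h; split=> //; exists o, v1, v2.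
Qed.

Lemma bir_closed psi : Bir33 psi -> ruled_closed psi \/ zclosure det33 psi.
Proof.
move=> /Bir33P[phi [h [k B]]]; have [rz|cl] := bir_closures B; first by left.
by right; apply/det33_closure.
Qed.

Lemma ruled33_irreducible : zirreducible ruled33.
Proof.
have [c [pc c0 hc]] := ruled_family_line K.
apply: (@family_irreducible _ (@ruledF K) c) => //.
- by move=> x; apply: pvec_ruledF; apply: pvec_const.
- move=> w /hc[f [g [h [k [B lr e]]]]]; exists f; split=> [|i|x]; first exact: line_ruled_rho B lr.
  exact: bir_fh B i.
 by rewrite -e (ev_pol _ (bir_fh B)).
- by move=> f /ruled33P[/Bir33P[g [h [k B]]] rz]; apply: ruled_closure B rz.
Qed.

(** Intersected with [Bir33], since components are taken inside it while [zclosure] lives in the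
    space of all quadruples. *)
Definition det_component (f : quad) := Bir33 f /\ zclosure det33 f.

Lemma det_component_irreducible : zirreducible det_component.
Proof.
have [c [pc c0 hc]] := det_family K.
apply: (@family_irreducible _ (@detF K) c) => //.
- by move=> x; have [] := pvec_detF (@pvec_const K _ 4 x).
- move=> w /hc[f [g [h [k [B e]]]]]; have Df := det_member B e.
 exists f; split=> [|i|x]; first by split; [case: Df|move=> Z _; apply].
  exact: bir_fh B i.
 by rewrite -e (ev_pol _ (bir_fh B)).
- by move=> f [_ /det33_closure].
Qed.

Lemma qsubset_antisym A B : qsubset A B -> qsubset B A -> A = B.
Proof.
by move=> AB BA; apply: functional_extensionality => f; apply: propositional_extensionality; split; [apply: AB|apply: BA].
Qed.

(** [ruled_closed] and the closure of [det33] are closed and cover [Bir33], so an irreducible set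
    lies in one of them. *)
Lemma irreducible_split D : qsubset D Bir33 -> zirreducible D -> qsubset D ruled33 \/ qsubset D det_component.
Proof.
move=> DB [_ /(_ _ _ zclosed_ruled (zclosure_closed det33))[|s|s]].
- by move=> f /DB/bir_closed.
- by left=> f Df; apply/ruled33P; split; [apply: DB|apply: s].
- by right=> f Df; split; [apply: DB|apply: s].
Qed.

Lemma ruled33_not_closure : ~ qsubset ruled33 (zclosure det33).
Proof.
have [f [g [h [k [B lr nc]]]]] := ruled_not_det_closure K.
by move=> /(_ f (line_ruled_rho B lr))/det33_closure.
Qed.

Lemma det_component_not_ruled : ~ qsubset det_component ruled33.
Proof.
have [f [g [h [k [w [B e [o [v1 [v2 /eqP nz]]]]]]]]] := det_not_ruled K => s.
have Df := det_member B e; case: nz; have /ruled33P[_] : ruled33 f; last exact.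
by apply: s; split; [case: Df|move=> Z _; apply].
Qed.

End Components.

Theorem theorem4p4 :
 irr_component Bir33 ruled33 /\
 (exists C : quad -> Prop,
   irr_component Bir33 C /\ C <> ruled33 /\
   forall D : quad -> Prop, irr_component Bir33 D -> D = ruled33 \/ D = C) /\
 qsubset (zclosure deJonquieres33) (zclosure det33) /\
 ~ qsubset ruled33 (zclosure det33).
Proof.
have rB : qsubset ruled33 Bir33 by move=> f [].
have dB : qsubset det_component Bir33 by move=> f [].
have nrd : ~ qsubset ruled33 det_component by move=> s; apply: ruled33_not_closure => f /s[].
split.
 split=> //; split=> [|D DB Di rD]; first exact: ruled33_irreducible.
 by have [Dr|Dd] := irreducible_split DB Di; [apply: qsubset_antisym|case: nrd => f /rD/Dd].
split; last split; last exact: ruled33_not_closure.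
 exists det_component; split; first split=> //.
  split=> [|D DB Di dD]; first exact: det_component_irreducible.
  have [Dr|Dd] := irreducible_split DB Di; last exact: qsubset_antisym.
  by case: det_component_not_ruled => f /dD/Dr.
 split=> [e|D [DB [Di mD]]]; first by case: nrd; rewrite e.
 have [Dr|Dd] := irreducible_split DB Di; [left|right]; apply: esym; apply: mD => //.
  exact: ruled33_irreducible.
 exact: det_component_irreducible.
move=> f /zclosureP h; apply/zclosureP => d P hP vP; apply: (h d P hP) => g /deJonquieres_closure/zclosureP c.
exact: c hP vP.
Qed.
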